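(* Let $n$ be a positive integer. There exists a constant $N(n)$, only depending on $n$, which satisfies the following. Let $x\in X$ be an $n$-dimensional affine toric variety and let $G<\mathrm{Aut}(X,x)$ be a finite subgroup. Then there exists a normal abelian subgroup $A\leqslant G$ of index at most $N(n)$ and rank at most $n$, so that $A<\mathbb{G}_m^n\leqslant \mathrm{Aut}(\widehat{X},x)$, where $\mathbb{G}_m^n$ is a maximal torus in $\mathrm{Aut}(\widehat{X},x)$.
   Context: We work over an algebraically closed field $\mathbb{K}$ of characteristic zero. An affine toric variety $x\in X$ of dimension $n$ means: $X=\mathrm{Spec}(\mathbb{K}[\sigma^\vee\cap M])$, where $N$ is a free abelian group of rank $n$, $M=\mathrm{Hom}(N,\mathbb{Z})$, $\sigma\subset N_{\mathbb{Q}}$ is a pointed convex polyhedral cone which is non-degenerate (it is not contained in a proper linear subspace of $N_{\mathbb{Q}}$), and $x$ is the unique closed torus-fixed point of $X$. $\mathrm{Aut}(X,x)$ is the group of automorphisms of $X$ fixing $x$. $\widehat{X}$ is the local completion of $X$ at $x$, i.e. the spectrum of the completion of the local ring $\mathcal{O}_{X,x}$, and $\mathrm{Aut}(\widehat{X},x)$ is the group of its automorphisms fixing $x$. Subgroups of $\mathrm{Aut}(X,x)$ are regarded in $\mathrm{Aut}(\widehat X,x)$ via the natural homomorphism. The rank of a finite group is its minimal number of generators. $\mathbb{G}_m^n$ denotes the $n$-dimensional $\mathbb{K}$-torus. *)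

(* Defs.v *)
From HB Require Import structures.
From mathcomp Require Import all_boot all_order all_algebra.
From mathcomp Require Import generic_quotient ring_quotient.
From mathcomp Require Import abelian.
From mathcomp Require Import boolp classical_sets.
From mathcomp Require Import finmap monalg ring.

Set Implicit Arguments.
Unset Strict Implicit.
Unset Printing Implicit Defensive.

Import Order.TTheory GRing.Theory Num.Theory.

Local Open Scope classical_set_scope.
Local Open Scope quotient_scope.
Local Open Scope ring_scope.

(* We fix bases: N = Z^n = 'rV[int]_n, N_Q = 'rV[rat]_n, and M = Hom(N, Z) is
   'rV[int]_n acting on N_Q by the standard pairing. *)

Definition pairing n (m : 'rV[int]_n) (v : 'rV[rat]_n) : rat :=
  \sum_(i < n) (m 0 i)%:~R * v 0 i.

Definition cone_of n (g : seq 'rV[rat]_n) : set 'rV[rat]_n :=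
  [set v | exists c : 'I_(size g) -> rat,
     (forall i, 0 <= c i) /\ v = \sum_(i < size g) c i *: g`_i].

Record toric_cone n := ToricCone {
  cone_set : set 'rV[rat]_n;
  cone_polyhedral : exists g, cone_set = cone_of g;
  cone_pointed : forall v, cone_set v -> cone_set (- v) -> v = 0;
  cone_nondegenerate : forall U : {vspace 'rV[rat]_n},
    (forall v, cone_set v -> v \in U) -> U = fullv
}.

Definition dual_cone n (s : toric_cone n) : pred 'rV[int]_n :=
  fun m => `[< forall v, cone_set s v -> 0 <= pairing m v >].

Definition dual_monoid n (s : toric_cone n) := {m : 'rV[int]_n | dual_cone s m}.

Section DualMonoid.
Variables (n : nat) (s : toric_cone n).

Lemma pairingDl (m1 m2 : 'rV[int]_n) v :
  pairing (m1 + m2) v = pairing m1 v + pairing m2 v.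
Proof.
rewrite /pairing -big_split /=; apply: eq_bigr => i _.
by rewrite mxE intrD mulrDl.
Qed.

Lemma dual_cone0 : dual_cone s 0.
Proof.
apply/asboolP => v _; rewrite /pairing big1 // => i _.
by rewrite mxE mul0r.
Qed.

Lemma dual_coneD m1 m2 :
  dual_cone s m1 -> dual_cone s m2 -> dual_cone s (m1 + m2).
Proof.
move=> /asboolP h1 /asboolP h2; apply/asboolP => v sv.
by rewrite pairingDl addr_ge0 ?h1 ?h2.
Qed.

Lemma pairing_is_linear (m : 'rV[int]_n) :
  linear (pairing m : 'rV[rat]_n -> rat^o).
Proof.
move=> a u v; rewrite /pairing scaler_sumr -big_split /=.
apply: eq_bigr => i _; rewrite !mxE mulrDr; congr (_ + _).
by rewrite mulrCA.
Qed.
HB.instance Definition _ (m : 'rV[int]_n) :=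
  GRing.isLinear.Build rat 'rV[rat]_n rat^o *:%R (pairing m : _ -> rat^o)
    (pairing_is_linear m).

Lemma dual_cone_sharp m1 m2 :
  dual_cone s m1 -> dual_cone s m2 -> m1 + m2 = 0 -> m1 = 0.
Proof.
move=> /asboolP h1 /asboolP h2 e.
pose f : 'Hom('rV[rat]_n, rat^o) := linfun (pairing m1 : _ -> rat^o).
have kerT : lker f = fullv.
  apply: (cone_nondegenerate (t := s)) => v sv; rewrite memv_ker lfunE /=.
  have := pairingDl m1 m2 v; rewrite e => e'.
  have p0 : pairing 0 v = 0.
    by rewrite /pairing big1 // => i _; rewrite mxE mul0r.
  move: e'; rewrite p0 => /esym/eqP; rewrite paddr_eq0 ?h1 ?h2 //.
  by case/andP.
apply/rowP => i; have : delta_mx 0 i \in lker f by rewrite kerT memvf.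
rewrite memv_ker lfunE /= /pairing (bigD1 i) //= big1 => [|j ji].
  by rewrite !mxE !eqxx mulr1 addr0 intr_eq0 => /eqP.
by rewrite !mxE eqxx (negbTE ji) mulr0.
Qed.

Definition dmone : dual_monoid s := exist _ 0 dual_cone0.
Definition dmmul (a b : dual_monoid s) : dual_monoid s :=
  exist _ (val a + val b) (dual_coneD (valP a) (valP b)).

Lemma dmmulA : associative dmmul.
Proof. by move=> a b c; apply: val_inj; rewrite /= addrA. Qed.
Lemma dmmulC : commutative dmmul.
Proof. by move=> a b; apply: val_inj; rewrite /= addrC. Qed.
Lemma dmmul1 : left_id dmone dmmul.
Proof. by move=> a; apply: val_inj; rewrite /= add0r. Qed.
Lemma dm1mul : right_id dmone dmmul.
Proof. by move=> a; rewrite dmmulC dmmul1. Qed.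
Lemma dmunit a b : dmmul a b = dmone -> a = dmone /\ b = dmone.
Proof.
move=> /(congr1 val) /= e; split; apply: val_inj => /=.
  exact: (dual_cone_sharp (valP a) (valP b) e).
by apply: (dual_cone_sharp (valP b) (valP a)); rewrite addrC.
Qed.

HB.instance Definition _ := Choice.on (dual_monoid s).
HB.instance Definition _ := Choice_isMonomialDef.Build (dual_monoid s)
  dmmulA dmmul1 dm1mul dmunit.
HB.instance Definition _ :=
  MonomialDef_isConomialDef.Build (dual_monoid s) dmmulC.
End DualMonoid.

(* X = Spec (toric_ring K s).  Affine schemes are handled through their
   coordinate rings: points are prime ideals and automorphisms of X (resp. of
   its completion) are K-algebra automorphisms.  The group law gets reversed,
   which affects neither subgroups nor their normality, index and rank. *)
Definition toric_ring (K : fieldType) n (s : toric_cone n) : comNzRingType :=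
  {malg K[dual_monoid s]}.

Definition toric_const (K : fieldType) n (s : toric_cone n) (c : K) :
  toric_ring K s := c%:MP.

(* K-points of the split torus of dimension r *)
Definition Gm (K : fieldType) r : set 'rV[K]_r := [set t | forall i, t 0 i != 0].

Definition Gm_mul (K : fieldType) r (t u : 'rV[K]_r) : 'rV[K]_r :=
  \row_i (t 0 i * u 0 i).

Definition laurent (K : fieldType) r (m : 'rV[int]_r) (t : 'rV[K]_r) : K :=
  \prod_(i < r) t 0 i ^ m 0 i.

Definition torus_act (K : fieldType) n (s : toric_cone n) (t : 'rV[K]_n)
    (f : toric_ring K s) : toric_ring K s :=
  \sum_(m <- msupp f) mkmalgU m (laurent (val m) t * mcoeff m f).

Definition closed_point (A : comNzRingType) (x : prime_idealr A) : Prop :=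
  forall J : idealr A, {subset x <= J} -> {subset J <= x}.

Definition torus_fixed (K : fieldType) n (s : toric_cone n)
    (x : prime_idealr (toric_ring K s)) : Prop :=
  forall t, Gm t -> forall f, f \in x -> torus_act t f \in x.

Section Localization.
Variables (A : comNzRingType) (x : prime_idealr A).

Lemma den1_subproof : (1 : A) \notin x.
Proof. by rewrite idealr1. Qed.

Definition denom := {s : A | s \notin x}.
HB.instance Definition _ := Choice.on denom.

Definition den1 : denom := exist (fun s => s \notin x) 1 den1_subproof.

Lemma denM_subproof (s t : denom) : val s * val t \notin x.
Proof. by rewrite prime_idealrM negb_or (valP s) (valP t). Qed.
Definition denM (s t : denom) : denom :=
  exist (fun s => s \notin x) _ (denM_subproof s t).

Definition frac_equiv (p q : A * denom) : bool :=
  `[< exists2 u, u \notin x & u * (p.1 * val q.2 - q.1 * val p.2) = 0 >].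

Lemma frac_equiv_is_equiv : equiv_class_of frac_equiv.
Proof.
split=> [p|p q|q p r].
- by apply/asboolP; exists 1; rewrite ?den1_subproof // subrr mulr0.
- by apply/asboolP/asboolP => -[u ux e]; exists u => //;
    rewrite -opprB mulrN e oppr0.
- move=> /asboolP[u ux e] /asboolP[v vx f]; apply/asboolP.
  exists (u * v * val q.2).
    by rewrite !prime_idealrM !negb_or ux vx (valP q.2).
  have -> : u * v * val q.2 * (p.1 * val r.2 - r.1 * val p.2) =
      (u * (p.1 * val q.2 - q.1 * val p.2)) * (v * val r.2)
      + (v * (q.1 * val r.2 - r.1 * val q.2)) * (u * val p.2).
    by ring.
  by rewrite e f !mul0r addr0.
Qed.

Canonical frac_equiv_equiv := EquivRelPack frac_equiv_is_equiv.
Canonical frac_equiv_encModRel := defaultEncModRel frac_equiv.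

Definition localization := {eq_quot frac_equiv}.
HB.instance Definition _ : EqQuotient _ frac_equiv localization :=
  EqQuotient.on localization.
HB.instance Definition _ := Choice.on localization.

Definition mkfrac (a : A) (s : denom) : localization :=
  \pi_localization (a, s).

(* a / s; only meaningful when s \notin x *)
Definition frac (a s : A) : localization := mkfrac a (insubd den1 s).

Definition numl (q : localization) : A := (repr q).1.
Definition denl (q : localization) : denom := (repr q).2.

Lemma mkfrac_repr q : q = mkfrac (numl q) (denl q).
Proof. by rewrite /mkfrac /numl /denl -surjective_pairing reprK. Qed.

Lemma mkfracP a s b t : reflect
  (exists2 u, u \notin x & u * (a * val t - b * val s) = 0)
  (mkfrac a s == mkfrac b t).
Proof.
rewrite /mkfrac; apply: (iffP eqP).
  by move=> /eqmodP /asboolP.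
by move=> h; apply/eqmodP/asboolP.
Qed.

Lemma mkfrac_eq a s b t : a * val t = b * val s -> mkfrac a s = mkfrac b t.
Proof.
move=> e; apply/eqP/mkfracP; exists 1; rewrite ?den1_subproof //.
by rewrite e subrr mulr0.
Qed.

Definition addl (p q : localization) : localization :=
  mkfrac (numl p * val (denl q) + numl q * val (denl p)) (denM (denl p) (denl q)).
Definition oppl (p : localization) : localization := mkfrac (- numl p) (denl p).
Definition mull (p q : localization) : localization :=
  mkfrac (numl p * numl q) (denM (denl p) (denl q)).

Lemma reprP a s : exists2 u, u \notin x &
  u * (a * val (denl (mkfrac a s)) - numl (mkfrac a s) * val s) = 0.
Proof. by apply/mkfracP; rewrite -mkfrac_repr. Qed.

Lemma addlE a s b t :
  addl (mkfrac a s) (mkfrac b t) = mkfrac (a * val t + b * val s) (denM s t).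
Proof.
have [u ux eu] := reprP a s; have [v vx ev] := reprP b t.
rewrite /addl; set a' := numl _ in eu *; set b' := numl (mkfrac b t) in ev *.
set s' := denl _ in eu *; set t' := denl (mkfrac b t) in ev *.
apply/eqP/mkfracP; exists (u * v).
  by rewrite prime_idealrM negb_or ux vx.
rewrite /=.
transitivity (- (u * (a * val s' - a' * val s)) * (v * val t * val t')
  - (v * (b * val t' - b' * val t)) * (u * val s * val s')); first by rewrite /=; ring.
by rewrite eu ev oppr0 !mul0r subr0.
Qed.

Lemma opplE a s : oppl (mkfrac a s) = mkfrac (- a) s.
Proof.
have [u ux eu] := reprP a s; apply/eqP/mkfracP; exists u => //.
by rewrite -[RHS]eu /=; ring.
Qed.

Lemma mullE a s b t :
  mull (mkfrac a s) (mkfrac b t) = mkfrac (a * b) (denM s t).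
Proof.
have [u ux eu] := reprP a s; have [v vx ev] := reprP b t.
rewrite /mull; set a' := numl _ in eu *; set b' := numl (mkfrac b t) in ev *.
set s' := denl _ in eu *; set t' := denl (mkfrac b t) in ev *.
apply/eqP/mkfracP; exists (u * v).
  by rewrite prime_idealrM negb_or ux vx.
rewrite /=.
transitivity (- (u * (a * val s' - a' * val s)) * (v * b * val t')
  - (v * (b * val t' - b' * val t)) * (u * a' * val s)); first by rewrite /=; ring.
by rewrite eu ev oppr0 !mul0r subr0.
Qed.

Lemma addlA : associative addl.
Proof.
move=> p q r; rewrite (mkfrac_repr p) (mkfrac_repr q) (mkfrac_repr r).
by rewrite !addlE; apply: mkfrac_eq => /=; ring.
Qed.
Lemma addlC : commutative addl.
Proof.
move=> p q; rewrite (mkfrac_repr p) (mkfrac_repr q).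
by rewrite !addlE; apply: mkfrac_eq => /=; ring.
Qed.
Lemma add0l : left_id (mkfrac 0 den1) addl.
Proof.
move=> p; rewrite (mkfrac_repr p).
by rewrite !addlE; apply: mkfrac_eq => /=; ring.
Qed.
Lemma addNl : left_inverse (mkfrac 0 den1) oppl addl.
Proof.
move=> p; rewrite (mkfrac_repr p).
by rewrite opplE addlE; apply: mkfrac_eq => /=; ring.
Qed.
HB.instance Definition _ :=
  GRing.isZmodule.Build localization addlA addlC add0l addNl.

Lemma mullA : associative mull.
Proof.
move=> p q r; rewrite (mkfrac_repr p) (mkfrac_repr q) (mkfrac_repr r).
by rewrite !mullE; apply: mkfrac_eq => /=; ring.
Qed.
Lemma mullC : commutative mull.
Proof.
move=> p q; rewrite (mkfrac_repr p) (mkfrac_repr q).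
by rewrite !mullE; apply: mkfrac_eq => /=; ring.
Qed.
Lemma mul1l : left_id (mkfrac 1 den1) mull.
Proof.
move=> p; rewrite (mkfrac_repr p).
by rewrite !mullE; apply: mkfrac_eq => /=; ring.
Qed.
Lemma mullDl : left_distributive mull +%R.
Proof.
move=> p q r; rewrite (mkfrac_repr p) (mkfrac_repr q) (mkfrac_repr r).
rewrite -[_ + mkfrac _ _]/(addl _ _) -[RHS]/(addl _ _).
by rewrite !(mullE, addlE); apply: mkfrac_eq => /=; ring.
Qed.
Lemma onel_neq0 : mkfrac 1 den1 != 0.
Proof.
apply/negP => /mkfracP[u ux] /=; rewrite !mulr1 subr0 mulr1 => u0.
by move: ux; rewrite u0 idealr0.
Qed.
HB.instance Definition _ := GRing.Zmodule_isComNzRing.Build localization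
  mullA mullC mul1l mullDl onel_neq0.

Definition local_max : pred localization :=
  fun q => `[< exists2 a, a \in x & exists s, q = mkfrac a s >].

Lemma local_max_idealr_closed : idealr_closed local_max.
Proof.
split.
- by apply/asboolP; exists 0; [exact: idealr0 | exists den1].
- apply/negP => /asboolP[a ax [s]] /eqP/mkfracP[u ux] /=.
  rewrite mul1r mulr1 mulrBr => /eqP; rewrite subr_eq0 => /eqP e.
  have : u * val s \in x by rewrite e idealMr.
  by rewrite prime_idealrM (negbTE ux) (negbTE (valP s)).
- move=> r _ _ /asboolP[a ax [s ->]] /asboolP[b bx [t ->]].
  rewrite (mkfrac_repr r); apply/asboolP.
  exists (numl r * a * val t + b * val (denM (denl r) s)).
    by rewrite rpredD // mulrC idealMr // idealMr.
  exists (denM (denM (denl r) s) t).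
  by rewrite -addlE -mullE.
Qed.
HB.instance Definition _ := isIdealr.Build localization local_max
  local_max_idealr_closed.
End Localization.

Section IdealPowers.
Variables (B : comNzRingType) (I : idealr B).

Fixpoint ideal_pow_set (k : nat) : set B :=
  if k is k'.+1 then
    [set b | exists2 l : seq (B * B),
       (forall p, p \in l -> p.1 \in I /\ ideal_pow_set k' p.2) &
       b = \sum_(p <- l) p.1 * p.2]
  else setT.

Definition ideal_pow k : pred B := fun b => `[< ideal_pow_set k b >].

Lemma ideal_pow_setM k a b : ideal_pow_set k b -> ideal_pow_set k (a * b).
Proof.
elim: k a b => [|k IH] a b //= [l hl ->].
exists [seq (p.1, a * p.2) | p <- l].
  by move=> _ /mapP[p /hl[h1 h2] ->]; split => //; apply: IH.
rewrite big_map mulr_sumr; apply: eq_bigr => p _ /=.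
by rewrite mulrCA.
Qed.

Lemma ideal_pow_idealr_closed k : idealr_closed (ideal_pow k.+1).
Proof.
split.
- by apply/asboolP; exists [::] => //; rewrite big_nil.
- apply/negP => /asboolP /= [l hl e].
  have : 1 \in I.
    rewrite e big_seq rpred_sum // => p /hl[h _].
    by rewrite mulrC idealMr.
  by rewrite idealr1.
- move=> a u v /asboolP hu /asboolP[m hm ->]; apply/asboolP.
  have [l hl ->] := ideal_pow_setM a hu.
  exists (l ++ m); last by rewrite big_cat.
  by move=> p; rewrite mem_cat => /orP[/hl|/hm].
Qed.
HB.instance Definition _ k := isIdealr.Build B (ideal_pow k.+1)
  (ideal_pow_idealr_closed k).
End IdealPowers.

Section Completion.
Variables (B : comNzRingType) (I : idealr B).

(* B / I^(k+1) *)
Definition trunc (k : nat) : comNzRingType :=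
  {ideal_quot (ideal_pow I k.+1 : idealr B)}.
Definition to_trunc (k : nat) (b : B) : trunc k :=
  \pi_({ideal_quot (ideal_pow I k.+1 : idealr B)}) b.

Definition coherent (c : forall k, trunc k) : Prop :=
  forall k, exists2 b, c k = to_trunc k b & c k.+1 = to_trunc k.+1 b.

(* the inverse limit of the B / I^(k+1) *)
Record completion := Completion {
  component :> forall k, trunc k;
  componentP : coherent component
}.

HB.instance Definition _ := gen_eqMixin completion.
HB.instance Definition _ := gen_choiceMixin completion.

Lemma completionP (c d : completion) : (forall k, c k = d k) -> c = d.
Proof.
case: c d => [c cP] [d dP] /= e.
have {}e : c = d by apply: functional_extensionality_dep.
by case: _ / e dP => dP; congr Completion; apply: Prop_irrelevance.
Qed.

Lemma to_truncD k : {morph to_trunc k : a b / a + b}.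
Proof. by move=> a b; rewrite /to_trunc rmorphD. Qed.
Lemma to_truncN k : {morph to_trunc k : a / - a}.
Proof. by move=> a; rewrite /to_trunc rmorphN. Qed.
Lemma to_truncM k : {morph to_trunc k : a b / a * b}.
Proof. by move=> a b; rewrite /to_trunc rmorphM. Qed.

Lemma coherent_const b : coherent (fun k => to_trunc k b).
Proof. by move=> k; exists b. Qed.
Definition to_completion (b : B) : completion := Completion (coherent_const b).

Lemma coherentD (c d : completion) : coherent (fun k => c k + d k).
Proof.
move=> k; have [a -> ->] := componentP c k; have [b -> ->] := componentP d k.
by exists (a + b); rewrite to_truncD.
Qed.
Lemma coherentN (c : completion) : coherent (fun k => - c k).
Proof.
move=> k; have [a -> ->] := componentP c k.
by exists (- a); rewrite to_truncN.
Qed.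
Lemma coherentM (c d : completion) : coherent (fun k => c k * d k).
Proof.
move=> k; have [a -> ->] := componentP c k; have [b -> ->] := componentP d k.
by exists (a * b); rewrite to_truncM.
Qed.

Definition addc c d := Completion (coherentD c d).
Definition oppc c := Completion (coherentN c).
Definition mulc c d := Completion (coherentM c d).

Lemma to_trunc0 k : to_trunc k 0 = 0.
Proof. by rewrite /to_trunc rmorph0. Qed.
Lemma to_trunc1 k : to_trunc k 1 = 1.
Proof. by rewrite /to_trunc rmorph1. Qed.

Lemma addcA : associative addc.
Proof. by move=> a b c; apply: completionP => k /=; rewrite addrA. Qed.
Lemma addcC : commutative addc.
Proof. by move=> a b; apply: completionP => k /=; rewrite addrC. Qed.
Lemma add0c : left_id (to_completion 0) addc.
Proof. by move=> a; apply: completionP => k /=; rewrite to_trunc0 add0r. Qed.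
Lemma addNc : left_inverse (to_completion 0) oppc addc.
Proof. by move=> a; apply: completionP => k /=; rewrite to_trunc0 addNr. Qed.
HB.instance Definition _ :=
  GRing.isZmodule.Build completion addcA addcC add0c addNc.

Lemma mulcA : associative mulc.
Proof. by move=> a b c; apply: completionP => k /=; rewrite mulrA. Qed.
Lemma mulcC : commutative mulc.
Proof. by move=> a b; apply: completionP => k /=; rewrite mulrC. Qed.
Lemma mul1c : left_id (to_completion 1) mulc.
Proof. by move=> a; apply: completionP => k /=; rewrite to_trunc1 mul1r. Qed.
Lemma mulcDl : left_distributive mulc +%R.
Proof. by move=> a b c; apply: completionP => k /=; rewrite mulrDl. Qed.
Lemma onec_neq0 : to_completion 1 != 0.
Proof.
apply/eqP => /(congr1 (fun c : completion => c 0%N)) /=.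
by rewrite to_trunc0 to_trunc1 => /eqP; rewrite oner_eq0.
Qed.
HB.instance Definition _ := GRing.Zmodule_isComNzRing.Build completion
  mulcA mulcC mul1c mulcDl onec_neq0.

Definition completion_max : pred completion := fun c => c 0%N == 0.
End Completion.

(* Automorphisms of the K-scheme Spec B fixing the point P; the K-algebra
   structure of B is given by st. *)
Definition Aut_pt (K : fieldType) (B : comNzRingType) (st : K -> B)
    (P : pred B) : set (B -> B) :=
  [set f | [/\ zmod_morphism f, monoid_morphism f, bijective f,
     forall c, f (st c) = st c & forall b, (f b \in P) = (b \in P)]].

Section ToricCompletion.
Variables (K : fieldType) (n : nat) (s : toric_cone n).
Variable x : prime_idealr (toric_ring K s).

Definition local_ring : comNzRingType := localization x.
Definition complete_ring : comNzRingType := completion (@local_max _ x).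

Definition complete_const (c : K) : complete_ring :=
  to_completion (@local_max _ x) (frac x (toric_const s c) 1).

(* Aut(X, x) *)
Definition Aut_toric : set (toric_ring K s -> toric_ring K s) :=
  Aut_pt (@toric_const K n s) x.

(* Aut(X^, x) *)
Definition Aut_complete : set (complete_ring -> complete_ring) :=
  Aut_pt complete_const (@completion_max _ (@local_max _ x)).

(* The map induced on O_{X,x} by f in Aut(X, x) *)
Definition local_map (f : toric_ring K s -> toric_ring K s)
    (q : local_ring) : local_ring := frac x (f (numl q)) (f (val (denl q))).

(* g is the image of f under Aut(X, x) -> Aut(X^, x) *)
Definition is_completion_of (f : toric_ring K s -> toric_ring K s)
    (g : complete_ring -> complete_ring) : Prop :=
  forall (c : complete_ring) k (q : local_ring),
    c k = to_trunc (@local_max _ x) k q ->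
    g c k = to_trunc (@local_max _ x) k (local_map f q).

(* T is the image of an injective algebraic homomorphism from the
   r-dimensional split torus to the pro-algebraic group Aut(X^, x); lambda is
   algebraic when it is so on each truncation O/m^(k+1), i.e. when the orbit
   map t |-> lambda t f mod m^(k+1) is a Laurent polynomial in t for every f. *)
Definition is_torus (r : nat) (T : set (complete_ring -> complete_ring)) : Prop :=
  exists lambda : 'rV[K]_r -> complete_ring -> complete_ring,
  [/\ forall t, Gm t -> Aut_complete (lambda t),
      forall t u, Gm t -> Gm u -> lambda (Gm_mul t u) = lambda t \o lambda u,
      forall t u, Gm t -> Gm u -> lambda t = lambda u -> t = u,
      forall f k, exists l : seq ('rV[int]_r * complete_ring), forall t, Gm t ->
        lambda t f k
          = (\sum_(p <- l) complete_const (laurent p.1 t) * p.2 : complete_ring) k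
    & T = [set lambda t | t in @Gm K r]].

Definition is_maximal_torus (r : nat)
    (T : set (complete_ring -> complete_ring)) : Prop :=
  is_torus r T /\ forall r' T', is_torus r' T' -> T `<=` T' -> T' = T.
End ToricCompletion.

(* Main.v *)
(* A derivation of K[S] that preserves the fixed point has, for a suitable
   grading, a leading part of degree 0; modulo the derivations that raise the
   degree these form a Lie algebra of dimension at most n + 3^n, spanned by the
   torus and the semisimple Demazure roots, on which Aut(X, x) acts by
   conjugation.  Jordan's theorem, applied to this action, gives a normal
   subgroup of bounded index that acts through commuting matrices.  A semisimple
   element h of the Lie algebra whose weights are as generic as this abelian
   group allows has the property that the c-th powers fix its centralizer, for a
   bounded c; let A consist of the elements that act as such a c-th power.

   The element h is diagonalized by a multiplicative basis (f_u) of K[S], so A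
   fixes the derivation f_u |-> <lam, u> f_u modulo higher terms, for a lam with
   <lam, u> != 0 for all u != 0.  Averaging over A lifts it to an A-invariant
   derivation d of K[S].  On the completion, d is conjugate to its leading part:
   its eigenlines are spanned by monomials y_u = f_u + higher terms in new
   coordinates.  Automorphisms that commute with d, in particular those of A,
   rescale each y_u, that is, belong to the torus of the new coordinates. *)
Require Import Defs.
From HB Require Import structures.
From mathcomp Require Import all_boot all_order all_algebra all_fingroup.
From mathcomp Require Import ring_quotient abelian.
From mathcomp Require Import boolp classical_sets.
From mathcomp Require Import finmap monalg fraction separable cyclotomic algC.
From mathcomp Require Import sesquilinear spectral mxrepresentation.
From mathcomp Require Import zify ring lra.
From mathcomp Require mpoly.

Set Implicit Arguments.
Unset Strict Implicit.
Unset Printing Implicit Defensive.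

Import Order.TTheory GRing.Theory Num.Theory.

Local Open Scope ring_scope.

(** The obvious linear representation, on the cotangent space m/m^2, cannot give a uniform bound:
    the embedding dimension of X is not bounded in terms of n. The adjoint action modulo raising
    derivations has bounded dimension because semisimple roots are separated by their residues
    modulo 3, whence 3^n. Automorphisms do not respect the grading, but the raising derivations form
    the kernel of the trace form of m/m^2, which is invariant under conjugation; so the action is
    well defined. It need not be faithful, hence commuting matrices say nothing yet about the group:
    that A is abelian of rank at most n is read off from its embedding in the torus. The element h
    comes from a derivation of the Lie algebra: a generic additive solution of the relations that
    the characters of the group satisfy multiplicatively is a derivation and, once it kills the
    centre, an inner one. The constant c has two sources: the centre has a rational structure, on
    which finite orders divide (2n)!, and a vanishing weight of h makes the corresponding character
    torsion, of an order controlled by the finitely many possible systems of relations. *)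

(** * Pairings, rational cones and primitive ray generators *)

(** The pairing of M with N after extension of scalars: [R] is [rat] for points of the cone, [int]
    for rays and [K] for torus weights. *)
Definition ev (R : pzRingType) n (v : 'rV[R]_n) (u : 'rV[int]_n) : R :=
  \sum_(i < n) (u 0 i)%:~R * v 0 i.

Section Evaluation.
Variables (R : pzRingType) (n : nat).
Implicit Types (v : 'rV[R]_n) (u : 'rV[int]_n).

Lemma ev_is_additive v : zmod_morphism (ev v).
Proof.
move=> a b; rewrite /ev -sumrB; apply: eq_bigr => i _.
by rewrite !mxE rmorphB mulrBl.
Qed.
HB.instance Definition _ v := GRing.isZmodMorphism.Build _ _ (ev v)
  (ev_is_additive v).

Lemma evMz v k u : ev v (k *: u) = k%:~R * ev v u.
Proof.
rewrite /ev mulr_sumr; apply: eq_bigr => i _.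
by rewrite mxE rmorphM /= mulrA.
Qed.

Lemma ev_delta v i : ev v (delta_mx 0 i) = v 0 i.
Proof.
rewrite /ev (bigD1 i) //= big1 => [|j ji].
  by rewrite !mxE !eqxx mul1r addr0.
by rewrite !mxE eqxx (negbTE ji) mul0r.
Qed.

Lemma evDr v w u : ev (v + w) u = ev v u + ev w u.
Proof.
by rewrite /ev -big_split; apply: eq_bigr => i _; rewrite mxE mulrDr.
Qed.

Lemma ev0r u : ev (0 : 'rV[R]_n) u = 0.
Proof. by rewrite /ev big1 // => i _; rewrite mxE mulr0. Qed.

Lemma evNr v u : ev (- v) u = - ev v u.
Proof. by apply/eqP; rewrite -addr_eq0 -evDr addNr ev0r. Qed.

Lemma ev_sumr (I : Type) (r : seq I) (P : pred I) (F : I -> 'rV[R]_n) u :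
  ev (\sum_(i <- r | P i) F i) u = \sum_(i <- r | P i) ev (F i) u.
Proof.
elim: r => [|i r IH]; first by rewrite !big_nil ev0r.
by rewrite !big_cons; case: (P i) => //; rewrite evDr IH.
Qed.
End Evaluation.

Lemma evZr (R : comPzRingType) n (a : R) (v : 'rV[R]_n) u :
  ev (a *: v) u = a * ev v u.
Proof.
by rewrite /ev mulr_sumr; apply: eq_bigr => i _; rewrite mxE mulrCA.
Qed.

Lemma ev_intr (R : pzRingType) n (v u : 'rV[int]_n) :
  ev (map_mx (intr : int -> R) v) u = (ev v u)%:~R.
Proof.
rewrite /ev rmorph_sum; apply: eq_bigr => i _.
by rewrite mxE rmorphM /= intz.
Qed.

Lemma ev_inj (R : pzRingType) n (v w : 'rV[R]_n) : ev v =1 ev w -> v = w.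
Proof. by move=> e; apply/rowP => i; rewrite -!ev_delta e. Qed.

Lemma intr_char0_eq0 (K : fieldType) (z : int) : [pchar K] =i pred0 ->
  (z%:~R == 0 :> K) = (z == 0).
Proof.
move=> /pcharf0P K0; case: z => m; first by rewrite -pmulrn K0.
by rewrite NegzE mulrNz oppr_eq0 -pmulrn K0.
Qed.

(* Gordan's alternative, with the cone generated by the vectors replaced by any
   pointed convex cone containing them. *)
Section Gordan.
Variable n : nat.
Implicit Types (m v w : 'rV[rat]_n) (vs : seq 'rV[rat]_n).

Let dq m v : rat := \sum_i m 0 i * v 0 i.

Let dqDl m m' v : dq (m + m') v = dq m v + dq m' v.
Proof.
by rewrite /dq -big_split; apply: eq_bigr => i _; rewrite mxE mulrDl.
Qed.
Let dqZl a m v : dq (a *: m) v = a * dq m v.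
Proof.
by rewrite /dq mulr_sumr; apply: eq_bigr => i _; rewrite mxE mulrA.
Qed.
Let dqDr m v w : dq m (v + w) = dq m v + dq m w.
Proof.
by rewrite /dq -big_split; apply: eq_bigr => i _; rewrite mxE mulrDr.
Qed.
Let dqZr a m v : dq m (a *: v) = a * dq m v.
Proof.
by rewrite /dq mulr_sumr; apply: eq_bigr => i _; rewrite mxE mulrCA.
Qed.

Variable C : set 'rV[rat]_n.
Hypothesis CD : forall v w, C v -> C w -> C (v + w).
Hypothesis CZ : forall a v, 0 <= a -> C v -> C (a *: v).
Hypothesis C_pointed : forall v, C v -> C (- v) -> v = 0.

Let positive_combination (m m' : 'rV[rat]_n) vs :
  (forall v, v \in vs -> 0 < dq m v) ->
  exists2 t, 0 < t & forall v, v \in vs -> 0 < dq m' v + t * dq m v.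
Proof.
move=> hm; elim: vs hm => [|v vs IH] hm; first by exists 1.
have [|t t0 ht] := IH; first by move=> w wv; apply: hm; rewrite inE wv orbT.
have hv : 0 < dq m v by apply: hm; rewrite inE eqxx.
exists (t + (`|dq m' v| + 1) / dq m v).
  by rewrite ltr_wpDr // divr_ge0 ?(ltW hv) // addr_ge0.
move=> w; rewrite inE => /orP[/eqP->|wv].
  rewrite mulrDl divfK ?gt_eqF //.
  have : 0 < t * dq m v by rewrite mulr_gt0.
  have := ler_norm (- dq m' v); rewrite normrN; lra.
have := ht _ wv; have hw : 0 < dq m w by apply: hm; rewrite inE wv orbT.
have : 0 <= (`|dq m' v| + 1) / dq m v * dq m w.
  by rewrite mulr_ge0 ?(ltW hw) // divr_ge0 ?(ltW hv) // addr_ge0.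
rewrite mulrDl; lra.
Qed.

Lemma pointed_cone_functional vs :
  (forall v, v \in vs -> C v /\ v != 0) ->
  exists m, forall v, v \in vs -> 0 < \sum_i m 0 i * v 0 i.
Proof.
suff main k : forall ws, size ws = k ->
    (forall v, v \in ws -> C v /\ v != 0) ->
    exists m, forall v, v \in ws -> 0 < dq m v by exact: main.
move=> {vs}.
elim: k => [|k IH] [|v vs] //=; first by exists 0.
move=> [szvs] hC; have hvs w : w \in vs -> C w /\ w != 0.
  by move=> wv; apply: hC; rewrite inE wv orbT.
have [Cv v0] : C v /\ v != 0 by apply: hC; rewrite inE eqxx.
have [m hm] := IH vs szvs hvs.
have [mv|mv] := ltP 0 (dq m v).
  by exists m => w; rewrite inE => /orP[/eqP->|/hm].
case: vs szvs hC hvs hm => [|v1 vs0] szvs hC hvs hm.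
  exists v => w; rewrite inE => /eqP ->.
  have h i : 0 <= v 0 i * v 0 i by rewrite -expr2 sqr_ge0.
  rewrite lt_def sumr_ge0 // andbT psumr_eq0 //; apply: contraNN v0 => /allP z.
  by apply/eqP/rowP => i; have := z i (mem_index_enum i);
     rewrite /= mxE -expr2 sqrf_eq0 => /eqP.
set vs := v1 :: vs0 in szvs hvs hm *.
(* Since m v <= 0 < m w, the vector [f w] is a conic combination of [v] and [w] in the hyperplane m
   = 0. It is nonzero, as otherwise -v would lie in [C]; so the induction hypothesis applies to
   these vectors. *)
pose f w := dq m w *: v - dq m v *: w.
have hf w : w \in [seq f w | w <- vs] -> C w /\ w != 0.
  move=> /mapP[w' w'v ->]; have [Cw' w0] := hvs _ w'v; have mw := hm _ w'v.
  have Cb : C (- dq m v *: w') by apply: CZ => //; rewrite oppr_ge0.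
  split; first by rewrite /f -scaleNr; apply: CD => //; apply: CZ => //; exact: ltW.
  apply: contraNN v0 => /eqP fw; apply/eqP; apply: C_pointed => //.
  have -> : - v = (dq m w')^-1 *: (- dq m v *: w').
    have e : dq m w' *: v = dq m v *: w' by apply/eqP; rewrite -subr_eq0; apply/eqP.
    by rewrite scaleNr -e scalerN scalerA mulVf ?scale1r ?gt_eqF.
  by apply: CZ => //; rewrite invr_ge0 ltW.
have [|m' hm'] := IH [seq f w | w <- vs] _ hf; first by rewrite size_map.
have {}hm' w : w \in vs -> dq m v * dq m' w < dq m w * dq m' v.
  move=> wv; have := hm' (f w) (map_f f wv).
  by rewrite /f -scaleNr dqDr !dqZr mulNr subr_gt0.
have [mv0|mv0] := eqVneq (dq m v) 0.
  have m'v : 0 < dq m' v.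
    have v1v : v1 \in vs by rewrite inE eqxx.
    by have := hm' _ v1v; rewrite mv0 mul0r pmulr_rgt0 // hm.
  have [t t0 ht] := @positive_combination m m' vs hm.
  exists (m' + t *: m) => w; rewrite inE dqDl dqZl => /orP[/eqP->|/ht //].
  by rewrite mv0 mulr0 addr0.
have {}mv : dq m v < 0 by rewrite lt_neqAle mv0.
(* [m1] vanishes at [v] and is positive on [vs], while [- m] is positive at [v]; a large multiple of
   [m1] corrects [- m] on [vs]. *)
pose m1 := - dq m v *: m' + dq m' v *: m.
have m1v : dq m1 v = 0 by rewrite dqDl !dqZl; ring.
have hm1 w : w \in vs -> 0 < dq m1 w.
  by move=> /hm'; rewrite dqDl !dqZl mulNr addrC subr_gt0 [X in _ < X]mulrC.
have [t t0 ht] := @positive_combination m1 (- m) vs hm1.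
exists (- m + t *: m1) => w; rewrite inE dqDl dqZl => /orP[/eqP->|/ht //].
by rewrite m1v mulr0 addr0 -scaleN1r dqZl mulN1r oppr_gt0.
Qed.
End Gordan.

(** After clearing denominators, the gcd of the coordinates is obtained as the least positive value
    of the pairing with [r0]; division with remainder shows that it divides all values. Primitivity
    is expressed as the existence of a point of value 1, the form in which it is used. *)
Lemma primitive_multiple n (v : 'rV[rat]_n) : v != 0 ->
  exists rho : 'rV[int]_n, (exists u, ev rho u = 1) /\
    exists2 c : rat, 0 < c & map_mx intr rho = c *: v.
Proof.
move=> v0; pose D : int := \prod_i denq (v 0 i).
have D0 : 0 < D by apply: prodr_gt0 => i _; exact: denq_gt0.
pose r0 : 'rV[int]_n := \row_i (numq (v 0 i) * \prod_(j | j != i) denq (v 0 j)).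
have r0E : map_mx intr r0 = D%:~R *: v.
  apply/rowP => i; rewrite !mxE.
  have -> : D = denq (v 0 i) * \prod_(j | j != i) denq (v 0 j).
    by rewrite /D (bigD1 i).
  by rewrite !intrM numqE; ring.
have r0n : r0 != 0.
  apply: contraNneq v0 => r00; move: r0E; rewrite r00 map_mx0 => /esym/eqP.
  by rewrite scaler_eq0 intr_eq0 gt_eqF.
have exk : exists k, `[< exists u, ev r0 u = k.+1%:Z >].
  have /rV0Pn[i ri] := r0n; exists `|r0 0%R i|%N.-1; apply/asboolP.
  have e : `|r0 0%R i|%N.-1.+1 = `|r0 0%R i|%N by rewrite prednK // absz_gt0.
  have [h|h] := leP 0 (r0 0 i).
    by exists (delta_mx 0 i); rewrite ev_delta e gez0_abs.
  by exists (- delta_mx 0 i); rewrite raddfN /= ev_delta e ltz0_abs.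
have [k /asboolP[u1 u1E] kmin] := ex_minnP exk.
have dvd u : ev r0 u = (ev r0 u %/ k.+1%:Z)%Z * k.+1%:Z.
  set q := (_ %/ _)%Z; have e := divz_eq (ev r0 u) k.+1.
  have m0 : 0 <= (ev r0 u %% k.+1)%Z by apply: modz_ge0.
  have m1 : (ev r0 u %% k.+1)%Z < k.+1 by apply: ltz_pmod.
  have r1 : ev r0 (u - q *: u1) = (ev r0 u %% k.+1)%Z.
    by rewrite raddfB /= evMz u1E intz /= {1}e -/q addrC addKr.
  suff : (ev r0 u %% k.+1)%Z = 0 by lia.
  case E : (ev r0 u %% k.+1)%Z m0 m1 r1 => [[|j]|j] // _ jk r1.
  by have := kmin j; rewrite asboolT; [lia | exists (u - q *: u1)].
pose rho : 'rV[int]_n := \row_i (r0 0%R i %/ k.+1%:Z)%Z.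
have rhoE : r0 = k.+1%:Z *: rho.
  apply/rowP => i; rewrite [RHS]mxE [X in _ = _ * X]mxE mulrC.
  by have := dvd (delta_mx 0 i); rewrite ev_delta.
exists rho; split.
  exists u1; apply: (@mulfI _ k.+1%:Z) => //.
  by rewrite -evZr -rhoE u1E mulr1.
exists (D%:~R / k.+1%:R); first by rewrite divr_gt0 ?ltr0z ?ltr0n.
apply: (@scalerI _ _ (k.+1%:R : rat)); first by rewrite pnatr_eq0.
rewrite scalerA mulrC mulfVK ?pnatr_eq0 // -r0E rhoE.
by apply/rowP => i; rewrite !mxE rmorphM.
Qed.

(* phi_l = ev (rho l) are the primitive inward normals of the facets of the
   dual cone, i.e. the primitive generators of the rays of the cone. *)
Record ray_data n (s : toric_cone n) := RayData {
  nrays : nat;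
  ray : 'I_nrays -> 'rV[int]_n;
  dual_coneE : forall u, dual_cone s u <-> forall l, 0 <= ev (ray l) u;
  facet_point : forall l, exists2 z, ev (ray l) z = 0 &
    forall l', l' != l -> 0 < ev (ray l') z;
  ray_primitive : forall l, exists u, ev (ray l) u = 1
}.

Section RayData.
Variables (n : nat) (s : toric_cone n).

Let good (G : seq 'rV[int]_n) := 
  (forall rho, rho \in G ->
     (exists u, ev rho u = 1) /\ cone_set s (map_mx intr rho)) /\
  (forall u, dual_cone s u <-> forall rho, rho \in G -> 0 <= ev rho u).

Let coneD v w : cone_set s v -> cone_set s w -> cone_set s (v + w).
Proof.
have [g ->] := cone_polyhedral s; move=> [c [c0 ->]] [d [d0 ->]].
exists (fun i => c i + d i); split=> [i|]; first by rewrite addr_ge0.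
by rewrite -big_split; apply: eq_bigr => i _; rewrite scalerDl.
Qed.

Let coneZ a v : 0 <= a -> cone_set s v -> cone_set s (a *: v).
Proof.
have [g ->] := cone_polyhedral s; move=> a0 [c [c0 ->]].
exists (fun i => a * c i); split=> [i|]; first by rewrite mulr_ge0.
by rewrite scaler_sumr; apply: eq_bigr => i _; rewrite scalerA.
Qed.

Let good_exists : exists G, good G.
Proof.
have [g gE] := cone_polyhedral s.
have gC v : v \in g -> cone_set s v.
  move=> vg; rewrite gE; have iv : (index v g < size g)%N by rewrite index_mem.
  exists (fun i => (i == Ordinal iv)%:R); split=> [i|]; first by rewrite ler0n.
  rewrite (bigD1 (Ordinal iv)) //= eqxx scale1r nth_index // big1 ?addr0 //.
  by move=> i /negbTE ->; rewrite scale0r.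
have pos : forall u, dual_cone s u <-> forall v, v \in g -> 0 <= ev v u.
  move=> u; split=> [/asboolP h v /gC /h //|h]; apply/asboolP => v.
  rewrite gE => -[c [c0 ->]]; rewrite -[pairing _ _]/(ev _ u) ev_sumr.
  by apply: sumr_ge0 => i _; rewrite evZr mulr_ge0 // h // mem_nth.
have [f hf] : exists f : 'rV[rat]_n -> 'rV[int]_n, forall v, v != 0 ->
    (exists u, ev (f v) u = 1) /\ exists2 c : rat, 0 < c & map_mx intr (f v) = c *: v.
  have /choice[f hf] : forall v : 'rV[rat]_n, exists w : 'rV[int]_n, v != 0 ->
     (exists u, ev w u = 1) /\ exists2 c : rat, 0 < c & map_mx intr w = c *: v.
    move=> v; have [->|v0] := eqVneq v 0; first by exists 0.
    by have [w hw] := primitive_multiple v0; exists w.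
  by exists f.
exists [seq f v | v <- g & v != 0]; split=> [rho|u].
  move=> /mapP[v]; rewrite mem_filter => /andP[/hf[h1 [c c0 e]] /gC Cv] ->.
  by split => //; rewrite e; apply: coneZ => //; exact: ltW.
rewrite pos; split=> h.
  move=> rho /mapP[v]; rewrite mem_filter => /andP[/hf[_ [c c0 e]] /h hv] ->.
  by rewrite -(ler0z rat) -ev_intr e evZr mulr_ge0 // ltW.
move=> v vg; have [->|v0] := eqVneq v 0; first by rewrite ev0r.
have [_ [c c0 e]] := hf _ v0; have := h (f v); rewrite map_f ?mem_filter ?v0 //.
by move=> /(_ isT); rewrite -(ler0z rat) -ev_intr e evZr pmulr_rge0.
Qed.

(** A shortest list of primitive vectors of the cone that cuts out the dual cone has no redundant
    inequality, so some [u] violates only the one of [R l]. By pointedness there is a [p] on which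
    the whole list is positive; the segment from [u] to [p] crosses the hyperplane of [R l] in the
    relative interior of the facet. *)
Lemma ray_data_exists : inhabited (ray_data s).
Proof.
have ex : exists k, `[< exists G, size G = k /\ good G >].
  by have [G gG] := good_exists; exists (size G); apply/asboolP; exists G.
have [k /asboolP[G [szG [Gprim GE]]] kmin] := ex_minnP ex.
have [p hp] : exists p : 'rV[int]_n, forall rho, rho \in G -> 0 < ev rho p.
  have [v|m hm] := @pointed_cone_functional n (cone_set s) coneD coneZ
     (@cone_pointed _ s) [seq map_mx intr rho | rho <- G].
    move=> /mapP[rho rG ->]; have [[u u1] Cr] := Gprim _ rG; split => //.
    apply/eqP => r0; have := ev_intr rat rho u.
    by rewrite r0 ev0r u1 => /eqP; rewrite eq_sym oner_eq0.
  have [m0|m0] := eqVneq m 0.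
    exists 0 => rho rG; have := hm _ (map_f _ rG).
    by rewrite m0 big1 ?ltxx // => i _; rewrite mxE mul0r.
  have [p [_ [c c0 pE]]] := primitive_multiple m0.
  exists p => rho rG; have := hm _ (map_f _ rG).
  rewrite -(ltr0z rat) -(pmulr_rgt0 _ c0) mulr_sumr rmorph_sum /=.
  congr (_ < _); apply: eq_bigr => i _.
  by rewrite mulrA rmorphM /= intz mxE; have /rowP/(_ i) := pE; rewrite !mxE => ->.
pose R l := tnth (in_tuple G) l.
have RG l : R l \in G by apply: mem_tnth.
have GR rho : rho \in G -> exists l, rho = R l by move=> /(@tnthP _ _ (in_tuple G)).
have drop l : exists u, ev (R l) u < 0 /\ forall l', l' != l -> 0 <= ev (R l') u.
  apply: contrapT => noex; pose G' := [seq R l' | l' <- enum 'I_(size G) & l' != l].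
  have szG0 : (0 < size G)%N by apply: leq_ltn_trans (ltn_ord l).
  have szG' : size G' = (size G).-1.
    have := cardC1 l; rewrite card_ord => <-; rewrite size_map cardE.
    by rewrite [in RHS]/enum_mem -enumT; congr size; apply: eq_filter => i; rewrite inE.
  have := kmin (size G).-1; rewrite -szG.
  rewrite asboolT; first by rewrite leqNgt prednK // leqnn => /(_ isT).
  exists G'; split=> //; split=> [rho /mapP[l' _ ->]|u]; first exact: Gprim.
  rewrite GE; split=> [h rho /mapP[l' _ ->]|h rho /GR[l' ->]]; first exact: h.
  have hl l2 : l2 != l -> 0 <= ev (R l2) u.
    by move=> l2l; apply: h; rewrite map_f // mem_filter l2l mem_enum.
  have [->|/hl //] := eqVneq l' l.
  by apply: contrapT => /negP; rewrite -ltNge => neg; apply: noex; exists u.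
constructor; apply: (@RayData _ _ (size G) R) => [u|l|l].
- by rewrite GE; split=> [h l|h rho /GR[l ->]]; [exact: h|exact: h].
- have [u [ul hu]] := drop l.
  exists (ev (R l) p *: u - ev (R l) u *: p).
    by rewrite raddfB /= !evMz !intz mulrC subrr.
  move=> l' l'l; rewrite raddfB /= !evMz !intz.
  have := hu _ l'l; have := hp _ (RG l); have := hp _ (RG l').
  move: (ev _ p) (ev _ p) (ev _ u) (ev _ u) ul => a b c d; nia.
- by have [] := Gprim _ (RG l).
Qed.
End RayData.

(** * The grading, its finite balls and the Hilbert basis *)

(** Dickson's lemma. If [f k x] exceeds the maximum [m] of [f k] on a list that works for the first
    [k] functions, a minorant from that list also works for [f k]; the finitely many levels up to
    [m] are treated one by one. *)
Lemma finite_minorants (T : eqType) (k : nat) (f : nat -> T -> nat)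
    (X : T -> Prop) : exists L : seq T, (forall x, x \in L -> X x) /\
  forall x, X x -> exists2 y, y \in L & forall i, (i < k)%N -> (f i y <= f i x)%N.
Proof.
elim: k X => [|k IH] X.
  have [[x Xx]|nX] := pselect (exists x, X x).
    exists [:: x]; split=> [y|y _]; first by rewrite inE => /eqP ->.
    by exists x; rewrite ?inE.
  by exists [::]; split=> // x Xx; case: nX; exists x.
have [L0 [L0X hL0]] := IH X.
have /choice[L hL] : forall j, exists L : seq T,
    (forall x, x \in L -> X x /\ f k x = j) /\
    forall x, X x /\ f k x = j ->
      exists2 y, y \in L & forall i, (i < k)%N -> (f i y <= f i x)%N.
  by move=> j; apply: IH (fun x => X x /\ f k x = j).
pose m := \max_(x <- L0) f k x.
exists (L0 ++ flatten [seq L j | j <- iota 0 m.+1]); split=> [x|x Xx].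
  rewrite mem_cat => /orP[/L0X //|/flattenP[_ /mapP[j _ ->]]].
  by case: (hL j) => h _ /h[].
have [le|gt] := leqP (f k x) m.
  have [h1 h2] := hL (f k x); have [//|y yL hy] := h2 x.
  exists y.
    rewrite mem_cat; apply/orP; right; apply/flattenP; exists (L (f k x)) => //.
    by apply: map_f; rewrite mem_iota.
  move=> i; rewrite ltnS leq_eqVlt => /orP[/eqP->|/hy //].
  by have [_ ->] := h1 _ yL.
have [y yL hy] := hL0 _ Xx; exists y; first by rewrite mem_cat yL.
move=> i; rewrite ltnS leq_eqVlt => /orP[/eqP->|/hy //].
by apply: leq_trans (ltnW gt); apply: (@leq_bigmax_seq _ _ predT (f k)).
Qed.

Section RayTheory.
Variables (n : nat) (s : toric_cone n) (D : ray_data s).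

Definition phi (l : 'I_(nrays D)) : 'rV[int]_n -> int := ev (ray l).

Lemma phiD l u v : phi l (u + v) = phi l u + phi l v.
Proof. exact: raddfD. Qed.
Lemma phiN l u : phi l (- u) = - phi l u.
Proof. exact: raddfN. Qed.
Lemma phiB l u v : phi l (u - v) = phi l u - phi l v.
Proof. exact: raddfB. Qed.
Lemma phi0 l : phi l 0 = 0.
Proof. exact: raddf0. Qed.

Lemma phiMz l k u : phi l (k *: u) = k * phi l u.
Proof. by rewrite /phi evMz intz. Qed.

Lemma inSE u : dual_cone s u <-> forall l, 0 <= phi l u.
Proof. exact: dual_coneE. Qed.

Lemma phi_ge0 l u : dual_cone s u -> 0 <= phi l u.
Proof. by move=> /inSE. Qed.

Lemma phi_eq0 u : (forall l, phi l u = 0) -> u = 0.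
Proof.
move=> h; apply: (@dual_cone_sharp _ s u (- u)); rewrite ?subrr //.
  by apply/inSE => l; rewrite h.
by apply/inSE => l; rewrite phiN h oppr0.
Qed.

Lemma phi_inj u v : (forall l, phi l u = phi l v) -> u = v.
Proof.
by move=> h; apply/subr0_eq/phi_eq0 => l; rewrite phiB h subrr.
Qed.

Lemma shift_interior l u z : (forall l', l' != l -> 0 < phi l' z) ->
  exists k : nat, forall l', l' != l -> 0 < phi l' (u + k%:Z *: z).
Proof.
move=> hz; exists (\sum_l' `|phi l' u|%N).+1 => l' l'l.
rewrite phiD phiMz; have := hz _ l'l.
have : (`|phi l' u| <= \sum_l' `|phi l' u|)%N by rewrite (bigD1 l') //= leq_addr.
move: (\sum_l' _)%N (phi l' u) (phi l' z) => a b c; nia.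
Qed.

(** A point of height one over the facet, pushed along the facet until all other normals are
    positive. Coefficients of root derivations are read off at such points. *)
Lemma unit_point l : exists u, phi l u = 1 /\ forall l', 0 < phi l' u.
Proof.
have [u u1] := ray_primitive l; have [z z0 hz] := facet_point l.
have [k hk] := @shift_interior l u z hz.
have e : phi l (u + k%:Z *: z) = 1.
  by rewrite phiD phiMz /phi u1 z0 mulr0 addr0.
exists (u + k%:Z *: z); split => // l'.
by have [->|/hk //] := eqVneq l' l; rewrite e.
Qed.

Lemma interior_point : exists p, forall l, 0 < phi l p.
Proof.
have [l0|no] := pselect (exists l : 'I_(nrays D), True).
  by have [l _] := l0; have [u [_ hu]] := unit_point l; exists u.
by exists 0 => l; case: no; exists l.
Qed.

(** S generates M as a group; through this, functions on S are extended to M. *)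
Lemma shift_in_cone u : exists p, dual_cone s p /\ dual_cone s (u + p).
Proof.
have [p hp] := interior_point.
pose k := (\sum_l `|phi l u|)%N.
have hk l : (`|phi l u| <= k)%N by rewrite /k (bigD1 l) //= leq_addr.
exists (k%:Z *: p); split; apply/inSE => l.
  by rewrite phiMz mulr_ge0 // ltW.
rewrite phiD phiMz; have := hp l; have := hk l.
move: (phi l u) (phi l p) => a b; nia.
Qed.

(** The sum of the ray generators is an interior point of the cone, hence a positive grading of S
    with finite pieces; this choice of interior point gives degree 0 to the semisimple roots. *)
Definition ell : 'rV[int]_n -> int := ev (\sum_l @ray _ _ D l).

Lemma ellD u v : ell (u + v) = ell u + ell v.
Proof. exact: raddfD. Qed.
Lemma ell0 : ell 0 = 0.
Proof. exact: raddf0. Qed.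
Lemma ellN u : ell (- u) = - ell u.
Proof. exact: raddfN. Qed.
Definition dg (u : 'rV[int]_n) : nat := `|ell u|%N.

Lemma ellE u : ell u = \sum_l phi l u.
Proof. by rewrite /ell ev_sumr. Qed.

Lemma ell_ge0 u : dual_cone s u -> 0 <= ell u.
Proof. by move=> Su; rewrite ellE sumr_ge0 // => l _; apply: phi_ge0. Qed.

Lemma dgE u : dual_cone s u -> (dg u)%:Z = ell u.
Proof. by move=> /ell_ge0 h; rewrite /dg gez0_abs. Qed.

Lemma dg0 : dg 0 = 0%N. Proof. by rewrite /dg ell0. Qed.

Lemma dgD u v : dual_cone s u -> dual_cone s v -> dg (u + v) = (dg u + dg v)%N.
Proof.
move=> Su Sv; apply: (can_inj absz_nat : injective Posz).
by rewrite PoszD !dgE ?dual_coneD // ellD.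
Qed.

Lemma phi_le_dg l u : dual_cone s u -> phi l u <= (dg u)%:Z.
Proof.
move=> Su; rewrite dgE // ellE (bigD1 l) //= lerDl sumr_ge0 // => l' _.
exact: phi_ge0.
Qed.

Lemma dg_eq0 u : dual_cone s u -> (dg u == 0%N) = (u == 0).
Proof.
move=> Su; apply/eqP/eqP => [e|->]; last exact: dg0.
apply: phi_eq0 => l; apply/eqP; rewrite eq_le phi_ge0 // andbT.
by have := phi_le_dg l Su; rewrite e.
Qed.

(** A point is determined by its values under the [phi l], each of which is at most its degree. *)
Lemma ball_exists q : exists B : seq 'rV[int]_n, uniq B /\
  forall u, (u \in B) = dual_cone s u && (dg u <= q)%N.
Proof.
pose T := {ffun 'I_(nrays D) -> 'I_q.+1}.
have /choice[f hf] : forall t : T, exists u,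
    (exists v, dual_cone s v /\ forall l, phi l v = t l) ->
    dual_cone s u /\ forall l, phi l u = t l.
  move=> t; have [[v hv]|no] := pselect (exists v, dual_cone s v /\
     forall l, phi l v = t l); first by exists v.
  by exists 0.
exists (undup [seq u <- [seq f t | t <- enum T] | dual_cone s u && (dg u <= q)%N]).
split=> [|u]; first exact: undup_uniq.
rewrite mem_undup mem_filter; apply: andb_idr => /andP[Su uq].
pose t : T := [ffun l => inord `|phi l u|].
have tE l : phi l u = t l.
  have h := phi_ge0 l Su; have h2 := phi_le_dg l Su.
  rewrite ffunE inordK ?gez0_abs // ltnS.
  by apply: leq_trans uq; rewrite -lez_nat gez0_abs.
apply/mapP; exists t; first by rewrite mem_enum.
have [|_ ht] := hf t; first by exists u.
by apply: phi_inj => l; rewrite tE ht.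
Qed.

Definition ball q := xget [::] [set B : seq 'rV[int]_n | uniq B /\
  forall u, (u \in B) = dual_cone s u && (dg u <= q)%N]%classic.

Lemma mem_ball q u : (u \in ball q) = dual_cone s u && (dg u <= q)%N.
Proof.
rewrite /ball; case: xgetP => [B _ [_ h]|h]; first exact: h.
by have [B hB] := ball_exists q; case: (h B).
Qed.

Lemma ball_uniq q : uniq (ball q).
Proof. by rewrite /ball; case: xgetP => [B _ []|]. Qed.

(** Dickson's lemma for the [phi l] yields finitely many minorants; an irreducible [h] dominates one
    of them, [y], and the decomposition h = (h - y) + y forces h = y. *)
Lemma hilbert_basis_exists : exists H : seq 'rV[int]_n, uniq H /\
  (forall h, (h \in H) <-> [/\ dual_cone s h, h != 0 & forall u v,
     dual_cone s u -> dual_cone s v -> h = u + v -> u = 0 \/ v = 0]).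
Proof.
pose f i (u : 'rV[int]_n) := if insub i is Some l then `|phi l u|%N else 0%N.
have [L [LS hL]] := @finite_minorants _ (nrays D) f
  (fun u => dual_cone s u /\ u != 0).
pose ind h := forall u v, dual_cone s u -> dual_cone s v -> h = u + v ->
  u = 0 \/ v = 0.
exists (undup [seq h <- L | `[< ind h >]]); split=> [|h]; first exact: undup_uniq.
rewrite mem_undup mem_filter; split=> [/andP[/asboolP ih /LS[Sh h0]] //|[Sh h0 ih]].
have [//|y yL hy] := hL h; have [Sy y0] := LS _ yL.
have Shy : dual_cone s (h - y).
  apply/inSE => l; rewrite phiB subr_ge0.
  have := hy l (ltn_ord l); rewrite /f valK -lez_nat !gez0_abs //; exact: phi_ge0.
have [e|e] := ih _ _ Shy Sy (esym (subrK _ _)); last by rewrite e eqxx in y0.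
apply/andP; split; [exact/asboolP | by rewrite (subr0_eq e)].
Qed.

Definition hb := xget [::] [set H : seq 'rV[int]_n | uniq H /\
  (forall h, (h \in H) <-> [/\ dual_cone s h, h != 0 & forall u v,
     dual_cone s u -> dual_cone s v -> h = u + v -> u = 0 \/ v = 0])]%classic.

Lemma mem_hb h : (h \in hb) <-> [/\ dual_cone s h, h != 0 & forall u v,
  dual_cone s u -> dual_cone s v -> h = u + v -> u = 0 \/ v = 0].
Proof.
rewrite /hb; case: xgetP => [B _ [_ h1]|h1]; first exact: h1.
by have [B hB] := hilbert_basis_exists; case: (h1 B).
Qed.

Lemma hb_uniq : uniq hb.
Proof. by rewrite /hb; case: xgetP => [B _ []|]. Qed.

Lemma hb_inS h : h \in hb -> dual_cone s h.
Proof. by move=> /mem_hb[]. Qed.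

Lemma hb_dg h : h \in hb -> (0 < dg h)%N.
Proof. by move=> /mem_hb[Sh h0 _]; rewrite lt0n dg_eq0. Qed.

Lemma hb_split u : dual_cone s u -> u != 0 ->
  exists h w, [/\ h \in hb, dual_cone s w & u = h + w].
Proof.
move: {2}(dg u) (leqnn (dg u)) => q; elim: q u => [|q IH] u uq Su u0.
  by move: uq; rewrite leqn0 dg_eq0 // (negbTE u0).
  have [uH|nH] := pselect (is_true (u \in hb)).
  by exists u, 0; rewrite addr0; split => //; exact: dual_cone0.
have [v [w [Sv Sw e v0 w0]]] : exists v w, [/\ dual_cone s v, dual_cone s w,
    u = v + w, v != 0 & w != 0].
  apply: contrapT => no; case: nH; apply/mem_hb; split => // v w Sv Sw e.
  have [->|v0] := eqVneq v 0; first by left.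
  have [->|w0] := eqVneq w 0; first by right.
  by case: no; exists v, w.
have [|h [w' [hH Sw' e']]] := IH v _ Sv v0.
  move: uq; rewrite e dgD //; have : (0 < dg w)%N by rewrite lt0n dg_eq0.
  by case: (dg w) => // k _; rewrite addnS ltnS => h; apply: leq_trans h; rewrite leq_addr.
exists h, (w' + w); rewrite dual_coneD //; split => //.
by rewrite e e' addrA.
Qed.

Lemma hb_ind (P : 'rV[int]_n -> Prop) : P 0 ->
  (forall h u, h \in hb -> dual_cone s u -> P u -> P (h + u)) ->
  forall u, dual_cone s u -> P u.
Proof.
move=> P0 PD u; move: {2}(dg u) (leqnn (dg u)) => q.
elim: q u => [|q IH] u uq Su.
  by move: uq; rewrite leqn0 dg_eq0 // => /eqP ->.
have [->//|u0] := eqVneq u 0.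
have [h [w [hH Sw e]]] := hb_split Su u0; rewrite e; apply: PD => //.
apply: IH => //; move: uq; rewrite e dgD //; last exact: hb_inS.
by have := hb_dg hH; lia.
Qed.
End RayTheory.

(** * Demazure roots *)

Section Roots.
Variables (n : nat) (s : toric_cone n) (D : ray_data s).
Local Notation S := (dual_cone s).

Section AdditiveFunction.
Variables (K : fieldType) (a : 'rV[int]_n -> K).
Hypothesis K0 : [pchar K] =i pred0.
Hypothesis aD : forall u v, S u -> S v -> a (u + v) = a u + a v.

Lemma additive_on_cone0 : a 0 = 0.
Proof.
have := aD (dual_cone0 s) (dual_cone0 s); rewrite addr0 => /eqP.
by rewrite eq_sym -subr_eq0 addrK => /eqP.
Qed.

Lemma dual_coneMn (k : nat) u : S u -> S (k%:Z *: u).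
Proof.
by move=> Su; apply/(inSE D) => l; rewrite phiMz mulr_ge0 // phi_ge0.
Qed.

Lemma additive_on_coneMn (k : nat) u : S u -> a (k%:Z *: u) = a u *+ k.
Proof.
move=> Su; elim: k => [|k IH]; first by rewrite scale0r additive_on_cone0.
by rewrite intS scalerDl scale1r aD ?dual_coneMn // IH mulrS.
Qed.

(** The extension to M takes the value a (u + p) - a p at [u], for any [p] in S that brings [u] into
    S. *)
Lemma additive_on_cone_linear : exists lam : 'rV[K]_n,
  forall u, S u -> a u = ev lam u.
Proof.
have /choice[p hp] := @shift_in_cone n s D.
pose b u := a (u + p u) - a (p u).
have bE u q : S q -> S (u + q) -> b u = a (u + q) - a q.
  move=> Sq Suq; have [Sp Sup] := hp u; apply/eqP.
  rewrite /b subr_eq addrAC eq_sym subr_eq -!aD // eq_sym; apply/eqP; congr a.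
  by rewrite addrAC.
have bD u v : b (u + v) = b u + b v.
  have [Sp Sup] := hp u; have [Sq Svq] := hp v.
  have Suv : S (u + v + (p u + p v)) by rewrite addrACA dual_coneD.
  by rewrite (bE _ _ (dual_coneD Sp Sq) Suv) /b addrACA (aD Sup Svq) (aD Sp Sq) opprD addrACA.
have b0 : b 0 = 0 by apply: (addrI (b 0)); rewrite -bD !addr0.
have bN u : b (- u) = - b u by apply/eqP; rewrite -addr_eq0 -bD addNr b0.
have bMz k u : b (k *: u) = k%:~R * b u.
  have bMn m : b (m%:Z *: u) = m%:R * b u.
    elim: m => [|m IH]; first by rewrite scale0r b0 mul0r.
    by rewrite intS scalerDl scale1r bD IH -addn1 addnC natrD mulrDl mul1r.
  case: k => m; first exact: bMn.
  by rewrite NegzE scaleNr bN bMn mulrNz mulNr.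
exists (\row_i b (delta_mx 0 i)) => u Su.
have -> : a u = b u.
  by rewrite (@bE u 0) ?addr0 ?additive_on_cone0 ?subr0 //; exact: dual_cone0.
rewrite {1}[u]row_sum_delta /ev; elim/big_rec2: _ => [|i x y _ IH] //.
by rewrite bD IH bMz mxE.
Qed.

(* If a derivation of K[S] has a nonzero homogeneous component of degree
   e \notin S, then e is a Demazure root. *)
Lemma demazure_root e : (forall u, S u -> a u != 0 -> S (u + e)) -> ~~ S e ->
  (exists2 u, S u & a u != 0) ->
  exists (j : 'I_(nrays D)) (c : K), [/\ c != 0, forall u, S u -> a u = c * (phi j u)%:~R,
    phi j e = -1 & forall l, l != j -> 0 <= phi l e].
Proof.
move=> ae eS [u0 Su0 au0].
(* A point of the facet [i] is moved out of S by [e], so [a] vanishes on the facet; being additive,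
   it is then a multiple of [phi i]. *)
have key (i : 'I_(nrays D)) : phi i e < 0 ->
    exists2 c : K, c != 0 & forall u, S u -> a u = c * (phi i u)%:~R.
  move=> ie; have face w : S w -> phi i w = 0 -> a w = 0.
    move=> Sw w0; apply/eqP; apply: contraTT ie => /(ae _ Sw) /(inSE D)/(_ i).
    by rewrite phiD w0 add0r -leNgt.
  have [z z0 hz] := facet_point i; have [u1 [u11 u1p]] := unit_point i.
  have Sz : S z.
    apply/(inSE D) => l; have [->|/hz/ltW //] := eqVneq l i.
    by rewrite /phi z0.
  have Su1 : S u1 by apply/(inSE D) => l; exact: ltW.
  have aE u : S u -> a u = a u1 * (phi i u)%:~R.
    move=> Su; have [k hk] := @shift_interior _ _ _ i (u - phi i u *: u1) z hz.
    set w := _ + _ in hk.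
    have w0 : phi i w = 0.
      by rewrite /w phiD phiB !phiMz u11 mulr1 subrr add0r [phi i z]z0 mulr0.
    have Sw : S w.
      by apply/(inSE D) => l; have [->|/hk/ltW //] := eqVneq l i; rewrite w0.
    have pE : phi i u = `|phi i u|%N by rewrite gez0_abs // phi_ge0.
    have e1 : u + k%:Z *: z = w + `|phi i u|%N%:Z *: u1.
      by rewrite -pE /w addrAC subrK.
    have := aD Su (dual_coneMn k Sz); rewrite e1 aD ?dual_coneMn //.
    rewrite !additive_on_coneMn // (face _ Sz z0) (face _ Sw w0) mul0rn addr0 add0r.
    by move=> <-; rewrite -mulr_natr [in RHS]pE.
  exists (a u1) => //; apply: contraNneq au0 => c0.
  by rewrite aE // c0 mul0r.
have [i ie] : exists i : 'I_(nrays D), phi i e < 0.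
  apply: contrapT => no; case/negP: eS; apply/(inSE D) => l.
  by rewrite leNgt; apply/negP => h; apply: no; exists l.
have [c c0 cE] := key i ie; exists i, c; split => //.
  have [u1 [u11 u1p]] := unit_point i.
  have Su1 : S u1 by apply/(inSE D) => l; exact: ltW.
  have := ae u1 Su1; rewrite cE // u11 mulr1 => /(_ c0) /(inSE D)/(_ i).
  by rewrite phiD u11; lia.
(* A second facet on which [e] is negative would make [a] proportional to two different normals. *)
move=> l li; rewrite leNgt; apply/negP => le.
have [d d0 dE] := key l le; have [z z0 hz] := facet_point i.
have Sz : S z.
  apply/(inSE D) => l'; have [->|/hz/ltW //] := eqVneq l' i.
  by rewrite /phi z0.
have := cE z Sz; rewrite dE // [phi i z]z0 mulr0 => /eqP.
by rewrite mulf_eq0 (negbTE d0) intr_char0_eq0 // gt_eqF // hz.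
Qed.
End AdditiveFunction.

(* A root e with tail j and head k is the degree of the derivation
   x_k d/dx_j in the homogeneous coordinates attached to the rays. *)
Definition is_root j k (e : 'rV[int]_n) :=
  j != k /\ forall l : 'I_(nrays D), phi l e = (l == k)%:Z - (l == j)%:Z.

Lemma is_root_inj j k e e' : is_root j k e -> is_root j k e' -> e = e'.
Proof. by move=> [_ h] [_ h']; apply: (@phi_inj _ _ D) => l; rewrite h h'. Qed.

Lemma is_rootN j k e : is_root j k e -> is_root k j (- e).
Proof. by move=> [jk h]; split=> [|l]; [rewrite eq_sym | rewrite phiN h opprB]. Qed.

Lemma is_rootD j k l e e' : j != l -> is_root j k e -> is_root k l e' ->
  is_root j l (e + e').
Proof. by move=> jl [_ h] [_ h']; split=> // i; rewrite phiD h h'; lia. Qed.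

Lemma is_root_tail j k e : is_root j k e -> phi j e = -1.
Proof. by move=> [jk ->]; rewrite eqxx (negbTE jk). Qed.

Lemma is_root_head j k e : is_root j k e -> phi k e = 1.
Proof. by move=> [jk ->]; rewrite eqxx eq_sym (negbTE jk). Qed.

Lemma is_root_uniq j k j' k' e : is_root j k e -> is_root j' k' e ->
  j = j' /\ k = k'.
Proof.
move=> h h'; have := is_root_tail h; have := is_root_head h.
case: h' => j'k' e'; rewrite !e'.
case: (eqVneq k k'); case: (eqVneq j j'); case: (eqVneq k j');
  case: (eqVneq j k') => //=; lia.
Qed.

Lemma is_root_inS j k e u : is_root j k e -> S u -> phi j u != 0 -> S (u + e).
Proof.
move=> [jk h] Su ju; apply/(inSE D) => l; rewrite phiD h.
have := phi_ge0 l Su; have [->|lj] := eqVneq l j; last by lia.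
by rewrite (negbTE jk); move: ju; lia.
Qed.

Lemma is_root_ell j k e : is_root j k e -> ell D e = 0.
Proof.
move=> [jk h]; rewrite ellE (bigD1 j) //= (bigD1 k) /= 1?eq_sym // big1.
  by rewrite !h !eqxx (negbTE jk) [k == j]eq_sym (negbTE jk).
by move=> l /andP[lj lk]; rewrite h (negbTE lj) (negbTE lk).
Qed.

Lemma is_root_neq0 j k e : is_root j k e -> e != 0.
Proof.
move=> h; apply/eqP => e0; have := is_root_head h.
by rewrite e0 phi0.
Qed.

Lemma is_root_notin j k e : is_root j k e -> ~~ S e.
Proof.
move=> h; apply/negP => /(inSE D)/(_ j); by rewrite (is_root_tail h).
Qed.

(** Roots are determined by their residues modulo 3: the values of a root under the [phi l] are -1,
    0 or 1, so those of two roots cannot differ by a nonzero multiple of 3. The bound does not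
    depend on the number of rays. *)
Lemma roots_exist : exists R : seq 'rV[int]_n, [/\ uniq R, (size R <= 3 ^ n)%N &
  forall e, (e \in R) <-> exists j k, is_root j k e].
Proof.
pose T := {ffun 'I_n -> 'I_3}.
pose res (u : 'rV[int]_n) : T := [ffun i => inord `|(u 0%R i %% 3)%Z|].
have res_inj e e' j k j' k' : is_root j k e -> is_root j' k' e' ->
    res e = res e' -> e = e'.
  move=> [_ h] [_ h'] re.
  have dv i : exists q, e 0 i = e' 0 i + 3 * q.
    have := congr1 (fun f : T => nat_of_ord (f i)) re; rewrite /= !ffunE !inordK; try by lia.
    by move=> q; exists ((e 0%R i %/ 3)%Z - (e' 0%R i %/ 3)%Z); lia.
  have /choice[q hq] := dv.
  have ee : e - e' = 3 *: \row_i q i.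
    by apply/rowP => i; rewrite !mxE hq addrC addKr.
  apply: (@phi_inj _ _ D) => l; have := phiMz l 3 (\row_i q i).
  by rewrite -ee phiB h h'; lia.
have /choice[f hf] : forall t : T, exists u,
    (exists e, (exists j k, is_root j k e) /\ res e = t) ->
    (exists j k, is_root j k u) /\ res u = t.
  move=> t; have [[e he]|no] := pselect (exists e,
     (exists j k, is_root j k e) /\ res e = t); first by exists e.
  by exists 0.
exists (undup [seq e <- [seq f t | t <- enum T] | `[< exists j k, is_root j k e >]]).
split=> [||e]; first exact: undup_uniq.
  apply: leq_trans (size_undup _) _; rewrite size_filter.
  apply: leq_trans (count_size _ _) _.
  by rewrite size_map -cardE card_ffun !card_ord.
rewrite mem_undup mem_filter; split=> [/andP[/asboolP //]|he].
rewrite asboolT //=; apply/mapP; exists (res e); first by rewrite mem_enum.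
have [|[j' [k' h']] re] := hf (res e); first by exists e.
by have [j [k h]] := he; apply: res_inj h h' _.
Qed.

Definition rts := xget [::] [set R : seq 'rV[int]_n |
  [/\ uniq R, (size R <= 3 ^ n)%N &
  forall e, (e \in R) <-> exists j k, is_root j k e]]%classic.

Lemma rtsP : [/\ uniq rts, (size rts <= 3 ^ n)%N &
  forall e, (e \in rts) <-> exists j k, is_root j k e].
Proof. by rewrite /rts; case: xgetP => [R _ //|h]; have [R /h] := roots_exist. Qed.

Lemma mem_rts e : (e \in rts) <-> exists j k, is_root j k e.
Proof. by have [] := rtsP. Qed.

Lemma size_rts : (size rts <= 3 ^ n)%N. Proof. by have [] := rtsP. Qed.
Lemma uniq_rts : uniq rts. Proof. by have [] := rtsP. Qed.
End Roots.

(** * The monoid algebra *)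

Section MonoidAlgebra.
Variables (K : fieldType) (n : nat) (s : toric_cone n).
Local Notation S := (dual_cone s).
Local Notation R := {malg K[dual_monoid s]}.
Implicit Types (f g : R) (u v w : 'rV[int]_n).

(* Monomials and coefficients are indexed by the whole lattice, with value 0
   outside of the monoid. *)
Definition mchi u : R :=
  if insub u is Some m then mkmalgU (m : dual_monoid s) 1 else 0.
Definition mcf f u : K :=
  if insub u is Some m then mcoeff (m : dual_monoid s) f else 0.

Lemma mcfD f g u : mcf (f + g) u = mcf f u + mcf g u.
Proof.
by rewrite /mcf; case: insub => [m|]; rewrite ?addr0 // mcoeffD.
Qed.
Lemma mcfN f u : mcf (- f) u = - mcf f u.
Proof.
by rewrite /mcf; case: insub => [m|]; rewrite ?oppr0 // mcoeffN.
Qed.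
Lemma mcfB f g u : mcf (f - g) u = mcf f u - mcf g u.
Proof. by rewrite mcfD mcfN. Qed.
Lemma mcf0 u : mcf 0 u = 0.
Proof. by rewrite /mcf; case: insub => [m|] //; rewrite mcoeff0. Qed.
Lemma mcfZ c f u : mcf (c *: f) u = c * mcf f u.
Proof.
by rewrite /mcf; case: insub => [m|]; rewrite ?mulr0 // mcoeffZ.
Qed.

Lemma mcf_val f (m : dual_monoid s) : mcf f (val m) = mcoeff m f.
Proof. by rewrite /mcf valK. Qed.

Lemma mcf_out f u : ~~ S u -> mcf f u = 0.
Proof. by move=> Su; rewrite /mcf insubN. Qed.

Lemma mcf_neq0 f u : mcf f u != 0 -> S u.
Proof. by apply: contraNT => /mcf_out ->. Qed.

Lemma mcfP f g : (forall u, S u -> mcf f u = mcf g u) -> f = g.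
Proof.
by move=> h; apply/malgP => m; rewrite -!mcf_val h // (valP m).
Qed.

Lemma mchi_val (m : dual_monoid s) : mchi (val m) = mkmalgU m 1.
Proof. by rewrite /mchi valK. Qed.

Lemma mcf_mchi u v : mcf (mchi u) v = (S u && (u == v))%:R.
Proof.
rewrite /mchi; case: insubP => [m Su mu|nS]; last by rewrite mcf0 (negbTE nS).
rewrite Su /mcf; case: insubP => [m' Sv mv|nS] /=.
  by rewrite mcoeffU -val_eqE /= mu mv; case: (u == v).
by case: eqP => // uv; rewrite -uv Su in nS.
Qed.

Lemma mchi0 : mchi 0 = 1.
Proof. by rewrite -[0]/(val (dmone s)) mchi_val. Qed.

Lemma mchiM u v : S u -> S v -> mchi u * mchi v = mchi (u + v).
Proof.
move=> Su Sv; pose a : dual_monoid s := exist _ u Su.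
pose b : dual_monoid s := exist _ v Sv.
rewrite -[u]/(val a) -[v]/(val b) -[_ + _]/(val (dmmul a b)) !mchi_val.
by rewrite malgM_def fgmulUU mulr1.
Qed.

Definition supps f : seq 'rV[int]_n := [seq val m | m <- msupp f].

Lemma mem_supps f u : (u \in supps f) = (mcf f u != 0).
Proof.
apply/mapP/idP => [[m mf ->]|h]; first by rewrite mcf_val mcoeff_neq0.
have Su := mcf_neq0 h; exists (exist _ u Su) => //.
by rewrite -mcoeff_neq0 -mcf_val.
Qed.

Lemma malg_mchiE f : f = \sum_(u <- supps f) mcf f u *: mchi u.
Proof.
rewrite {1}[f]monalgE /supps big_map; apply: eq_bigr => m _.
rewrite mcf_val mchi_val; apply/malgP => m'.
by move: (mcoeff m f) => c; rewrite mcoeffZ [LHS]mcoeffU [X in _ * X]mcoeffU mulrnAr mulr1.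
Qed.

Lemma supps_uniq f : uniq (supps f).
Proof. by rewrite map_inj_uniq //; exact: val_inj. Qed.
End MonoidAlgebra.

(* The monoid algebra K[S] through its monomials and coefficients only; keeping
   its multiplication abstract prevents rewriting from unfolding it. *)
Record toric_alg (K : fieldType) n (s : toric_cone n) := ToricAlg {
  talg :> comAlgType K;
  chi : 'rV[int]_n -> talg;
  cf : talg -> 'rV[int]_n -> K;
  supp : talg -> seq 'rV[int]_n;
  cfD : forall f g u, cf (f + g) u = cf f u + cf g u;
  cfZ : forall c f u, cf (c *: f) u = c * cf f u;
  cf_out : forall f u, ~~ dual_cone s u -> cf f u = 0;
  cfP : forall f g, (forall u, dual_cone s u -> cf f u = cf g u) -> f = g;
  cf_chi : forall u v, cf (chi u) v = (dual_cone s u && (u == v))%:R;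
  chi0 : chi 0 = 1;
  chiM : forall u v, dual_cone s u -> dual_cone s v ->
    chi u * chi v = chi (u + v);
  supp_uniq : forall f, uniq (supp f);
  mem_supp : forall f u, (u \in supp f) = (cf f u != 0);
  chiE : forall f, f = \sum_(u <- supp f) cf f u *: chi u
}.

Definition malg_toric_alg (K : fieldType) n (s : toric_cone n) : toric_alg K s :=
  @ToricAlg K n s {malg K[dual_monoid s]} (@mchi K n s) (@mcf K n s) (@supps K n s)
    (@mcfD K n s) (@mcfZ K n s) (@mcf_out K n s) (@mcfP K n s) (@mcf_mchi K n s)
    (@mchi0 K n s) (@mchiM K n s) (@supps_uniq K n s) (@mem_supps K n s)
    (@malg_mchiE K n s).

Section ToricAlg.
Variables (K : fieldType) (n : nat) (s : toric_cone n) (R : toric_alg K s).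
Local Notation S := (dual_cone s).
Implicit Types (f g : R) (u v w : 'rV[int]_n).

Lemma cf0 u : cf (0 : R) u = 0.
Proof. by apply: (addrI (cf (0 : R) u)); rewrite -cfD !addr0. Qed.
Lemma cfN f u : cf (- f) u = - cf f u.
Proof. by apply/eqP; rewrite -addr_eq0 -cfD addNr cf0. Qed.
Lemma cfB f g u : cf (f - g) u = cf f u - cf g u.
Proof. by rewrite cfD cfN. Qed.
Lemma cf_sum (I : Type) (r : seq I) (P : pred I) (F : I -> R) u :
  cf (\sum_(i <- r | P i) F i) u = \sum_(i <- r | P i) cf (F i) u.
Proof.
elim: r => [|i r IH]; first by rewrite !big_nil cf0.
by rewrite !big_cons; case: (P i) => //; rewrite cfD IH.
Qed.

Lemma cf_neq0 f u : cf f u != 0 -> S u.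
Proof. by apply: contraNT => /cf_out ->. Qed.

Lemma supp_inS f u : u \in supp f -> S u.
Proof. by rewrite mem_supp => /cf_neq0. Qed.

Definition linext (F : 'rV[int]_n -> R) f : R :=
  \sum_(u <- supp f) cf f u *: F u.

Lemma linextEw F f (r : seq 'rV[int]_n) : uniq r -> {subset supp f <= r} ->
  linext F f = \sum_(u <- r) cf f u *: F u.
Proof.
move=> ur sub; rewrite /linext (perm_big (filter (mem (supp f)) r)); last first.
  apply: uniq_perm; rewrite ?supp_uniq ?filter_uniq // => u.
  by rewrite mem_filter inE andb_idr // => /sub.
rewrite big_filter big_mkcond; apply: eq_bigr => u _.
by rewrite inE mem_supp; case: eqP => //= ->; rewrite scale0r.
Qed.

Section Linear.
Variables (V : zmodType) (sc : K -> V -> V).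
(** Scalars act on the target through [sc], so that one notion covers endomorphisms of [R],
    coefficient functionals and maps to larger rings. *)
Definition klin (F : R -> V) :=
  (forall f g, F (f + g) = F f + F g) /\ forall c f, F (c *: f) = sc c (F f).

Lemma klin0 F : klin F -> F 0 = 0.
Proof. by move=> [h _]; apply: (addrI (F 0)); rewrite -h !addr0. Qed.

Lemma klin_sum F (I : Type) (r : seq I) (P : pred I) (f : I -> R) : klin F ->
  F (\sum_(i <- r | P i) f i) = \sum_(i <- r | P i) F (f i).
Proof.
move=> lF; elim: r => [|i r IH]; first by rewrite !big_nil klin0.
by rewrite !big_cons; case: (P i) => //; rewrite (lF.1) IH.
Qed.

Lemma klin_chi F : klin F ->
  forall f, F f = \sum_(u <- supp f) sc (cf f u) (F (chi R u)).
Proof.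
move=> lF f; rewrite {1}[f]chiE klin_sum //.
by apply: eq_bigr => u _; rewrite (lF.2).
Qed.

Lemma klin_eq F G : klin F -> klin G -> (forall u, S u -> F (chi R u) = G (chi R u)) ->
  forall f, F f = G f.
Proof.
move=> lF lG h f; rewrite (klin_chi lF) (klin_chi lG) !big_seq.
by apply: eq_bigr => u /supp_inS /h ->.
Qed.
End Linear.

Local Notation lin F := (klin (@GRing.scale K R) (F : R -> R)).

Lemma lin_linext F : lin (linext F).
Proof.
split=> [f g|c f].
  pose r := undup (supp f ++ supp g ++ supp (f + g)).
  rewrite !(@linextEw _ _ r) ?undup_uniq //; first 1 last.
  - by move=> u; rewrite mem_undup !mem_cat => ->; rewrite ?orbT.
  - by move=> u; rewrite mem_undup !mem_cat => ->; rewrite ?orbT.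
  - by move=> u; rewrite mem_undup !mem_cat => ->; rewrite ?orbT.
  by rewrite -big_split; apply: eq_bigr => u _; rewrite cfD scalerDl.
pose r := undup (supp f ++ supp (c *: f)).
rewrite !(@linextEw _ _ r) ?undup_uniq //; first 1 last.
- by move=> u; rewrite mem_undup !mem_cat => ->; rewrite ?orbT.
- by move=> u; rewrite mem_undup !mem_cat => ->; rewrite ?orbT.
by rewrite scaler_sumr; apply: eq_bigr => u _; rewrite cfZ scalerA.
Qed.

Lemma linext_chi F u : S u -> linext F (chi R u) = F u.
Proof.
move=> Su; rewrite (@linextEw _ _ [:: u]) //.
  by rewrite big_seq1 cf_chi Su eqxx scale1r.
by move=> v; rewrite mem_supp cf_chi inE Su [v == u]eq_sym; case: (u == v); rewrite ?eqxx.
Qed.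
End ToricAlg.

(** * Derivations and automorphisms of the monoid algebra *)

Lemma leibnizD (A : comPzRingType) (a b c d f g : A) :
  a * g + f * c + (b * g + f * d) = (a + b) * g + f * (c + d).
Proof. by ring. Qed.
Lemma leibnizB (A : comPzRingType) (a b c d f g : A) :
  a * g + f * c - (b * g + f * d) = (a - b) * g + f * (c - d).
Proof. by ring. Qed.
Lemma leibniz_brk (A : comPzRingType) (f g df dg ef eg def deg edf edg : A) :
  def * g + ef * dg + (df * eg + f * deg) -
    (edf * g + df * eg + (ef * dg + f * edg)) =
  (def - edf) * g + f * (deg - edg).
Proof. by ring. Qed.

Section Derivations.
Variables (K : fieldType) (n : nat) (s : toric_cone n) (D : ray_data s).
Variable R : toric_alg K s.
Hypothesis K0 : [pchar K] =i pred0.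
Local Notation S := (dual_cone s).
Local Notation chi := (chi R).
Local Notation lin F := (klin (@GRing.scale K R) (F : R -> R)).
Local Notation klin1 F := (klin (@GRing.mul K) (F : R -> K)).
Local Notation dg := (dg D).
Implicit Types (f g : R) (u v w e : 'rV[int]_n).

Lemma lin_mull g : lin (fun f => f * g).
Proof. by split=> [a b|c a]; rewrite ?mulrDl ?scalerAl. Qed.
Lemma lin_mulr g : lin (fun f => g * f).
Proof. by split=> [a b|c a]; rewrite ?mulrDr ?scalerAr. Qed.
Lemma lin_comp F G : lin F -> lin G -> lin (F \o G).
Proof. by move=> [F1 F2] [G1 G2]; split=> [a b|c a] /=; rewrite ?G1 ?G2 ?F1 ?F2. Qed.
Lemma lin_add F G : lin F -> lin G -> lin (fun f => F f + G f).
Proof.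
move=> [F1 F2] [G1 G2]; split=> [a b|c a]; first by rewrite F1 G1 addrACA.
by rewrite F2 G2 scalerDr.
Qed.
Lemma lin_scale c F : lin F -> lin (fun f => c *: F f).
Proof.
move=> [F1 F2]; split=> [a b|c' a]; first by rewrite F1 scalerDr.
by rewrite F2 !scalerA mulrC.
Qed.
Lemma lin_opp F : lin F -> lin (fun f => - F f).
Proof.
move=> [F1 F2]; split=> [a b|c a]; first by rewrite F1 opprD.
by rewrite F2 scalerN.
Qed.
Lemma lin_sub F G : lin F -> lin G -> lin (fun f => F f - G f).
Proof. by move=> hF hG; exact: (lin_add hF (lin_opp hG)). Qed.
Lemma lin_sum (I : Type) (r : seq I) (F : I -> R -> R) :
  (forall i, lin (F i)) -> lin (fun f => \sum_(i <- r) F i f).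
Proof.
move=> h; split=> [a b|c a].
  by rewrite -big_split; apply: eq_bigr => i _; rewrite (h i).1.
by rewrite scaler_sumr; apply: eq_bigr => i _; rewrite (h i).2.
Qed.
Lemma lin_id : lin id. Proof. by []. Qed.
Lemma lin_cf F u : lin F -> klin1 (fun f => cf (F f) u).
Proof.
by move=> [F1 F2]; split=> [a b|c a]; rewrite ?F1 ?F2 ?cfD ?cfZ.
Qed.

Lemma cf_chiM u f w : S u -> cf (chi u * f) (u + w) = cf f w.
Proof.
move=> Su; move: f; apply: (@klin_eq K n s R K *%R (fun f => cf (chi u * f) (u + w)) (fun f => cf f w)).
- exact: lin_cf (lin_mulr _).
- exact: lin_cf lin_id.
by move=> v Sv; rewrite chiM // !cf_chi dual_coneD // Sv (inj_eq (addrI u)).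
Qed.

Lemma cfM f g u :
  cf (f * g) u = \sum_(v <- ball D (dg u)) cf f v * cf g (u - v).
Proof.
move: f; apply: (@klin_eq K n s R K *%R (fun f => cf (f * g) u)
   (fun f => \sum_(v <- ball D (dg u)) cf f v * cf g (u - v))).
- exact: lin_cf (lin_mull _).
- split=> [a b|c a].
    by rewrite -big_split; apply: eq_bigr => v _; rewrite cfD mulrDl.
  by rewrite mulr_sumr; apply: eq_bigr => v _; rewrite cfZ mulrA.
move=> v Sv; have e : cf (chi v * g) u = cf g (u - v).
  by rewrite -{1}(subrKC v u) cf_chiM.
rewrite e; have [vB|vB] := boolP (v \in ball D (dg u)).
  rewrite (big_rem v) //= cf_chi Sv eqxx mul1r big_seq big1 ?addr0 // => w.
  move=> wB; have : w != v.
    by apply: contraTneq wB => ->; rewrite mem_rem_uniqF // ball_uniq.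
  by rewrite cf_chi eq_sym => /negbTE ->; rewrite andbF mul0r.
rewrite big_seq big1 => [|w wB]; last first.
  have : v != w by apply: contraNneq vB => ->.
  by rewrite cf_chi => /negbTE ->; rewrite andbF mul0r.
apply: cf_out; apply: contra vB => Suv; rewrite mem_ball Sv /=.
by rewrite -[X in (_ <= dg X)%N](subrKC v u) dgD // leq_addr.
Qed.

Lemma cfM0 f g : cf (f * g) 0 = cf f 0 * cf g 0.
Proof.
rewrite cfM dg0 (big_rem 0) /=; last by rewrite mem_ball dg0 dual_cone0.
rewrite subr0 big_seq big1 ?addr0 // => w.
rewrite mem_rem_uniq ?ball_uniq // inE mem_ball leqn0 => /and3P[w0 Sw].
by rewrite dg_eq0 // (negbTE w0).
Qed.

Lemma cf1 : cf (1 : R) 0 = 1.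
Proof. by rewrite -chi0 cf_chi dual_cone0 eqxx. Qed.

(** The last clause says that the maximal ideal of the fixed point is preserved. *)
Definition is_der (d : R -> R) := [/\ lin d,
  forall f g, d (f * g) = d f * g + f * d g
  & forall f, cf f 0 = 0 -> cf (d f) 0 = 0].

Lemma is_der_lin d : is_der d -> lin d. Proof. by case. Qed.

Lemma is_der0 d : is_der d -> forall f, cf (d f) 0 = 0.
Proof.
move=> [ld dM dm] f; have d1 : d 1 = 0.
  by apply: (addrI (d 1)); rewrite addr0 -{3}[1](mulr1 1) dM mulr1 mul1r.
have -> : f = cf f 0 *: 1 + (f - cf f 0 *: 1) by rewrite addrC subrK.
rewrite (ld.1) (ld.2) d1 scaler0 add0r dm //.
by rewrite cfB cfZ cf1 mulr1 subrr.
Qed.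

Lemma is_der_add d d' : is_der d -> is_der d' -> is_der (fun f => d f + d' f).
Proof.
move=> [l m z] [l' m' z']; split=> [|f g|f f0]; first exact: (lin_add l l').
  by rewrite m m' leibnizD.
by rewrite cfD z // z' // addr0.
Qed.

Lemma is_der_scale c d : is_der d -> is_der (fun f => c *: d f).
Proof.
move=> [l m z]; split=> [|f g|f f0]; first exact: (lin_scale c l).
  by rewrite m scalerDr; congr (_ + _); [exact: scalerAl | exact: scalerAr].
by rewrite cfZ z // mulr0.
Qed.

Lemma is_der_sub d d' : is_der d -> is_der d' -> is_der (fun f => d f - d' f).
Proof.
move=> [l m z] [l' m' z']; split=> [|f g|f f0]; first exact: (lin_sub l l').
  by rewrite m m' leibnizB.
by rewrite cfB z // z' // subr0.
Qed.

Lemma is_der_sum (I : Type) (r : seq I) (d : I -> R -> R) :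
  (forall i, is_der (d i)) -> is_der (fun f => \sum_(i <- r) d i f).
Proof.
move=> h; split=> [|f g|f f0].
- by apply: lin_sum => i; case: (h i).
- rewrite mulr_suml mulr_sumr -big_split; apply: eq_bigr => i _.
  by case: (h i) => _ ->.
- by rewrite cf_sum big1 // => i _; case: (h i) => _ _ ->.
Qed.

Definition brk (d d' : R -> R) f := d (d' f) - d' (d f).

Lemma is_der_brk d d' : is_der d -> is_der d' -> is_der (brk d d').
Proof.
move=> [l m z] [l' m' z']; split=> [|f g|f f0].
- by apply: lin_sub; [exact: (lin_comp l l')|exact: (lin_comp l' l)].
- rewrite /brk (m f g) (m' f g) (l.1) (l'.1) (m (d' f)) (m f) (m' (d f)) (m' f).
  exact: leibniz_brk.
- by rewrite /brk cfB (z _ (z' _ f0)) (z' _ (z _ f0)) subr0.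
Qed.

Definition is_aut (g : R -> R) := [/\ lin g, forall a b, g (a * b) = g a * g b,
  bijective g & forall f, (cf (g f) 0 == 0) = (cf f 0 == 0)].

Lemma is_aut1 (g : R -> R) : is_aut g -> g 1 = 1.
Proof.
move=> [l m [h gK hK] _].
by rewrite -[LHS]mulr1 -[X in _ * X](hK 1) -m mul1r hK.
Qed.

Lemma is_autV (g h : R -> R) : is_aut g -> cancel g h -> is_aut h.
Proof.
move=> ag gK; have [l m bg z] := ag.
have hK : cancel h g.
  by have [h' gK' hK'] := bg; move=> x; rewrite -{1}(hK' x) gK hK'.
split=> [|a b||f]; last by rewrite -z hK.
- by split=> [a b|c a]; apply: (bij_inj bg); rewrite ?(l.1) ?(l.2) !hK.
- by apply: (bij_inj bg); rewrite m !hK.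
- by exists g.
Qed.

Lemma is_der_conj (g h d : R -> R) : is_aut g -> cancel g h -> is_der d ->
  is_der (g \o d \o h).
Proof.
move=> ag gK [ld dM dm]; have [lg gM bg gz] := ag.
have [lh hM bh hz] := is_autV ag gK.
have hK : cancel h g.
  by have [h' gK' hK'] := bg; move=> x; rewrite -{1}(hK' x) gK hK'.
split=> [|a b|f f0].
- by apply: lin_comp => //; apply: lin_comp.
- by rewrite /= hM dM (lg.1) !gM !hK.
- by apply/eqP; rewrite /= gz; apply/eqP/dm/eqP; rewrite hz; apply/eqP.
Qed.

Definition hder (b : 'rV[K]_n) e : R -> R := linext (fun u => ev b u *: chi (u + e)).

Lemma hder_chi b e u : S u -> hder b e (chi u) = ev b u *: chi (u + e).
Proof. exact: linext_chi. Qed.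

Lemma is_der_hder b e :
  (forall u, S u -> ev b u != 0 -> S (u + e) /\ u + e != 0) -> is_der (hder b e).
Proof.
move=> be; have lh : lin (hder b e) by exact: lin_linext.
have z f : cf (hder b e f) 0 = 0.
  move: f; apply: (@klin_eq K n s R K *%R (fun f => cf (hder b e f) 0) (fun=> 0)).
  - exact: lin_cf lh.
  - by split=> [a c|c a]; rewrite ?addr0 ?mulr0.
  move=> u Su; rewrite hder_chi // cfZ cf_chi; have [->|bu] := eqVneq (ev b u) 0.
    by rewrite mul0r.
  by have [_ /negbTE ->] := be u Su bu; rewrite andbF mulr0.
split=> // f g; move: f.
apply: (@klin_eq K n s R R *:%R (fun f => hder b e (f * g))
  (fun f => hder b e f * g + f * hder b e g)).
- exact: (lin_comp lh (lin_mull g)).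
- by apply: lin_add; [exact: (lin_comp (lin_mull g) lh)|exact: lin_mull].
move=> u Su; move: g.
apply: (@klin_eq K n s R R *:%R (fun g => hder b e (chi u * g))
  (fun g => hder b e (chi u) * g + chi u * hder b e g)).
- exact: (lin_comp lh (lin_mulr _)).
- by apply: lin_add; [exact: lin_mulr|exact: (lin_comp (lin_mulr _) lh)].
move=> v Sv; rewrite chiM // !hder_chi ?dual_coneD // raddfD /= scalerDl.
rewrite -scalerAl -scalerAr; congr (_ + _).
  have [->|bu] := eqVneq (ev b u) 0; first by rewrite !scale0r.
  by have [Sue _] := be u Su bu; rewrite chiM // addrAC.
have [->|bv] := eqVneq (ev b v) 0; first by rewrite !scale0r.
by have [Sve _] := be v Sv bv; rewrite chiM // addrA.
Qed.

(** Each homogeneous component of a derivation is governed by an additive function of the exponent,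
    to which the classification of Demazure roots applies. *)
Lemma der_coefD d e u v : is_der d -> S u -> S v ->
  cf (d (chi (u + v))) (u + v + e) = cf (d (chi u)) (u + e) + cf (d (chi v)) (v + e).
Proof.
move=> [ld dM dm] Su Sv; rewrite -chiM // dM cfD [d _ * _]mulrC.
have -> : u + v + e = v + (u + e) by rewrite addrCA addrA.
by rewrite cf_chiM // addrCA cf_chiM.
Qed.

(* The degrees that occur in a derivation and do not raise ell are 0 and the
   semisimple roots: by the shape of a Demazure root e, ell e >= 0, with
   equality only if -e is a Demazure root as well. *)
Lemma der_weight d u w : is_der d -> S u -> cf (d (chi u)) w != 0 ->
  [\/ (dg u < dg w)%N, w = u | exists j k, is_root (D := D) j k (w - u)].
Proof.
move=> dd Su cw; have Sw := cf_neq0 cw; pose e := w - u.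
have wE : w = u + e by rewrite /e subrKC.
pose a v := cf (d (chi v)) (v + e).
have aD v v' : S v -> S v' -> a (v + v') = a v + a v' by exact: der_coefD.
have au : a u != 0 by rewrite /a -wE.
have [e0|e0] := eqVneq e 0; first by constructor 2; rewrite wE e0 addr0.
have [Se|Se] := boolP (S e).
  constructor 1; rewrite wE dgD // -[X in (X < _)%N]addn0 ltn_add2l lt0n.
  by rewrite dg_eq0.
have ae v : S v -> a v != 0 -> S (v + e) by move=> _; exact: cf_neq0.
have [j [c [c0 cE ej el]]] := @demazure_root n s D K a K0 aD e ae Se (ex_intro2 _ _ u Su au).
(* Otherwise the derivation would send [chi (- e)] to an element with nonzero constant term, out of
   the maximal ideal. *)
have SNe : ~~ S (- e).
  apply/negP => Sne; have := cE _ Sne.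
  by rewrite phiN ej /a addNr is_der0 // mulr1 => /esym/eqP; rewrite (negbTE c0).
have [k ek] : exists k : 'I_(nrays D), 0 < phi k e.
  apply: contrapT => no; case/negP: SNe; apply/(inSE D) => l.
  by rewrite phiN oppr_ge0 leNgt; apply/negP => h; apply: no; exists l.
have kj : k != j by apply: contraTneq ek => ->; rewrite ej.
have dwu : (dg w)%:Z = (dg u)%:Z + ell D e.
  by rewrite !dgE // wE ellD.
have eE : ell D e = phi k e - 1 + \sum_(l | (l != j) && (l != k)) phi l e.
  by rewrite ellE (bigD1 j) //= (bigD1 k) //= ej; ring.
have sum0 : 0 <= \sum_(l | (l != j) && (l != k)) phi l e.
  by apply: sumr_ge0 => l /andP[lj _]; exact: el.
have [lt|ge] := ltnP (dg u) (dg w); first by constructor 1.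
constructor 3; exists j, k; rewrite -/e; split=> [|l]; first by rewrite eq_sym.
have k1 : phi k e = 1 by lia.
have s0 : \sum_(l | (l != j) && (l != k)) phi l e = 0 by lia.
have [->|lj] := eqVneq l j; first by rewrite ej eq_sym (negbTE kj).
have [->|lk] := eqVneq l k; first by rewrite k1.
move/eqP: s0; rewrite psumr_eq0 => [/allP/(_ l (mem_index_enum l))|l' /andP[h _]].
  by rewrite /= lj lk /= => /eqP ->.
exact: el.
Qed.
End Derivations.

Lemma integral_multiple m n (X : 'M[rat]_(m, n)) : exists2 N : int, N != 0 &
  exists Y : 'M[int]_(m, n), map_mx intr Y = N%:~R *: X.
Proof.
pose N : int := \prod_(p : 'I_m * 'I_n) denq (X p.1 p.2); exists N.
  by apply/prodf_neq0 => p _; exact: denq_neq0.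
exists (\matrix_(i, j) (numq (X i j) * \prod_(p | p != (i, j)) denq (X p.1 p.2))).
apply/matrixP => i j; rewrite !mxE.
have -> : N = denq (X i j) * \prod_(p | p != (i, j)) denq (X p.1 p.2).
  by rewrite /N (bigD1 (i, j)).
by rewrite !intrM numqE; ring.
Qed.

(* E^T E and E have the same rank over Q, hence over any field of
   characteristic 0. *)
Lemma gram_kernel (K : fieldType) (n : nat) (hs : seq 'rV[int]_n) (lam : 'rV[K]_n) :
  [pchar K] =i pred0 ->
  (forall j, \sum_(h <- hs) ev lam h * (h 0 j)%:~R = 0) ->
  forall h, h \in hs -> ev lam h = 0.
Proof.
move=> K0 hl; pose E : 'M[int]_(size hs, n) := \matrix_(a, j) (nth 0 hs a) 0 j.
pose Eq : 'M[rat]_(size hs, n) := map_mx intr E.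
(* Over Q, E^T E C = 0 gives (E C)^T (E C) = 0, and a sum of squares vanishes only termwise. The
   resulting factorization of E through E^T E is then cleared of denominators and carried over to
   [K]. *)
have sub : (Eq <= Eq^T *m Eq)%MS.
  rewrite submxE; set C := cokermx _; have EC : Eq^T *m Eq *m C = 0 by apply: mulmx_coker.
  have : (Eq *m C)^T *m (Eq *m C) = 0.
    by rewrite trmx_mul -!mulmxA [X in C^T *m X]mulmxA EC mulmx0.
  move=> Z; apply/eqP/matrixP => a j; rewrite [RHS]mxE.
  have /matrixP/(_ j j) := Z; rewrite mxE [RHS]mxE => /eqP.
  rewrite psumr_eq0 => [/allP/(_ a (mem_index_enum a))|i _]; last first.
    by rewrite mxE -expr2 sqr_ge0.
  by rewrite /= mxE mulf_eq0 orbb => /eqP.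
have /submxP[X XE] := sub; have [N N0 [Y YE]] := integral_multiple X.
have {}YE : N *: E = Y *m (E^T *m E).
  apply/matrixP => i j; apply: (@intr_inj rat).
  suff /matrixP/(_ i j) : map_mx intr (N *: E) = map_mx intr (Y *m (E^T *m E)) :> 'M[rat]_(_, _).
    by rewrite ![(map_mx _ _) _ _]mxE.
  by rewrite map_mxZ !map_mxM -map_trmx YE -scalemxAl -XE.
move=> h hh; pose a := Ordinal (etrans (index_mem h hs) hh).
have hE : h = nth 0 hs a by rewrite nth_index.
have : N%:~R * ev lam h = 0.
  have -> : N%:~R * ev lam h = \sum_j ((N *: E : 'M_(_, _)) a j)%:~R * lam 0 j.
    rewrite /ev mulr_sumr; apply: eq_bigr => j _.
    by rewrite mxE [E a j]mxE -hE intrM mulrA.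
  rewrite YE.
  have -> : \sum_j ((Y *m (E^T *m E)) a j)%:~R * lam 0 j =
      \sum_i (Y a i)%:~R * \sum_(h <- hs) ev lam h * (h 0 i)%:~R.
    under eq_bigr do rewrite mxE rmorph_sum mulr_suml.
    rewrite exchange_big; apply: eq_bigr => i _ /=.
    under eq_bigr do rewrite intrM -mulrA.
    rewrite -mulr_sumr; congr (_ * _).
    under [LHS]eq_bigr do rewrite mxE rmorph_sum mulr_suml.
    rewrite exchange_big (big_nth 0) big_mkord; apply: eq_bigr => b _ /=.
    rewrite /ev mulr_suml; apply: eq_bigr => j _.
    by rewrite !mxE intrM; ring.
  by apply: big1 => i _; rewrite hl mulr0.
by move/eqP; rewrite mulf_eq0 intr_char0_eq0 // (negbTE N0) => /eqP.
Qed.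

(** * Derivations of degree zero *)

Section DegreeZero.
Variables (K : fieldType) (n : nat) (s : toric_cone n) (D : ray_data s).
Variable R : toric_alg K s.
Hypothesis K0 : [pchar K] =i pred0.
Local Notation S := (dual_cone s).
Local Notation chi := (chi R).
Local Notation lin F := (klin (@GRing.scale K R) (F : R -> R)).
Local Notation dg := (dg D).
Local Notation r0 := (n + size (rts D))%N.
Local Notation is_der := (@is_der K n s R).
Local Notation is_aut := (@is_aut K n s R).

Definition root_of (k : 'I_(size (rts D))) : 'rV[int]_n := (rts D)`_k.
Definition root_ray e : 'rV[int]_n :=
  xget 0 [set r | exists j k, is_root (D := D) j k e /\ r = ray j]%classic.

Lemma root_rayE j k e : is_root (D := D) j k e -> root_ray e = ray j.
Proof.
move=> h; rewrite /root_ray; case: xgetP => [r _ [j' [k' [h' ->]]]|no].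
  by have [-> _] := is_root_uniq h h'.
by case: (no (ray j)); exists j, k.
Qed.

Lemma root_ofP k : exists a b, is_root (D := D) a b (root_of k).
Proof. by apply/mem_rts; exact: mem_nth. Qed.

Lemma root_of_inj : injective root_of.
Proof.
move=> i j /eqP; rewrite /root_of nth_uniq ?uniq_rts // => /eqP.
exact: val_inj.
Qed.

Lemma root_of_surj j k e : is_root (D := D) j k e -> exists i, root_of i = e.
Proof.
move=> h; have eR : e \in rts D by apply/mem_rts; exists j, k.
by exists (Ordinal (etrans (index_mem e (rts D)) eR)); rewrite /root_of nth_index.
Qed.

(** [bcov i] and [bwt i] are the covector and the degree of the i-th basic derivation of degree
    zero. The first n span the torus; for a root, the covector is the normal of its tail, as the
    classification of roots dictates. *)
Definition bcov (i : 'I_r0) : 'rV[K]_n :=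
  match split i with inl k => delta_mx 0 k
  | inr k => map_mx intr (root_ray (root_of k)) end.
Definition bwt (i : 'I_r0) : 'rV[int]_n :=
  match split i with inl k => 0 | inr k => root_of k end.

Lemma bcovl k : bcov (lshift _ k) = delta_mx 0 k.
Proof. by rewrite /bcov (unsplitK (inl k)). Qed.
Lemma bcovr k : bcov (rshift _ k) = map_mx intr (root_ray (root_of k)).
Proof. by rewrite /bcov (unsplitK (inr k)). Qed.
Lemma bwtl k : bwt (lshift _ k) = 0.
Proof. by rewrite /bwt (unsplitK (inl k)). Qed.
Lemma bwtr k : bwt (rshift _ k) = root_of k.
Proof. by rewrite /bwt (unsplitK (inr k)). Qed.

Lemma ev_bcovl k u : ev (bcov (lshift _ k)) u = (u 0 k)%:~R.
Proof.
rewrite bcovl /ev (bigD1 k) //= big1 => [|j jk].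
  by rewrite !mxE !eqxx mulr1 addr0.
by rewrite !mxE eqxx (negbTE jk) mulr0.
Qed.
Lemma ev_bcovr k a b u : is_root (D := D) a b (root_of k) ->
  ev (bcov (rshift _ k)) u = (phi a u)%:~R.
Proof. by move=> h; rewrite bcovr (root_rayE h) ev_intr. Qed.

Lemma bwt_ell i : ell D (bwt i) = 0.
Proof.
case: (split_ordP i) => k ->; rewrite ?bwtl ?bwtr ?ell0 //.
by have [a [b h]] := root_ofP k; exact: is_root_ell h.
Qed.

Lemma bas_inS i u : S u -> ev (bcov i) u != 0 -> S (u + bwt i).
Proof.
move=> Su; case: (split_ordP i) => k ->; rewrite ?bwtl ?bwtr ?addr0 //.
have [a [b h]] := root_ofP k; rewrite (ev_bcovr _ h) intr_char0_eq0 //.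
exact: (is_root_inS h Su).
Qed.

Lemma dg_bwt i u : S u -> S (u + bwt i) -> dg (u + bwt i) = dg u.
Proof.
move=> Su Sui; apply: (can_inj absz_nat : injective Posz).
by rewrite !dgE // ellD bwt_ell addr0.
Qed.

Definition bas i : R -> R := hder (bcov i) (bwt i).

Lemma is_der_bas i : is_der (bas i).
Proof.
apply: is_der_hder => u Su cu; have Sui := bas_inS Su cu; split=> //.
apply: contraNneq cu => u0; have := dg_bwt Su Sui; rewrite u0 dg0 => /esym/eqP.
by rewrite dg_eq0 // => /eqP ->; rewrite raddf0.
Qed.

Definition der (v : 'rV[K]_r0) f := \sum_i v 0 i *: bas i f.

Lemma is_der_der v : is_der (der v).
Proof.
by apply: is_der_sum => i; apply: is_der_scale; exact: is_der_bas.
Qed.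

Lemma derD v w f : der (v + w) f = der v f + der w f.
Proof.
by rewrite /der -big_split; apply: eq_bigr => i _; rewrite mxE scalerDl.
Qed.
Lemma derZ c v f : der (c *: v) f = c *: der v f.
Proof.
by rewrite /der scaler_sumr; apply: eq_bigr => i _; rewrite mxE scalerA.
Qed.
Lemma der0 f : der 0 f = 0.
Proof. by rewrite /der big1 // => i _; rewrite mxE scale0r. Qed.
Lemma derB v w f : der (v - w) f = der v f - der w f.
Proof. by rewrite derD -scaleN1r derZ scaleN1r. Qed.
Lemma der_delta i f : der (delta_mx 0 i) f = bas i f.
Proof.
rewrite /der (bigD1 i) //= big1 => [|j ji].
  by rewrite mxE !eqxx scale1r addr0.
by rewrite mxE eqxx (negbTE ji) scale0r.
Qed.

Lemma der_chi v u : S u ->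
  der v (chi u) = \sum_i (v 0 i * ev (bcov i) u) *: chi (u + bwt i).
Proof.
by move=> Su; apply: eq_bigr => i _; rewrite /bas hder_chi // scalerA.
Qed.

Lemma cf_der v u w : S u -> cf (der v (chi u)) w =
  \sum_(i | u + bwt i == w) v 0 i * ev (bcov i) u.
Proof.
move=> Su; rewrite der_chi // cf_sum [RHS]big_mkcond; apply: eq_bigr => i _.
rewrite cfZ cf_chi; have [->|cu] := eqVneq (ev (bcov i) u) 0.
  by rewrite mulr0 mul0r if_same.
by rewrite bas_inS //=; case: (_ == w); rewrite ?mulr1 ?mulr0.
Qed.

Lemma cf_der_diag v u : S u -> cf (der v (chi u)) u = ev (lsubmx v) u.
Proof.
move=> Su; rewrite cf_der // big_split_ord /= [X in _ + X]big1 => [|k]; last first.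
  rewrite bwtr -subr_eq0 addrC addKr; have [a [b h]] := root_ofP k.
  by rewrite (negbTE (is_root_neq0 h)).
rewrite addr0 [in RHS]/ev big_mkcond; apply: eq_bigr => k _.
by rewrite bwtl addr0 eqxx ev_bcovl mxE mulrC.
Qed.

Lemma cf_der_root v u k a b : S u -> is_root (D := D) a b (root_of k) ->
  cf (der v (chi u)) (u + root_of k) = v 0 (rshift _ k) * (phi a u)%:~R.
Proof.
move=> Su h; rewrite cf_der // (bigD1 (rshift _ k)) /= ?bwtr //.
rewrite (ev_bcovr _ h) big1 ?addr0 // => i /andP[]; rewrite (inj_eq (addrI u)).
case: (split_ordP i) => k' ->; rewrite ?bwtl ?bwtr.
  by rewrite eq_sym (negbTE (is_root_neq0 h)).
by rewrite (inj_eq root_of_inj) => /eqP ->; rewrite eqxx.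
Qed.

Lemma cf_der_dg v u w : S u -> cf (der v (chi u)) w != 0 -> dg w = dg u.
Proof.
move=> Su h; have Sw := cf_neq0 h; move: h; rewrite cf_der // => h.
have [i /eqP iw] : exists i, u + bwt i == w.
  apply: contrapT => no; case/eqP: h; apply: big1 => i iw.
  by case: no; exists i.
by rewrite -iw dg_bwt // iw.
Qed.

Definition raising (d : R -> R) :=
  forall u w, S u -> cf (d (chi u)) w != 0 -> (dg u < dg w)%N.

Lemma raising_der v : raising (der v) -> v = 0.
Proof.
move=> rv; have z u w : S u -> cf (der v (chi u)) w = 0.
  move=> Su; apply/eqP; apply: contraT => h.
  by have := rv _ _ Su h; rewrite (cf_der_dg Su h) ltnn.
apply/rowP => i; rewrite [RHS]mxE; case: (split_ordP i) => k ->.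
  have l0 : lsubmx v = 0.
    apply: ev_inj => u; rewrite ev0r; have [p [Sp Sup]] := shift_in_cone D u.
    have := z _ (u + p) Sup; rewrite cf_der_diag // raddfD /=.
    by have := z _ p Sp; rewrite cf_der_diag // => ->; rewrite addr0.
  by have := congr1 (fun x : 'rV_n => x 0 k) l0; rewrite !mxE.
have [a [b h]] := root_ofP k; have [u [ua up]] := unit_point a.
have Su : S u by apply/(inSE D) => l; exact: ltW.
by have := z u (u + root_of k) Su; rewrite (cf_der_root _ Su h) ua mulr1.
Qed.

(** The component of degree 0 is linear in the exponent, those in the degrees of roots are multiples
    of the tail normal, and by [der_weight] everything else raises the degree. *)
Lemma der_leading d : is_der d -> exists v, raising (fun f => d f - der v f).
Proof.
move=> dd.
have [lam lamE] : exists lam : 'rV[K]_n, forall u, S u -> cf (d (chi u)) u = ev lam u.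
  apply: (@additive_on_cone_linear n s D K (fun u => cf (d (chi u)) u)) => u v Su Sv.
  by have := der_coefD 0 dd Su Sv; rewrite !addr0.
have /choice[c cE] : forall k : 'I_(size (rts D)), exists c : K, forall a b u,
    is_root (D := D) a b (root_of k) -> S u ->
    cf (d (chi u)) (u + root_of k) = c * (phi a u)%:~R.
  move=> k; have [a [b h]] := root_ofP k; set e := root_of k in h *.
  have [[u0 Su0 u0a]|no] := pselect (exists2 u, S u & cf (d (chi u)) (u + e) != 0).
    have aD u v : S u -> S v -> cf (d (chi (u + v))) (u + v + e) =
       cf (d (chi u)) (u + e) + cf (d (chi v)) (v + e) by exact: der_coefD.
    have ae u : S u -> cf (d (chi u)) (u + e) != 0 -> S (u + e) by move=> _; exact: cf_neq0.
    have [j [c [_ cE ej el]]] := @demazure_root n s D K (fun u => cf (d (chi u)) (u + e))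
       K0 aD e ae (is_root_notin h) (ex_intro2 _ _ u0 Su0 u0a).
    exists c => a' b' u h' Su; rewrite cE //; congr (_ * (phi _ u)%:~R).
    apply/eqP; apply: contraT => ja; have := el a'; rewrite eq_sym ja.
    by move=> /(_ isT); rewrite (is_root_tail h').
  exists 0 => a' b' u _ Su; rewrite mul0r; apply/eqP; apply: contraT => nz.
  by case: no; exists u.
exists (row_mx lam (\row_k c k)) => u w Su; rewrite cfB => h.
rewrite ltnNge; apply/negP => le.
have Sw : S w.
  by apply: contraNT h => Sw; rewrite !cf_out // subrr.
case/eqP: h; have [e|wu] := eqVneq w u.
  by rewrite e lamE // cf_der_diag // row_mxKl subrr.
have [[j [k h]]|no] := pselect (exists j k, is_root (D := D) j k (w - u)).
  have [i iE] := root_of_surj h.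
  have wE : w = u + root_of i by rewrite iE subrKC.
  rewrite wE; rewrite -iE in h; rewrite (cE i j k) // (cf_der_root _ Su h).
  by rewrite row_mxEr mxE subrr.
have z : cf (d (chi u)) w = 0.
  apply/eqP; apply: contraT => nz; have [] := der_weight D K0 dd Su nz => //.
  - by rewrite ltnNge le.
  - by move/eqP; rewrite (negbTE wu).
rewrite z sub0r cf_der // big1 ?oppr0 // => i /eqP iw.
move: no wu; rewrite -iw; case: (split_ordP i) => k ->; rewrite ?bwtl ?bwtr.
  by rewrite addr0 eqxx.
by rewrite addrC addKr => no; case: no; exact: root_ofP.
Qed.
End DegreeZero.

(** * The trace form on the cotangent space and the adjoint action *)

Section TraceForm.
Variables (K : fieldType) (n : nat) (s : toric_cone n) (D : ray_data s).
Variable R : toric_alg K s.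
Hypothesis K0 : [pchar K] =i pred0.
Local Notation S := (dual_cone s).
Local Notation chi := (chi R).
Local Notation lin F := (klin (@GRing.scale K R) (F : R -> R)).
Local Notation dg := (dg D).
Local Notation r0 := (n + size (rts D))%N.
Local Notation is_der := (@is_der K n s R).
Local Notation is_aut := (@is_aut K n s R).
Local Notation raising := (@raising K n s D R).
Local Notation der := (@der K n s D R).
Local Notation bas := (@bas K n s D R).
Implicit Types (f : R) (u w h : 'rV[int]_n).

Lemma linB F f1 f2 : lin F -> F (f1 - f2) = F f1 - F f2.
Proof. by move=> [FD FZ]; rewrite FD -scaleN1r FZ scaleN1r. Qed.

Lemma cf_lin F f w : lin F -> cf (F f) w != 0 ->
  exists u, [/\ S u, cf f u != 0 & cf (F (chi u)) w != 0].
Proof.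
move=> lF; rewrite (klin_chi lF) cf_sum => h; apply: contrapT => no.
case/eqP: h; rewrite big_seq big1 // => u uf; rewrite cfZ.
have [->|c] := eqVneq (cf (F (chi u)) w) 0; first by rewrite mulr0.
by case: no; exists u; rewrite -mem_supp uf; split => //; exact: supp_inS uf.
Qed.

Lemma der_dg d u w : is_der d -> S u -> cf (d (chi u)) w != 0 -> (dg u <= dg w)%N.
Proof.
move=> dd Su h; have Sw := cf_neq0 h.
have [/ltnW //|->//|[j [k r]]] := der_weight D K0 dd Su h.
have : ell D w = ell D u.
  by have := is_root_ell r; rewrite ellD ellN => /eqP; rewrite subr_eq0 => /eqP.
by rewrite /dg => ->.
Qed.

Lemma raising_compl d d' : is_der d -> lin d' -> raising d' -> raising (d \o d').
Proof.
move=> dd ld rd u w Su /= /(cf_lin (is_der_lin dd))[v [Sv c1 c2]].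
by apply: leq_trans (der_dg dd Sv c2); apply: rd.
Qed.

Lemma raising_compr d d' : is_der d -> lin d' -> raising d' -> raising (d' \o d).
Proof.
move=> dd ld rd u w Su /= /(cf_lin ld)[v [Sv c1 c2]].
by apply: leq_ltn_trans (der_dg dd Su c1) _; apply: rd.
Qed.

Lemma raisingB d d' : raising d -> raising d' -> raising (fun f => d f - d' f).
Proof.
move=> r r' u w Su; rewrite cfB; have [->|h _] := eqVneq (cf (d (chi u)) w) 0.
  by rewrite sub0r oppr_eq0; exact: r'.
exact: r.
Qed.

Lemma raisingD d d' : raising d -> raising d' -> raising (fun f => d f + d' f).
Proof.
move=> r r' u w Su; rewrite cfD; have [->|h _] := eqVneq (cf (d (chi u)) w) 0.
  by rewrite add0r; exact: r'.
exact: r.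
Qed.

Lemma raisingZ c d : raising d -> raising (fun f => c *: d f).
Proof. by move=> r u w Su; rewrite cfZ mulf_eq0 negb_or => /andP[_]; exact: r. Qed.

Lemma raising_ext d d' : d =1 d' -> raising d -> raising d'.
Proof. by move=> e r u w Su; rewrite -e; exact: r. Qed.

(** Coordinates of the leading part of a derivation; they are unique since no nonzero [der v] is
    raising. *)
Definition crd (d : R -> R) : 'rV[K]_r0 :=
  xget 0 [set v | raising (fun f => d f - der v f)]%classic.

Lemma crdP d : is_der d -> raising (fun f => d f - der (crd d) f).
Proof.
move=> dd; rewrite /crd; case: xgetP => [v _ //|no].
by have [v /no] := der_leading D K0 dd.
Qed.

Lemma crd_uniq d v : is_der d -> raising (fun f => d f - der v f) -> crd d = v.
Proof.
move=> dd rv; apply/eqP; rewrite -subr_eq0; apply/eqP/(raising_der K0 (R := R)).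
apply: raising_ext (raisingB rv (crdP dd)) => f.
by rewrite derB opprB addrC addrA subrK.
Qed.

Lemma crd_der v : crd (der v) = v.
Proof.
apply: crd_uniq => [|u w Su]; first exact: is_der_der.
by rewrite cfB subrr eqxx.
Qed.

Lemma crd_raising d : is_der d -> raising d -> crd d = 0.
Proof.
move=> dd rd; apply: crd_uniq => //; apply: raising_ext rd => f.
by rewrite der0 subr0.
Qed.

Lemma crd_eq0 d : is_der d -> crd d = 0 -> raising d.
Proof.
by move=> dd c0; apply: raising_ext (crdP dd) => f; rewrite c0 der0 subr0.
Qed.

Lemma crdD d d' : is_der d -> is_der d' ->
  crd (fun f => d f + d' f) = crd d + crd d'.
Proof.
move=> dd dd'; apply: crd_uniq; first exact: is_der_add.
apply: raising_ext (raisingD (crdP dd) (crdP dd')) => f.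
by rewrite derD opprD addrACA.
Qed.

Lemma crdZ c d : is_der d -> crd (fun f => c *: d f) = c *: crd d.
Proof.
move=> dd; apply: crd_uniq; first exact: is_der_scale.
have h := raisingZ (c := c) (crdP dd); apply: raising_ext h => f.
by rewrite derZ scalerBr.
Qed.

Lemma crdB d d' : is_der d -> is_der d' ->
  crd (fun f => d f - d' f) = crd d - crd d'.
Proof.
move=> dd dd'; apply: crd_uniq; first exact: is_der_sub.
apply: raising_ext (raisingB (crdP dd) (crdP dd')) => f.
by rewrite derB !opprD addrACA.
Qed.

Lemma crd_sum (I : Type) (r : seq I) (d : I -> R -> R) : (forall i, is_der (d i)) ->
  crd (fun f => \sum_(i <- r) d i f) = \sum_(i <- r) crd (d i).
Proof.
move=> dd; elim: r => [|i r IH].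
  rewrite big_nil; apply: crd_raising; first by apply: is_der_sum.
  by move=> u w Su; rewrite big_nil cf0 eqxx.
rewrite big_cons -IH -crdD //; last exact: is_der_sum.
by congr crd; apply/funext => f; rewrite big_cons.
Qed.

Lemma crd_brk d d' : is_der d -> is_der d' ->
  crd (brk d d') = crd (brk (der (crd d)) (der (crd d'))).
Proof.
move=> dd dd'; set e := der (crd d); set e' := der (crd d').
have de : is_der e := is_der_der _ K0 _.
have de' : is_der e' := is_der_der _ K0 _.
have re := crdP dd; have re' := crdP dd'.
have sl := is_der_lin (is_der_sub dd de); have sl' := is_der_lin (is_der_sub dd' de').
apply/eqP; rewrite -subr_eq0 -crdB; try exact: is_der_brk.
apply/eqP/crd_raising; first by apply: is_der_sub; exact: is_der_brk.
have h1 := raisingB (raising_compr dd' sl re) (raising_compl dd' sl re).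
have h2 := raisingB (raising_compl de sl' re') (raising_compr de sl' re').
apply: raising_ext (raisingD h1 h2) => f; rewrite /= -/e -/e' /brk.
have [ld _ _] := dd; have [le _ _] := de; have [ld' _ _] := dd'; have [le' _ _] := de'.
rewrite !(linB _ _ ld') !(linB _ _ le).
by rewrite !opprB !addrA; apply/eqP; rewrite -subr_eq0; apply/eqP; ring.
Qed.

(* The trace of d' \o d on the cotangent space m/m^2. *)
Definition tf (d d' : R -> R) : K := \sum_(h <- hb s) cf (d' (d (chi h))) h.

Lemma tf_raisingl d d' : is_der d' -> lin d -> raising d -> tf d d' = 0.
Proof.
move=> dd ld rd; rewrite /tf big_seq big1 // => h hH; apply/eqP; apply: contraT.
by move=> /(raising_compl dd ld rd (hb_inS D hH)); rewrite ltnn.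
Qed.

Lemma tfBl d e d' : lin d' -> tf (fun f => d f - e f) d' = tf d d' - tf e d'.
Proof.
move=> ld; rewrite /tf -sumrB; apply: eq_bigr => h _.
by rewrite (ld.1) cfD -scaleN1r (ld.2) cfZ mulN1r.
Qed.

Lemma tf_crd d d' : is_der d -> is_der d' -> tf d d' = tf (der (crd d)) d'.
Proof.
move=> dd dd'; apply/eqP; rewrite -subr_eq0 -tfBl; last exact: is_der_lin.
apply/eqP/tf_raisingl => //; last exact: crdP.
by apply: lin_sub; apply: is_der_lin => //; exact: is_der_der.
Qed.

Lemma cf_hb_mul f g h : cf f 0 = 0 -> cf g 0 = 0 -> h \in hb s -> cf (f * g) h = 0.
Proof.
move=> f0 g0 /(mem_hb D)[Sh h0 ih]; rewrite (cfM D) big_seq big1 // => v.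
rewrite mem_ball => /andP[Sv _]; have [Shv|Shv] := boolP (S (h - v)); last first.
  by rewrite [cf g _]cf_out // mulr0.
have [->|->] := ih v (h - v) Sv Shv (esym (subrKC _ _)).
  by rewrite f0 mul0r.
by rewrite g0 mulr0.
Qed.

(** The maps that induce an endomorphism of m/m^2: an element of m lies in m^2 exactly when it has
    no coefficient on the Hilbert basis. *)
Definition cotangent (F : R -> R) := [/\ lin F,
  forall f, cf f 0 = 0 -> cf (F f) 0 = 0 &
  forall f, cf f 0 = 0 -> (forall h, h \in hb s -> cf f h = 0) ->
    forall h, h \in hb s -> cf (F f) h = 0].

Lemma cotangentP F : lin F -> (forall f, cf f 0 = 0 -> cf (F f) 0 = 0) ->
  (forall u v h, S u -> S v -> u != 0 -> v != 0 -> h \in hb s ->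
     cf (F (chi u * chi v)) h = 0) -> cotangent F.
Proof.
move=> lF Fm Fm2; split=> // f f0 fh h hH; apply/eqP; apply: contraT.
move=> /(cf_lin lF)[u [Su fu]]; have u0 : u != 0 by apply: contraNneq fu => ->; rewrite f0.
have [h' [w [h'H Sw uE]]] := hb_split D Su u0.
have [w0|w0] := eqVneq w 0; first by rewrite uE w0 addr0 fh ?eqxx in fu.
have [Sh' h'0 _] := (mem_hb D h').1 h'H.
by rewrite uE -chiM // Fm2 ?eqxx.
Qed.

Lemma cf_chi0 u : u != 0 -> cf (chi u) 0 = 0.
Proof. by move=> u0; rewrite cf_chi (negbTE u0) andbF. Qed.

Lemma cotangent_der d : is_der d -> cotangent d.
Proof.
move=> dd; have [ld dM dm] := dd; apply: cotangentP => // u v h Su Sv u0 v0 hH.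
by rewrite dM cfD !cf_hb_mul ?addr0 ?is_der0 ?cf_chi0.
Qed.

Lemma cotangent_aut g : is_aut g -> cotangent g.
Proof.
move=> [lg gM bg gz]; have gm f : cf f 0 = 0 -> cf (g f) 0 = 0.
  by move/eqP; rewrite -gz => /eqP.
apply: cotangentP => // u v h Su Sv u0 v0 hH.
by rewrite gM cf_hb_mul // gm // cf_chi0.
Qed.

Local Notation hbn a := ((hb s)`_(nat_of_ord a)).
Definition cmx (F : R -> R) : 'M[K]_(size (hb s)) :=
  \matrix_(a, b) cf (F (chi (hbn a))) (hbn b).

Lemma hbnP (a : 'I_(size (hb s))) : hbn a \in hb s. Proof. exact: mem_nth. Qed.

Lemma cmx_comp F G : cotangent F -> cotangent G -> cmx (G \o F) = cmx F *m cmx G.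
Proof.
move=> [lF Fm Fm2] [lG Gm Gm2]; apply/matrixP => a b; rewrite !mxE /=.
under [RHS]eq_bigr do rewrite !mxE.
have : cf (F (chi (hbn a))) 0 = 0.
  by apply: Fm; rewrite cf_chi0 //; have [] := (mem_hb D (hbn a)).1 (hbnP a).
move: (F (chi (hbn a))) => f f0; pose f1 := f - \sum_(c < size (hb s)) cf f (hbn c) *: chi (hbn c).
have hN (c : 'I_(size (hb s))) : hbn c != 0 by have [] := (mem_hb D (hbn c)).1 (hbnP c).
have f10 : cf f1 0 = 0.
  by rewrite cfB f0 cf_sum big1 ?subr0 // => c _; rewrite cfZ cf_chi0 ?mulr0.
have f1h h : h \in hb s -> cf f1 h = 0.
  move=> /(nthP 0)[c cH <-]; rewrite -[c]/(nat_of_ord (Ordinal cH)) cfB cf_sum (bigD1 (Ordinal cH)) //=.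
  rewrite cfZ cf_chi (hb_inS D (hbnP (Ordinal cH))) eqxx mulr1 big1 ?addr0 ?subrr //.
  move=> d dc; rewrite cfZ cf_chi nth_uniq ?hb_uniq //.
  by rewrite -val_eqE /= in dc; rewrite (negbTE dc) andbF mulr0.
have fE : f = f1 + \sum_(c < size (hb s)) cf f (hbn c) *: chi (hbn c) by rewrite subrK.
rewrite [in LHS]fE (lG.1) cfD (Gm2 f1 f10 f1h _ (hbnP b)) add0r (klin_sum _ _ _ lG) cf_sum.
by apply: eq_bigr => c _; rewrite (lG.2) cfZ.
Qed.

Lemma cotangent_comp F G : cotangent F -> cotangent G -> cotangent (G \o F).
Proof.
move=> [lF Fm Fm2] [lG Gm Gm2]; split=> [|f f0|f f0 fh].
- exact: lin_comp.
- by apply: Gm; exact: Fm.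
- by apply: Gm2; [exact: Fm | exact: Fm2].
Qed.

Lemma tfE d d' : cotangent d -> cotangent d' -> tf d d' = \tr (cmx d *m cmx d').
Proof.
move=> cd cd'; rewrite -cmx_comp // /tf (big_nth 0) big_mkord.
by apply: eq_bigr => a _; rewrite mxE.
Qed.

Lemma tf_conj (g h d d' : R -> R) : is_aut g -> is_aut h -> cancel h g -> is_der d -> is_der d' ->
  tf (g \o d \o h) d' = tf d (h \o d' \o g).
Proof.
move=> ag ah hK dd dd'.
have cg := cotangent_aut ag; have ch := cotangent_aut ah.
have cd := cotangent_der dd; have cd' := cotangent_der dd'.
rewrite (tfE (cotangent_comp ch (cotangent_comp cd cg)) cd').
rewrite (tfE cd (cotangent_comp cg (cotangent_comp cd' ch))).
rewrite (cmx_comp ch (cotangent_comp cd cg)) (cmx_comp cd cg).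
rewrite (cmx_comp cg (cotangent_comp cd' ch)) (cmx_comp cd' ch).
by rewrite -!mulmxA mxtrace_mulC -!mulmxA.
Qed.

Lemma ell_hb_eq0 (lam : 'rV[K]_n) : (forall h, h \in hb s -> ev lam h = 0) -> lam = 0.
Proof.
move=> lh; have lS u : S u -> ev lam u = 0.
  move: u; apply: (@hb_ind n s D); first by rewrite raddf0.
  by move=> h u hH _ uE; rewrite raddfD /= lh // uE addr0.
apply: ev_inj => u; rewrite ev0r; have [p [Sp Sup]] := shift_in_cone D u.
by have := lS _ Sup; rewrite raddfD /= (lS p) // addr0.
Qed.

(** Torus coordinates are detected by torus derivations, through the Gram matrix of the Hilbert
    basis. The coordinate of a root with tail a and head b is detected by the opposite root: up to
    that coordinate the trace is the sum of the natural numbers phi a h (phi b h + 1), which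
    vanishes only if [phi a] vanishes on the Hilbert basis. *)
Lemma tf_nondegenerate v : (forall d', is_der d' -> tf (der v) d' = 0) -> v = 0.
Proof.
move=> tv; apply/rowP => i; rewrite [RHS]mxE; case: (split_ordP i) => k ->.
  suff l0 : lsubmx v = 0 by have := congr1 (fun x : 'rV_n => x 0 k) l0; rewrite !mxE.
  apply: ell_hb_eq0; apply: gram_kernel => // j.
  rewrite -[RHS](tv (bas (lshift _ j)) (is_der_bas R K0 _)).
  rewrite /tf !big_seq; apply: eq_bigr => h hH; have Sh := hb_inS D hH.
  have lb := is_der_lin (is_der_bas R K0 (lshift (size (rts D)) j)).
  rewrite der_chi // (klin_sum _ _ _ lb) cf_sum.
  transitivity (\sum_i if h + bwt i == h then v 0 i * ev (bcov K i) h * (h 0 j)%:~R else 0).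
    rewrite -big_mkcond -mulr_suml -(cf_der R K0) // cf_der_diag //.
  apply: eq_bigr => i' _; rewrite (lb.2) cfZ.
  have [->|ci] := eqVneq (ev (bcov K i') h) 0; first by rewrite mulr0 !mul0r if_same.
  have Shi := bas_inS K0 Sh ci.
  rewrite /bas hder_chi // cfZ cf_chi bwtl addr0 Shi ev_bcovl /=.
  by case: eqP => [->|]; rewrite ?mulr1 ?mulr0.
have [a [b r]] := root_ofP k; have rN := is_rootN r; have [k' k'E] := root_of_surj rN.
have := tv (bas (rshift _ k')) (is_der_bas R K0 _).
have lb := is_der_lin (is_der_bas R K0 (rshift n k')).
have -> : tf (der v) (bas (rshift n k')) =
   v 0 (rshift n k) * (\sum_(h <- hb s) `|phi a h|%N * (`|phi b h|%N + 1))%:R.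
  rewrite natr_sum mulr_sumr /tf !big_seq; apply: eq_bigr => h hH; have Sh := hb_inS D hH.
  rewrite der_chi // (klin_sum _ _ _ lb) cf_sum (bigD1 (rshift n k)) //= big1 ?addr0 => [|i2 ik].
    rewrite (lb.2) cfZ -mulrA; congr (_ * _).
    rewrite (ev_bcovr K _ r) -{1}[phi a h]gez0_abs ?phi_ge0 // -pmulrn.
    have [->|ph] := eqVneq `|phi a h|%N 0%N; first by rewrite mul0r.
    have Shk : S (h + bwt (rshift n k)).
      by rewrite bwtr; apply: is_root_inS r Sh _; rewrite -absz_eq0.
    rewrite natrM; congr (_ * _); rewrite /bas hder_chi // cfZ cf_chi !bwtr.
    rewrite k'E addrK Sh eqxx /= mulr1; have r' := rN; rewrite -k'E in r'.
    by rewrite (ev_bcovr K _ r') phiD (is_root_head r) -[phi b h]gez0_abs ?phi_ge0 // -natz -(natrD _ _ 1) -pmulrn.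
  rewrite (lb.2) cfZ.
  have [->|ci] := eqVneq (ev (bcov K i2) h) 0; first by rewrite mulr0 mul0r.
  rewrite /bas hder_chi ?(bas_inS K0) // cfZ cf_chi bwtr k'E.
  rewrite -addrA -[X in _ == X]addr0 (inj_eq (addrI h)) subr_eq0.
  suff /negbTE-> : bwt i2 != root_of k by rewrite andbF !mulr0.
  apply: contra ik; case: (split_ordP i2) => i' ->; rewrite ?bwtl ?bwtr.
    by rewrite eq_sym (negbTE (is_root_neq0 r)).
  by move=> /eqP/root_of_inj ->.
move/eqP; rewrite mulf_eq0 => /orP[/eqP //|].
rewrite ((pcharf0P K).1 K0) sum_nat_seq_eq0 => /allP z.
have pa u : S u -> phi a u = 0.
  move: u; apply: (@hb_ind n s D); first by rewrite phi0.
  move=> h u hH _ uE; rewrite phiD uE addr0; have := z h hH.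
  by rewrite muln_eq0 addn1 orbF absz_eq0 => /eqP.
have [u [ua up]] := unit_point a.
have Su : S u by apply/(inSE D) => l; exact: ltW.
by rewrite pa in ua.
Qed.

Lemma raising_conj (g h d : R -> R) : is_aut g -> cancel g h -> is_der d -> raising d ->
  raising (g \o d \o h).
Proof.
move=> ag gK dd rd; have ah := is_autV ag gK.
have hK : cancel h g.
  by case: (ag) => _ _ [h' gK' hK'] _ x; rewrite -{1}(hK' x) gK hK'.
have dc := is_der_conj ag gK dd; apply: (crd_eq0 dc); apply: tf_nondegenerate => d' dd'.
rewrite -tf_crd // tf_conj // tf_raisingl //; first exact: is_der_conj ah hK dd'.
exact: is_der_lin.
Qed.

(* The action of automorphisms on degree-0 derivations, by conjugation modulo
   the raising ones; matrices act on row vectors. *)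
Definition tau (g h : R -> R) : 'M[K]_r0 :=
  \matrix_(i, j) crd (g \o bas i \o h) 0 j.

Lemma tauP (g h d : R -> R) : is_aut g -> cancel g h -> is_der d ->
  crd (g \o d \o h) = crd d *m tau g h.
Proof.
move=> ag gK dd; have [lg _ _ _] := ag; have [lh _ _ _] := is_autV ag gK.
have dder v : is_der (der v) by exact: is_der_der.
have rc := raising_conj ag gK (is_der_sub dd (dder (crd d))) (crdP dd).
have -> : crd (g \o d \o h) = crd (g \o der (crd d) \o h).
  apply/eqP; rewrite -subr_eq0 -crdB; try exact: is_der_conj.
  apply/eqP; apply: crd_raising.
    by apply: is_der_sub; exact: is_der_conj.
  apply: raising_ext rc => f /=.
  exact: linB.
move: (crd d) => v.
have -> : g \o der v \o h = fun f => \sum_i v 0 i *: (g \o bas i \o h) f.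
  apply/funext => f; rewrite /= (klin_sum _ _ _ lg).
  by apply: eq_bigr => i _; rewrite (lg.2).
rewrite crd_sum => [|i]; last by apply/is_der_scale/is_der_conj => //; exact: is_der_bas.
apply/rowP => j; rewrite summxE mxE; apply: eq_bigr => i _.
rewrite (crdZ (v 0 i)) ?mxE //.
by apply: is_der_conj => //; exact: is_der_bas.
Qed.

Lemma tau_comp (g h g' h' : R -> R) : is_aut g -> cancel g h -> is_aut g' -> cancel g' h' ->
  tau (g' \o g) (h \o h') = tau g h *m tau g' h'.
Proof.
move=> ag gK ag' gK'; apply/row_matrixP => i; rewrite row_mul.
have ri (g1 h1 : R -> R) : row i (tau g1 h1) = crd (g1 \o bas i \o h1).
  by apply/rowP => j; rewrite !mxE.
have db : is_der (bas i) by exact: is_der_bas.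
by rewrite !ri -tauP //; exact: is_der_conj.
Qed.

Lemma tau_id : tau id id = 1%:M.
Proof.
apply/row_matrixP => i; rewrite row1.
have -> : row i (tau id id) = crd (bas i) by apply/rowP => j; rewrite !mxE.
rewrite -[RHS]crd_der; congr crd; apply/funext => f.
by rewrite der_delta.
Qed.

Definition br (v w : 'rV[K]_r0) : 'rV[K]_r0 := crd (brk (der v) (der w)).

Lemma crd_brkE d d' : is_der d -> is_der d' -> crd (brk d d') = br (crd d) (crd d').
Proof. exact: crd_brk. Qed.

Lemma br_tau (g h : R -> R) (v w : 'rV[K]_r0) : is_aut g -> cancel g h ->
  br (v *m tau g h) (w *m tau g h) = br v w *m tau g h.
Proof.
move=> ag gK; have dd (u : 'rV[K]_r0) : is_der (der u) by exact: is_der_der.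
have e (u : 'rV[K]_r0) : u *m tau g h = crd (g \o der u \o h) by rewrite tauP // crd_der.
rewrite (e v) (e w) -crd_brkE; try exact: is_der_conj.
rewrite [in RHS]/br -tauP //; last exact: is_der_brk.
congr crd; apply/funext => f; rewrite /brk /= !gK.
by have [lg _ _ _] := ag; rewrite -(linB _ _ lg).
Qed.

Lemma der_crd_graded d : is_der d ->
  (forall u w, S u -> cf (d (chi u)) w != 0 -> dg w = dg u) -> der (crd d) =1 d.
Proof.
move=> dd gd; have ld := is_der_lin dd.
have lc := is_der_lin (is_der_der R K0 (crd d)).
apply: (klin_eq lc ld) => u Su; apply: cfP => w Sw.
have [e|ne] := eqVneq (dg w) (dg u); last first.
  have -> : cf (d (chi u)) w = 0.
    by apply/eqP; apply: contraT => /(gd _ _ Su)/eqP; rewrite (negbTE ne).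
  by apply/eqP; apply: contraT => /(cf_der_dg K0 Su)/eqP; rewrite (negbTE ne).
have : cf (d (chi u) - der (crd d) (chi u)) w = 0.
  by apply/eqP; apply: contraT => /(crdP dd Su); rewrite e ltnn.
by rewrite cfB => /eqP; rewrite subr_eq0 eq_sym => /eqP.
Qed.

(** [br] is defined by a leading part, but the commutator of derivations that preserve the degree
    preserves it too, so nothing is cut off. *)
Lemma der_br (v w : 'rV[K]_r0) : der (br v w) =1 brk (der v) (der w).
Proof.
have dd (u : 'rV[K]_r0) : is_der (der u) by exact: is_der_der.
apply: der_crd_graded; first exact: is_der_brk.
move=> u z Su; rewrite /brk cfB => h.
have [h1|h1] := eqVneq (cf (der v (der w (chi u))) z) 0.
  rewrite h1 sub0r oppr_eq0 in h.
  have [x [Sx c1 c2]] := cf_lin (is_der_lin (dd w)) h.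
  by rewrite (cf_der_dg K0 Sx c2) (cf_der_dg K0 Su c1).
have [x [Sx c1 c2]] := cf_lin (is_der_lin (dd v)) h1.
by rewrite (cf_der_dg K0 Sx c2) (cf_der_dg K0 Su c1).
Qed.
End TraceForm.

(** * Jordan's theorem in characteristic zero *)

(* Any identity and inequation between finitely many elements of a field of
   characteristic 0 can be specialized to F: adjoin the elements one at a time,
   the kernel of A[X] -> K at a new element being controlled by pseudo-division
   by an element of minimal size. *)
Section Specialization.
Variables (K : fieldType) (F : closedFieldType).
Hypotheses (K0 : [pchar K] =i pred0) (F0 : [pchar F] =i pred0).

(** A single [f] suffices: finitely many inequations are imposed by multiplying them together. *)
Definition specializable (A : comNzRingType) (th : {rmorphism A -> K}) :=
  forall f, th f != 0 -> exists psi : {rmorphism A -> F},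
    psi f != 0 /\ forall p, th p = 0 -> psi p = 0.

Lemma specializable_int : specializable (intr : {rmorphism int -> K}).
Proof.
move=> f; rewrite intr_char0_eq0 // => f0.
exists (intr : {rmorphism int -> F}); split; first by rewrite intr_char0_eq0.
by move=> p /eqP; rewrite intr_char0_eq0 // => /eqP ->; rewrite rmorph0.
Qed.

Section Adjoin.
Variables (A : comNzRingType) (th : {rmorphism A -> K}) (a : K).
Hypothesis sA : specializable th.

Let thX : {rmorphism {poly A} -> K} := horner_eval a \o map_poly th.
Let nz (p : {poly A}) := map_poly th p != 0.

Let ce (B : nzRingType) (g : {rmorphism A -> B}) (p : {poly A}) i : g p`_i = (map_poly g p)`_i.
Proof. by rewrite coef_map. Qed.

Let thX0 p : map_poly th p = 0 -> thX p = 0.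
Proof. by rewrite /thX /= => ->; rewrite horner_evalE horner0. Qed.

Let thXM p q : thX (p * q) = thX p * thX q. Proof. exact: rmorphM. Qed.
Let thXD p q : thX (p + q) = thX p + thX q. Proof. exact: rmorphD. Qed.

Let thXC c : thX c%:P = th c.
Proof. by rewrite /thX /= map_polyC /= horner_evalE hornerC. Qed.

(* dropping the coefficients killed by th *)
Let trim p : nz p -> exists p', [/\ map_poly th p' = map_poly th p,
  th (lead_coef p') != 0 & size p' = size (map_poly th p)].
Proof.
move=> np; pose m := size (map_poly th p).
have m0 : (0 < m)%N by rewrite size_poly_gt0.
have lm : th p`_m.-1 != 0 by rewrite -coef_map -lead_coefE lead_coef_eq0.
have pm : p`_m.-1 != 0 by apply: contraNneq lm => ->; rewrite rmorph0.
have szp' : size (\poly_(i < m) p`_i) = m by rewrite size_poly_eq.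
exists (\poly_(i < m) p`_i); split=> //.
- apply/polyP => i; rewrite !coef_map coef_poly; case: ltnP => // mi.
  by rewrite -[RHS]coef_map [RHS]nth_default //; exact: rmorph0.
- by rewrite lead_coefE szp' coef_poly prednK // leqnn.
Qed.

Let pdiv (g p : {poly A}) : exists k q r,
  (lead_coef g ^+ k) *: p = q * g + r /\ (g != 0 -> (size r < size g)%N).
Proof.
exists (Pdiv.CommonRing.rscalp p g), (Pdiv.CommonRing.rdivp p g),
  (Pdiv.CommonRing.rmodp p g); split; first exact: Pdiv.ComRing.rdivp_eq.
by rewrite Pdiv.CommonRing.ltn_rmodp.
Qed.

Let szm p : (size (map_poly th p) <= size p)%N. Proof. exact: size_poly. Qed.

Let thX_eval (psi : {rmorphism A -> F}) t :
  (forall p, th p = 0 -> psi p = 0) ->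
  forall p, map_poly th p = 0 -> (map_poly psi p).[t] = 0.
Proof.
move=> hpsi p mp; suff -> : map_poly psi p = 0 by rewrite horner0.
apply/polyP => i; rewrite coef_map coef0; apply: hpsi.
by rewrite -coef_map mp coef0.
Qed.

Lemma specializable_adjoin : specializable thX.
Proof.
(* If only polynomials with coefficients killed by [th] vanish at [a], any value [t] off the roots
   of the specialized [f] will do; the integers provide enough candidates. *)
move=> f fX; have [[q0 nq0 q0X]|tr] := pselect (exists2 q, nz q & thX q = 0); last first.
  have nf : map_poly th f != 0 by apply: contraNneq fX => /thX0 ->.
  have [f' [mf lf szf]] := trim nf.
  have [psi [psil psik]] := sA lf.
  have pf : map_poly psi f != 0.
    apply: contraNneq psil => mpf; rewrite lead_coefE.
    have /psik : th (f'`_(size f').-1 - f`_(size f').-1) = 0.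
      by rewrite rmorphB /= !ce mf subrr.
    by move/eqP; rewrite rmorphB /= subr_eq0 => /eqP ->; rewrite ce mpf coef0.
  have [t tf] : exists t, ~~ root (map_poly psi f) t.
    pose rs := [seq i%:R | i <- iota 0 (size (map_poly psi f))] : seq F.
    apply: contrapT => no; have : (size rs < size (map_poly psi f))%N.
      apply: max_poly_roots => //.
        by apply/allP => x _; apply: contrapT => /negP h; apply: no; exists x.
      rewrite map_inj_uniq ?iota_uniq // => i j /eqP.
      by rewrite -subr_eq0 !pmulrn -intrB intr_char0_eq0 // subr_eq0 eqz_nat => /eqP.
    by rewrite size_map size_iota ltnn.
  exists (horner_eval t \o map_poly psi); split=> [|p pX].
    by rewrite /= horner_evalE -rootE.
  rewrite /= horner_evalE; apply: thX_eval => //; apply/eqP.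
  by apply: contrapT => /negP np; apply: tr; exists p.
have exm : exists m, `[< exists q, [/\ nz q, thX q = 0 & size (map_poly th q) = m] >].
  by exists (size (map_poly th q0)); apply/asboolP; exists q0.
have [m /asboolP[q1 [nq1 q1X szq1]] mmin] := ex_minnP exm.
have [q [mq lq szq]] := trim nq1.
have qX : thX q = 0 by rewrite -q1X /thX /= mq.
have nq : nz q by rewrite /nz mq.
have minq p : thX p = 0 -> (size (map_poly th p) < size q)%N -> map_poly th p = 0.
  move=> pX lt; apply/eqP; apply: contraT => np.
  have : (m <= size (map_poly th p))%N by apply: mmin; apply/asboolP; exists p.
  by rewrite leqNgt -szq1 -szq lt.
have q_neq0 : q != 0 by apply: contraNneq nq => ->; rewrite map_poly0.
(* [q] serves as the minimal polynomial of [a]. A smallest [g] that does not vanish at [a] and lies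
   in the ideal of [q] and [f], modulo the kernel, turns out to be constant: a Bezout relation, by
   which [f] cannot vanish at a root of the specialized [q]. *)
pose I g := thX g != 0 /\ exists u v, map_poly th (g - u * q - v * f) = 0.
have [k0 [s0 [r0 [e0 sr0]]]] := pdiv q f.
have thXZ c p : thX (c *: p) = th c * thX p.
  by rewrite -mul_polyC thXM thXC.
have Ir0 : I r0.
  split.
    have := congr1 thX e0; rewrite thXZ thXD thXM qX mulr0 add0r => <-.
    by rewrite mulf_neq0 // rmorphXn expf_neq0.
  exists (- s0), (lead_coef q ^+ k0)%:P; rewrite mul_polyC e0.
  suff -> : r0 - - s0 * q - (s0 * q + r0) = 0 by rewrite map_poly0.
  by ring.
have exg : exists m, `[< exists2 g, I g & size (map_poly th g) = m >].
  by exists (size (map_poly th r0)); apply/asboolP; exists r0.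
have [mg /asboolP[g1 [g1X [u1 [v1 e1]]] szg1] gmin] := ex_minnP exg.
have ng1 : nz g1 by apply: contraNneq g1X => /thX0 ->.
have [g [mgE lg szg]] := trim ng1.
have gX : thX g != 0 by move: g1X; rewrite /thX /= mgE.
have {}e1 : map_poly th (g - u1 * q - v1 * f) = 0.
  by rewrite -e1 !rmorphB /= mgE.
have g0 : g != 0 by apply: contraNneq gX => ->; rewrite rmorph0.
have szgq : (size g < size q)%N.
  apply: leq_ltn_trans (sr0 q_neq0); rewrite szg szg1.
  apply: leq_trans (szm r0); apply: gmin; apply/asboolP; by exists r0.
(* If [g] were not constant, it would divide a nonzero multiple of [q] by a constant, and the
   quotient, which vanishes at [a], would contradict the minimality of [q]. *)
have szg2 : (size g <= 1)%N.
  rewrite leqNgt; apply/negP => gt1.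
  have [k [s [r [e /(_ g0) sr]]]] := pdiv g q.
  have rX : thX r = 0.
    apply/eqP; apply: contraT => rX.
    have : (mg <= size (map_poly th r))%N.
      apply: gmin; apply/asboolP; exists r => //; split=> //.
      exists ((lead_coef g ^+ k)%:P - s * u1), (- (s * v1)).
      have -> : r = (lead_coef g ^+ k)%:P * q - s * g by rewrite mul_polyC e addrC addKr.
      set L := _%:P; have -> : L * q - s * g - (L - s * u1) * q - - (s * v1) * f =
        - s * (g - u1 * q - v1 * f) by ring.
      by rewrite rmorphM /= e1 mulr0.
    by rewrite leqNgt -szg1 -szg (leq_ltn_trans (szm r)).
  have mr : map_poly th r = 0.
    by apply: minq => //; apply: leq_ltn_trans (szm r) (ltn_trans sr szgq).
  have sX : thX s = 0.
    have := congr1 thX e; rewrite thXZ qX mulr0 thXD thXM rX addr0.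
    by move=> /esym/eqP; rewrite mulf_eq0 (negbTE gX) orbF => /eqP.
  have em : th (lead_coef g) ^+ k *: map_poly th q = map_poly th s * map_poly th g.
    rewrite -rmorphXn -map_polyZ e rmorphD rmorphM /= mr addr0 //.
  have lk : th (lead_coef g) ^+ k != 0 by rewrite expf_neq0.
  have ms0 : map_poly th s != 0.
    apply: contraNneq nq => ms; move: em; rewrite ms mul0r => /eqP.
    by rewrite scaler_eq0 (negbTE lk) => /eqP ->.
  have /eqP := ms0; apply; apply: minq => //.
  have mg0 : map_poly th g != 0 by rewrite mgE.
  have sz : size (map_poly th q) = (size (map_poly th s) + size (map_poly th g)).-1.
    by rewrite -(size_scale _ lk) em size_mul.
  have sg : size (map_poly th g) = size g by rewrite mgE szg.
  have sq : size q = size (map_poly th q) by rewrite mq szq.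
  rewrite sq sz sg; move: ms0 gt1; rewrite -size_poly_gt0.
  move: (size (map_poly th s)) (size g) => [|x] [|[|y]] // _ _.
  by rewrite addnS /= addnS ltnS leq_addr.
have [c gc] : exists c, g = c%:P by exists g`_0; exact: size1_polyC.
have thc : th c != 0 by rewrite -thXC -gc.
have [psi [psin psik]] : exists psi : {rmorphism A -> F}, psi (c * lead_coef q) != 0 /\
    forall p, th p = 0 -> psi p = 0.
  by apply: sA; rewrite rmorphM mulf_neq0.
move: psin; rewrite rmorphM mulf_eq0 negb_or => /andP[psic psil].
have szmq : size (map_poly psi q) = size q.
  by rewrite size_poly_eq // -lead_coefE.
have szq1' : size q != 1%N.
  apply: contraNneq lq => /eqP/size_poly1P[d d0 qd].
  by rewrite qd lead_coefC -thXC -qd qX.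
have [t qt] : exists t, root (map_poly psi q) t.
  by apply/closed_rootP; rewrite szmq.
exists (horner_eval t \o map_poly psi); split=> [|p pX].
  rewrite /= horner_evalE; apply: contraNneq psic => ft.
  have := thX_eval t psik e1; rewrite !rmorphB !rmorphM /= !hornerE (eqP qt) ft.
  by rewrite !mulr0 !subr0 gc map_polyC /= hornerC => ->.
have [k [s [r [e /(_ q_neq0) sr]]]] := pdiv q p.
have rX : thX r = 0.
  by have := congr1 thX e; rewrite thXZ pX mulr0 thXD thXM qX mulr0 add0r => <-.
have mr : map_poly th r = 0 by apply: minq => //; exact: leq_ltn_trans (szm r) sr.
have := congr1 (fun p => (map_poly psi p).[t]) e.
rewrite map_polyZ rmorphD rmorphM /= !hornerE (eqP qt) mulr0 (thX_eval t psik mr) addr0.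
move=> /eqP; rewrite mulf_eq0 rmorphXn expf_eq0 (negbTE psil) andbF /=.
by rewrite horner_evalE => /eqP.
Qed.
End Adjoin.

Lemma specialization (r : seq K) : exists (A : comNzRingType) (th : {rmorphism A -> K}),
  specializable th /\ forall x, x \in r -> exists y, th y = x.
Proof.
elim: r => [|a r [A [th [sA hA]]]].
  by exists int, intr; split=> //; exact: specializable_int.
exists {poly A}, (horner_eval a \o map_poly th); split.
  exact: specializable_adjoin.
move=> x; rewrite inE => /orP[/eqP->|/hA[y <-]].
  by exists 'X; rewrite /= map_polyX horner_evalE hornerX.
by exists y%:P; rewrite /= map_polyC horner_evalE hornerC.
Qed.
End Specialization.

Section JordanIndex.
Local Open Scope sesquilinear_scope.
Section GroupIndex.
Variable gT : finGroupType.
Implicit Types G A B : {group gT}.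

Lemma index_le_imset (T : finType) (f : gT -> T) G A : A \subset G ->
  (forall g h, g \in G -> h \in G -> f g = f h -> (h * g^-1)%g \in A) ->
  (#|G : A|%g <= #|f @: G|)%N.
Proof.
move=> sAG hf; rewrite /indexg.
have rG X : X \in rcosets A G -> repr X \in G /\ X = (A :* repr X)%g.
  move=> /rcosetsP[g gG ->]; have := mem_repr_rcoset A g => h.
  split; last by rewrite rcoset_repr.
  by case/rcosetP: h => a aA ->; rewrite groupM // (fintype.subsetP sAG).
rewrite -(@card_in_imset _ _ (f \o repr)) => [|X Y /rG[gX eX] /rG[gY eY] e].
  apply/subset_leq_card/fintype.subsetP => _ /imsetP[X /rG[gX _] ->].
  by apply: imset_f.
by rewrite eX eY; apply/esym/rcoset_eqP; rewrite mem_rcoset; exact: hf.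
Qed.

Lemma index_le_card (T : finType) (f : gT -> T) G A : A \subset G ->
  (forall g h, g \in G -> h \in G -> f g = f h -> (h * g^-1)%g \in A) ->
  (#|G : A|%g <= #|T|)%N.
Proof. by move=> sAG hf; apply: leq_trans (index_le_imset sAG hf) (max_card _). Qed.

Lemma index_cap G A B : A \subset G -> B \subset G ->
  (#|G : A :&: B|%g <= #|G : A|%g * #|G : B|%g)%N.
Proof.
move=> sA sB.
apply: leq_trans (@index_le_imset _ (fun g => (A :* g, B :* g)%g) G (A :&: B)%G _ _) _.
- exact: (fintype.subset_trans (finset.subsetIl _ _) sA).
- move=> g h gG hG [e1 e2]; rewrite inE -!mem_rcoset.
  by rewrite e1 e2 !rcoset_refl.
rewrite /indexg -cardsX; apply/subset_leq_card/fintype.subsetP => _ /imsetP[g gG ->].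
by rewrite inE /=; apply/andP; split; apply/rcosetsP; exists g.
Qed.

(** The core is the kernel of the action on the cosets; all maps from the set of cosets to itself
    are counted. *)
Lemma index_gcore G A : A \subset G -> exists2 B : {group gT}, (B <| G)%g &
  B \subset A /\ (#|G : B|%g <= #|G : A|%g ^ #|G : A|%g)%N.
Proof.
move=> sA; exists (gcore A G)%G; first exact: gcore_normal.
split; first exact: gcore_sub.
pose T := seq_sub (enum (rcosets A G)).
have cT : #|{: T}| = #|G : A|%g by rewrite card_seq_sub ?enum_uniq // -cardE.
have T0 : T by exists (A : {set gT}); rewrite mem_enum; apply/rcosetsP; exists 1%g; rewrite ?mulg1.
pose f g : {ffun T -> T} := [ffun X : T => insubd T0 (ssval X :* g)%g].
rewrite -cT -card_ffun; apply: (@index_le_card _ f).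
  exact: (fintype.subset_trans (gcore_sub A G) sA).
move=> g h gG hG fe; apply/bigcapP => x xG.
have xT : (A :* x)%g \in enum (rcosets A G).
  by rewrite mem_enum; apply/rcosetsP; exists x.
have yT y : y \in G -> (A :* x :* y)%g \in enum (rcosets A G).
  by move=> yG; rewrite mem_enum; apply/rcosetsP; exists (x * y)%g; rewrite ?groupM // rcosetM.
have /(congr1 val) := congr1 (fun F : {ffun T -> T} => F (SeqSub xT)) fe.
rewrite !ffunE !val_insubd /= !yT // => e.
have : (x * h)%g \in (A :* x :* g)%g by rewrite e -rcosetM rcoset_refl.
by rewrite -rcosetM mem_rcoset invMg !mulgA mem_conjg conjgE invgK !mulgA.
Qed.
End GroupIndex.

Section Frobenius.
Local Notation C := algC.
Variable d : nat.
Implicit Types X Y U : 'M[C]_d.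

(** The square of the Hilbert-Schmidt norm, which measures the distance to the identity in the
    geometric proof of Jordan's theorem. *)
Definition hsn X : C := \sum_i \sum_j `|X i j| ^+ 2.

Lemma hsn_ge0 X : 0 <= hsn X.
Proof. by apply: sumr_ge0 => i _; apply: sumr_ge0 => j _; rewrite exprn_ge0. Qed.

Lemma hsn_tr X : hsn X = \tr (X *m X ^t*).
Proof.
apply: eq_bigr => i _; rewrite mxE; apply: eq_bigr => j _.
by rewrite !mxE normCK.
Qed.

Lemma hsn_eq0 X : hsn X = 0 -> X = 0.
Proof.
move=> /eqP; rewrite psumr_eq0 => [/allP h|i _]; last first.
  by apply: sumr_ge0 => j _; rewrite exprn_ge0.
apply/matrixP => i j; have := h i (mem_index_enum i); rewrite /= psumr_eq0 => [/allP|k _].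
  by move=> /(_ j (mem_index_enum j)); rewrite /= sqrf_eq0 normr_eq0 mxE => /eqP.
by rewrite exprn_ge0.
Qed.

Lemma hsn_unitr X U : U \is unitarymx -> hsn (X *m U) = hsn X.
Proof.
move=> /unitarymxP UU; rewrite !hsn_tr trmx_mul map_mxM /= -mulmxA.
by rewrite [U *m _]mulmxA UU mul1mx.
Qed.

Lemma normD_sq (a b : C) : `|a + b| ^+ 2 <= 2 * (`|a| ^+ 2 + `|b| ^+ 2).
Proof.
have h : `|a + b| ^+ 2 <= (`|a| + `|b|) ^+ 2.
  by rewrite ler_pXn2r ?nnegrE ?addr_ge0 // ler_normD.
apply: le_trans h _; rewrite -subr_ge0.
have -> : 2 * (`|a| ^+ 2 + `|b| ^+ 2) - (`|a| + `|b|) ^+ 2 = (`|a| - `|b|) ^+ 2 by ring.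
by rewrite real_exprn_even_ge0 // rpredB // normr_real.
Qed.

Lemma hsnD X Y : hsn (X + Y) <= 2 * (hsn X + hsn Y).
Proof.
rewrite /hsn -big_split mulr_sumr; apply: ler_sum => i _ /=.
rewrite -big_split mulr_sumr; apply: ler_sum => j _ /=.
by rewrite mxE normD_sq.
Qed.

Lemma hsnN X : hsn (- X) = hsn X.
Proof. by apply: eq_bigr => i _; apply: eq_bigr => j _; rewrite mxE normrN. Qed.

Lemma norm_sum_sq (n : nat) (z : 'I_n -> C) :
  `|\sum_k z k| ^+ 2 <= n%:R * \sum_k `|z k| ^+ 2.
Proof.
have h : `|\sum_k z k| ^+ 2 <= (\sum_k `|z k|) ^+ 2.
  rewrite ler_pXn2r ?nnegrE ?sumr_ge0 //; exact: ler_norm_sum.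
apply: le_trans h _; rewrite -subr_ge0.
have : 0 <= \sum_k \sum_l (`|z k| - `|z l|) ^+ 2.
  apply: sumr_ge0 => k _; apply: sumr_ge0 => l _.
  by rewrite real_exprn_even_ge0 // rpredB // normr_real.
have -> : \sum_k \sum_l (`|z k| - `|z l|) ^+ 2 =
   2 * (n%:R * (\sum_k `|z k| ^+ 2) - (\sum_k `|z k|) ^+ 2).
  have -> : \sum_k \sum_l (`|z k| - `|z l|) ^+ 2 =
      \sum_k (n%:R * `|z k| ^+ 2 - 2 * `|z k| * (\sum_l `|z l|) + \sum_l `|z l| ^+ 2).
    apply: eq_bigr => k _; rewrite mulr_sumr.
    have -> : n%:R * `|z k| ^+ 2 = \sum_(l < n) `|z k| ^+ 2.
      by rewrite sumr_const card_ord mulr_natl.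
    by rewrite -sumrB -big_split; apply: eq_bigr => l _ /=; ring.
  rewrite big_split /= sumrB sumr_const card_ord -mulr_sumr -mulr_suml -mulr_sumr.
  by rewrite -mulr_natl; ring.
by rewrite pmulr_rge0.
Qed.

Lemma hsnM X Y : hsn (X *m Y) <= d%:R * (hsn X * hsn Y).
Proof.
apply: (@le_trans _ _ (\sum_i \sum_j d%:R * \sum_k `|X i k| ^+ 2 * `|Y k j| ^+ 2)).
  apply: ler_sum => i _; apply: ler_sum => j _; rewrite mxE.
  apply: le_trans (norm_sum_sq _) _; rewrite ler_wpM2l ?ler0n //.
  by apply: ler_sum => k _; rewrite normrM exprMn.
under eq_bigr do rewrite -mulr_sumr exchange_big.
rewrite -mulr_sumr ler_wpM2l ?ler0n // /hsn mulr_suml; apply: ler_sum => i _ /=.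
rewrite mulr_suml; apply: ler_sum => k _; rewrite -mulr_sumr ler_wpM2l ?exprn_ge0 //.
rewrite [leRHS](bigD1 k) //= lerDl; apply: sumr_ge0 => l _; apply: sumr_ge0 => j _.
by rewrite exprn_ge0.
Qed.

(** The commutator equals that of g - 1 and h - 1, so it is quadratically small near the
    identity. *)
Lemma hsn_comm g h : hsn (g *m h - h *m g) <= 4 * d%:R * (hsn (g - 1%:M) * hsn (h - 1%:M)).
Proof.
have -> : g *m h - h *m g = (g - 1%:M) *m (h - 1%:M) - (h - 1%:M) *m (g - 1%:M).
  rewrite !mulmxBl !mulmxBr !mulmx1 !mul1mx.
  by apply/matrixP => i j; rewrite !mxE; ring.
apply: le_trans (hsnD _ _) _; rewrite hsnN.
have h1 := hsnM (g - 1%:M) (h - 1%:M); have h2 := hsnM (h - 1%:M) (g - 1%:M).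
have := lerD h1 h2; rewrite [hsn (h - _) * _]mulrC -mulr2n -mulr_natl => h3.
have := ler_wpM2l (ler0n C 2) h3; congr (_ <= _); by ring.
Qed.

Lemma hsn_scalar (z : C) : hsn z%:M = d%:R * `|z| ^+ 2.
Proof.
rewrite /hsn; transitivity (\sum_(i < d) `|z| ^+ 2); last first.
  by rewrite sumr_const card_ord mulr_natl.
apply: eq_bigr => i _; rewrite (bigD1 i) //= big1 => [|j ji].
  by rewrite mxE eqxx mulr1n addr0.
by rewrite mxE eq_sym (negbTE ji) mulr0n normr0 expr0n.
Qed.

(** The n powers of [z] sum to 0, so the differences z^i - 1 sum to -n, while each of them has
    modulus at most n |z - 1|. *)
Lemma root_of_unity_gap (n : nat) (z : C) : z ^+ n = 1 -> z != 1 -> (0 < n)%N ->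
  1 <= n%:R * `|z - 1|.
Proof.
move=> zn z1 n0; have nz : `|z| = 1.
  by apply/eqP; rewrite -(@pexpr_eq1 _ _ n) ?normr_ge0 // -normrX zn normr1.
have s0 : \sum_(i < n) z ^+ i = 0.
  apply/eqP; have := subrX1 z n; rewrite zn subrr => /esym/eqP.
  by rewrite mulf_eq0 subr_eq0 (negbTE z1).
have le i : `|z ^+ i - 1| <= i%:R * `|z - 1|.
  elim: i => [|i IH]; first by rewrite expr0 subrr normr0 mul0r.
  have -> : z ^+ i.+1 - 1 = z * (z ^+ i - 1) + (z - 1) by rewrite exprS; ring.
  apply: le_trans (ler_normD _ _) _; rewrite normrM nz mul1r -addn1 natrD mulrDl mul1r.
  by rewrite lerD2r.
have : n%:R <= \sum_(i < n) n%:R * `|z - 1|.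
  have {1}-> : n%:R = `|\sum_(i < n) (z ^+ i - 1)|.
    by rewrite sumrB s0 sub0r normrN sumr_const card_ord normr_nat.
  apply: le_trans (ler_norm_sum _ _ _) _; apply: ler_sum => i _.
  apply: le_trans (le i) _; rewrite ler_wpM2r // ler_nat; exact: ltnW.
rewrite sumr_const card_ord -(mulr_natl (n%:R * _)) => h; by rewrite -(@ler_pM2l C n%:R) ?ltr0n ?mulr1.
Qed.

Lemma unitary_norm_le1 U i j : U \is unitarymx -> `|U i j| <= 1.
Proof.
move=> /unitarymxP /matrixP/(_ i i); rewrite mxE [RHS]mxE eqxx mulr1n => e.
rewrite -(@ler_pXn2r _ 2) ?nnegrE // expr1n -e (bigD1 j) //= !mxE -normCK lerDl.
by apply: sumr_ge0 => k _; rewrite !mxE -normCK exprn_ge0.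
Qed.

Section Boxes.
Variable q : nat.
Hypothesis q0 : (0 < q)%N.

Let part (x : C) : 'I_(q.*2).+1 := inord (Num.truncn (q%:R * (x + 1))).

Let partP x y : x \is Num.real -> y \is Num.real -> `|x| <= 1 -> `|y| <= 1 ->
  part x = part y -> q%:R * `|x - y| <= 1.
Proof.
have h (z : C) : z \is Num.real -> `|z| <= 1 -> 0 <= q%:R * (z + 1) /\
    (Num.truncn (q%:R * (z + 1)) < (q.*2).+1)%N.
  move=> rz; rewrite real_ler_norml // => /andP[h1 h2].
  have z0 : 0 <= z + 1 by rewrite -lerBlDr sub0r.
  have qz : 0 <= q%:R * (z + 1) by rewrite mulr_ge0.
  split=> //; have /andP[le _] := truncn_itv qz.
  rewrite ltnS -(ler_nat C); apply: le_trans le _.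
  rewrite -muln2 natrM ler_pM2l ?ltr0n // -[2%:R]/(1 + 1) lerD2r //.
move=> rx ry nx ny e; have [x0 xq] := h _ rx nx; have [y0 yq] := h _ ry ny.
have {}e : Num.truncn (q%:R * (x + 1)) = Num.truncn (q%:R * (y + 1)).
  by have := congr1 val e; rewrite /= !inordK.
have /andP[x1 x2] := truncn_itv x0; have /andP[y1 y2] := truncn_itv y0.
rewrite -{1}[q%:R]normr_nat -normrM real_ler_norml; last by rewrite rpredM ?rpredB ?realn.
move: x1 x2 y1 y2; rewrite e -addn1 natrD; move: (Num.truncn _)%:R => t x1 x2 y1 y2.
apply/andP; split.
  rewrite lerNl -mulrN opprB; have := lerB (ltW y2) x1.
  by congr (_ <= _); ring.
have := lerB (ltW x2) y1; by congr (_ <= _); ring.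
Qed.

Definition box U : {ffun 'I_d * 'I_d -> 'I_(q.*2).+1 * 'I_(q.*2).+1} :=
  [ffun p => (part ('Re (U p.1 p.2)), part ('Im (U p.1 p.2)))].

(** Truncation of q (x + 1) cuts the interval from -1 to 1 into pieces of length 1/q; each of the
    d^2 entries contributes at most one squared piece for its real part and one for its imaginary
    part. *)
Lemma boxP U V : U \is unitarymx -> V \is unitarymx -> box U = box V ->
  q%:R ^+ 2 * hsn (U - V) <= 2 * d%:R ^+ 2.
Proof.
move=> uU uV e; rewrite /hsn mulr_sumr.
apply: (@le_trans _ _ (\sum_(i < d) \sum_(j < d) 2)); last first.
  by rewrite !sumr_const !card_ord -mulrnA -(mulr_natr (2 : C)) natrM expr2.
apply: ler_sum => i _; rewrite mulr_sumr; apply: ler_sum => j _.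
have := congr1 (fun f : {ffun _ -> _} => f (i, j)) e; rewrite !ffunE /= => -[e1 e2].
have nR z : `|z| <= 1 -> `|'Re z| <= 1 :> C by apply: le_trans; case: (leif_normC_Re_Creal z).
have nI z : `|z| <= 1 -> `|'Im z| <= 1 :> C.
  move=> h; rewrite -(@expr_le1 _ 2) // real_normK ?Creal_Im //.
  apply: (@le_trans _ _ (`|z| ^+ 2)); last by rewrite expr_le1.
  by rewrite normC2_Re_Im lerDr real_exprn_even_ge0 ?Creal_Re.
have uUi := unitary_norm_le1 i j uU; have uVi := unitary_norm_le1 i j uV.
have r1 := partP (Creal_Re _) (Creal_Re _) (nR _ uUi) (nR _ uVi) e1.
have r2 := partP (Creal_Im _) (Creal_Im _) (nI _ uUi) (nI _ uVi) e2.
have sq (x : C) : x \is Num.real -> q%:R * `|x| <= 1 -> q%:R ^+ 2 * x ^+ 2 <= 1.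
  by move=> rx h; rewrite -(real_normK rx) -exprMn expr_le1 // mulr_ge0.
have := lerD (sq _ _ r1) (sq _ _ r2); rewrite !mxE normC2_Re_Im !raddfB /= mulrDr.
by apply; rewrite rpredB ?Creal_Re ?Creal_Im.
Qed.
End Boxes.
End Frobenius.
End JordanIndex.

Section Unitarization.
Local Open Scope sesquilinear_scope.
Section Unitarize.
Local Notation C := algC.
Variables (gT : finGroupType) (G : {group gT}) (d : nat).
Variable rG : mx_representation C G d.

(** The averaged Hermitian matrix [H] is positive definite, because the term of the neutral element
    is already the identity. Writing H as T times its adjoint, conjugation by the inverse of T turns
    the invariance of H into unitarity. *)
Lemma unitarizable : exists2 S : 'M[C]_d, S \in unitmx &
  forall g, g \in G -> S *m rG g *m invmx S \is unitarymx.
Proof.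
pose H := \sum_(g in G) rG g *m (rG g) ^t*.
have adjM (X Y : 'M[C]_d) : (X *m Y) ^t* = Y ^t* *m X ^t* by rewrite trmx_mul map_mxM.
have HJ g : g \in G -> rG g *m H *m (rG g) ^t* = H.
  move=> gG; rewrite /H mulmx_sumr mulmx_suml [RHS](reindex_inj (mulgI g)) /=.
  apply: eq_big => [x|x xG]; first by rewrite groupMl.
  by rewrite repr_mxM // adjM !mulmxA.
have Hh : H \is hermsymmx.
  apply/is_hermitianmxP; rewrite expr0 scale1r /H raddf_sum map_mx_sum.
  by apply: eq_bigr => g _; rewrite adjM trmxCK.
have /orthomx_spectralP := hermitian_normalmx Hh.
have uP := spectral_unitarymx H; set P := spectralmx H in uP *; set D := spectral_diag H => HE.
have PV : P *m P ^t* = 1%:M by apply/unitarymxP.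
have VP : P ^t* *m P = 1%:M by rewrite -invmx_unitary // mulVmx ?unitarymx_unit.
have Dpos i : 0 < D 0 i.
  have : diag_mx D = P *m H *m P ^t* by rewrite HE invmx_unitary // !mulmxA PV mul1mx -mulmxA PV mulmx1.
  move=> /matrixP/(_ i i); rewrite mxE eqxx mulr1n => ->.
  rewrite /H mulmx_sumr mulmx_suml summxE (bigD1 1%g) //= repr_mx1.
  rewrite trmx1 map_mx1 !mulmx1 PV mxE eqxx mulr1n ltr_wpDr // sumr_ge0 // => g _.
  rewrite mulmxA -mulmxA -adjM mxE sumr_ge0 // => j _.
  by rewrite !mxE -normCK exprn_ge0.
pose Q := diag_mx (map_mx sqrtC D).
have QQ : Q *m Q ^t* = diag_mx D.
  rewrite /Q tr_diag_mx map_diag_mx mulmx_diag; congr diag_mx; apply/rowP => i; rewrite !mxE.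
  have rD : sqrtC (D 0 i) \is Num.real by rewrite ger0_real ?sqrtC_ge0 ?ltW.
  transitivity (sqrtC (D 0 i) * sqrtC (D 0 i)); last by rewrite -expr2 sqrtCK.
  by congr (_ * _); exact: conj_Creal.
pose T := P ^t* *m Q.
have HT : H = T *m T ^t* by rewrite /T adjM trmxCK mulmxA -(mulmxA _ Q) QQ HE invmx_unitary.
have uT : T \in unitmx.
  rewrite unitmx_mul unitarymx_unit ?trmxC_unitary //= unitmxE unitfE det_diag.
  by apply/prodf_neq0 => i _; rewrite mxE sqrtC_eq0 gt_eqF.
move: T HT uT => T HT uT.
exists (invmx T); first by rewrite unitmx_inv.
move=> g gG; apply/unitarymxP; rewrite invmxK.
have TTV : T ^t* *m (invmx T) ^t* = 1%:M by rewrite -adjM mulVmx // trmx1 map_mx1.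
rewrite !adjM -!mulmxA [T *m (_ *m _)]mulmxA -HT (mulmxA H) (mulmxA (rG g)) (mulmxA (rG g)).
rewrite HJ // HT -mulmxA TTV mulmx1 mulVmx //.
Qed.
End Unitarize.

Lemma eq_le (x y : algC) : x = y -> x <= y. Proof. by move->. Qed.

(** [g0] is a non-scalar element nearest to the identity. For h close to the identity, the
    commutator of g0 and h is nearer than g0, hence a scalar z of determinant 1; as a d-th root of
    unity close to 1, z is 1. So [g0] commutes with a whole neighbourhood of the identity, and its
    centralizer has at most as many cosets as there are boxes. The value of [q] ensures 16 d^3 2 d^2
    < q^2, so that elements of one box differ by such an h. *)
Lemma jordan_step d q (gT : finGroupType) (G : {group gT}) (rG : mx_representation algC G d) :
  (0 < d)%N -> q = (6 * d ^ 3)%N -> (exists2 g, g \in G & ~~ is_scalar_mx (rG g)) ->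
  exists2 g0, g0 \in G & ~~ is_scalar_mx (rG g0) /\
    exists A : {group gT}, [/\ A \subset G, forall a, a \in A -> rG a *m rG g0 = rG g0 *m rG a
      & (#|G : A|%g <= (((q.*2).+1 * (q.*2).+1) ^ (d * d)))%N].
Proof.
move=> d0 qE [g1 g1G g1n].
have [S uS uU] := unitarizable rG.
pose U g := S *m rG g *m invmx S.
have UM g h : g \in G -> h \in G -> U (g * h)%g = U g *m U h.
  by move=> gG hG; rewrite /U repr_mxM // -!mulmxA mulKmx.
have U1 : U 1%g = 1%:M by rewrite /U repr_mx1 mulmx1 mulmxV.
have UV g : g \in G -> U g *m U g^-1%g = 1%:M.
  by move=> gG; rewrite -UM ?groupV // mulgV U1.
have Usc g : is_scalar_mx (rG g) = is_scalar_mx (U g).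
  apply/is_scalar_mxP/is_scalar_mxP => -[a e]; exists a; rewrite /U.
    by rewrite e -scalemx1 -scalemxAr mulmx1 -scalemxAl mulmxV // scalemx1.
  have : invmx S *m U g *m S = rG g by rewrite /U !mulmxA mulVmx // mul1mx mulmxKV.
  by rewrite e -scalemx1 -scalemxAr mulmx1 -scalemxAl mulVmx // scalemx1.
have UE g : rG g = invmx S *m U g *m S by rewrite /U !mulmxA mulVmx // mul1mx mulmxKV.
have {}uU : forall g, g \in G -> U g \is unitarymx := uU.
clearbody U.
pose Pr g := (g \in G) && ~~ is_scalar_mx (rG g).
have Pr1 : Pr g1 by rewrite /Pr g1G.
have [g0 /andP[g0G g0n] gmin] := real_arg_minP (F := fun g => hsn (U g - 1%:M)) Pr1
  (fun i _ => ger0_real (hsn_ge0 _)).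
exists g0 => //; split=> //.
have key h : h \in G -> 16 * d%:R ^+ 3 * hsn (U h - 1%:M) < 1 -> U h *m U g0 = U g0 *m U h.
  move=> hG small.
  have hsn0 : 0 < hsn (U g0 - 1%:M).
    rewrite lt_def hsn_ge0 andbT; apply: contra g0n => /eqP/hsn_eq0 /eqP.
    by rewrite subr_eq0 Usc => /eqP->; exact: scalar_mx_is_scalar.
  pose c := (g0 * h * g0^-1 * h^-1)%g.
  have cG : c \in G by rewrite !groupM ?groupV.
  have Uc : U c - 1%:M = (U g0 *m U h - U h *m U g0) *m U (g0^-1 * h^-1)%g.
    rewrite mulmxBl -!UM ?groupM ?groupV // /c !mulgA; congr (_ - _).
    by rewrite -!mulgA mulKVg mulgV U1.
  have le1 : hsn (U c - 1%:M) <= 4 * d%:R * (hsn (U g0 - 1%:M) * hsn (U h - 1%:M)).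
    by rewrite Uc hsn_unitr ?hsn_comm // uU ?groupM ?groupV.
  have d1 : (1 : algC) <= d%:R by rewrite ler1n.
  have lt4 : 4 * d%:R * hsn (U h - 1%:M) < 1.
    apply: le_lt_trans small; rewrite ler_wpM2r ?hsn_ge0 // exprSr.
    have d2 : (1 : algC) <= d%:R ^+ 2 by rewrite exprn_ege1.
    rewrite mulrA ler_wpM2r ?ler0n // -[leLHS]mulr1 ler_pM ?ler0n // ler_nat //.
  have [z Uz] : exists z, U c = z%:M.
    apply/is_scalar_mxP; rewrite -Usc; apply: contraT => cn.
    have := gmin c; rewrite /Pr cG cn => /(_ isT) le2.
    have := le_trans le2 le1; rewrite mulrCA -[leLHS]mulr1 ler_pM2l // => le3.
    by have := le_lt_trans le3 lt4; rewrite ltxx.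
  have zd : z ^+ d = 1.
    have detV g : g \in G -> \det (U g) * \det (U g^-1%g) = 1.
      by move=> gG; rewrite -det_mulmx UV // det1.
    rewrite -det_scalar -Uz /c !UM ?groupM ?groupV // !det_mulmx.
    by rewrite -mulrA mulrACA detV // detV // mul1r.
  have z1 : z = 1.
    apply/eqP; apply: contraT => zn1; have gap := root_of_unity_gap zd zn1 d0.
    have le2 : d%:R * `|z - 1| ^+ 2 <= 16 * d%:R ^+ 2 * hsn (U h - 1%:M).
      rewrite -hsn_scalar raddfB /= -Uz; apply: le_trans le1 _.
      have n4 : hsn (U g0 - 1%:M) <= 4 * d%:R.
        apply: le_trans (hsnD _ _) _; rewrite hsnN -[U g0]mul1mx hsn_unitr ?uU //.
        by rewrite hsn_scalar normr1 expr1n mulr1; apply: eq_le; ring.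
      have := ler_wpM2r (hsn_ge0 (U h - 1%:M)) n4 => n5.
      have := ler_wpM2l (_ : 0 <= 4 * d%:R) n5; rewrite mulr_ge0 ?ler0n // => /(_ isT).
      by move/le_trans; apply; apply: eq_le; ring.
    have le3 : 1 <= d%:R ^+ 2 * `|z - 1| ^+ 2 by rewrite -exprMn exprn_ege1.
    have := ler_wpM2l (ler0n algC d) le2 => le4.
    have : 16 * d%:R ^+ 3 * hsn (U h - 1%:M) < 16 * d%:R ^+ 3 * hsn (U h - 1%:M).
      apply: lt_le_trans small _; apply: le_trans le3 _; rewrite expr2 -mulrA.
      by apply: le_trans le4 _; apply: eq_le; ring.
    by rewrite ltxx.
  have e1 : U (c * (h * g0))%g = U (h * g0)%g.
    by rewrite UM ?groupM ?groupV // Uz z1 mul1mx.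
  by rewrite -!UM // -e1 /c !mulgA !mulgKV.
pose AS := [set g in G | U g *m U g0 == U g0 *m U g].
have AP g : reflect (g \in G /\ U g *m U g0 = U g0 *m U g) (g \in AS).
  by rewrite inE; apply: (iffP andP) => -[? /eqP].
have gA : group_set AS.
  apply/group_setP; split; first by apply/AP; rewrite group1 U1 mul1mx mulmx1.
  move=> a b /AP[aG ea] /AP[bG eb]; apply/AP; rewrite groupM // !UM //; split=> //.
  by rewrite -mulmxA eb mulmxA ea mulmxA.
exists (Group gA); split=> /=.
- by apply/fintype.subsetP => a /AP[].
- move=> a /AP[aG ea].
  rewrite !UE !mulmxA; congr (_ *m _); rewrite -!mulmxA ![S *m (invmx S *m _)]mulKVmx //.
  by congr (_ *m _).
- have -> : (((q.*2).+1 * (q.*2).+1) ^ (d * d))%N =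
     #|{: {ffun 'I_d * 'I_d -> 'I_(q.*2).+1 * 'I_(q.*2).+1}}|.
    by rewrite card_ffun !card_prod !card_ord.
  have := @index_le_card gT _ (fun g => box q (U g)) G (Group gA).
  apply; first by apply/fintype.subsetP => a /AP[].
  move=> g h gG hG e; apply/AP; rewrite groupM ?groupV //; split=> //.
  apply: key; first by rewrite groupM ?groupV.
  have -> : U (h * g^-1)%g - 1%:M = (U h - U g) *m U g^-1%g.
    by rewrite mulmxBl UV // UM ?groupV.
  rewrite hsn_unitr ?uU ?groupV //.
  have q0 : (0 < q)%N by rewrite qE muln_gt0 expn_gt0 d0.
  have := boxP q0 (uU _ hG) (uU _ gG) (esym e) => le1.
  have dp : 0 < (d%:R : algC) by rewrite ltr0n.
  rewrite -(@ltr_pM2l _ (q%:R ^+ 2)) ?exprn_gt0 ?ltr0n // mulr1.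
  rewrite mulrCA; apply: (@le_lt_trans _ _ (16 * d%:R ^+ 3 * (2 * d%:R ^+ 2))).
    by rewrite ler_wpM2l // mulr_ge0 ?exprn_ge0 ?ler0n.
  rewrite qE -!natrX -!natrM ltr_nat; move: d0; clear; nia.
Qed.

(** The centralizer of [g0] preserves an eigenspace of [g0] and, by Maschke, a complement; both have
    smaller dimension as [g0] is not scalar. The bound adds up three cases: M for smaller dimension,
    1 for scalar matrices, and B M^2 for the centralizer followed by an intersection of two
    subgroups. *)
Theorem jordan_algC d : exists N, forall d' (gT : finGroupType) (G : {group gT})
    (rG : mx_representation algC G d'), (d' <= d)%N ->
  exists A : {group gT}, [/\ A \subset G, (#|G : A|%g <= N)%N &
    forall a b, a \in A -> b \in A -> rG a *m rG b = rG b *m rG a].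
Proof.
elim: d => [|d [M IH]].
  exists 1%N => d' gT G rG; rewrite leqn0 => /eqP d0; exists G; rewrite indexgg; split=> //.
  by move=> a b _ _; apply/matrixP => i; exfalso; have := ltn_ord i; rewrite {2}d0.
pose q := (6 * d.+1 ^ 3)%N; pose B := (((q.*2).+1 * (q.*2).+1) ^ (d.+1 * d.+1))%N.
have B0 : (0 < B)%N by rewrite expn_gt0.
exists (M + 1 + B * (M * M))%N => d' gT G rG; rewrite leq_eqVlt => /orP[/eqP d'E|]; last first.
  rewrite ltnS => /(IH _ _ _ rG)[A [sA iA cA]]; exists A; split=> //.
  by apply: leq_trans iA _; rewrite -addnA leq_addr.
move: rG; rewrite d'E => {d'E d'} rG.
have [[g gG gn]|allsc] := pselect (exists2 g, g \in G & ~~ is_scalar_mx (rG g)); last first.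
  exists G; rewrite indexgg; split=> //; first by lia.
  move=> a b aG bG; have : is_scalar_mx (rG a).
    by apply: contraT => an; case: allsc; exists a.
  by case/is_scalar_mxP => z ->; rewrite scalar_mxC.
have [g0 g0G [g0n [A [sA cA iA]]]] := @jordan_step d.+1 q gT G rG isT erefl
  (ex_intro2 _ _ g gG gn).
have [a av] : exists a, eigenvalue (rG g0) a.
  have [x rx] := closed_rootP (char_poly (rG g0)) ltac:(by rewrite size_char_poly).
  by exists x; rewrite eigenvalue_root_char.
pose V := eigenspace (rG g0) a.
pose rA := subg_repr rG sA.
have Vmod : mxmodule rA V.
  apply/mxmoduleP => x xA; apply/eigenspaceP; rewrite -mulmxA /= cA //.
  by rewrite mulmxA (eigenspaceP (submx_refl _)) scalemxAl.
have pA : pgroup.pgroup ([pchar algC]%R)^' A.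
  by apply/pgroup.pgroupP => p pp _; rewrite inE /= pchar_num.
have [W Wmod VW dVW] := mx_Maschke_pchar rA pA Vmod (submx1 _).
have rk : (\rank V + \rank W = d.+1)%N.
  by have /= <- := mxdirectP dVW; rewrite VW mxrank1.
have V0 : (0 < \rank V)%N by rewrite lt0n mxrank_eq0.
have V1 : (\rank V < d.+1)%N.
  rewrite ltn_neqAle rank_leq_row andbT; apply: contra g0n => /eqP fullV.
  have /eigenspaceP : (1%:M <= eigenspace (rG g0) a)%MS.
    by rewrite sub1mx /row_full -/V fullV.
  by rewrite mul1mx scalemx1 => ->; exact: scalar_mx_is_scalar.
have [|A1 [sA1 iA1 cA1]] := IH _ _ _ (submod_repr Vmod); first by rewrite -ltnS.
have [|A2 [sA2 iA2 cA2]] := IH _ _ _ (submod_repr Wmod).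
  by move: V0 rk; clear; lia.
exists (A1 :&: A2)%G; split.
- exact: fintype.subset_trans (fintype.subset_trans (finset.subsetIl _ _) sA1) sA.
- have sA12 : A1 :&: A2 \subset A by apply: fintype.subset_trans (finset.subsetIl _ _) sA1.
  rewrite -(Lagrange_index sA sA12); apply: leq_trans (leq_addl _ _).
  apply: leq_mul => //; apply: leq_trans (index_cap sA1 sA2) _; exact: leq_mul.
move=> x y /finset.setIP[x1 x2] /finset.setIP[y1 y2].
have xA := fintype.subsetP sA1 _ x1; have yA := fintype.subsetP sA1 _ y1.
have onsub (Z : 'M_d.+1) (Zmod : mxmodule rA Z) :
    submod_mx Zmod x *m submod_mx Zmod y = submod_mx Zmod y *m submod_mx Zmod x ->
    Z *m (rG x *m rG y) = Z *m (rG y *m rG x).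
  move=> e.
  have vJ u (k : nat) (W1 : 'M_(k, \rank Z)) : u \in A ->
      val_submod W1 *m rG u = val_submod (W1 *m submod_mx Zmod u).
    by move=> uA; rewrite (val_submodJ Zmod _ uA).
  rewrite -[Z](in_submodK (submx_refl Z)); move: (in_submod Z Z) => W1.
  by rewrite !mulmxA !vJ // -(mulmxA W1) e (mulmxA W1).
have eV := onsub _ _ (cA1 _ _ x1 y1); have eW := onsub _ _ (cA2 _ _ x2 y2).
have /sub_addsmxP[[X Y] /= e1] : (1%:M <= V + W)%MS by rewrite VW.
rewrite -[LHS]mul1mx -[RHS]mul1mx e1 !mulmxDl -!(mulmxA X) -!(mulmxA Y).
by rewrite eV eW.
Qed.
End Unitarization.

(** The matrix entries are specialized to [algC] so that the group law persists and every nonzero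
    entry of a commutator stays nonzero, their product [f] being kept nonzero; matrices with
    commuting images then commute. Normality is obtained from the core, hence the self-power. *)
Theorem jordan_closed d : exists2 N, (0 < N)%N & forall (K : closedFieldType)
    (K0 : [pchar K] =i pred0) (gT : finGroupType) (rho : gT -> 'M[K]_d),
    rho 1%g = 1%:M -> (forall g h, rho (g * h)%g = rho g *m rho h) ->
  exists A : {group gT}, [/\ (A <| [set: gT])%g, (#|[set: gT] : A|%g <= N)%N &
    forall a b, a \in A -> b \in A -> rho a *m rho b = rho b *m rho a].
Proof.
have [J hJ] := jordan_algC d.
exists (J.+1 ^ J.+1)%N => [|K K0 gT rho rho1 rhoM]; first by rewrite expn_gt0.
pose r := [seq rho p.1 p.2.1 p.2.2 | p : gT * ('I_d * 'I_d)].
have [A [th [sp hr]]] := @specialization K algC K0 (pchar_num algC) r.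
have [l lE] : exists l : gT -> 'I_d -> 'I_d -> A, forall g i j, th (l g i j) = rho g i j.
  have h (p : gT * ('I_d * 'I_d)) : exists y, th y = rho p.1 p.2.1 p.2.2.
    by apply: hr; apply/mapP; exists p; rewrite ?mem_enum.
  have [f fE] := choice h; exists (fun g i j => f (g, (i, j))) => g i j.
  by rewrite fE.
pose cm (p : gT * gT * ('I_d * 'I_d)) : A :=
  \sum_k (l p.1.1 p.2.1 k * l p.1.2 k p.2.2 - l p.1.2 p.2.1 k * l p.1.1 k p.2.2).
have thcm p : th (cm p) = (rho p.1.1 *m rho p.1.2 - rho p.1.2 *m rho p.1.1) p.2.1 p.2.2.
  rewrite rmorph_sum !mxE -sumrB; apply: eq_bigr => k _.
  by rewrite rmorphB !rmorphM !lE.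
pose f := \prod_(p | th (cm p) != 0) cm p.
have [|psi [psif psik]] := sp f.
  by rewrite rmorph_prod; apply/prodf_neq0.
pose sg g : 'M[algC]_d := \matrix_(i, j) psi (l g i j).
have psi_eq x y : th x = th y -> psi x = psi y.
  move=> e; apply/eqP; rewrite -subr_eq0 -rmorphB; apply/eqP/psik.
  by rewrite rmorphB e subrr.
have sgr : mx_repr [set: gT] sg.
  split=> [|g h _ _].
    apply/matrixP => i j; rewrite !mxE.
    have -> : (i == j)%:R = psi ((i == j)%:R) by rewrite rmorph_nat.
    by apply: psi_eq; rewrite lE rho1 mxE rmorph_nat.
  apply/matrixP => i j; rewrite !mxE.
  have -> : \sum_k sg g i k * sg h k j = psi (\sum_k l g i k * l h k j).
    by rewrite rmorph_sum; apply: eq_bigr => k _; rewrite !mxE rmorphM.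
  apply: psi_eq; rewrite lE rhoM mxE rmorph_sum; apply: eq_bigr => k _.
  by rewrite rmorphM !lE.
have [B [sB iB cB]] := hJ d gT [set: gT]%G (MxRepresentation sgr) (leqnn d).
have [C nC [sC iC]] := index_gcore sB.
exists C; split=> //.
  apply: leq_trans iC _; apply: leq_trans (_ : J.+1 ^ #|[set: gT] : B|%g <= _)%N.
    by rewrite leq_exp2r ?indexg_gt0 //; apply: leq_trans iB _.
  by apply: leq_pexp2l => //; apply: leq_trans iB _.
move=> a b aC bC; apply/eqP; rewrite -subr_eq0; apply/eqP/matrixP => i j.
rewrite -(thcm ((a, b), (i, j))) [RHS]mxE; apply/eqP; apply: contraT => nz.
have : psi (cm (a, b, (i, j))) = 0.
  have := cB a b (fintype.subsetP sC _ aC) (fintype.subsetP sC _ bC).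
  move/matrixP/(_ i j); rewrite !mxE /= => /eqP; rewrite -subr_eq0 -sumrB => /eqP e.
  rewrite rmorph_sum -[RHS]e; apply: eq_bigr => k _.
  by rewrite rmorphB !rmorphM !mxE.
move: psif; rewrite /f (bigD1 (a, b, (i, j))) //= rmorphM mulf_eq0 negb_or => /andP[+ _].
by move=> /eqP.
Qed.

(** * Generic vectors, rational matrices of finite order and generic weights *)

Lemma Xn_sub2_irreducible m : (0 < m)%N -> irreducible_poly ('X^m - 2 : {poly rat}).
Proof.
move=> m0.
have -> : ('X^m - 2 : {poly rat}) = map_poly (intr : int -> rat) ('X^m - 2%:P).
  by rewrite rmorphB /= map_polyXn map_polyC /= -polyCMn.
apply/irreducible_rat_int.
have sz : size ('X^m - 2%:P : {poly int}) = m.+1 by rewrite size_XnsubC.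
have co i : ('X^m - 2%:P : {poly int})`_i = (i == m)%:R - (if i == 0%N then 2 else 0).
  by rewrite coefB coefXn coefC.
apply: (@eisenstein_crit 2) => //.
- by rewrite sz eqSS -lt0n.
- by rewrite lead_coefE sz co eqxx gtn_eqF.
- by rewrite co eqxx ltn_eqF.
move=> i; rewrite sz /= => im; rewrite co (ltn_eqF im).
by case: (i == 0%N).
Qed.

(** The powers of an m-th root of 2 with exponents below m are independent over Q, the polynomial
    X^m - 2 being irreducible. This works even when [K] is algebraic over Q. *)
Lemma generic_vector (K : closedFieldType) m : [pchar K] =i pred0 ->
  exists th : 'rV[K]_m, forall u : 'rV[int]_m, ev th u = 0 -> u = 0.
Proof.
move=> K0; have [m0|m0] := posnP m.
  by exists 0 => u _; apply/rowP => i; exfalso; have := ltn_ord i; rewrite {2}m0.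
have [al ral] : exists al : K, root ('X^m - 2%:P) al.
  by apply/closed_rootP; rewrite size_XnsubC //; lia.
pose th := \row_(i < m) al ^+ i.
exists th => u u0; pose p : {poly int} := \poly_(i < m) u 0 (insubd (Ordinal m0) i).
have pE (i : 'I_m) : p`_i = u 0 i by rewrite coef_poly ltn_ord valKd.
suff p0 : p = 0 by apply/rowP => i; rewrite -pE p0 coef0 mxE.
apply/eqP; apply: contraT => pn.
pose pQ : {poly rat} := map_poly intr p; pose q : {poly int} := 'X^m - 2%:P.
have qE : ('X^m - 2 : {poly rat}) = map_poly intr q.
  by rewrite rmorphB /= map_polyXn map_polyC /= -polyC_natr.
have szp : size pQ = size p by rewrite size_map_inj_poly //; exact: intr_inj.
have : coprimep ('X^m - 2) pQ.
  rewrite irreducible_poly_coprime; last exact: Xn_sub2_irreducible.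
  apply/negP => /dvdp_leq; rewrite -size_poly_gt0 szp size_poly_gt0 pn => /(_ isT).
  by rewrite -[2]polyC_natr size_XnsubC // leqNgt ltnS size_poly.
move=> /Bezout_eq1_coprimepP[[U V] /=]; rewrite qE.
have [U' [a a0 ->]] := rat_poly_scale U; have [V' [b b0 ->]] := rat_poly_scale V => e.
have {}e : b%:P * U' * q + a%:P * V' * p = (a * b)%:P.
  have iinj : injective (map_poly (intr : int -> rat)).
    by apply: map_inj_poly => //; exact: intr_inj.
  apply: iinj; rewrite rmorphD !rmorphM /= !map_polyC /= -[RHS]mulr1 -e mulrDr.
  rewrite !mul_polyC -!scalerAl !mul_polyC !scalerA.
  have [aq bq] : (a%:~R : rat) != 0 /\ (b%:~R : rat) != 0 by rewrite !intr_eq0.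
  by congr (_ *: _ + _ *: _); field.
have := congr1 (fun g => (map_poly (intr : int -> K) g).[al]) e.
rewrite rmorphD !rmorphM /= map_polyC hornerD !hornerM.
have -> : (map_poly intr q).[al] = 0.
  by rewrite rmorphB /= map_polyXn map_polyC /=; have /rootP := ral; rewrite rmorph_nat.
have -> : (map_poly intr p).[al] = 0.
  rewrite -[RHS]u0 (@horner_coef_wide _ m); last first.
    by apply: leq_trans (size_poly _ _) _; rewrite size_poly.
  by apply: eq_bigr => i _; rewrite coef_map /= pE mxE.
rewrite !mulr0 addr0 ?map_polyC /= !hornerE /= => /esym/eqP.
by rewrite mulf_eq0 !intr_char0_eq0 // (negbTE a0) (negbTE b0).
Qed.

(** If p^e is the exact power of p in d, then p^e <= 2 totient (p^e) <= 2 k, so p^e divides (2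
    k)!. *)
Lemma totient_dvd_fact d k : (0 < d)%N -> (totient d <= k)%N -> (d %| (k.*2)`!)%N.
Proof.
move=> d0 le; apply/dvdn_partP => // p pd; have /and3P[pp _ pdvd] : [&& prime p, (0 < d)%N & (p %| d)%N] by rewrite -mem_primes.
apply: dvdn_fact; rewrite part_gt0 /=.
have e0 : (0 < logn p d)%N by rewrite logn_gt0.
have := totient_coprime (coprime_partC p d d); rewrite partnC // => te.
have tp : (totient d`_p <= k)%N.
  apply: leq_trans le; rewrite te leq_pmulr // totient_gt0 part_gt0 //.
move: tp; rewrite p_part totient_pfactor //.
have := prime_gt1 pp; case: (logn p d) e0 => // e _ p1 /=; rewrite expnS => tp.
have : (p * p ^ e <= (p.-1 * p ^ e).*2)%N.
  by rewrite -muln2 mulnAC leq_mul2r; apply/orP; right; lia.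
by move/leq_trans; apply; rewrite leq_double.
Qed.

(** An eigenvalue is a root of unity whose order d has totient at most the size of [Y], since its
    minimal polynomial over Q divides the characteristic polynomial. So d divides (2 n)!, and [Y] is
    diagonalizable because Y^m = 1. *)
Lemma rat_finite_order n k (Y : 'M[rat]_k.+1) m : (k < n)%N -> (0 < m)%N -> Y ^+ m = 1 ->
  Y ^+ (n.*2)`! = 1.
Proof.
move=> kn m0 Ym; set c := (n.*2)`!.
have iM : injective (map_mx (ratr : rat -> algC) : 'M_k.+1 -> 'M_k.+1).
  by move=> A B /matrixP e; apply/matrixP => i j; have := e i j; rewrite !mxE; apply: fmorph_inj.
apply: iM; pose Z := map_mx (ratr : {rmorphism rat -> algC}) Y.
have ZX e : map_mx ratr (Y ^+ e) = Z ^+ e by rewrite -rmorphXn.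
rewrite ZX map_mx1.
have Zm : Z ^+ m = 1 by rewrite -ZX Ym map_mx1.
have hm e : horner_mx Z ('X^e - 1) = Z ^+ e - 1.
  by rewrite rmorphB rmorph1 rmorphXn /= horner_mx_X.
have min1 : mxminpoly Z %| 'X^m - 1 by apply: mxminpoly_min; rewrite hm Zm subrr.
have [w pw] := C_prim_root_exists m0.
suff min2 : mxminpoly Z %| 'X^c - 1.
  by have /mxminpoly_minP := min2; rewrite hm => /eqP; rewrite subr_eq0 => /eqP.
have rt x : root (mxminpoly Z) x -> x ^+ c = 1.
  rewrite root_mxminpoly => rx; have xm : x ^+ m = 1.
    have : root (mxminpoly Z) x by rewrite root_mxminpoly.
    by rewrite -!dvdp_XsubCl => /dvdp_trans/(_ min1); rewrite dvdp_XsubCl => /rootP; rewrite !hornerE => /eqP; rewrite subr_eq0 => /eqP.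
  have [d pd dm] := prim_order_exists m0 xm.
  have [q [qE qm] qd] := minCpolyP x.
  have : (q %| char_poly Y)%R by rewrite -qd map_char_poly.
  move=> /(dvdp_leq (monic_neq0 (char_poly_monic Y))).
  rewrite size_char_poly -(size_map_poly (ratr : {rmorphism rat -> algC})) -qE.
  rewrite (minCpoly_cyclotomic pd) size_cyclotomic ltnS => td.
  apply/eqP; rewrite -(prim_order_dvd pd); apply: totient_dvd_fact.
    exact: prim_order_gt0 pd.
  exact: leq_trans td kn.
have := min1; rewrite -(factor_Xn_sub_1 pw) big_mkord => /dvdp_prod_XsubC[b eb].
set rs := [seq w ^+ (i : 'I_m) | i <- mask b (index_enum 'I_m)].
have {}eb : mxminpoly Z %= \prod_(x <- rs) ('X - x%:P) by rewrite big_map.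
rewrite (eqp_dvdl _ eb); apply: uniq_roots_dvdp.
  apply/allP => x xr; apply/rootP; rewrite !hornerE rt ?subrr //.
  by rewrite (eqp_root eb) root_prod_XsubC.
rewrite uniq_rootsE map_inj_in_uniq ?mask_uniq ?index_enum_uniq // => i l _ _ /eqP.
by rewrite (eq_prim_root_expr pw) !modn_small // => /eqP/val_inj.
Qed.

Section Laurent.
Variables (K : fieldType) (r : nat) (t : 'rV[K]_r).
Hypothesis t0 : Gm t.

Lemma laurent0 : laurent 0 t = 1.
Proof. by rewrite /laurent big1 // => i _; rewrite mxE expr0z. Qed.

Lemma laurentD u v : laurent (u + v) t = laurent u t * laurent v t.
Proof. by rewrite /laurent -big_split; apply: eq_bigr => i _; rewrite mxE expfzDr ?t0. Qed.

Lemma laurent_neq0 u : laurent u t != 0.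
Proof. by apply/prodf_neq0 => i _; rewrite expfz_eq0 negb_and t0 orbT. Qed.

Lemma laurentN u : laurent (- u) t = (laurent u t)^-1.
Proof.
by apply: (mulfI (laurent_neq0 u)); rewrite -laurentD subrr laurent0 divff ?laurent_neq0.
Qed.

Lemma laurentZ (k : int) u : laurent (k *: u) t = laurent u t ^ k.
Proof.
have m1 : (1 : K) ^ k = 1 by rewrite exp1rz.
have mM (x y : K) : (x * y) ^ k = x ^ k * y ^ k by rewrite expfzMl.
rewrite /laurent (big_morph (fun x : K => x ^ k) mM m1).
by apply: eq_bigr => i _; rewrite mxE mulrC exprz_exp.
Qed.

Lemma laurent_delta i : laurent (delta_mx 0 i) t = t 0 i.
Proof.
rewrite /laurent (bigD1 i) //= big1 => [|j ji]; rewrite mxE ?eqxx ?(negbTE ji) ?andbF //.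
by rewrite mulr1 expr1z.
Qed.

Lemma laurent_sum (I : Type) (s : seq I) (P : pred I) (F : I -> 'rV[int]_r) :
  laurent (\sum_(i <- s | P i) F i) t = \prod_(i <- s | P i) laurent (F i) t.
Proof. by apply: (big_morph (fun u => laurent u t)); [exact: laurentD | exact: laurent0]. Qed.
End Laurent.

Section GenericWeights.
Variable r : nat.

(** Indices of relations: [inl (i, j, k)] stands for e_i + e_j = e_k and [inr i] for e_i = 0. *)
Let T := ('I_r * 'I_r * 'I_r + 'I_r)%type.
Let rel (t : T) : 'rV[int]_r :=
  match t with
  | inl (i, j, k) => delta_mx 0 i + delta_mx 0 j - delta_mx 0 k
  | inr i => delta_mx 0 i
  end.

Let torsion (p : {set T} * 'I_r) (m : nat) := (0 < m)%N /\ exists (N : int) (z : T -> int),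
  (m = `|N|)%N /\ N *: delta_mx 0 p.2 = \sum_(t in p.1) z t *: rel t.

(** [w] is a generic point of the space of additive solutions. If w_i = 0, all rational solutions
    vanish at i, so a nonzero multiple of e_i is an integral combination of the relations, and x_i
    has finite order for every multiplicative solution x. As there are finitely many sets of
    relations, [c] can be the product of these orders over all sets and indices, which makes it
    independent of the field. *)
Lemma generic_weights : exists2 c, (0 < c)%N & forall (K : closedFieldType)
    (K0 : [pchar K] =i pred0) (S : pred ('I_r * 'I_r * 'I_r)) (Z : pred 'I_r),
  exists w : 'rV[K]_r, [/\ forall i j k, S (i, j, k) -> w 0 i + w 0 j = w 0 k,
    forall i, Z i -> w 0 i = 0 &
    forall i, w 0 i = 0 -> forall x : 'rV[K]_r, Gm x ->
      (forall i j k, S (i, j, k) -> x 0 i * x 0 j = x 0 k) ->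
      (forall i, Z i -> x 0 i = 1) -> x 0 i ^+ c = 1].
Proof.
(* The factor 1 is the default for a set of relations that has no multiple of e_i in its span. *)
pose m p := if pselect (exists m, torsion p m) is left h then projT1 (cid h) else 1%N.
have m0 p : (0 < m p)%N.
  by rewrite /m; case: pselect => // h; case: (projT2 (cid h)).
have mP p : (exists m, torsion p m) -> torsion p (m p).
  by move=> h; rewrite /m; case: pselect => // h'; exact: projT2 (cid h').
exists (\prod_p m p)%N; first by apply: prodn_gt0.
move=> K K0 S Z; pose A := [set t : T | match t with inl s => S s | inr i => Z i end].
pose RA : 'M[rat]_(#|{: T}|, r) :=
  \matrix_(a, j) (if enum_val a \in A then (rel (enum_val a) 0 j)%:~R else 0).
pose B : 'M[rat]_r := kermx RA^T.
have BR : B *m RA^T = 0 by rewrite mulmx_ker.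
have [N N0 [BZ BZE]] := integral_multiple B.
have [th thP] := generic_vector r K0.
pose w : 'rV[K]_r := th *m map_mx intr BZ.
have wE i : w 0 i = ev th (\row_k BZ k i).
  by rewrite mxE; apply: eq_bigr => k _; rewrite !mxE mulrC.
have BZrel t k : t \in A -> \sum_j BZ k j * rel t 0 j = 0.
  move=> tA; apply/eqP; rewrite -(intr_eq0 rat) rmorph_sum /=; apply/eqP.
  have := congr1 (fun M : 'M[rat]_(r, #|{: T}|) => N%:~R * M k (enum_rank t)) BR.
  rewrite !mxE mulr0 mulr_sumr => {2}<-; apply: eq_bigr => j _.
  have := congr1 (fun M : 'M[rat]_r => M k j) BZE; rewrite !mxE => e.
  by rewrite enum_rankK tA intrM e mulrA.
have wrel t : t \in A -> ev w (rel t) = 0.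
  move=> tA; rewrite -(raddf0 (ev th)).
  have -> : (0 : 'rV[int]_r) = \row_k (\sum_j BZ k j * rel t 0 j).
    by apply/rowP => k; rewrite !mxE BZrel.
  rewrite /ev; under eq_bigr => i _ do rewrite wE mulr_sumr.
  rewrite exchange_big /=; apply: eq_bigr => k _; rewrite mxE rmorph_sum mulr_suml.
  by apply: eq_bigr => j _; rewrite !mxE /= intrM; ring.
exists w; split.
- move=> i j k Sijk; have := wrel (inl (i, j, k)); rewrite inE => /(_ Sijk) /=.
  by rewrite raddfB raddfD /= !ev_delta => /eqP; rewrite subr_eq0 => /eqP.
- by move=> i Zi; have := wrel (inr i); rewrite inE => /(_ Zi) /=; rewrite ev_delta.
move=> i wi0 x x0 xS xZ; pose p := (A, i).
suff /mP[_ [N1 [z [mE e]]]] : exists m, torsion p m.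
  rewrite (bigD1 p) //= exprM.
  have : x 0 i ^ N1 = 1.
    rewrite -laurent_delta -laurentZ e laurent_sum // big1 // => t tA.
    rewrite laurentZ //; suff -> : laurent (rel t) x = 1 by rewrite exp1rz.
    move: tA; rewrite inE; case: (t) => [[[a b] k]|a] /= h; last by rewrite laurent_delta // xZ.
    by rewrite !laurentD // laurentN // !laurent_delta // (xS _ _ _ h) divff ?x0.
  move=> xN; suff -> : x 0 i ^+ m p = 1 by rewrite expr1n.
  rewrite mE; case: (N1) xN => k //= /eqP; rewrite invr_eq1 => /eqP -> //.
have BZ0 k : BZ k i = 0.
  by have := thP _ (etrans (esym (wE i)) wi0) => /rowP/(_ k); rewrite !mxE.
have B0 k : B k i = 0.
  have := congr1 (fun M : 'M[rat]_r => M k i) BZE; rewrite !mxE BZ0 => /esym/eqP.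
  by rewrite mulf_eq0 intr_eq0 (negbTE N0) => /eqP.
(* e_i is orthogonal to all rational solutions, hence lies in the row space of the relations. *)
have /submxP[y ye] : ((delta_mx 0 i : 'rV[rat]_r) <= RA)%MS.
  rewrite submxE; have : ((cokermx RA)^T <= B)%MS.
    by apply/sub_kermxP; rewrite -trmx_mul mulmx_coker trmx0.
  move=> /submxP[D De]; apply/eqP; rewrite -[cokermx RA]trmxK De trmx_mul mulmxA.
  suff -> : delta_mx 0 i *m B^T = 0 :> 'rV[rat]_r by rewrite mul0mx.
  by rewrite -rowE; apply/rowP => k; rewrite [LHS]mxE [LHS]mxE B0 mxE.
have [N1 N10 [Y YE]] := integral_multiple y.
exists `|N1|%N; split; first by rewrite absz_gt0.
exists N1, (fun t => Y 0 (enum_rank t)); split=> //=.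
apply/rowP => j; apply: (@intr_inj rat); rewrite summxE rmorph_sum /=.
have := congr1 (fun M : 'rV[rat]_r => N1%:~R * M 0 j) ye; rewrite !mxE => e.
rewrite intrM; transitivity (N1%:~R * ((0 == 0 :> 'I_1) && (j == i))%:R : rat).
  by congr (_ * _); case: (_ && _).
rewrite e mulr_sumr (reindex enum_rank) /=; last by apply: onW_bij; exact: enum_rank_bij.
rewrite [RHS]big_mkcond; apply: eq_bigr => t _; rewrite !mxE enum_rankK.
case: ifP => _; last by rewrite !mulr0.
have := congr1 (fun M : 'rV[rat]__ => M 0 (enum_rank t)) YE; rewrite !mxE => e1.
by rewrite intrM e1 mulrA.
Qed.
End GenericWeights.

(** * Brackets of semisimple roots *)

Section RayRelation.
Variables (n : nat) (s : toric_cone n) (D : ray_data s).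
Local Notation N := (nrays D).
Local Notation is_root := (@is_root n s D).

Let rel (j k : 'I_N) (e : 'rV[int]_n) := forall l, phi l e = (l == k)%:Z - (l == j)%:Z.

(* Rays j and k are related when x_k / x_j is a character in the homogeneous
   coordinates; rvec j k is then its exponent. *)
Definition rrel (j k : 'I_N) : bool := `[< exists e, rel j k e >].
Definition rvec (j k : 'I_N) : 'rV[int]_n := xget 0 [set e | rel j k e]%classic.
(** A representative of the class of [j]: [pick] sees only the predicate, so related rays get the
    same one. *)
Definition rrep (j : 'I_N) : 'I_N := odflt j [pick l | rrel j l].

Lemma phi_rvec j k : rrel j k -> forall l, phi l (rvec j k) = (l == k)%:Z - (l == j)%:Z.
Proof. by move=> /asboolP[e he]; apply: (xgetPex 0 (P := [set e | rel j k e]%classic)); exists e. Qed.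

Lemma rvec_uniq j k e : rel j k e -> rrel j k /\ rvec j k = e.
Proof.
move=> h; have jk : rrel j k by apply/asboolP; exists e.
by split=> //; apply: (phi_inj (D := D)) => l; rewrite (phi_rvec jk) h.
Qed.

Lemma rrel_refl j : rrel j j. Proof. by apply/asboolP; exists 0 => l; rewrite phi0 subrr. Qed.
Lemma rvec_refl j : rvec j j = 0.
Proof. by apply: (rvec_uniq _).2 => l; rewrite phi0 subrr. Qed.

Lemma rrel_sym j k : rrel j k -> rrel k j.
Proof. by move=> h; apply/asboolP; exists (- rvec j k) => l; rewrite phiN phi_rvec // opprB. Qed.

Lemma rrel_trans j k l : rrel j k -> rrel k l -> rrel j l /\ rvec j k + rvec k l = rvec j l.
Proof.
move=> h h'; have [-> ->] // : rrel j l /\ rvec j l = rvec j k + rvec k l.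
by apply: rvec_uniq => m; rewrite phiD !phi_rvec //; lia.
Qed.

Lemma rrepP j : rrel (rrep j) j.
Proof.
rewrite /rrep; case: pickP => [l /rrel_sym //|/(_ j)]; by rewrite rrel_refl.
Qed.

Lemma rrep_eq j k : rrel j k -> rrep j = rrep k.
Proof.
move=> jk; rewrite /rrep; have e : rrel j =1 rrel k.
  move=> l; apply/idP/idP => h; last exact: (rrel_trans jk h).1.
  exact: (rrel_trans (rrel_sym jk) h).1.
rewrite (eq_pick e); case: pickP => [//|/(_ k)]; by rewrite rrel_refl.
Qed.

Lemma is_root_rvec j k e : is_root j k e <-> [/\ j != k, rrel j k & e = rvec j k].
Proof.
split=> [[jk /rvec_uniq[? <-]] //|[jk r ->]]; split=> // l; exact: phi_rvec.
Qed.
End RayRelation.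

Lemma ev_deltar (K : pzRingType) n (j : 'I_n) u : ev (delta_mx 0 j : 'rV[K]_n) u = (u 0 j)%:~R.
Proof.
rewrite /ev (bigD1 j) //= big1 => [|i ij]; first by rewrite mxE !eqxx mulr1 addr0.
by rewrite mxE (negbTE ij) andbF mulr0.
Qed.

Section Brackets.
Variables (K : fieldType) (n : nat) (s : toric_cone n) (D : ray_data s).
Variable R : toric_alg K s.
Hypothesis K0 : [pchar K] =i pred0.
Local Notation S := (dual_cone s).
Local Notation chi := (chi R).
Local Notation lin F := (klin (@GRing.scale K R) (F : R -> R)).
Local Notation m0 := (size (rts D)).
Local Notation r0 := (n + m0)%N.
Local Notation N := (nrays D).
Local Notation der := (@der K n s D R).
Local Notation br := (@br K n s D R).
Local Notation is_root := (@is_root n s D).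
Local Notation rrel := (@rrel n s D).
Local Notation rvec := (@rvec n s D).
Implicit Types (u : 'rV[int]_n) (lam mu : 'rV[K]_n) (v w x : 'rV[K]_r0).

Definition rayK (l : 'I_N) : 'rV[K]_n := map_mx intr (ray l).

Lemma ev_rayK l u : ev (rayK l) u = (phi l u)%:~R.
Proof. by rewrite /phi -ev_intr. Qed.

Lemma der_inj v w : (forall u, S u -> der v (chi u) = der w (chi u)) -> v = w.
Proof.
move=> h; apply/eqP; rewrite -subr_eq0; apply/eqP/(raising_der (R := R) K0) => u x Su.
by rewrite derB h // subrr cf0 eqxx.
Qed.

Let dD v f g : der v (f + g) = der v f + der v g.
Proof. by case: (is_der_lin (is_der_der R K0 v)). Qed.
Let dZ v c f : der v (c *: f) = c *: der v f.
Proof. by case: (is_der_lin (is_der_der R K0 v)). Qed.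
Let dB v f g : der v (f - g) = der v f - der v g.
Proof. by rewrite dD -scaleN1r dZ scaleN1r. Qed.
Let dbr v w f : der (br v w) f = der v (der w f) - der w (der v f).
Proof. by rewrite (der_br K0). Qed.

Lemma brP v w x : (forall u, S u -> der x (chi u) = der v (der w (chi u)) - der w (der v (chi u))) ->
  br v w = x.
Proof. by move=> h; apply: der_inj => u Su; rewrite dbr h. Qed.

Lemma brDl v w x : br (v + w) x = br v x + br w x.
Proof. by apply: brP => u _; rewrite !derD !dbr dD opprD addrACA. Qed.
Lemma brZl c v x : br (c *: v) x = c *: br v x.
Proof. by apply: brP => u _; rewrite !derZ dbr dZ scalerBr. Qed.
Lemma brC v w : br v w = - br w v.
Proof. by apply: brP => u _; rewrite -scaleN1r derZ dbr scaleN1r opprB. Qed.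
Lemma brDr v w x : br x (v + w) = br x v + br x w.
Proof. by rewrite brC brDl opprD -!(brC x). Qed.
Lemma brZr c v x : br x (c *: v) = c *: br x v.
Proof. by rewrite brC brZl -scalerN -brC. Qed.
Lemma br0l x : br 0 x = 0. Proof. by have := brZl 0 0 x; rewrite !scale0r. Qed.
Lemma br0r x : br x 0 = 0. Proof. by rewrite brC br0l oppr0. Qed.
Lemma brBl v w x : br (v - w) x = br v x - br w x.
Proof. by rewrite brDl -scaleN1r brZl scaleN1r. Qed.
Lemma brBr v w x : br x (v - w) = br x v - br x w.
Proof. by rewrite brDr -scaleN1r brZr scaleN1r. Qed.
Lemma br_suml (I : Type) (r : seq I) (P : pred I) (F : I -> 'rV[K]_r0) x :
  br (\sum_(i <- r | P i) F i) x = \sum_(i <- r | P i) br (F i) x.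
Proof. by apply: (big_morph (br^~ x)) => [v w|]; rewrite ?brDl ?br0l. Qed.
Lemma br_sumr (I : Type) (r : seq I) (P : pred I) (F : I -> 'rV[K]_r0) x :
  br x (\sum_(i <- r | P i) F i) = \sum_(i <- r | P i) br x (F i).
Proof. by apply: (big_morph (br x)) => [v w|]; rewrite ?brDr ?br0r. Qed.

Lemma jacobi x v w : br x (br v w) = br (br x v) w + br v (br x w).
Proof.
apply: der_inj => u _; rewrite derD !dbr !dB; set a := der x _; set b := der x _.
by rewrite !opprB; move: (der v _) (der v _) (der w _) (der w _) => *; ring.
Qed.

(** [tor lam] is the torus derivation with eigenvectors [chi u] of eigenvalue [ev lam u], and [rt k]
    is the k-th root derivation. The brackets below are those of a reductive Lie algebra of type
    A. *)
Definition tor lam : 'rV[K]_r0 := row_mx lam 0.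
Definition rt (k : 'I_m0) : 'rV[K]_r0 := delta_mx 0 (rshift n k).

Lemma torD lam mu : tor (lam + mu) = tor lam + tor mu.
Proof. by rewrite /tor add_row_mx addr0. Qed.
Lemma torZ c lam : tor (c *: lam) = c *: tor lam.
Proof. by rewrite /tor scale_row_mx scaler0. Qed.

Lemma lie_basis v : v = tor (lsubmx v) + \sum_k v 0 (rshift n k) *: rt k.
Proof.
rewrite -{1}[v]hsubmxK; apply/rowP => i; rewrite !mxE summxE.
case: (split_ordP i) => j ->.
  by rewrite big1 ?addr0 // => k _; rewrite !mxE eq_lrshift andbF mulr0.
rewrite [X in X + _]mxE add0r (bigD1 j) //= big1 => [|k kj]; first by rewrite !mxE !eqxx mulr1 addr0.
by rewrite !mxE eq_rshift [j == k]eq_sym (negbTE kj) mulr0.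
Qed.

Lemma der_tor lam u : S u -> der (tor lam) (chi u) = ev lam u *: chi u.
Proof.
move=> Su; rewrite der_chi // big_split_ord /= [X in _ + X]big1 ?addr0 => [|k _].
  rewrite [ev lam u]/ev scaler_suml; apply: eq_bigr => i _.
  by rewrite row_mxEl ev_bcovl bwtl addr0 mulrC.
by rewrite row_mxEr mxE mul0r scale0r.
Qed.

Lemma der_rt k j l u : S u -> is_root j l (root_of k) ->
  der (rt k) (chi u) = (phi j u)%:~R *: chi (u + root_of k).
Proof.
move=> Su r; rewrite der_delta /bas hder_chi // bwtr; congr (_ *: _).
exact: ev_bcovr r.
Qed.

Lemma der_rt2 v k j l u c : S u -> is_root j l (root_of k) ->
  (S (u + root_of k) -> der v (chi (u + root_of k)) = c) ->
  der v (der (rt k) (chi u)) = (phi j u)%:~R *: c.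
Proof.
move=> Su r h; rewrite (der_rt Su r) dZ; have [->|pn] := eqVneq (phi j u) 0.
  by rewrite !scale0r.
by rewrite h //; exact: is_root_inS r Su pn.
Qed.

Lemma br_tor2 lam mu : br (tor lam) (tor mu) = 0.
Proof.
apply: brP => u Su; rewrite der0 !der_tor // !dZ !der_tor // !scalerA mulrC subrr.
by [].
Qed.

Lemma br_tor_rt lam k : br (tor lam) (rt k) = ev lam (root_of k) *: rt k.
Proof.
have [j [l r]] := root_ofP k; apply: brP => u Su; rewrite derZ der_tor // dZ (der_rt Su r).
rewrite -(der_rt Su r) (der_rt2 Su r (fun h => der_tor lam h)) (der_rt Su r) !scalerA -scalerBl.
by rewrite raddfD /=; congr (_ *: _); ring.
Qed.

Lemma br_tor lam v :
  br (tor lam) v = \sum_k (ev lam (root_of k) * v 0 (rshift n k)) *: rt k.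
Proof.
rewrite {1}[v]lie_basis brDr br_tor2 add0r br_sumr; apply: eq_bigr => k _.
by rewrite brZr br_tor_rt scalerA mulrC.
Qed.

Lemma sum_rt_coord (a : 'I_m0 -> K) k : (\sum_l a l *: rt l) 0 (rshift n k) = a k.
Proof.
rewrite summxE (bigD1 k) //= big1 => [|l lk]; first by rewrite !mxE !eqxx mulr1 addr0.
by rewrite !mxE eq_rshift [k == l]eq_sym (negbTE lk) mulr0.
Qed.

Lemma sum_rt_lsub (a : 'I_m0 -> K) : lsubmx (\sum_l a l *: rt l) = 0.
Proof.
apply/rowP => i; rewrite !mxE summxE big1 // => l _.
by rewrite !mxE eq_lrshift mulr0.
Qed.

Lemma br_tor_coord lam v k :
  (br (tor lam) v) 0 (rshift n k) = ev lam (root_of k) * v 0 (rshift n k).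
Proof. by rewrite br_tor sum_rt_coord. Qed.

Lemma br_rt_opp a b j k : is_root j k (root_of a) -> is_root k j (root_of b) ->
  br (rt a) (rt b) = tor (rayK k - rayK j).
Proof.
move=> ra rb; have ab : root_of b = - root_of a := is_root_inj rb (is_rootN ra).
apply: brP => u Su; rewrite der_tor // (der_rt2 Su rb (fun h => der_rt h ra)).
rewrite (der_rt2 Su ra (fun h => der_rt h rb)) -!addrA ab subrr addNr addr0 !scalerA -scalerBl.
rewrite evDr evNr !ev_rayK; congr (_ *: _); have [jk hra] := ra.
rewrite -!intrM -!intrB; congr (_%:~R); rewrite !phiD phiN !hra !eqxx [k == j]eq_sym (negbTE jk); lia.
Qed.

Lemma br_rt_comp a b c j k l : j != l -> is_root j k (root_of a) -> is_root k l (root_of b) ->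
  root_of c = root_of a + root_of b -> br (rt a) (rt b) = - rt c.
Proof.
move=> jl ra rb rc; have rC : is_root j l (root_of c) by rewrite rc; exact: is_rootD ra rb.
apply: brP => u Su; rewrite -scaleN1r derZ (der_rt Su rC) (der_rt2 Su rb (fun h => der_rt h ra)).
rewrite (der_rt2 Su ra (fun h => der_rt h rb)) -!addrA rc [root_of b + _]addrC !scalerA -scalerBl.
congr (_ *: _); have [jk hra] := ra; have [kl hrb] := rb.
rewrite -!intrM -!intrB; have -> : (-1 : K) = (-1)%:~R by [].
rewrite -intrM; congr (_%:~R); rewrite !phiD hra hrb !eqxx [k == j]eq_sym (negbTE jk).
rewrite (negbTE jl); lia.
Qed.
End Brackets.

(** * Derivations of the Lie algebra that kill the centre are inner *)

Section InnerDerivations.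
Variables (K : fieldType) (n : nat) (s : toric_cone n) (D : ray_data s).
Variable R : toric_alg K s.
Hypothesis K0 : [pchar K] =i pred0.
Local Notation m0 := (size (rts D)).
Local Notation r0 := (n + m0)%N.
Local Notation N := (nrays D).
Local Notation br := (@br K n s D R).
Local Notation tor := (@tor K n s D).
Local Notation rt := (@rt K n s D).
Local Notation rayK := (@rayK K n s D).
Local Notation rrel := (@rrel n s D).
Local Notation rvec := (@rvec n s D).
Local Notation rrep := (@rrep n s D).
Local Notation root_of := (@root_of n s D).
Local Notation is_root := (@is_root n s D).
Implicit Types (u : 'rV[int]_n) (lam mu : 'rV[K]_n) (v w x : 'rV[K]_r0).

(** The elements [tor lam] of this kind make up the centre of the Lie algebra. *)
Definition central lam := forall k : 'I_m0, ev lam (root_of k) = 0.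

Lemma evB_r lam mu u : ev (lam - mu) u = ev lam u - ev mu u.
Proof. by rewrite evDr evNr. Qed.

Lemma centralP lam : central lam <-> forall j k, rrel j k -> ev lam (rvec j k) = 0.
Proof.
split=> [h j k jk|h k].
  have [<-|jnk] := eqVneq j k; first by rewrite rvec_refl raddf0.
  have /is_root_rvec/root_of_surj[i <-] : [/\ j != k, rrel j k & rvec j k = rvec j k] by [].
  exact: h.
by have [j [l /is_root_rvec[_ jl ->]]] := root_ofP k; exact: h.
Qed.

Definition raycomb (y : 'I_N -> K) : 'rV[K]_n := \sum_l y l *: rayK l.

Lemma ev_raycomb y u : ev (raycomb y) u = \sum_l y l * (phi l u)%:~R.
Proof. by rewrite ev_sumr; apply: eq_bigr => l _; rewrite evZr ev_rayK. Qed.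

Lemma ev_raycomb_rvec y j k : rrel j k -> ev (raycomb y) (rvec j k) = y k - y j.
Proof.
move=> jk; rewrite ev_raycomb; under eq_bigr => l _ do rewrite phi_rvec // rmorphB mulrBr.
rewrite sumrB /= (bigD1 k) //= big1 => [|l lk]; last by rewrite (negbTE lk) mulr0.
rewrite (bigD1 j) //= big1 => [|l lj]; last by rewrite (negbTE lj) mulr0.
by rewrite !eqxx !mulr1 !addr0.
Qed.

(** The values of [lam] on the [rvec] are differences of a potential, the value on the vector from
    the class representative; the combination of rays with this potential as coefficients has the
    same values. *)
Lemma ray_split lam : central (lam - raycomb (fun l => ev lam (rvec (rrep l) l))).
Proof.
apply/centralP => j k jk; rewrite evB_r ev_raycomb_rvec // -(rrep_eq jk).
have [_ <-] := rrel_trans (rrepP (D := D) j) jk.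
by rewrite raddfD /=; ring.
Qed.

Variable De : 'M[K]_r0.
Hypothesis derDe : forall v w, br v w *m De = br (v *m De) w + br v (w *m De).
Hypothesis centDe : forall lam, central lam -> tor lam *m De = 0.

Let tail_head k : exists p : 'I_N * 'I_N, is_root p.1 p.2 (root_of k).
Proof. by have [j [l h]] := root_ofP k; exists (j, l). Qed.
Let th k := projT1 (cid (tail_head k)).
Let thP k : is_root (th k).1 (th k).2 (root_of k).
Proof. exact: projT2 (cid (tail_head k)). Qed.
Let ev_head k : ev (rayK (th k).2) (root_of k) = 1.
Proof. by rewrite ev_rayK (is_root_head (thP k)). Qed.

Let al lam k := (tor lam *m De) 0 (rshift n k).
(** Subtracting the bracket with [h0] removes the root components of [De] on the torus. *)
Let h0 : 'rV[K]_r0 := \sum_k (- al (rayK (th k).2) k) *: rt k.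
Let D1 v := v *m De - br h0 v.

Let D1D v w : D1 (v + w) = D1 v + D1 w.
Proof. by rewrite /D1 mulmxDl brDr // opprD addrACA. Qed.
Let D1Z c v : D1 (c *: v) = c *: D1 v.
Proof. by rewrite /D1 -scalemxAl brZr // scalerBr. Qed.
Let D1br v w : D1 (br v w) = br (D1 v) w + br v (D1 w).
Proof.
by rewrite /D1 derDe jacobi // brBl // brBr // opprD addrACA.
Qed.
Let D10 : D1 0 = 0. Proof. by have := D1Z 0 0; rewrite !scale0r. Qed.
Let D1sum (I : finType) (F : I -> 'rV[K]_r0) : D1 (\sum_i F i) = \sum_i D1 (F i).
Proof. by apply: (big_morph D1) => [v w|]; rewrite ?D1D ?D10. Qed.

Let al_rel lam mu k : ev mu (root_of k) * al lam k = ev lam (root_of k) * al mu k.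
Proof.
have := derDe (tor lam) (tor mu); rewrite br_tor2 // mul0mx => /rowP/(_ (rshift n k)).
have h1 : (br (tor lam *m De) (tor mu)) 0 (rshift n k) = - (ev mu (root_of k) * al lam k).
  by rewrite brC // mxE br_tor_coord.
rewrite mxE [RHS]mxE h1 br_tor_coord // => /esym/eqP.
by rewrite addrC subr_eq0 => /eqP <-.
Qed.

Let D1_tor lam : D1 (tor lam) = tor (lsubmx (D1 (tor lam))).
Proof.
rewrite [LHS]lie_basis big1 ?addr0 // => k _; have := al_rel lam (rayK (th k).2) k.
rewrite ev_head mul1r => e; suff -> : (D1 (tor lam)) 0 (rshift n k) = 0 by rewrite scale0r.
rewrite !mxE; have := br_tor_coord R K0 lam h0 k; rewrite brC // => /eqP.
rewrite mxE eqr_oppLR => /eqP ->; rewrite sum_rt_coord mulrN opprK -e.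
by rewrite /al !mxE subrr.
Qed.
Let tht lam := lsubmx (D1 (tor lam)).

Let D1_cent lam : central lam -> D1 (tor lam) = 0.
Proof.
move=> cl; rewrite /D1 centDe // brC // br_tor // big1 => [|k _]; first by rewrite !oppr0 addr0.
by rewrite cl mul0r scale0r.
Qed.

Let rt_step lam k : ev (tht lam) (root_of k) *: rt k + br (tor lam) (D1 (rt k)) =
  ev lam (root_of k) *: D1 (rt k).
Proof. by rewrite -(br_tor_rt R K0) -D1_tor -D1br br_tor_rt // D1Z. Qed.

Let D1_rt k : D1 (rt k) = (D1 (rt k)) 0 (rshift n k) *: rt k.
Proof.
have [i ei] : exists i, root_of k 0 i != 0.
  apply/existsP; apply: contraT; rewrite negb_exists => /forallP h.
  have /negP[] := is_root_neq0 (thP k); apply/eqP/rowP => i.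
  by have := h i; rewrite negbK mxE => /eqP.
rewrite {1}[D1 (rt k)]lie_basis.
have -> : lsubmx (D1 (rt k)) = 0.
  have := congr1 lsubmx (rt_step (rayK (th k).2) k).
  rewrite ev_head scale1r br_tor // => <-; apply/rowP => j.
  rewrite !mxE summxE big1 => [|l _]; first by rewrite eq_lrshift andbF mulr0 addr0.
  by rewrite !mxE eq_lrshift andbF mulr0.
rewrite (_ : tor 0 = 0) ?add0r; last by rewrite /tor row_mx0.
rewrite (bigD1 k) //= big1 ?addr0 // => m mk.
suff -> : (D1 (rt k)) 0 (rshift n m) = 0 by rewrite scale0r.
have [j ej] : exists j, root_of k 0 j != root_of m 0 j.
  apply/existsP; apply: contraT; rewrite negb_exists => /forallP h.
  have /negP[] := mk; apply/eqP/root_of_inj/rowP => j.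
  by have := h j; rewrite negbK => /eqP.
have := congr1 (fun v => v 0 (rshift n m)) (rt_step (delta_mx 0 j) k).
rewrite mxE br_tor_coord // [RHS]mxE [X in X + _ = _]mxE [X in _ * X + _ = _]mxE eq_rshift.
rewrite (negbTE mk) andbF mulr0 add0r !ev_deltar; move: (D1 _ _ _) => y.
move=> /eqP; rewrite -subr_eq0 -mulrBl mulf_eq0 -rmorphB /=.
by rewrite intr_char0_eq0 // subr_eq0 eq_sym (negbTE ej) => /eqP.
Qed.
Let a k := (D1 (rt k)) 0 (rshift n k).

Let tht_cent lam : central (tht lam).
Proof.
move=> k; have := congr1 (fun v => v 0 (rshift n k)) (rt_step lam k).
rewrite mxE br_tor_coord // !mxE !eqxx mulr1 => /eqP.
by rewrite -subr_eq0 addrK => /eqP.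
Qed.

Let root_pair j l : j != l -> rrel j l -> exists k, root_of k = rvec j l.
Proof. by move=> jl r; apply: (root_of_surj (j := j) (k := l)); apply/is_root_rvec. Qed.

(** The bracket of opposite root vectors is a coroot, which [D1] multiplies by a p + a q. But [D1]
    maps the torus into the centre, where the root vanishes, whereas the root has value 2 on the
    coroot. *)
Let opp_pair j k p q : is_root j k (root_of p) -> is_root k j (root_of q) ->
  a p + a q = 0 /\ D1 (tor (rayK k - rayK j)) = 0.
Proof.
move=> rp rq; have := D1br (rt p) (rt q).
rewrite D1_rt [D1 (rt q)]D1_rt -/(a p) -/(a q) brZl // brZr // (br_rt_opp R K0 rp rq) -scalerDl.
move=> e; have e2 := congr1 (fun v => ev (lsubmx v) (root_of p)) e.
move: e2; rewrite -/(tht _) tht_cent -torZ row_mxKl evZr evB_r !ev_rayK.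
rewrite (is_root_head rp) (is_root_tail rp) => /esym/eqP.
rewrite mulf_eq0 -rmorphB /= intr_char0_eq0 // orbF => /eqP a0.
by split=> //; rewrite e a0 scale0r.
Qed.

(** As many times [rayK j] as its class has rays is the sum of the rays of the class, which is
    central, plus differences of rays, which are coroots or 0; [D1] kills all of these. *)
Let D1_ray j : D1 (tor (rayK j)) = 0.
Proof.
pose C := [set l | rrel j l]%SET.
have : (#|C|%:R : K) *: tor (rayK j) = tor (\sum_(l in C) rayK l) + \sum_(l in C) tor (rayK j - rayK l).
  have tsum (F : 'I_N -> 'rV[K]_n) : tor (\sum_(l in C) F l) = \sum_(l in C) tor (F l).
    by apply: (big_morph tor) => [? ?|]; rewrite ?torD // /tor row_mx0.
  rewrite -tsum -torD -torZ sumrB addrCA subrr addr0 sumr_const scaler_nat.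
  by [].
have cC : central (\sum_(l in C) rayK l).
  apply/centralP => b c bc; rewrite ev_sumr.
  under eq_bigr => l _ do rewrite ev_rayK phi_rvec // rmorphB.
  rewrite sumrB /=; have [jb|jb] := boolP (rrel j b).
    have jc := (rrel_trans jb bc).1.
    have cC : c \in C by rewrite inE.
    have bC : b \in C by rewrite inE.
    rewrite (bigD1 c cC) /= big1 => [|l /andP[_ lc]]; last by rewrite (negbTE lc).
    rewrite (bigD1 b bC) /= big1 => [|l /andP[_ lb]]; last by rewrite (negbTE lb).
    by rewrite !eqxx !addr0 subrr.
  rewrite !big1 ?subrr // => l; rewrite inE => jl.
    by have [e|//] := eqVneq l b; rewrite -e jl in jb.
  have [e|//] := eqVneq l c; rewrite e in jl.
  by rewrite (rrel_trans jl (rrel_sym bc)).1 in jb.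
move/(congr1 D1); rewrite D1Z D1D (D1_cent cC) add0r.
have -> : D1 (\sum_(l in C) tor (rayK j - rayK l)) = 0.
  rewrite big_mkcond D1sum big1 // => l _; case: ifP; last by rewrite D10.
  rewrite inE => jl; have [<-|lj] := eqVneq j l.
    by rewrite subrr (_ : tor 0 = 0) ?D10 // /tor row_mx0.
  have [p pE] := root_pair lj jl; have lj' : l != j by rewrite eq_sym.
  have [q qE] := root_pair lj' (rrel_sym jl).
  have := @opp_pair l j q p; rewrite pE qE => -[||_ //]; apply/is_root_rvec; split=> //.
  exact: rrel_sym.
move=> /eqP; rewrite scaler_eq0 => /orP[|/eqP //].
rewrite -[_%:R]/((#|C|%:Z)%:~R) intr_char0_eq0 // => /eqP[] /eqP.
by rewrite cards_eq0 => /eqP/setP/(_ j); rewrite !inE rrel_refl.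
Qed.

Let D1_tor0 lam : D1 (tor lam) = 0.
Proof.
pose y l := ev lam (rvec (rrep l) l).
have -> : lam = (lam - raycomb y) + raycomb y by rewrite subrK.
rewrite torD D1D D1_cent ?add0r; last exact: ray_split.
have -> : tor (raycomb y) = \sum_l y l *: tor (rayK l).
  rewrite /raycomb (big_morph tor (op1 := +%R) (id1 := 0)) => [|? ?|]; rewrite ?torD //.
    by apply: eq_bigr => l _; rewrite torZ.
  by rewrite /tor row_mx0.
by rewrite D1sum big1 // => l _; rewrite D1Z D1_ray scaler0.
Qed.

Let A j l := if [pick k | (j != l) && (root_of k == rvec j l)] is Some k then a k else 0.
Let AE k : A (th k).1 (th k).2 = a k.
Proof.
have /is_root_rvec[jl _ e] := thP k; rewrite /A; case: pickP => [k' /andP[_ /eqP]|/(_ k)].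
  by rewrite -e => /root_of_inj ->.
by rewrite jl e eqxx.
Qed.
Let Ajj j : A j j = 0.
Proof. by rewrite /A; case: pickP => [k|//]; rewrite eqxx. Qed.
Let A_root k j l : is_root j l (root_of k) -> A j l = a k.
Proof. by move=> h; have [-> ->] := is_root_uniq h (thP k); exact: AE. Qed.

(** The bracket of two composable roots shows that the scalars by which [D1] acts on root vectors
    form a cocycle. *)
Let A_add j k l : rrel j k -> rrel k l -> A j l = A j k + A k l.
Proof.
move=> jk kl; have [jl e] := rrel_trans jk kl.
have [<-|njk] := eqVneq j k; first by rewrite Ajj add0r.
have [<-|nkl] := eqVneq k l; first by rewrite Ajj addr0.
have rt2 (x y : 'I_N) : x != y -> rrel x y -> exists2 p, root_of p = rvec x y & is_root x y (root_of p).
  move=> xy r; have [p pE] := root_pair xy r; exists p => //; rewrite pE.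
  by apply/is_root_rvec.
have [p pE pR] := rt2 _ _ njk jk; have [q qE qR] := rt2 _ _ nkl kl.
rewrite (A_root pR) (A_root qR).
have [lj|njl] := eqVneq j l.
  by rewrite -lj Ajj; rewrite -lj in qR; have [-> _] := opp_pair pR qR.
have [r rE rR] := rt2 _ _ njl jl; rewrite (A_root rR).
have := D1br (rt p) (rt q); rewrite D1_rt [D1 (rt q)]D1_rt brZl // brZr // -scalerDl.
rewrite (br_rt_comp R K0 njl pR qR (c := r)); last by rewrite rE pE qE e.
rewrite -scaleN1r D1Z D1_rt !scalerA => /rowP/(_ (rshift n r)).
by rewrite [LHS]mxE [RHS]mxE [(rt r) _ _]mxE !eqxx !mulr1 mulrN1 mulN1r => /oppr_inj.
Qed.

(** After the correction by [h0] the derivation kills the torus and scales the root vectors by a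
    cocycle; the cocycle is the coboundary of [x], so this is the bracket with a torus element. *)
Theorem derivation_inner : exists h, forall v, v *m De = br h v.
Proof.
pose x l := A (rrep l) l; pose lam := raycomb x.
exists (h0 + tor lam) => v; rewrite brDl //.
suff D1E : D1 v = br (tor lam) v by rewrite -D1E /D1 addrC subrK.
rewrite {1}[v]lie_basis D1D D1_tor0 add0r D1sum br_tor //; apply: eq_bigr => k _.
rewrite D1Z D1_rt scalerA mulrC; congr (_ * _ *: _).
have /is_root_rvec[_ jl ->] := thP k; rewrite ev_raycomb_rvec // -/(a k) -AE /x.
rewrite -(rrep_eq jl) (A_add (rrepP (D := D) _) jl) addrAC subrr add0r.
by [].
Qed.
End InnerDerivations.

(** * The rational structure of the centre *)

Section RatEmbedding.
Variable K : fieldType.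
Hypothesis K0 : [pchar K] =i pred0.

(** The argument [K0] carries the hypothesis that makes [ratr] a ring morphism, so that the
    instances below can be attached. *)
Definition ratK (K0 : [pchar K] =i pred0) : rat -> K := ratr.

Lemma ratKE (x : rat) (a b : int) : b != 0 -> x * b%:~R = a%:~R -> ratK K0 x = a%:~R / b%:~R.
Proof.
move=> b0 e; have bK : (b%:~R : K) != 0 by rewrite intr_char0_eq0.
have dK : ((denq x)%:~R : K) != 0 by rewrite intr_char0_eq0 // denq_neq0.
have : numq x * b = a * denq x.
  apply: (@intr_inj rat); rewrite !intrM -e numqE; ring.
move=> /(congr1 (fun z : int => z%:~R : K)); rewrite !intrM => e2.
by rewrite /ratK /ratr; apply: (mulIf bK); apply: (mulIf dK); rewrite mulfVK // mulrAC mulfVK.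
Qed.

Lemma ratK_zmod : zmod_morphism (ratK K0).
Proof.
move=> x y; rewrite (@ratKE (x - y) (numq x * denq y - numq y * denq x) (denq x * denq y)).
- have dx : ((denq x)%:~R : K) != 0 by rewrite intr_char0_eq0 // denq_neq0.
  have dy : ((denq y)%:~R : K) != 0 by rewrite intr_char0_eq0 // denq_neq0.
  by rewrite /ratK /ratr intrB !intrM; field; rewrite dx dy.
- by rewrite mulf_neq0 ?denq_neq0.
by rewrite intrB !intrM !numqE; ring.
Qed.

Lemma ratK_monoid : monoid_morphism (ratK K0).
Proof.
split=> [|x y]; first by rewrite (@ratKE 1 1 1) ?mulr1 // divff ?oner_eq0.
rewrite (@ratKE (x * y) (numq x * numq y) (denq x * denq y)).
- have dx : ((denq x)%:~R : K) != 0 by rewrite intr_char0_eq0 // denq_neq0.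
  have dy : ((denq y)%:~R : K) != 0 by rewrite intr_char0_eq0 // denq_neq0.
  by rewrite /ratK /ratr !intrM; field; rewrite dx dy.
- by rewrite mulf_neq0 ?denq_neq0.
by rewrite !intrM !numqE; ring.
Qed.
HB.instance Definition _ := GRing.isZmodMorphism.Build rat K (ratK K0) ratK_zmod.
HB.instance Definition _ := GRing.isMonoidMorphism.Build rat K (ratK K0) ratK_monoid.
End RatEmbedding.

(** Each matrix is killed by a separable polynomial X^m - 1, and commuting diagonalizable matrices
    are diagonalized together. *)
Lemma finite_order_codiag (K : closedFieldType) (r : nat) (As : seq 'M[K]_r.+1) :
  [pchar K] =i pred0 -> {in As &, forall A B, A *m B = B *m A} ->
  (forall A, A \in As -> exists2 m, (0 < m)%N & A ^+ m = 1) ->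
  exists2 B : 'M[K]_r.+1, B \in unitmx &
    forall A, A \in As -> exists d : 'rV[K]_r.+1, B *m A = diag_mx d *m B.
Proof.
move=> K0 comm fin; have [|B uB /allP hB] := (codiagonalizableP As).1; last first.
  exists B => // A AA; have /(diagonalizable_forP _ uB) h := hB A AA.
  exists (\row_i (B *m A *m invmx B) i i).
  have -> : diag_mx (\row_i (B *m A *m invmx B) i i) = B *m A *m invmx B.
    apply/matrixP => i j; rewrite [LHS]mxE [X in X *+ _]mxE; have [<-|ij] := eqVneq i j.
      by rewrite mulr1n.
    by rewrite mulr0n h.
  by rewrite mulmxKV.
split=> [A C AA CA|A AA]; first exact: comm.
have [m m0 Am] := fin A AA; apply/diagonalizableP.
have [rs rsE] := closed_field_poly_normal ('X^m - 1 : {poly K}).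
rewrite (monicP (monic_Xn_sub_1 _ m0)) scale1r in rsE.
exists rs.
  rewrite -separable_prod_XsubC -rsE separable_Xn_sub_1 //.
  by rewrite -[_%:R]/((m%:Z)%:~R) intr_char0_eq0 // -lt0n.
rewrite -rsE; apply: mxminpoly_min.
by rewrite rmorphB rmorph1 rmorphXn /= horner_mx_X Am subrr.
Qed.

Section Center.
Variables (K : fieldType) (n : nat) (s : toric_cone n) (D : ray_data s).
Variable R : toric_alg K s.
Hypothesis K0 : [pchar K] =i pred0.
Local Notation S := (dual_cone s).
Local Notation chi := (chi R).
Local Notation dg := (dg D).
Local Notation r0 := (n + size (rts D))%N.
Local Notation der := (@der K n s D R).
Local Notation br := (@br K n s D R).
Local Notation tor := (@tor K n s D).
Local Notation rt := (@rt K n s D).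
Local Notation tau := (@tau K n s D R).
Local Notation central := (@central K n s D).
Local Notation is_aut := (@is_aut K n s R).
Local Notation lin F := (klin (@GRing.scale K R) (F : R -> R)).
Local Notation klin1 F := (klin (@GRing.mul K) (F : R -> K)).

Lemma cf_der_tor lam f w : cf (der (tor lam) f) w = ev lam w * cf f w.
Proof.
have l1 : klin1 (fun f => cf (der (tor lam) f) w).
  by apply: lin_cf; exact: is_der_lin (is_der_der R K0 _).
have l2 : klin1 (fun f : R => ev lam w * cf f w).
  by split=> [a b|c a]; rewrite ?cfD ?mulrDr // cfZ mulrCA.
apply: (klin_eq l1 l2) => u Su; rewrite der_tor // cfZ cf_chi Su /=.
by case: eqP => [->|]; rewrite ?mulr1 ?mulr0.
Qed.

Lemma br_central lam v : central lam -> br (tor lam) v = 0.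
Proof. by move=> c; rewrite br_tor // big1 // => k _; rewrite c mul0r scale0r. Qed.

Lemma centralE v : (forall w, br v w = 0) -> exists2 lam, central lam & v = tor lam.
Proof.
move=> h; have v0 k : v 0 (rshift n k) = 0.
  have [j [l r]] := root_ofP k; have := congr1 (fun x : 'rV_r0 => x 0 (rshift n k)) (h (tor (rayK K l))).
  rewrite brC // mxE br_tor_coord // ev_rayK (is_root_head r) mul1r mxE => /eqP.
  by rewrite oppr_eq0 => /eqP.
have vE : v = tor (lsubmx v).
  by rewrite {1}[v]lie_basis big1 ?addr0 // => k _; rewrite v0 scale0r.
exists (lsubmx v) => // k; have := h (rt k); rewrite {1}vE br_tor_rt // => /rowP/(_ (rshift n k)).
by rewrite !mxE !eqxx mulr1.
Qed.

Lemma tau_central g h lam : is_aut g -> cancel g h -> central lam ->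
  exists2 mu, central mu & tor lam *m tau g h = tor mu.
Proof.
move=> ga gh cl; have ha := is_autV ga gh.
have hg : cancel h g by case: ga => _ _ [k gk kg] _; move=> x; rewrite -{1}[x]kg gh kg.
apply: centralE => w; have -> : w = (w *m tau h g) *m tau g h.
  rewrite -mulmxA -(tau_comp D K0 ha hg ga gh).
  have -> : tau (g \o h) (g \o h) = tau id id by congr (tau _ _); apply/funext => x /=; rewrite hg.
  by rewrite tau_id // mulmx1.
by rewrite br_tau // br_central // mul0mx.
Qed.

(** Let c run over the values of [lam] on the Hilbert basis. The product of the operators der (tor
    lam) - c is zero on m/m^2, hence so is its conjugate by [g]. Up to raising terms the conjugate
    involves der (tor mu), so it multiplies the leading coefficient at [h0] by the product of the ev
    mu h0 - c, which therefore vanishes. *)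
Lemma tau_central_eigen g h lam mu : is_aut g -> cancel g h ->
  tor lam *m tau g h = tor mu ->
  forall h0, h0 \in hb s -> exists2 h1, h1 \in hb s & ev mu h0 = ev lam h1.
Proof.
move=> ga gh e h0 h0hb; pose T := g \o der (tor lam) \o h.
have dd x : is_der (der x) := is_der_der R K0 x.
have dT : is_der T := is_der_conj ga gh (dd _).
have rT : raising D (fun f => T f - der (tor mu) f).
  by have := crdP (D := D) K0 dT; rewrite tauP // crd_der // e.
have [gl _ _ _] := ga; have ha := is_autV ga gh; have [hl _ _ hz] := ha.
pose PT F cs (x : R) := foldr (fun c y => F y - c *: y) x cs : R.
have gP cs y : PT T cs (g y) = g (PT (der (tor lam)) cs y).
  elim: cs => //= c cs ->; rewrite /T /= gh linB //; congr (_ - _); by case: gl => _ ->.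
have cfP2 cs y w : cf (PT (der (tor lam)) cs y) w = (\prod_(c <- cs) (ev lam w - c)) * cf y w.
  elim: cs => [|c cs IH] /=; first by rewrite big_nil mul1r.
  by rewrite cfB cfZ cf_der_tor IH big_cons mulrBl !mulrA mulrBl.
have lT : lin T := is_der_lin dT.
have lN : lin (fun f => T f - der (tor mu) f) by apply: lin_sub => //; exact: is_der_lin.
pose low (f : R) := forall w, cf f w != 0 -> w = h0 \/ (dg h0 < dg w)%N.
have lowT c f : low f -> low (T f - c *: f) /\ cf (T f - c *: f) h0 = (ev mu h0 - c) * cf f h0.
  move=> lf; have N0 w : cf (T f - der (tor mu) f) w != 0 -> (dg h0 < dg w)%N.
    move=> /(cf_lin lN)[u [Su /lf h1 /(rT _ _ Su)]].
    by case: h1 => [->//|]; exact: ltn_trans.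
  have TE w : cf (T f - c *: f) w = cf (T f - der (tor mu) f) w + (ev mu w - c) * cf f w.
    by rewrite !cfB cfZ cf_der_tor mulrBl addrA subrK.
  split=> [w|]; rewrite TE; last first.
    have [/eqP ->|/N0] := boolP (cf (T f - der (tor mu) f) h0 == 0); first by rewrite add0r.
    by rewrite ltnn.
  have [/eqP ->|/N0] := boolP (cf (T f - der (tor mu) f) w == 0); last by right.
  by rewrite add0r mulf_eq0 negb_or => /andP[_ /lf].
pose cs := [seq ev lam h | h <- hb s].
have low0 : low (chi h0).
  by move=> w; rewrite cf_chi; case: (h0 =P w) => [->|]; [left | rewrite andbF eqxx].
have : cf (PT T cs (chi h0)) h0 = \prod_(c <- cs) (ev mu h0 - c).
  suff [_ ->] : low (PT T cs (chi h0)) /\ cf (PT T cs (chi h0)) h0 =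
      (\prod_(c <- cs) (ev mu h0 - c)) * cf (chi h0) h0.
    by rewrite cf_chi (hb_inS D h0hb) eqxx mulr1.
  elim: (cs) => [|c l [lo IH]] /=; first by rewrite big_nil mul1r.
  by have [lo' ->] := lowT c _ lo; rewrite IH big_cons mulrA.
have hg : cancel h g by case: ga => _ _ [k gk kg] _; move=> x; rewrite -{1}[x]kg gh kg.
rewrite -(hg (chi h0)) gP.
have [_ _ -> //] := cotangent_aut D ga.
- move=> /esym/eqP; rewrite prodf_seq_eq0 => /hasP[c /mapP[h1 h1b ->] /=].
  by rewrite subr_eq0 => /eqP; exists h1.
- rewrite cfP2; have := hz (chi h0); rewrite cf_chi0 ?eqxx; first by move=> /eqP ->; rewrite mulr0.
  by have /(mem_hb D)[] := h0hb.
- move=> h1 h1b; rewrite cfP2 (big_rem (ev lam h1)) /=; first by rewrite subrr !mul0r.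
  exact: map_f.
Qed.

Local Notation io := (ratK K0).

Lemma io_ev (q : 'rV[rat]_n) u : ev (map_mx io q) u = io (ev q u).
Proof. by rewrite /ev rmorph_sum; apply: eq_bigr => i _; rewrite mxE rmorphM rmorph_int. Qed.

(** The new values on the Hilbert basis are among the old ones, hence rational. So the group acts on
    the centre through rational matrices, whose finite orders are bounded in terms of n. *)
Lemma tau_central_rat g h (q : 'rV[rat]_n) : is_aut g -> cancel g h -> central (map_mx io q) ->
  exists q' : 'rV[rat]_n, tor (map_mx io q) *m tau g h = tor (map_mx io q').
Proof.
move=> ga gh /(tau_central ga gh)[mu _ e]; have eig := tau_central_eigen ga gh e.
have hS u : S u -> exists x, ev mu u = io x.
  move: u; apply: (@hb_ind n s D); first by exists 0; rewrite raddf0 rmorph0.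
  move=> h1 u /eig[h2 _ e1] _ [x xE]; exists (ev q h2 + x).
  by rewrite raddfD rmorphD /= e1 io_ev xE.
have hA u : exists x, ev mu u = io x.
  have [p [/hS[x xE] /hS[y yE]]] := shift_in_cone D u.
  by exists (y - x); rewrite rmorphB /= -xE -yE raddfD /= addrK.
have [f fE] := choice (fun i => hA (delta_mx 0 i)).
exists (\row_i f i); rewrite e; congr tor; apply/rowP => i.
by rewrite !mxE -fE ev_delta.
Qed.
End Center.

Section CenterFixed.
Variables (K : fieldType) (n' : nat).
Let n := n'.+1.
Variables (s : toric_cone n) (D : ray_data s).
Variable R : toric_alg K s.
Hypothesis K0 : [pchar K] =i pred0.
Local Notation m0 := (size (rts D)).
Local Notation r0 := (n + m0)%N.
Local Notation tor := (@tor K n s D).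
Local Notation central := (@central K n s D).
Local Notation io := (ratK K0).
Variables (gT : finGroupType) (tg : gT -> 'M[K]_r0).
Hypothesis tg1 : tg 1%g = 1%:M.
Hypothesis tgM : forall x y, tg (x * y)%g = tg x *m tg y.
Hypothesis tg_rat : forall x (q : 'rV[rat]_n), central (map_mx io q) ->
  exists q' : 'rV[rat]_n, central (map_mx io q') /\ tor (map_mx io q) *m tg x = tor (map_mx io q').

(** [P] projects Q^n onto the rational central weights and [F] is the matrix of [tg x] there.
    Completed by the complementary projection [Q], it becomes a rational n by n matrix of finite
    order, to which the factorial bound applies; rational central weights span all central ones. *)
Lemma tg_central_torsion x lam : central lam -> tor lam *m tg (x ^+ (n.*2)`!)%g = tor lam.
Proof.
pose E : 'M[rat]_(n, m0) := \matrix_(i, k) (root_of k 0 i)%:~R.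
have cE p (X : 'M[rat]_(p, n)) : X *m E = 0 <-> forall i, central (map_mx io (row i X)).
  split=> [XE i k|h].
    have := congr1 (fun M : 'M[rat]_(p, m0) => io (M i k)) XE; rewrite !mxE rmorph0 => <-.
    rewrite rmorph_sum; apply: eq_bigr => j _.
    by rewrite !mxE rmorphM rmorph_int mulrC.
  apply/matrixP => i k; apply: (fmorph_inj io); rewrite !mxE rmorph0 -(h i k).
  rewrite rmorph_sum; apply: eq_bigr => j _.
  by rewrite !mxE rmorphM rmorph_int mulrC.
pose P : 'M[rat]_n := 1%:M - E *m pinvmx E.
have PE : P *m E = 0 by rewrite mulmxBl mul1mx mulmxKpV // subrr.
have EP p (X : 'M[rat]_(p, n)) : X *m E = 0 -> X *m P = X.
  by move=> XE; rewrite mulmxBr mulmx1 mulmxA XE mul0mx subr0.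
have PP : P *m P = P by exact: EP.
have [f fP] := choice (fun i => tg_rat x ((cE _ P).1 PE i)).
pose F : 'M[rat]_n := \matrix_(i, j) f i 0 j.
have rF i : row i F = f i by apply/rowP => j; rewrite !mxE.
have FE : F *m E = 0 by apply/cE => i; rewrite rF; exact: (fP i).1.
pose T p (X : 'M[rat]_(p, n)) : 'M[K]_(p, r0) := row_mx (map_mx io X) 0.
have Tinj p : injective (T p).
  by move=> X Y /eq_row_mx[/matrixP e _]; apply/matrixP => i j; have := e i j; rewrite !mxE => /fmorph_inj.
have TM p q (X : 'M[rat]_(p, q)) (Y : 'M_(q, n)) : T p (X *m Y) = map_mx io X *m T q Y.
  by rewrite /T mul_mx_row mulmx0 map_mxM.
have TP : T n P *m tg x = T n F.
  apply/row_matrixP => i; rewrite row_mul !row_row_mx row0 -!map_row (fP i).2 -rF.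
  by rewrite /tor map_row.
have PF : P *m F = F by apply: Tinj; rewrite TM -TP mulmxA -TM PP.
have Tpow k : T n P *m tg (x ^+ k.+1)%g = T n (F ^+ k.+1).
  elim: k => [|k IH]; first by rewrite expg1 expr1.
  have e : F ^+ k.+1 = F ^+ k.+1 *m P.
    by rewrite EP // exprSr -[X in X *m E]/(F ^+ k *m F) -mulmxA FE mulmx0.
  rewrite expgSr tgM mulmxA IH e TM -mulmxA TP -TM; congr (T n _).
  by rewrite [RHS]exprSr.
have FP : F *m P = F by exact: EP.
have Fm : F ^+ #[x]%g = P.
  apply: Tinj; have := Tpow #[x]%g.-1; rewrite prednK ?order_gt0 // => <-.
  by rewrite expg_order tg1 mulmx1.
pose Q : 'M[rat]_n := 1 - P.
have FQ : F * Q = 0 by rewrite mulrBr mulr1 -[F * P]/(F *m P) FP subrr.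
have QF : Q * F = 0 by rewrite mulrBl mul1r -[P * F]/(P *m F) PF subrr.
have QQ : Q * Q = Q.
  by rewrite {2}/Q mulrBr mulr1 mulrBl mul1r -[P * P]/(P *m P) PP subrr subr0.
have PQ : P + Q = 1 by rewrite addrC subrK.
clearbody Q.
have Ypow k : (F + Q) ^+ k.+1 = F ^+ k.+1 + Q.
  elim: k => [|k IH]; first by rewrite !expr1.
  rewrite exprSr IH mulrDl !mulrDr QF QQ [F ^+ k.+1]exprSr -[_ * F * Q]mulrA FQ mulr0 addr0 add0r.
  by rewrite -!exprSr.
have Y1 : (F + Q) ^+ #[x]%g = 1.
  by have := Ypow #[x]%g.-1; rewrite prednK ?order_gt0 // => ->; rewrite Fm PQ.
have := rat_finite_order (leqnn n) (order_gt0 x) Y1.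
have := Ypow ((n.*2)`!).-1; rewrite prednK ?fact_gt0 // => -> FQ1.
have Fc : F ^+ (n.*2)`! = P by apply: (addIr Q); rewrite FQ1 PQ.
move=> cl; have lP : lam = lam *m map_mx io P.
  rewrite map_mxB map_mx1 mulmxBr mulmx1 map_mxM mulmxA.
  suff -> : lam *m map_mx io E = 0 by rewrite mul0mx subr0.
  apply/rowP => k; rewrite !mxE -[RHS](cl k); apply: eq_bigr => j _.
  by rewrite !mxE rmorph_int mulrC.
have -> : tor lam = lam *m T n P by rewrite /T mul_mx_row mulmx0 -lP.
rewrite -mulmxA; congr (_ *m _); have := Tpow ((n.*2)`!).-1.
by rewrite prednK ?fact_gt0 // => ->; rewrite Fc.
Qed.
End CenterFixed.

Lemma row_diagM (K : fieldType) m n (d : 'rV[K]_m) (A : 'M[K]_(m, n)) i :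
  row i (diag_mx d *m A) = d 0 i *: row i A.
Proof. by rewrite row_mul row_diag_mx -scalemxAl -rowE. Qed.

(** * A semisimple element with small centralizer *)

Section InvariantElement.
Variable n' : nat.
Let n := n'.+1.

(** In a common eigenbasis [B] the group acts by characters [X], and a nonzero structure constant
    forces X_i X_j = X_k. A generic additive solution [w] of the same relations defines a diagonal
    derivation [De] of the Lie algebra; it vanishes on the centre and so is the bracket with some
    [h]. What commutes with [h] involves only indices with w_i = 0, where the characters have
    bounded order. *)
Lemma invariant_semisimple (m : nat) : exists2 c, (0 < c)%N & forall (K : closedFieldType)
    (s : toric_cone n) (D : ray_data s) (R : toric_alg K s) (K0 : [pchar K] =i pred0)
    (gT : finGroupType) (G : {group gT}) (tg : gT -> 'M[K]_(n + size (rts D))),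
    size (rts D) = m -> tg 1%g = 1%:M -> (forall x y, tg (x * y)%g = tg x *m tg y) ->
    (forall x v w, br R (v *m tg x) (w *m tg x) = br R v w *m tg x) ->
    (forall x (q : 'rV[rat]_n), central D (map_mx (ratK K0) q) -> exists q' : 'rV[rat]_n,
      central D (map_mx (ratK K0) q') /\
      tor D (map_mx (ratK K0) q) *m tg x = tor D (map_mx (ratK K0) q')) ->
    (forall x y, x \in G -> y \in G -> tg x *m tg y = tg y *m tg x) ->
  exists h : 'rV[K]_(n + size (rts D)),
   (exists2 B, B \in unitmx & exists w : 'rV[K]__, forall i, br R h (row i B) = w 0 i *: row i B) /\
   forall v, br R h v = 0 -> forall x, x \in G -> v *m tg (x ^+ c)%g = v.
Proof.
have [c1 c10 gen] := generic_weights (n + m); set c2 := (n.*2)`!.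
exists (c2 * c1)%N; first by rewrite muln_gt0 fact_gt0.
move=> K s D R K0 gT G tg mE tg1 tgM tgbr tgrat tgC; move: gen; rewrite -mE => {m mE} gen.
have tgX x k : tg (x ^+ k)%g = tg x ^+ k.
  by elim: k => [|k IH]; rewrite ?expg0 ?expr0 // expgSr tgM IH exprSr.
have [||B uB hB] := @finite_order_codiag K (n' + size (rts D)) [seq tg x | x in G] K0.
- move=> _ _ /mapP[x + ->] /mapP[y + ->]; rewrite !mem_enum => xG yG; exact: tgC.
- move=> _ /mapP[x _ ->]; exists #[x]%g; first exact: order_gt0.
  by rewrite -tgX expg_order.
have [X XE] : exists X : gT -> 'rV[K]_(n + size (rts D)), forall x, x \in G ->
    B *m tg x = diag_mx (X x) *m B.
  have h x : exists d, x \in G -> B *m tg x = diag_mx d *m B.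
    have [xG|_] := boolP (x \in G); last by exists 0.
    by have [|d dE] := hB (tg x); [by rewrite map_f ?mem_enum | by exists d].
  by have [f fE] := choice h; exists f.
have rB x i : x \in G -> row i B *m tg x = X x 0 i *: row i B.
  by move=> xG; rewrite -row_mul XE // row_diagM.
have expand v : v = \sum_i (v *m invmx B) 0 i *: row i B.
  by rewrite -mulmx_sum_row mulmxKV.
have coord (a : 'rV[K]_(n + size (rts D))) i : ((\sum_i a 0 i *: row i B) *m invmx B) 0 i = a 0 i.
  by rewrite -mulmx_sum_row mulmxK.
have coord_eq (a b : 'rV[K]_(n + size (rts D))) :
    \sum_i a 0 i *: row i B = \sum_i b 0 i *: row i B -> forall i, a 0 i = b 0 i.
  by move=> e i; rewrite -coord e coord.
have actX v x k : x \in G -> v *m tg (x ^+ k)%g = \sum_i (v *m invmx B) 0 i * X x 0 i ^+ k *: row i B.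
  move=> xG; rewrite {1}[v]expand mulmx_suml; apply: eq_bigr => i _.
  rewrite -scalemxAl -scalerA; congr (_ *: _); elim: k => [|k IH].
    by rewrite expg0 tg1 mulmx1 expr0 scale1r.
  by rewrite expgSr tgM mulmxA IH -scalemxAl rB // scalerA -exprSr.
have Xo x i : x \in G -> X x 0 i ^+ #[x]%g = 1.
  move=> xG; have := actX (row i B) x #[x]%g xG; rewrite expg_order tg1 mulmx1 => e.
  have ai : (row i B *m invmx B) 0 i = 1 by rewrite -row_mul mulmxV // !mxE eqxx.
  have /(_ _ i) := coord_eq (row i B *m invmx B)
    (\row_j ((row i B *m invmx B) 0 j * X x 0 j ^+ #[x]%g)).
  rewrite [(\row_j _) _ _]mxE ai mul1r => <- //.
  by rewrite -expand [LHS]e; apply: eq_bigr => j _; congr (_ *: _); rewrite [RHS]mxE.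
have Xn0 x i : x \in G -> X x 0 i != 0.
  move=> xG; have := Xo x i xG; apply: contra_eqN => /eqP ->.
  by rewrite expr0n gtn_eqF ?order_gt0 // eq_sym oner_eq0.
pose cs i j := br R (row i B) (row j B) *m invmx B.
have csE i j : br R (row i B) (row j B) = \sum_k cs i j 0 k *: row k B by exact: expand.
pose S := fun t : 'I_(n + size (rts D)) * 'I_(n + size (rts D)) * 'I_(n + size (rts D)) =>
  cs t.1.1 t.1.2 0 t.2 != 0.
(* These indices include all that occur in central elements, so [w] will kill the centre. The
   matching condition x_i = 1 holds for the c2-th powers of the characters, to which the torsion
   property of [w] is applied; hence the product c2 c1. *)
pose Z := fun i : 'I_(n + size (rts D)) => `[< forall x, x \in G -> X x 0 i ^+ c2 = 1 >].
have XS x i j k : x \in G -> S (i, j, k) -> X x 0 i * X x 0 j = X x 0 k.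
  move=> xG /= Sijk; have := tgbr x (row i B) (row j B); rewrite !rB // brZl // brZr // scalerA csE.
  rewrite scaler_sumr mulmx_suml => e.
  have /coord_eq/(_ k) : \sum_l (\row_k (X x 0 i * X x 0 j * cs i j 0 k)) 0 l *: row l B =
      \sum_l (\row_k (cs i j 0 k * X x 0 k)) 0 l *: row l B.
    transitivity (\sum_l (X x 0 i * X x 0 j) *: (cs i j 0 l *: row l B)).
      by apply: eq_bigr => l _; rewrite scalerA; congr (_ *: _); rewrite [LHS]mxE.
    rewrite e; apply: eq_bigr => l _; rewrite -scalemxAl rB // scalerA; congr (_ *: _).
    by rewrite [RHS]mxE.
  rewrite [LHS]mxE [RHS]mxE => ee; apply: (mulIf Sijk); rewrite /= ee mulrC.
  by [].
have [w [wS wZ wT]] := gen K K0 S Z.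
pose De := invmx B *m diag_mx w *m B.
have DeE v : v *m De = \sum_i ((v *m invmx B) 0 i * w 0 i) *: row i B.
  rewrite /De !mulmxA mulmx_sum_row; apply: eq_bigr => i _; congr (_ *: _).
  by rewrite mul_mx_diag mxE.
have DeB i : row i B *m De = w 0 i *: row i B.
  by rewrite -row_mul /De !mulmxA mulmxV // mul1mx row_diagM.
have Deder v1 v2 : br R v1 v2 *m De = br R (v1 *m De) v2 + br R v1 (v2 *m De).
  have base i j : br R (row i B) (row j B) *m De =
      br R (row i B *m De) (row j B) + br R (row i B) (row j B *m De).
    rewrite !DeB brZl // brZr // -scalerDl csE mulmx_suml scaler_sumr; apply: eq_bigr => k _.
    rewrite -scalemxAl DeB !scalerA; have [->|nz] := eqVneq (cs i j 0 k) 0.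
      by rewrite mul0r mulr0.
    by rewrite (wS i j k nz) mulrC.
  rewrite [v1]expand [v2]expand; move: (v1 *m invmx B) (v2 *m invmx B) => a b.
  rewrite !mulmx_suml !br_suml // mulmx_suml -big_split /=; apply: eq_bigr => i _.
  rewrite !br_sumr // mulmx_suml -big_split /=; apply: eq_bigr => j _.
  by rewrite -!scalemxAl !brZl // !brZr // -!scalemxAl base !scalerDr.
have Decent lam : central D lam -> tor D lam *m De = 0.
  move=> cl; rewrite DeE big1 // => i _.
  have [->|vi] := eqVneq ((tor D lam *m invmx B) 0 i) 0; first by rewrite mul0r scale0r.
  rewrite wZ ?mulr0 ?scale0r //; apply/asboolP => x xG; apply: (mulfI vi); rewrite mulr1.
  have e := tg_central_torsion tg1 tgM tgrat x cl; rewrite actX // in e.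
  have /(_ _ i) := coord_eq (\row_i ((tor D lam *m invmx B) 0 i * X x 0 i ^+ c2)) (tor D lam *m invmx B).
  rewrite mxE => -> //; rewrite -expand -[RHS]e.
  by apply: eq_bigr => j _; rewrite mxE.
have [h hE] := derivation_inner K0 Deder Decent.
exists h; split.
  by exists B => //; exists w => i; rewrite -hE DeB.
move=> v hv x xG; rewrite [RHS]expand actX //; apply: eq_bigr => i _.
have [->|vi] := eqVneq ((v *m invmx B) 0 i) 0; first by rewrite mul0r.
suff -> : X x 0 i ^+ (c2 * c1) = 1 by rewrite mulr1.
have wi : w 0 i = 0.
  have := DeE v; rewrite hE hv => e.
  have /coord_eq/(_ i) : \sum_l (\row_i ((v *m invmx B) 0 i * w 0 i)) 0 l *: row l B =
      \sum_l (0 : 'rV[K]_(n + size (rts D))) 0 l *: row l B.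
    rewrite [RHS]big1 => [|j _]; last by rewrite mxE scale0r.
    by rewrite [RHS]e; apply: eq_bigr => j _; congr (_ *: _); rewrite [LHS]mxE.
  by rewrite [LHS]mxE [RHS]mxE => ee; apply: (mulfI vi); rewrite mulr0 ee.
have := wT i wi (\row_j X x 0 j ^+ c2); rewrite mxE -exprM; apply.
- by move=> j /=; rewrite mxE expf_neq0 // Xn0.
- by move=> j k l Sjkl; rewrite !mxE -exprMn (XS _ _ _ _ xG Sjkl).
- by move=> j /asboolP hj; rewrite mxE hj.
Qed.
End InvariantElement.

(** * Degree-zero derivations as block matrices *)

Section Blocks.
Variables (K : fieldType) (n : nat) (s : toric_cone n) (D : ray_data s).
Variable R : toric_alg K s.
Hypothesis K0 : [pchar K] =i pred0.
Local Notation S := (dual_cone s).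
Local Notation chi := (chi R).
Local Notation dg := (dg D).
Local Notation m0 := (size (rts D)).
Local Notation r0 := (n + m0)%N.
Local Notation N := (nrays D).
Local Notation der := (@der K n s D R).
Local Notation br := (@br K n s D R).
Local Notation tor := (@tor K n s D).
Local Notation rt := (@rt K n s D).
Local Notation rrel := (@rrel n s D).
Local Notation rvec := (@rvec n s D).
Local Notation root_of := (@root_of n s D).
Local Notation is_root := (@is_root n s D).
Local Notation raycomb := (@raycomb K n s D).
Local Notation central := (@central K n s D).
Implicit Types (u v : 'rV[int]_n) (z lam : 'rV[K]_n) (X Z : 'M[K]_N).

Definition blocky X := forall j l, ~~ rrel j l -> X j l = 0.

Lemma root_ends_ex (k : 'I_m0) : exists p : 'I_N * 'I_N, is_root p.1 p.2 (root_of k).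
Proof. by have [j [l h]] := root_ofP k; exists (j, l). Qed.
Definition root_ends k := projT1 (cid (root_ends_ex k)).
Lemma root_endsP k : is_root (root_ends k).1 (root_ends k).2 (root_of k).
Proof. exact: projT2 (cid (root_ends_ex k)). Qed.

(** In homogeneous coordinates, the torus derivation [z] plus the linear vector field with terms X j
    l x_l d/dx_j; the diagonal of [X] enters the torus through the rays. *)
Definition vec z X : 'rV[K]_r0 :=
  tor (z + raycomb (fun j => X j j)) + \sum_k X (root_ends k).1 (root_ends k).2 *: rt k.

Lemma sum_roots (V : zmodType) (G : 'I_N -> 'I_N -> V) :
  (forall j l, ~~ rrel j l -> G j l = 0) ->
  \sum_j \sum_l G j l = \sum_j G j j + \sum_k G (root_ends k).1 (root_ends k).2.
Proof.
move=> G0; rewrite pair_big /= (bigID (fun p : 'I_N * 'I_N => p.1 == p.2)) /=; congr (_ + _).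
  rewrite (reindex (fun j : 'I_N => (j, j))) /=; first by apply: eq_bigl => j; rewrite eqxx.
  by exists fst => [//|[j l]]; rewrite inE /= => /eqP ->.
rewrite (bigID (fun p : 'I_N * 'I_N => rrel p.1 p.2)) /= [X in _ + X]big1 ?addr0; last first.
  by move=> p /andP[_]; exact: G0.
transitivity (\sum_(p in [set root_ends k | k : 'I_m0]%SET) G p.1 p.2).
  apply: eq_bigl => p; apply/idP/imsetP => [/andP[pn pr]|[k _ ->]].
    have /root_of_surj[k kE] : is_root p.1 p.2 (rvec p.1 p.2) by apply/is_root_rvec.
    exists k => //; have := root_endsP k; rewrite kE => /is_root_rvec[_ r2 e2].
    have r1 : is_root p.1 p.2 (rvec p.1 p.2) by apply/is_root_rvec.
    have [] := is_root_uniq r1 (_ : is_root (root_ends k).1 (root_ends k).2 (rvec p.1 p.2)).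
      by rewrite -kE; exact: root_endsP.
    by case: (p) (root_ends k) => ? ? [? ?] /= -> ->.
  by have /is_root_rvec[-> -> _] := root_endsP k.
rewrite big_imset //= => k l _ _ e; apply: root_of_inj.
have /is_root_rvec[_ _ ->] := root_endsP k; have /is_root_rvec[_ _ ->] := root_endsP l.
by rewrite e.
Qed.

Lemma rvec_inS j l u : rrel j l -> S u -> phi j u != 0 -> S (u + rvec j l).
Proof.
move=> r Su pn; have [<-|jl] := eqVneq j l; first by rewrite rvec_refl addr0.
by apply: (is_root_inS (D := D) (j := j) (k := l)) => //; apply/is_root_rvec.
Qed.

Lemma vec_term_inS X j l u : blocky X -> S u -> X j l * (phi j u)%:~R != 0 ->
  rrel j l /\ S (u + rvec j l).
Proof.
move=> bX Su; rewrite mulf_eq0 negb_or => /andP[Xn pn].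
have r : rrel j l by apply: contraNT Xn => /bX ->.
by split=> //; apply: rvec_inS => //; apply: contraNneq pn => ->.
Qed.

Lemma der_vec z X u : blocky X -> S u -> der (vec z X) (chi u) =
  ev z u *: chi u + \sum_j \sum_l (X j l * (phi j u)%:~R) *: chi (u + rvec j l).
Proof.
move=> bX Su; rewrite sum_roots => [|j l /bX ->]; last by rewrite mul0r scale0r.
rewrite /vec derD der_tor // evDr scalerDl -addrA; congr (_ + (_ + _)).
  rewrite ev_raycomb scaler_suml; apply: eq_bigr => j _.
  by rewrite rvec_refl addr0.
rewrite /der; under eq_bigr => i _ do rewrite summxE scaler_suml.
rewrite exchange_big /=; apply: eq_bigr => k _.
transitivity (der (X (root_ends k).1 (root_ends k).2 *: rt k) (chi u)); first by [].
rewrite derZ (der_rt R Su (root_endsP k)) scalerA; congr (_ *: chi (_ + _)).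
by have /is_root_rvec[_ _ ->] := root_endsP k.
Qed.

Lemma vec_coord z X k : vec z X 0 (rshift n k) = X (root_ends k).1 (root_ends k).2.
Proof. by rewrite mxE sum_rt_coord row_mxEr mxE add0r. Qed.

Lemma vec_lsub z X : lsubmx (vec z X) = z + raycomb (fun j => X j j).
Proof.
apply/rowP => i; rewrite mxE [LHS]mxE row_mxEl.
by have /rowP/(_ i) := sum_rt_lsub (fun k => X (root_ends k).1 (root_ends k).2); rewrite mxE => ->; rewrite [X in _ + X]mxE addr0.
Qed.

Lemma vec_onto h : exists z X, [/\ central z, blocky X & h = vec z X].
Proof.
pose lam := lsubmx h; pose y l := ev lam (rvec (rrep l) l).
pose X : 'M[K]_N := \matrix_(j, l) (if j == l then y j else
  if [pick k | (root_ends k).1 == j & (root_ends k).2 == l] is Some k then h 0 (rshift n k) else 0).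
exists (lam - raycomb y), X; split; first exact: ray_split.
  move=> j l r; rewrite mxE; case: eqP => [e|_]; first by rewrite e rrel_refl in r.
  case: pickP => [k /andP[/eqP ej /eqP el]|//]; case/negP: r.
  by have /is_root_rvec[_] := root_endsP k; rewrite ej el.
rewrite [LHS]lie_basis /vec; congr (tor _ + _).
  rewrite -[LHS]/lam -[LHS](subrK (raycomb y)); congr (_ + _).
  by apply: eq_bigr => j _; rewrite mxE eqxx.
apply: eq_bigr => k _; congr (_ *: _); have kr := root_endsP k.
have [kn _] := kr; rewrite mxE (negbTE kn); case: pickP => [k' /andP[/eqP e1 /eqP e2]|/(_ k)].
  congr (h 0 (rshift n _)); apply/esym/root_of_inj; have := root_endsP k'.
  by rewrite e1 e2 => /is_root_inj; apply.
by rewrite !eqxx.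
Qed.

Section Host.
Variables (F : fieldType) (io : {rmorphism K -> F}) (y : 'rV[int]_n -> F).
Hypotheses (y0 : y 0 = 1) (yD : forall u v, y (u + v) = y u * y v).
Hypothesis yind : forall (r : seq 'rV[int]_n) (c : 'rV[int]_n -> K), uniq r ->
  \sum_(v <- r) io (c v) * y v = 0 -> forall v, v \in r -> c v = 0.

(** An embedding of K[S] into a field with a monomial [y u] for every u in M. There the quotients
    x_l / x_j, whose exponents need not lie in S, are available and derivations can be treated
    logarithmically. *)
Definition host (f : R) : F := \sum_(v <- supp f) io (cf f v) * y v.

Lemma hostEw f (r : seq 'rV[int]_n) : uniq r -> {subset supp f <= r} ->
  host f = \sum_(v <- r) io (cf f v) * y v.
Proof.
move=> ur sr; rewrite [RHS](bigID (mem (supp f))) /= [X in _ + X]big1 ?addr0 => [|v].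
  rewrite -big_filter; apply/perm_big/uniq_perm; rewrite ?supp_uniq ?filter_uniq //.
  by move=> v; rewrite mem_filter; case: (boolP (v \in supp f)) => //= /sr ->.
by rewrite mem_supp negbK => /eqP ->; rewrite rmorph0 mul0r.
Qed.

Lemma host_klin : klin (fun c x => io c * x) host.
Proof.
split=> [f g|c f].
  pose r := undup (supp f ++ supp g ++ supp (f + g)).
  have sr h : {subset h <= supp f ++ supp g ++ supp (f + g)} -> {subset h <= r}.
    by move=> sh v /sh; rewrite mem_undup.
  rewrite !(@hostEw _ r) ?undup_uniq //; try by apply: sr => v vh; rewrite !mem_cat vh ?orbT.
  by rewrite -big_split; apply: eq_bigr => v _; rewrite cfD rmorphD mulrDl.
rewrite (@hostEw (c *: f) (supp f)) ?supp_uniq // => [|v]; last first.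
  by rewrite !mem_supp cfZ mulf_eq0 negb_or => /andP[].
by rewrite mulr_sumr; apply: eq_bigr => v _; rewrite cfZ rmorphM mulrA.
Qed.

Lemma host_chi u : S u -> host (chi u) = y u.
Proof.
move=> Su; rewrite (@hostEw _ [:: u]) // => [|v].
  by rewrite big_seq1 cf_chi Su eqxx rmorph1 mul1r.
by rewrite mem_supp cf_chi Su inE [v == u]eq_sym /=; case: (u == v) => //=; rewrite mulr0n eqxx.
Qed.

Lemma host_inj f g : host f = host g -> f = g.
Proof.
move=> e; apply/eqP; rewrite -subr_eq0; apply/eqP; apply: cfP => u Su; rewrite cf0.
have : host (f - g) = 0.
  by rewrite -scaleN1r host_klin.1 host_klin.2 rmorphN1 mulN1r e subrr.
move/(yind (supp_uniq _)) => h; have [|] := boolP (u \in supp (f - g)); first exact: h.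
by rewrite mem_supp negbK => /eqP.
Qed.

Lemma hostM f g : host (f * g) = host f * host g.
Proof.
have e1 u : S u -> forall g, host (chi u * g) = y u * host g.
  move=> Su; apply: (klin_eq (sc := fun c x => io c * x)).
  - by split=> [a b|c a]; rewrite ?mulrDr ?host_klin.1 // -scalerAr host_klin.2.
  - by split=> [a b|c a]; rewrite ?host_klin.1 ?mulrDr // host_klin.2 mulrCA.
  by move=> v Sv; rewrite chiM // !host_chi ?yD //; exact: dual_coneD.
apply: (klin_eq (sc := fun c x => io c * x) (F := fun f => host (f * g)) (G := fun f => host f * host g)).
- by split=> [a b|c a]; rewrite ?mulrDl ?host_klin.1 // -scalerAl host_klin.2.
- by split=> [a b|c a]; rewrite ?host_klin.1 ?mulrDl // host_klin.2 mulrA.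
by move=> u Su; rewrite e1 // host_chi.
Qed.

Let P0 := fun z X u => \sum_j \sum_l io (X j l * (phi j u)%:~R) * y (rvec j l).

(* Logarithmic derivative of y u under the derivation vec z X. *)
Definition logd z X u : F := io (ev z u) + P0 z X u.
(** With [y (rvec l m)] read as x_m / x_l, this is the l-th entry of X x divided by x_l. *)
Definition rowsum X l : F := \sum_m io (X l m) * y (rvec l m).

Lemma logdD z X u v : logd z X (u + v) = logd z X u + logd z X v.
Proof.
rewrite /logd raddfD rmorphD /= addrACA; congr (_ + _).
rewrite /P0 -big_split; apply: eq_bigr => j _; rewrite -big_split; apply: eq_bigr => l _ /=.
by rewrite phiD intrD mulrDr rmorphD mulrDl.
Qed.

Lemma logdE z X u : logd z X u = io (ev z u) + \sum_j (phi j u)%:~R * rowsum X j.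
Proof.
congr (_ + _); apply: eq_bigr => j _; rewrite mulr_sumr; apply: eq_bigr => l _.
by rewrite rmorphM rmorph_int; ring.
Qed.

Lemma logd_rvec z X j l : central z -> rrel j l ->
  logd z X (rvec j l) = rowsum X l - rowsum X j.
Proof.
move=> cz r; rewrite logdE ((centralP D z).1 cz) // rmorph0 add0r.
under eq_bigr => i _ do rewrite phi_rvec // rmorphB mulrBl /=.
rewrite sumrB /= (bigD1 l) //= big1 => [|i il]; last by rewrite (negbTE il) mul0r.
rewrite (bigD1 j) //= big1 => [|i ij]; last by rewrite (negbTE ij) mul0r.
by rewrite !eqxx !mul1r !addr0.
Qed.

Lemma host_der_term z X c v : blocky X -> (c != 0 -> S v) ->
  host (der (vec z X) (c *: chi v)) = io c * (logd z X v * y v).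
Proof.
move=> bX cS; have [_ dZ] := is_der_lin (is_der_der R K0 (vec z X)); rewrite dZ.
have [->|/cS Sv] := eqVneq c 0; first by rewrite scale0r (klin0 host_klin) rmorph0 mul0r.
rewrite host_klin.2 der_vec //; congr (_ * _).
rewrite host_klin.1 host_klin.2 host_chi // /logd mulrDl; congr (_ + _).
rewrite (klin_sum _ _ _ host_klin) mulr_suml; apply: eq_bigr => j _.
rewrite (klin_sum _ _ _ host_klin) mulr_suml; apply: eq_bigr => l _.
rewrite host_klin.2; have [->|/(vec_term_inS bX Sv)[r Svr]] := eqVneq (X j l * (phi j v)%:~R) 0.
  by rewrite rmorph0 !mul0r.
by rewrite host_chi // yD -mulrA; congr (_ * _); rewrite mulrC.
Qed.

Lemma rowsumM (A B : 'M[K]_N) j : blocky A -> blocky B ->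
  rowsum (A *m B) j = \sum_l io (A j l) * y (rvec j l) * rowsum B l.
Proof.
move=> bA bB; rewrite /rowsum.
have -> : \sum_m io ((A *m B) j m) * y (rvec j m) =
    \sum_m \sum_l io (A j l) * (io (B l m) * y (rvec j m)).
  apply: eq_bigr => m _; rewrite mxE rmorph_sum mulr_suml; apply: eq_bigr => l _.
  by rewrite rmorphM mulrA.
rewrite exchange_big; apply: eq_bigr => l _; rewrite mulr_sumr; apply: eq_bigr => m _.
have [jl|/bA ->] := boolP (rrel j l); last by rewrite rmorph0 !mul0r.
have [lm|/bB ->] := boolP (rrel l m); last by rewrite rmorph0 !(mul0r, mulr0).
by have [_ <-] := rrel_trans jl lm; rewrite yD; ring.
Qed.

(** Linear vector fields bracket like matrices, in reversed order. In the host field, the products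
    of two logarithmic derivatives cancel in the commutator and the remaining terms are row sums of
    Z X and X Z. *)
Lemma br_vec z X Z : central z -> blocky X -> blocky Z ->
  blocky (Z *m X - X *m Z) /\ br (vec z X) (vec 0 Z) = vec 0 (Z *m X - X *m Z).
Proof.
move=> cz bX bZ.
have bM (A B : 'M[K]_N) : blocky A -> blocky B -> blocky (A *m B).
  move=> bA bB j l njl; rewrite mxE big1 // => k _.
  have [jk|/bA ->] := boolP (rrel j k); last by rewrite mul0r.
  rewrite bB ?mulr0 //; apply: contra njl => kl; exact: (rrel_trans jk kl).1.
have bZX : blocky (Z *m X - X *m Z).
  by move=> j l njl; rewrite !mxE; have := bM _ _ bZ bX j l njl; rewrite mxE => ->;
    have := bM _ _ bX bZ j l njl; rewrite mxE => ->; rewrite subrr.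
split=> //; apply: brP => // u Su; apply: host_inj.
have c0 : central 0 by move=> k; rewrite ev0r.
have [dl1 dz1] := is_der_lin (is_der_der R K0 (vec z X)).
have hostN f g : host (f - g) = host f - host g.
  by rewrite -scaleN1r host_klin.1 host_klin.2 rmorphN1 mulN1r.
have two z1 A z2 B : central z1 -> central z2 -> blocky A -> blocky B ->
    host (der (vec z1 A) (der (vec z2 B) (chi u))) =
    logd z1 A u * logd z2 B u * y u +
    \sum_j (phi j u)%:~R * (\sum_l io (B j l) * y (rvec j l) * (rowsum A l - rowsum A j)) * y u.
  move=> cz1 cz2 bA bB; have ld := is_der_lin (is_der_der R K0 (vec z1 A)).
  rewrite (der_vec _ bB Su) ld.1 host_klin.1 host_der_term //.
  rewrite (klin_sum _ _ _ ld) (klin_sum _ _ _ host_klin).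
  under eq_bigr => j _ do rewrite (klin_sum _ _ _ ld) (klin_sum _ _ _ host_klin).
  have -> : \sum_j \sum_l host (der (vec z1 A) ((B j l * (phi j u)%:~R) *: chi (u + rvec j l))) =
     \sum_j \sum_l (io (B j l * (phi j u)%:~R) * y (rvec j l) * (logd z1 A u * y u) +
       (phi j u)%:~R * (io (B j l) * y (rvec j l) * (rowsum A l - rowsum A j)) * y u).
    apply: eq_bigr => j _; apply: eq_bigr => l _.
    rewrite host_der_term // => [|/(vec_term_inS bB Su)[] //].
    have [->|Bn] := eqVneq (B j l) 0; first by rewrite !mul0r !rmorph0; ring.
    have r : rrel j l by apply: contraNT Bn => /bB ->.
    by rewrite logdD logd_rvec // yD rmorphM rmorph_int; ring.
  under eq_bigr => j _ do rewrite big_split /=.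
  rewrite big_split /= addrA; congr (_ + _).
    have -> : logd z1 A u * logd z2 B u * y u = logd z2 B u * (logd z1 A u * y u) by ring.
    move: (logd z1 A u * y u) => L; rewrite /logd mulrDl; congr (_ + _).
    by rewrite /P0 mulr_suml; apply: eq_bigr => j _; rewrite mulr_suml.
  by apply: eq_bigr => j _; rewrite mulr_sumr mulr_suml.
rewrite hostN !two // -[chi u]scale1r host_der_term ?scale1r // rmorph1 mul1r.
rewrite logdE ev0r rmorph0 add0r opprD addrACA [logd 0 Z u * _]mulrC subrr add0r.
rewrite -sumrB mulr_suml; apply: eq_bigr => j _; rewrite -mulrBl -mulrBr; congr (_ * _ * _).
have -> : rowsum (Z *m X - X *m Z) j = rowsum (Z *m X) j - rowsum (X *m Z) j.
  rewrite /rowsum -sumrB; apply: eq_bigr => m _.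
  have -> : (Z *m X - X *m Z) j m = (Z *m X) j m - (X *m Z) j m by rewrite [LHS]mxE [X in _ + X]mxE.
  by rewrite rmorphB mulrBl.
rewrite !rowsumM //; under [X in _ = X - _]eq_bigr => l _ do rewrite mulrBr.
under [X in _ = _ - X]eq_bigr => l _ do rewrite mulrBr.
by rewrite !sumrB -!mulr_suml -/(rowsum Z j) -/(rowsum X j); ring.
Qed.
End Host.
End Blocks.

Section MatrixLemmas.
Variable K : closedFieldType.

Definition killc (N : nat) (X : 'M[K]_N) (cs : seq K) (v : 'cV[K]_N) :=
  foldr (fun c v => X *m v - c *: v) v cs.

Lemma killcE (N : nat) (X : 'M[K]_N.+1) cs v :
  killc X cs v = horner_mx X (\prod_(c <- cs) ('X - c%:P)) *m v.
Proof.
elim: cs => [|c cs IH] /=; first by rewrite big_nil rmorph1 mul1mx.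
rewrite IH big_cons rmorphM /= rmorphB /= horner_mx_X horner_mx_C.
rewrite -[X in _ = X *m v]/((X - c%:M) *m horner_mx X (\prod_(c <- cs) ('X - c%:P))).
by rewrite -mulmxA mulmxBl mul_scalar_mx.
Qed.

(** The product of the factors over all distinct values in the lists kills every basis vector and
    has simple roots. *)
Lemma diag_of_killc (N : nat) (X : 'M[K]_N) (al : 'I_N -> seq K) :
  (forall j, uniq (al j)) -> (forall j, killc X (al j) (delta_mx j 0) = 0) ->
  exists2 P, P \in unitmx & similar_diag P X.
Proof.
case: N X al => [|N] X al ual hal.
  by exists 1%:M; rewrite ?unitmx1 //; apply/(diagonalizable_forP _ (unitmx1 _ _)) => -[].
apply/diagonalizableP; pose rs := undup (flatten [seq al j | j : 'I_N.+1]).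
exists rs; first exact: undup_uniq.
apply: mxminpoly_min; apply/matrixP => i j; rewrite [RHS]mxE.
have /dvdpP[q ->] : \prod_(c <- al j) ('X - c%:P) %| \prod_(c <- rs) ('X - c%:P).
  apply: uniq_roots_dvdp; last by rewrite uniq_rootsE.
  apply/allP => c cj; rewrite root_prod_XsubC mem_undup; apply/flattenP; exists (al j) => //.
  by apply/mapP; exists j; rewrite ?mem_enum.
rewrite rmorphM /= -[_ * _]/(horner_mx X q *m horner_mx X _).
have := hal j; rewrite killcE => e.
have := congr1 (fun v : 'cV[K]_N.+1 => (horner_mx X q *m v) i 0) e.
by rewrite mulmx0 [RHS]mxE mulmxA -colE mxE.
Qed.

(** The factors of the characteristic polynomial, applied to [e] one after the other, end in 0; the
    last nonzero vector is an eigenvector and still satisfies [Q], which stands for an invariant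
    subspace. *)
Lemma left_eigenvector (N : nat) (X : 'M[K]_N) (Q : 'rV[K]_N -> Prop) (e : 'rV[K]_N) :
  (forall v a, Q v -> Q (v *m X - a *: v)) -> Q e -> e != 0 ->
  exists v a, [/\ Q v, v != 0 & v *m X = a *: v].
Proof.
case: N X Q e => [|N] X Q e QX Qe e0; first by case/eqP: e0; apply/rowP => -[].
have [rs rsE] := closed_field_poly_normal (char_poly X).
rewrite (monicP (char_poly_monic X)) scale1r in rsE.
have : foldr (fun c v => v *m X - c *: v) e rs = 0.
  have -> : foldr (fun c v => v *m X - c *: v) e rs = e *m horner_mx X (\prod_(c <- rs) ('X - c%:P)).
    elim: (rs) => [|c l IH] /=; first by rewrite big_nil rmorph1 mulmx1.
    rewrite IH big_cons mulrC rmorphM /= rmorphB /= horner_mx_X horner_mx_C.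
    rewrite -[X in _ = _ *m X]/(horner_mx X (\prod_(c <- l) ('X - c%:P)) *m (X - c%:M)).
    by rewrite mulmxA mulmxBr mul_mx_scalar.
  by rewrite -rsE Cayley_Hamilton mulmx0.
elim: (rs) => [|c l IH] /= h; first by rewrite h eqxx in e0.
have Ql : Q (foldr (fun c v => v *m X - c *: v) e l) by elim: (l) => //= c' l' IHl; exact: QX.
have [/eqP/IH //|ln] := boolP (foldr (fun c v => v *m X - c *: v) e l == 0).
exists (foldr (fun c v => v *m X - c *: v) e l), c; split=> //.
by apply/eqP; rewrite -subr_eq0 h.
Qed.
End MatrixLemmas.

Section BlockDiagonalization.
Variables (K : closedFieldType) (n : nat) (s : toric_cone n) (D : ray_data s).
Variable R : toric_alg K s.
Hypothesis K0 : [pchar K] =i pred0.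
Local Notation S := (dual_cone s).
Local Notation chi := (chi R).
Local Notation dg := (dg D).
Local Notation m0 := (size (rts D)).
Local Notation r0 := (n + m0)%N.
Local Notation N := (nrays D).
Local Notation der := (@der K n s D R).
Local Notation br := (@br K n s D R).
Local Notation rrel := (@rrel n s D).
Local Notation rvec := (@rvec n s D).
Local Notation raycomb := (@raycomb K n s D).
Local Notation central := (@central K n s D).
Local Notation vec := (@vec K n s D).
Local Notation blocky := (@blocky K n s D).
Implicit Types (u v : 'rV[int]_n) (z lam : 'rV[K]_n) (X Z : 'M[K]_N).

Lemma vecD X Z : vec 0 (X + Z) = vec 0 X + vec 0 Z.
Proof.
rewrite /vec !add0r; have -> : raycomb (fun j => (X + Z) j j) = raycomb (fun j => X j j) + raycomb (fun j => Z j j).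
  by rewrite /raycomb -big_split; apply: eq_bigr => j _; rewrite mxE scalerDl.
rewrite torD addrACA; congr (_ + _); rewrite -big_split; apply: eq_bigr => k _.
by rewrite mxE scalerDl.
Qed.

Lemma vecZ c X : vec 0 (c *: X) = c *: vec 0 X.
Proof.
rewrite /vec !add0r scalerDr -torZ; congr (tor _ _ + _).
  by rewrite /raycomb scaler_sumr; apply: eq_bigr => j _; rewrite mxE scalerA.
by rewrite scaler_sumr; apply: eq_bigr => k _; rewrite mxE scalerA.
Qed.

Lemma vec_eq0 X : blocky X -> vec 0 X = 0 -> forall j l, rrel j l ->
  (j != l -> X j l = 0) /\ X j j = X l l.
Proof.
move=> bX e j l r; split=> [jl|].
  have /root_of_surj[k kE] : is_root (D := D) j l (rvec j l) by apply/is_root_rvec.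
  have := vec_coord 0 X k; rewrite e mxE; have := root_endsP k; rewrite kE => h.
  have h' : is_root (D := D) j l (rvec j l) by apply/is_root_rvec.
  by have [<- <-] := is_root_uniq h' h.
have := vec_lsub 0 X; rewrite e add0r => e1.
have := congr1 (fun v : 'rV[K]_n => ev v (rvec j l)) e1; rewrite ev_raycomb_rvec // => /esym/eqP; rewrite (_ : lsubmx 0 = 0) ?ev0r ?subr_eq0.
  by move=> /eqP ->.
by apply/rowP => i; rewrite !mxE.
Qed.

Section WithHost.
Variables (F : fieldType) (io : {rmorphism K -> F}) (y : 'rV[int]_n -> F).
Hypotheses (y0 : y 0 = 1) (yD : forall u v, y (u + v) = y u * y v).
Hypothesis yind : forall (r : seq 'rV[int]_n) (c : 'rV[int]_n -> K), uniq r ->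
  \sum_(v <- r) io (c v) * y v = 0 -> forall v, v \in r -> c v = 0.
Local Notation rowsum := (@rowsum K n s D F io y).
Local Notation logd := (@logd K n s D F io y).
Local Notation host := (@host K n s R F io y).

(** Let v be a left eigenvector of X in the block of j, with eigenvalue a. On the matrices q v with
    q a column in this block, the bracket acts through q as a - X, so a product of distinct linear
    factors in X takes q to a column for which [vec 0] of the product with v is 0. Such a matrix is
    scalar on each block; being of rank at most one, it is 0 unless the block has size one, a case
    treated apart. *)
Lemma block_diagonalizable z X (B : 'M[K]_r0) (w : 'rV[K]_r0) : central z -> blocky X ->
  B \in unitmx -> (forall i, br (vec z X) (row i B) = w 0 i *: row i B) ->
  exists2 P, P \in unitmx & similar_diag P X.
Proof.
move=> cz bX uB hB; pose ws := undup [seq w 0 i | i : 'I_r0].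
pose T c x := c *: x - br (vec z X) x.
have TD c x x' : T c (x + x') = T c x + T c x' by rewrite /T scalerDr brDr // opprD addrACA.
have TZ c a x : T c (a *: x) = a *: T c x by rewrite /T brZr // scalerBr !scalerA mulrC.
have kill x : foldr T x ws = 0.
  have fD l x1 x2 : foldr T (x1 + x2) l = foldr T x1 l + foldr T x2 l.
    by elim: l => //= c l ->; rewrite TD.
  have fZ l a x1 : foldr T (a *: x1) l = a *: foldr T x1 l by elim: l => //= c l ->; rewrite TZ.
  have f0 l : foldr T 0 l = 0 by have := fZ l 0 0; rewrite !scale0r.
  have -> : x = \sum_i (x *m invmx B) 0 i *: row i B by rewrite -mulmx_sum_row mulmxKV.
  rewrite (big_morph (fun x => foldr T x ws) (fD ws) (f0 ws)) big1 // => i _; rewrite fZ.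
  have -> : foldr T (row i B) ws = (\prod_(c <- ws) (c - w 0 i)) *: row i B.
    elim: (ws) => [|c l IH] /=; first by rewrite big_nil scale1r.
    by rewrite IH TZ /T hB -scalerBl scalerA big_cons mulrC.
  rewrite (big_rem (w 0 i)) /= ?subrr ?mul0r ?scale0r ?scaler0 //.
  by rewrite mem_undup; apply/mapP; exists i; rewrite ?mem_enum.
pose Q j (v : 'rV[K]_N) := forall l, ~~ rrel j l -> v 0 l = 0.
have left j : exists va : 'rV[K]_N * K, [/\ Q j va.1, va.1 != 0 & va.1 *m X = va.2 *: va.1].
  have [|||v [a h]] := @left_eigenvector K N X (Q j) (delta_mx 0 j); last by exists (v, a).
  - move=> v a Qv l jl; rewrite !mxE Qv // mulr0 subr0 big1 // => k _.
    have [jk|/Qv ->] := boolP (rrel j k); last by rewrite mul0r.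
    by rewrite bX ?mulr0 //; apply: contra jl => kl; exact: (rrel_trans jk kl).1.
  - by move=> l jl; rewrite mxE eqxx; case: eqP => // e; rewrite e rrel_refl in jl.
  by apply/eqP => /rowP/(_ j)/eqP; rewrite !mxE !eqxx oner_eq0.
have [va vaP] := choice left.
pose al j := if [pick l | rrel j l && (j != l)] is Some _ then [seq (va j).2 - c | c <- ws]
  else [:: X j j].
apply: (@diag_of_killc K N X al) => j; rewrite /al.
  case: pickP => // _ _; rewrite map_inj_uniq ?undup_uniq // => c c' /addrI/oppr_inj //.
case: pickP => [l /andP[jl njl]|h]; last first.
  apply/colP => i; rewrite /= -colE !mxE andbT; have [->|ij] := eqVneq i j.
    by rewrite mulr1 subrr.
  rewrite mulr0 subr0; apply: bX; apply/negP => /rrel_sym ji.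
  by have := h i; rewrite ji eq_sym ij.
have [Qv vn vX] := vaP j; set v := (va j).1 in Qv vn vX *; set a := (va j).2 in vX *.
pose Qc (q : 'cV[K]_N) := forall i, ~~ rrel j i -> q i 0 = 0.
have Qblock q : Qc q -> blocky (q *m v).
  move=> Qq i k ik; rewrite mxE big_ord1; have [ji|/Qq ->] := boolP (rrel j i); last by rewrite mul0r.
  have [jk|/Qv ->] := boolP (rrel j k); last by rewrite mulr0.
  by case/negP: ik; exact: (rrel_trans (rrel_sym ji) jk).1.
have step q c : Qc q -> Qc (X *m q - (a - c) *: q) /\
    vec 0 ((X *m q - (a - c) *: q) *m v) = T c (vec 0 (q *m v)).
  move=> Qq; split=> [i ji|].
    rewrite !mxE Qq // mulr0 subr0 big1 // => k _.
    have [jk|/Qq ->] := boolP (rrel j k); last by rewrite mulr0.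
    by rewrite bX ?mul0r //; apply: contra ji => /rrel_sym ki; exact: (rrel_trans jk ki).1.
  rewrite /T (br_vec R K0 yD yind cz bX (Qblock q Qq)).2 -mulmxA vX -[- vec 0 _]scaleN1r.
  rewrite -!vecZ -vecD; congr (vec 0 _); rewrite mulmxBl -scalemxAl -scalemxAr scalerBr !scaleN1r.
  rewrite opprK -mulmxA; move: (q *m v) (X *m _) => A1 A2.
  by rewrite scalerBl opprB addrC -addrA.
have Q0 : Qc (delta_mx j 0).
  by move=> i ji; rewrite mxE andbT; case: eqP => // e; rewrite e rrel_refl in ji.
set q := killc _ _ _; have [Qq vq] : Qc q /\ vec 0 (q *m v) = 0.
  rewrite -(kill (vec 0 (delta_mx j 0 *m v))) /q; elim: (ws) => [|c l' [IH1 IH2]] //=.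
  by have [s1 s2] := step _ c IH1; rewrite s2 IH2.
have eq0 := vec_eq0 (Qblock q Qq) vq.
have [k0 vk0] : exists k0, v 0 k0 != 0.
  apply/existsP; apply: contraT; rewrite negb_exists => /forallP h.
  by case/negP: vn; apply/eqP/rowP => k; have := h k; rewrite negbK mxE => /eqP.
have jk0 : rrel j k0 by apply: contraNT vk0 => /Qv ->.
have ME i k : (q *m v) i k = q i 0 * v 0 k by rewrite mxE big_ord1.
have q_off i : rrel j i -> i != k0 -> q i 0 = 0.
  move=> ji ik; have r := (rrel_trans (rrel_sym ji) jk0).1.
  by have [/(_ ik)] := eq0 _ _ r; rewrite ME => /eqP; rewrite mulf_eq0 (negbTE vk0) orbF => /eqP.
have [i ji ik] : exists2 i, rrel j i & i != k0.
  have [jk|] := eqVneq j k0; last by move=> ?; exists j; rewrite ?rrel_refl.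
  by exists l => //; rewrite -jk eq_sym.
apply/colP => i'; rewrite [RHS]mxE; have [ji'|/Qq //] := boolP (rrel j i').
have [->|/q_off -> //] := eqVneq i' k0.
have [_] := eq0 _ _ (rrel_trans (rrel_sym ji) jk0).1.
rewrite !ME (q_off _ ji ik) mul0r => /esym/eqP; rewrite mulf_eq0 (negbTE vk0) orbF => /eqP.
by [].
Qed.

(** Diagonalizing X together with the block projectors [E j] gives eigenvectors supported in single
    blocks. A nonzero term of the determinant orders the rows so that the diagonal is nonzero; row j
    then lies in the block of j. *)
Lemma block_eigenbasis X : blocky X -> (exists2 P, P \in unitmx & similar_diag P X) ->
  exists (P : 'M[K]_N) (nu : 'rV[K]_N), [/\ P \in unitmx, blocky P, forall j, P j j != 0 &
    P *m X = diag_mx nu *m P] /\ forall nu' : 'rV[K]_N, blocky (invmx P *m diag_mx nu' *m P).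
Proof.
move=> bX dX; pose E j : 'M[K]_N := diag_mx (\row_l (rrel j l)%:R).
have blockE Z : (forall j, E j *m Z = Z *m E j) <-> blocky Z.
  split=> [h j l jl|bZ j].
    have := congr1 (fun M : 'M[K]_N => M j l) (h j); rewrite mul_diag_mx mul_mx_diag !mxE.
    by rewrite rrel_refl (negbTE jl) mul1r mulr0.
  apply/matrixP => i l; rewrite mul_diag_mx mul_mx_diag !mxE.
  have [il|/bZ ->] := boolP (rrel i l); last by rewrite mul0r mulr0.
  have -> : rrel j i = rrel j l; last by rewrite mulrC.
  apply/idP/idP => h; first exact: (rrel_trans h il).1.
  exact: (rrel_trans h (rrel_sym il)).1.
have diagE j : is_diag_mx (E j) by exact: diag_mx_is_diag.
have [|B uB /allP hB] := (codiagonalizableP (X :: [seq E j | j : 'I_N])).1.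
  split=> [A C|A]; rewrite !inE.
    move=> /orP[/eqP->|/mapP[j _ ->]] /orP[/eqP->|/mapP[l _ ->]]; rewrite /comm_mx //.
    - by rewrite (blockE X).2.
    - by rewrite (blockE X).2.
    by rewrite diag_mxC.
  move=> /orP[/eqP->//|/mapP[j _ ->]]; exists 1%:M; first exact: unitmx1.
  apply/(diagonalizable_forP _ (unitmx1 _ _)) => i l il; rewrite invmx1 mulmx1 mul1mx.
  by rewrite mxE; case: eqP => [e|_]; [rewrite e eqxx in il | rewrite mulr0n].
have rowB A i : A \in X :: [seq E j | j : 'I_N] -> exists a, row i B *m A = a *: row i B.
  move=> /hB /(diagonalizable_forP _ uB) h; exists ((B *m A *m invmx B) i i).
  have {1}-> : row i B *m A = row i (B *m A *m invmx B) *m B by rewrite -row_mul mulmxKV // row_mul.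
  rewrite mulmx_sum_row (bigD1 i) //= big1 ?addr0 => [|l li]; first by rewrite mxE.
  by rewrite mxE h ?scale0r // eq_sym.
have [sg sgn] : exists sg : 'S_N, forall i, B i (sg i) != 0.
  suff /existsP[sg /forallP h] : [exists sg : 'S_N, [forall i, B i (sg i) != 0]] by exists sg.
  move: uB; rewrite unitmxE unitfE => dB; apply: contraT.
  rewrite negb_exists => /forallP h; case/negP: dB; apply/eqP; rewrite /determinant big1 // => sg _.
  have := h sg; rewrite negb_forall => /existsP[i]; rewrite negbK => /eqP bi.
  by rewrite (bigD1 i) //= bi mul0r mulr0.
pose P := row_perm (sg^-1)%g B.
have rP j : row j P = row ((sg^-1)%g j) B by apply/rowP => l; rewrite !mxE.
have Pn j : P j j != 0 by rewrite mxE; have := sgn ((sg^-1)%g j); rewrite permKV.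
have uP : P \in unitmx by rewrite /P row_permE unitmx_mul unitmx_perm.
have EX j : E j \in X :: [seq E j | j : 'I_N] by rewrite inE map_f ?mem_enum ?orbT.
have bP : blocky P.
  move=> j l jl; have [a e] := rowB (E j) ((sg^-1)%g j) (EX j); rewrite -rP in e.
  have ecoord k : P j k * (rrel j k)%:R = a * P j k.
    by have := congr1 (fun v : 'rV[K]_N => v 0 k) e; rewrite mul_mx_diag !mxE.
  have a1 : a = 1.
    by have := ecoord j; rewrite rrel_refl mulr1 -{1}[P j j]mul1r => /(mulIf (Pn j)) ->.
  by have := ecoord l; rewrite (negbTE jl) mulr0 a1 mul1r.
have nuP j : exists a, row j P *m X = a *: row j P by rewrite rP; apply: rowB; rewrite inE eqxx.
have [nu nuE] := choice nuP; exists P, (\row_j nu j); split; first split=> //.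
  by apply/row_matrixP => j; rewrite row_mul nuE row_mul row_diag_mx -scalemxAl -rowE mxE.
move=> nu'; apply/blockE => j; have cP := (blockE P).2 bP j.
have cV : E j *m invmx P = invmx P *m E j.
  by rewrite -[LHS](mulKmx uP); congr (_ *m _); rewrite mulmxA -cP -mulmxA mulmxV ?mulmx1.
by rewrite !mulmxA cV -!(mulmxA (invmx P)) diag_mxC -!mulmxA cP.
Qed.
End WithHost.
End BlockDiagonalization.

(** * Graded diagonalization *)

Section GradedDiagonalization.
Variables (K : closedFieldType) (n : nat) (s : toric_cone n) (D : ray_data s).
Variable R : toric_alg K s.
Hypothesis K0 : [pchar K] =i pred0.
Local Notation S := (dual_cone s).
Local Notation chi := (chi R).
Local Notation dg := (dg D).
Local Notation r0 := (n + size (rts D))%N.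
Local Notation N := (nrays D).
Local Notation der := (@der K n s D R).
Local Notation br := (@br K n s D R).
Local Notation rrel := (@rrel n s D).
Local Notation rvec := (@rvec n s D).
Local Notation raycomb := (@raycomb K n s D).
Local Notation central := (@central K n s D).
Local Notation vec := (@vec K n s D).
Local Notation blocky := (@blocky K n s D).
Implicit Types (u v : 'rV[int]_n) (z lam : 'rV[K]_n) (X Z : 'M[K]_N).

(** The last clause asks that the whole torus attached to the basis [f], and not only [h], be made
    of degree-zero derivations. *)
Definition graded_eigenbasis (h : 'rV[K]_r0) (f : 'rV[int]_n -> R) :=
  [/\ forall u, S u -> f u != 0, forall u w, S u -> cf (f u) w != 0 -> dg w = dg u, f 0 = 1,
    forall u v, S u -> S v -> f (u + v) = f u * f v &
    (exists mu, forall u, S u -> der h (f u) = ev mu u *: f u) /\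
    forall lam, exists h', forall u, S u -> der h' (f u) = ev lam u *: f u].

Section WithHost.
Variables (F : fieldType) (io : {rmorphism K -> F}) (y : 'rV[int]_n -> F).
Hypotheses (y0 : y 0 = 1) (yD : forall u v, y (u + v) = y u * y v).
Hypothesis yind : forall (r : seq 'rV[int]_n) (c : 'rV[int]_n -> K), uniq r ->
  \sum_(v <- r) io (c v) * y v = 0 -> forall v, v \in r -> c v = 0.
Local Notation rowsum := (@rowsum K n s D F io y).
Local Notation logd := (@logd K n s D F io y).
Local Notation host := (@host K n s R F io y).

Lemma multiset_exists (m : 'I_N -> nat) : exists js : seq 'I_N,
  (forall j, count_mem j js = m j) /\
  forall G : 'I_N -> F, \prod_(j <- js) G j = \prod_j G j ^+ m j.
Proof.
exists (flatten [seq nseq (m j) j | j <- enum 'I_N]); split=> [j|G].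
  rewrite count_flatten -map_comp sumnE big_map big_enum /= (bigD1 j) //= big1 => [|i ij].
    by rewrite count_nseq /= eqxx mul1n addn0.
  by rewrite count_nseq /= (negbTE ij).
rewrite big_flatten big_map big_enum /=; apply: eq_bigr => j _.
by rewrite big_nseq iter_mulr_1.
Qed.

Lemma y_neq0 u : y u != 0.
Proof. by apply/eqP => e; have := yD u (- u); rewrite subrr y0 e mul0r => /eqP; rewrite oner_eq0. Qed.

Variable P : 'M[K]_N.
Hypothesis bP : blocky P.

Let eigen z X (nu : 'rV[K]_N) := [/\ central z, blocky X & P *m X = diag_mx nu *m P].

(** The product replaces a factor x_j by the linear form (P x)_j once for each j in [js]. The
    exponents that occur lose at most that many units of [phi j], and so stay in S as long as j
    occurs at most [phi j u] times. Rows of [P] being left eigenvectors of X, each replacement adds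
    nu_j minus a row sum to the logarithmic derivative. *)
Lemma product_expansion u (js : seq 'I_N) : exists l : seq (K * 'rV[int]_n),
  [/\ forall p, p \in l -> ell D p.2 = ell D u /\
        forall j, phi j u - (count_mem j js)%:Z <= phi j p.2,
    \sum_(p <- l) io p.1 * y p.2 = y u * \prod_(j <- js) rowsum P j &
    forall z X nu, eigen z X nu -> \sum_(p <- l) io p.1 * (logd z X p.2 * y p.2) =
      (logd z X u + \sum_(j <- js) (io (nu 0 j) - rowsum X j)) *
      (y u * \prod_(j <- js) rowsum P j)].
Proof.
elim: js => [|j js [l [lc lv lD]]].
  exists [:: (1, u)]; split=> [p|| z X nu _]; rewrite ?inE ?big_seq1 ?big_nil /=.
  - by move=> /eqP ->; split=> // j; rewrite subr0.
  - by rewrite rmorph1 mul1r mulr1.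
  by rewrite rmorph1 mul1r addr0 mulr1.
pose ks := [seq k <- enum 'I_N | rrel j k].
have ksP (G : 'I_N -> F) : \sum_(k <- ks) io (P j k) * G k = \sum_k io (P j k) * G k.
  rewrite big_filter big_enum_cond /= [RHS](bigID (rrel j)) /= [X in _ = _ + X]big1 ?addr0 //.
  by move=> k /bP ->; rewrite rmorph0 mul0r.
exists [seq (p.1 * P j k, p.2 + rvec j k) | p <- l, k <- ks].
have big2 (G : K * 'rV[int]_n -> F) :
    \sum_(q <- [seq (p.1 * P j k, p.2 + rvec j k) | p <- l, k <- ks]) G q =
    \sum_(p <- l) \sum_(k <- ks) G (p.1 * P j k, p.2 + rvec j k).
  by rewrite big_allpairs_dep.
split.
- move=> q /allpairsP[[p k] /= [/lc[pe pp]]]; rewrite mem_filter => /andP[jk _] -> /=.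
  split=> [|i].
    rewrite ellD pe (_ : ell D (rvec j k) = 0) ?addr0 // ellE.
    have [<-|jnk] := eqVneq j k; first by rewrite big1 // => i _; rewrite rvec_refl phi0.
    by rewrite -ellE; apply: (is_root_ell (j := j) (k := k)); apply/is_root_rvec.
  have := pp i; rewrite phiD phi_rvec // [j == i]eq_sym; move: (count_mem i js) (phi i p.2) (phi i u).
  by move=> c1 c2 c3; case: (i == k); case: (i == j); lia.
- rewrite big2 big_cons; transitivity ((\sum_(p <- l) io p.1 * y p.2) * rowsum P j).
    rewrite mulr_suml; apply: eq_bigr => p _; rewrite /rowsum -ksP mulr_sumr.
    by apply: eq_bigr => k _ /=; rewrite yD rmorphM; ring.
  by rewrite lv; ring.
move=> z X nu ez; have [cz bX PX] := ez; rewrite big2 !big_cons.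
have rP : \sum_(k <- ks) io (P j k) * (y (rvec j k) * rowsum X k) = io (nu 0 j) * rowsum P j.
  rewrite ksP; under eq_bigr => k _ do rewrite mulrA.
  rewrite -(rowsumM io yD) // PX /rowsum mulr_sumr; apply: eq_bigr => k _.
  by rewrite mul_diag_mx mxE rmorphM mulrA.
have lr k : rrel j k -> logd z X (rvec j k) = rowsum X k - rowsum X j.
  by move=> jk; rewrite (logd_rvec io y X cz jk).
have rPs : rowsum P j = \sum_(k <- ks) io (P j k) * y (rvec j k) by rewrite ksP.
have lDX := lD z X nu ez; have lgD u' v' := logdD io y z X u' v'.
move: lr rP lDX lgD; move: (rowsum X) (logd z X) (rowsum P) rPs lv => rX lX rPP rPs lv lr rP lDX lgD.
transitivity ((\sum_(p <- l) io p.1 * (lX p.2 * y p.2)) * rPP j +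
   (\sum_(p <- l) io p.1 * y p.2) * (io (nu 0 j) * rPP j - rX j * rPP j)).
  have e1 : rX j * rPP j = \sum_(k <- ks) io (P j k) * (y (rvec j k) * rX j).
    by rewrite rPs mulr_sumr; apply: eq_bigr => k _; ring.
  rewrite e1 -rP -sumrB rPs !mulr_suml -big_split; apply: eq_bigr => p _ /=.
  rewrite !mulr_sumr -big_split !big_seq; apply: eq_bigr => k; rewrite mem_filter => /andP[jk _].
  by rewrite /= lgD (lr _ jk) yD rmorphM; ring.
by rewrite lv lDX; ring.
Qed.

Hypothesis Pn : forall j, P j j != 0.

Lemma rowsum_neq0 j : rowsum P j != 0.
Proof.
apply/negP => /eqP e; pose c v := if [pick k | rrel j k && (rvec j k == v)] is Some k then P j k else 0.
pose r := [seq rvec j k | k <- enum 'I_N & rrel j k].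
have inj k k' : rrel j k -> rrel j k' -> rvec j k = rvec j k' -> k = k'.
  move=> jk jk' ee; have [jj|nj] := eqVneq k j.
    have := phi_rvec jk k'; rewrite ee (phi_rvec jk') eqxx jj; case: eqVneq => //= _; lia.
  have := phi_rvec jk k; rewrite ee (phi_rvec jk') eqxx (negbTE nj); case: eqVneq => //= _; lia.
have cE k : rrel j k -> c (rvec j k) = P j k.
  move=> jk; rewrite /c; case: pickP => [k' /andP[jk' /eqP /inj <-] //|/(_ k)].
  by rewrite jk eqxx.
have ur : uniq r.
  rewrite map_inj_in_uniq; first by apply: filter_uniq; exact: enum_uniq.
  move=> k k'; rewrite !mem_filter => /andP[jk _] /andP[jk' _].
  exact: inj.
have : \sum_(v <- r) io (c v) * y v = 0.
  transitivity (rowsum P j); last exact: e.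
  rewrite /rowsum big_map big_filter big_enum_cond [RHS](bigID (rrel j)) /=.
  rewrite [X in _ = _ + X]big1 ?addr0 => [|k /bP ->]; last by rewrite rmorph0 mul0r.
  by apply: eq_bigr => k jk; rewrite cE.
move=> /(yind ur)/(_ (rvec j j)); rewrite cE ?rrel_refl // => h.
by have /negP[] := Pn j; rewrite h //; apply: map_f; rewrite mem_filter rrel_refl mem_enum.
Qed.

(** [chi u] is the monomial with exponents [phi j u] in the homogeneous coordinates x; [G u] is the
    same monomial in the coordinates P x. *)
Let G u := y u * \prod_j rowsum P j ^+ `|phi j u|%N.

Lemma eigenbasis_from_host : exists f : 'rV[int]_n -> R,
  [/\ forall u, S u -> f u != 0, forall u w, S u -> cf (f u) w != 0 -> dg w = dg u, f 0 = 1,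
    forall u v, S u -> S v -> f (u + v) = f u * f v &
    forall z X nu, eigen z X nu -> forall u, S u ->
      der (vec z X) (f u) = ev (z + raycomb (fun j => nu 0 j)) u *: f u].
Proof.
have ex u : exists f : R, S u -> [/\ host f = G u, forall w, cf f w != 0 -> dg w = dg u &
    forall z X nu, eigen z X nu -> der (vec z X) f = ev (z + raycomb (fun j => nu 0 j)) u *: f].
  have [Su|_] := boolP (S u); last by exists 0.
  have [js [jc jG]] := multiset_exists (fun j => `|phi j u|%N).
  have [l [lc lv lD]] := product_expansion u js.
  have lS p : p \in l -> S p.2 /\ dg p.2 = dg u.
    move=> /lc[pe pp]; have Sp : S p.2.
      by apply/inSE => j; have := pp j; rewrite jc; have := phi_ge0 j Su; lia.
    split=> //; apply: (can_inj absz_nat (x1 := dg p.2)); congr (absz _).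
    exact: pe.
  exists (\sum_(p <- l) p.1 *: chi p.2) => _.
  have hostE : host (\sum_(p <- l) p.1 *: chi p.2) = G u.
    rewrite (klin_sum _ _ _ (host_klin _ _ _)) /G -jG -lv big_seq [RHS]big_seq.
    by apply: eq_bigr => p /lS[Sp _]; rewrite (host_klin _ _ _).2 host_chi.
  split=> // [w|z X nu ez].
    rewrite cf_sum => h; have [p pl pw] : exists2 p, p \in l & cf (p.1 *: chi p.2) w != 0.
      apply/hasP; apply: contraNT h => /hasPn h; rewrite big_seq big1 // => p /h.
      by rewrite negbK => /eqP.
    have [Sp <-] := lS p pl; move: pw; rewrite cfZ cf_chi Sp /=.
    by case: (p.2 =P w) => [->|]; rewrite ?mulr0 ?eqxx.
  have [cz bX PX] := ez; apply: (host_inj yind); have ld := is_der_lin (is_der_der R K0 (vec z X)).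
  rewrite (host_klin _ _ _).2 hostE (klin_sum _ _ _ ld) (klin_sum _ _ _ (host_klin _ _ _)).
  transitivity (\sum_(p <- l) io p.1 * (logd z X p.2 * y p.2)).
    rewrite big_seq [RHS]big_seq; apply: eq_bigr => p /lS[Sp _].
    by rewrite (host_der_term R K0 io yD).
  rewrite (lD _ _ nu ez) jG -/(G u); congr (_ * _).
  have -> : \sum_(j <- js) (io (nu 0 j) - rowsum X j) =
      \sum_j (phi j u)%:~R * (io (nu 0 j) - rowsum X j).
    have sumE (H : 'I_N -> F) : \sum_(j <- js) H j = \sum_j H j *+ count_mem j js.
      elim: (js) => [|i t IH] /=; first by rewrite big_nil big1 // => j _; rewrite mulr0n.
      rewrite big_cons IH; under [RHS]eq_bigr do rewrite mulrnDr.
      rewrite big_split /= [X in _ = X + _](bigD1 i) //= eqxx mulr1n.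
      rewrite [X in _ = _ + X + _]big1 ?addr0 // => j ji.
      by rewrite eq_sym (negbTE ji) mulr0n.
    rewrite sumE; apply: eq_bigr => j _; rewrite jc -mulr_natl; congr (_ * _).
    by rewrite -[LHS]/((`|phi j u|%N%:Z)%:~R) gez0_abs // phi_ge0.
  rewrite logdE -addrA -big_split evDr rmorphD ev_raycomb /=; congr (_ + _); rewrite rmorph_sum.
  by apply: eq_bigr => j _; rewrite -mulrDr addrC subrK rmorphM rmorph_int mulrC.
have [f fP] := choice ex; exists f.
have GD u v : S u -> S v -> G (u + v) = G u * G v.
  move=> Su Sv; rewrite /G yD mulrACA -big_split; congr (_ * _); apply: eq_bigr => j _ /=.
  rewrite -exprD phiD; congr (_ ^+ _); have := phi_ge0 j Su; have := phi_ge0 j Sv; lia.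
have S0 : S 0 := dual_cone0 s.
split.
- move=> u Su; have [e _ _] := fP u Su; apply/negP => /eqP f0; move: e; rewrite f0.
  rewrite (klin0 (host_klin _ _ _)) => /esym/eqP; rewrite mulf_eq0 (negbTE (y_neq0 u)) /=.
  rewrite prodf_seq_eq0 => /hasP[j _ /=]; rewrite expf_eq0 (negbTE (rowsum_neq0 j)) andbF.
  by [].
- by move=> u w Su; have [_ h _] := fP u Su; exact: h.
- apply: (host_inj yind); have [-> _ _] := fP 0 S0; rewrite -(chi0 R) host_chi // /G y0 mul1r.
  by rewrite big1 // => j _; rewrite phi0 expr0.
- move=> u v Su Sv; apply: (host_inj yind); rewrite (hostM io yD).
  have [-> _ _] := fP _ (dual_coneD Su Sv); have [-> _ _] := fP u Su; have [-> _ _] := fP v Sv.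
  exact: GD.
by move=> z X nu ez u Su; have [_ _ h] := fP u Su; exact: h.
Qed.
End WithHost.

(** The fraction field of the polynomial ring: a relation between Laurent monomials is multiplied by
    a monomial large enough to make all exponents nonnegative. *)
Lemma laurent_host : exists (F : fieldType) (io : {rmorphism K -> F}) (y : 'rV[int]_n -> F),
  [/\ y 0 = 1, forall u v, y (u + v) = y u * y v &
   forall (r : seq 'rV[int]_n) (c : 'rV[int]_n -> K), uniq r ->
  \sum_(v <- r) io (c v) * y v = 0 -> forall v, v \in r -> c v = 0].
Proof.
Import -(notations) mpoly.
pose A : idomainType := mpoly.mpoly n K.
pose Xi (i : 'I_n) : A := mpoly.mpolyX K (mpoly.mnm1 i).
pose io : {rmorphism K -> {fraction A}} := @tofrac A \o @mpoly.mpolyC n K.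
pose t : 'rV[{fraction A}]_n := \row_i tofrac (Xi i).
have mono (m : 'I_n -> nat) : laurent (\row_i (m i)%:Z) t =
    tofrac (mpoly.mpolyX K (mpoly.Multinom [tuple m i | i < n]) : A).
  rewrite mpoly.mpolyXE_id rmorph_prod; apply: eq_bigr => i _.
  by rewrite !mxE rmorphXn mpoly.mnmE.
have t0 : Gm t.
  move=> i /=; rewrite mxE tofrac_eq0; apply/eqP => /(congr1 (mpoly.mcoeff (mpoly.mnm1 i))).
  by rewrite mpoly.mcoeffX eqxx mpoly.mcoeff0 => /eqP; rewrite oner_eq0.
exists {fraction A}, io, (fun u => laurent u t); split.
- exact: laurent0.
- by move=> u v; rewrite laurentD.
move=> r c ur e v0 v0r.
pose M := (\sum_(v <- r) \sum_i `|v 0%R i|)%N.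
have vM v i : v \in r -> 0 <= v 0 i + M%:Z.
  move=> vr; have : (`|v 0%R i| <= M)%N.
    by rewrite /M (big_rem v vr) /= (bigD1 i) //= -!addnA leq_addr.
  by lia.
pose mv (v : 'rV[int]_n) (i : 'I_n) := absz (v 0 i + M%:Z).
have shift v : v \in r -> laurent v t * laurent (const_mx M%:Z) t =
    tofrac (mpoly.mpolyX K (mpoly.Multinom [tuple mv v i | i < n]) : A).
  move=> vr; rewrite -laurentD // -mono; congr (laurent _ t); apply/rowP => i.
  by rewrite !mxE gez0_abs ?vM.
have : tofrac (\sum_(v <- r) c v *: mpoly.mpolyX K (mpoly.Multinom [tuple mv v i | i < n]) : A) = 0.
  rewrite -(mul0r (laurent (const_mx M%:Z) t)) -e mulr_suml rmorph_sum big_seq [RHS]big_seq.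
  apply: eq_bigr => v vr; rewrite -mulrA shift // -mpoly.mul_mpolyC rmorphM.
  by [].
move=> /eqP; rewrite tofrac_eq0 => /eqP.
move=> /(congr1 (mpoly.mcoeff (mpoly.Multinom [tuple mv v0 i | i < n]))).
rewrite mpoly.mcoeff0 (big_morph _ (@mpoly.mcoeffD _ _ _) (@mpoly.mcoeff0 _ _ _)).
rewrite (bigD1_seq v0) //= mpoly.mcoeffZ mpoly.mcoeffX eqxx mulr1 big1_seq ?addr0 // => v /andP[vv0 vr].
rewrite mpoly.mcoeffZ mpoly.mcoeffX; case: eqP => [em|_]; last by rewrite mulr0.
case/eqP: vv0; apply/rowP => i.
have := congr1 (fun m : mpoly.multinom n => mpoly.fun_of_multinom m i) em.
rewrite !mpoly.mnmE /mv => /(congr1 Posz); rewrite !gez0_abs ?vM // => /addIr.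
by [].
Qed.

Theorem graded_diagonalization (h : 'rV[K]_r0) (B : 'M[K]_r0) (w : 'rV[K]_r0) :
  B \in unitmx -> (forall i, br h (row i B) = w 0 i *: row i B) ->
  exists f, graded_eigenbasis h f.
Proof.
move=> uB hB; have [F [io [y [y0 yD yind]]]] := laurent_host.
have [z [X [cz bX hE]]] := vec_onto h; rewrite hE in hB *.
have dX := block_diagonalizable K0 yD yind cz bX uB hB.
have [P [nu [[uP bP Pn PX] bP']]] := block_eigenbasis bX dX.
have [f [f1 f2 f3 f4 f5]] := eigenbasis_from_host y0 yD yind bP Pn.
exists f; split=> //; split.
  by exists (z + raycomb (fun j => nu 0 j)) => u Su; apply: f5.
move=> lam; pose nu' : 'rV[K]_N := \row_l ev lam (rvec (rrep l) l).
(* [lam] is a central weight plus a combination of rays; the latter is realized by a matrix that is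
   diagonal in the basis [P]. *)
exists (vec (lam - raycomb (fun l => ev lam (rvec (rrep l) l))) (invmx P *m diag_mx nu' *m P)) => u Su.
rewrite (f5 _ _ nu') //; last first.
  by split; [exact: ray_split | exact: bP' | rewrite !mulmxA mulmxV // mul1mx].
congr (ev _ u *: _); rewrite -[RHS](subrK (raycomb (fun l => ev lam (rvec (rrep l) l)))).
by congr (_ + _); apply: eq_bigr => l _; rewrite mxE.
Qed.
End GradedDiagonalization.

(** * Linearization of derivations on formal series *)

(* The algebra of formal series with exponents in the cone, through its
   coefficients; it is realized by the completed local ring. *)
Record series_alg (K : fieldType) n (s : toric_cone n) (D : ray_data s) (R : toric_alg K s) :=
  SeriesAlg {
  salg :> comNzRingType;
  emb : R -> salg;
  sf : salg -> 'rV[int]_n -> K;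
  emb1 : emb 1 = 1;
  embD : forall f g, emb (f + g) = emb f + emb g;
  embM : forall f g, emb (f * g) = emb f * emb g;
  sfD : forall a b u, sf (a + b) u = sf a u + sf b u;
  sfM : forall a b u, sf (a * b) u = \sum_(v <- ball D (dg D u)) sf a v * sf b (u - v);
  sf_out : forall a u, ~~ dual_cone s u -> sf a u = 0;
  sf_ext : forall a b, (forall u, dual_cone s u -> sf a u = sf b u) -> a = b;
  sf_emb : forall f u, sf (emb f) u = cf f u;
  sf_real : forall c : 'rV[int]_n -> K, exists a, forall u, dual_cone s u -> sf a u = c u
}.
Arguments emb {K n s D R} _ _.
Arguments sf {K n s D R _} _ _.

Section SeriesAlgebra.
Variables (K : fieldType) (n : nat) (s : toric_cone n) (D : ray_data s).
Variables (R : toric_alg K s) (A : series_alg D R).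
Local Notation S := (dual_cone s).
Local Notation chi := (chi R).
Local Notation dg := (dg D).
Implicit Types (f : R) (a b : A) (u v w : 'rV[int]_n).

Definition const (c : K) : A := emb A (c *: 1).
Lemma constE c : const c = emb A (c *: 1).
Proof. by []. Qed.

Definition ordge q a := forall u, S u -> (dg u < q)%N -> sf a u = 0.
Definition cutoff q (a : A) : R := \sum_(v <- ball D q) sf a v *: chi v.

Lemma sf0 u : sf (0 : A) u = 0.
Proof. by apply: (addrI (sf (0 : A) u)); rewrite -sfD !addr0. Qed.
Lemma sfN a u : sf (- a) u = - sf a u.
Proof. by apply/eqP; rewrite -addr_eq0 -sfD addNr sf0. Qed.
Lemma sfB a b u : sf (a - b) u = sf a u - sf b u.
Proof. by rewrite sfD sfN. Qed.
Lemma emb_inj : injective (emb A).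
Proof. by move=> f g e; apply: cfP => u Su; rewrite -!(sf_emb A) e. Qed.
Lemma emb0 : emb A 0 = 0.
Proof. by apply: (addrI (emb A 0)); rewrite -embD !addr0. Qed.

Lemma embZ c f : emb A (c *: f) = const c * emb A f.
Proof. by rewrite /const -embM -scalerAl mul1r. Qed.
Lemma sf_const c a u : sf (const c * a) u = c * sf a u.
Proof.
have [Su|nS] := boolP (S u); last by rewrite !sf_out ?mulr0.
rewrite sfM (big_rem 0) /=; last by rewrite mem_ball dg0 dual_cone0.
rewrite subr0 sf_emb cfZ -(chi0 R) cf_chi dual_cone0 eqxx mulr1 big_seq big1 ?addr0 // => v.
rewrite mem_rem_uniq ?ball_uniq // inE => /andP[v0 _].
by rewrite sf_emb cfZ -(chi0 R) cf_chi eq_sym (negbTE v0) andbF mulr0 mul0r.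
Qed.
Lemma sf_sum (I : Type) (r : seq I) (P : pred I) (F : I -> A) u :
  sf (\sum_(i <- r | P i) F i) u = \sum_(i <- r | P i) sf (F i) u.
Proof. by apply: (big_morph (fun a => sf a u)) => [a b|]; rewrite ?sfD ?sf0. Qed.

Lemma ordge0 q : ordge q 0. Proof. by move=> u _ _; rewrite sf0. Qed.
Lemma ordge_0 a : ordge 0 a. Proof. by []. Qed.
Lemma ordgeD q a b : ordge q a -> ordge q b -> ordge q (a + b).
Proof. by move=> ha hb u Su lt; rewrite sfD ha // hb // addr0. Qed.
Lemma ordgeN q a : ordge q a -> ordge q (- a).
Proof. by move=> ha u Su lt; rewrite sfN ha // oppr0. Qed.
Lemma ordgeB q a b : ordge q a -> ordge q b -> ordge q (a - b).
Proof. by move=> ha hb; apply: ordgeD => //; exact: ordgeN. Qed.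
Lemma ordgeW q r a : (q <= r)%N -> ordge r a -> ordge q a.
Proof. by move=> qr ha u Su lt; apply: ha => //; exact: leq_trans lt qr. Qed.
Lemma ordgeM p q a b : ordge p a -> ordge q b -> ordge (p + q) (a * b).
Proof.
move=> ha hb u Su lt; rewrite sfM big_seq big1 // => v; rewrite mem_ball => /andP[Sv _].
have [Suv|nS] := boolP (S (u - v)); last by rewrite [sf b _]sf_out ?mulr0.
have : dg u = (dg v + dg (u - v))%N by rewrite -dgD // addrC subrK.
have [lv|le] := ltnP (dg v) p; first by rewrite ha ?mul0r.
by move=> e; rewrite hb ?mulr0 //; lia.
Qed.
Lemma ordge_eq0 a : (forall q, ordge q a) -> a = 0.
Proof. by move=> h; apply: sf_ext => u Su; rewrite sf0 (h (dg u).+1). Qed.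

Lemma cf_cutoff q a u : S u -> (dg u <= q)%N -> cf (cutoff q a) u = sf a u.
Proof.
move=> Su le; rewrite cf_sum (big_rem u) /=; last by rewrite mem_ball Su.
rewrite cfZ cf_chi Su eqxx mulr1 big_seq big1 ?addr0 // => v.
rewrite mem_rem_uniq ?ball_uniq // inE => /andP[vu _].
by rewrite cfZ cf_chi (negbTE vu) andbF mulr0.
Qed.
Lemma ordge_cutoff q a : ordge q.+1 (a - emb A (cutoff q a)).
Proof. by move=> u Su lt; rewrite sfB sf_emb cf_cutoff // subrr. Qed.

(** Additivity and continuity for the filtration by order, which reduce identities to K[S]. *)
Definition ctn (T : A -> A) := (forall a b, T (a + b) = T a + T b) /\
  forall q, exists N, forall a, ordge N a -> ordge q (T a).

Lemma ctnB T a b : ctn T -> T (a - b) = T a - T b.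
Proof. by case=> TD _; apply/eqP; rewrite eq_sym subr_eq -TD subrK. Qed.
Lemma ctn0 T : ctn T -> T 0 = 0.
Proof. by case=> TD _; apply: (addrI (T 0)); rewrite -TD !addr0. Qed.
Lemma ctn_comp T T' : ctn T -> ctn T' -> ctn (T \o T').
Proof.
move=> [TD Tc] [TD' Tc']; split=> [a b|q]; first by rewrite /= TD' TD.
by have [N hN] := Tc q; have [N' hN'] := Tc' N; exists N' => a /hN'/hN.
Qed.
Lemma ctn_mulr b : ctn (fun a => a * b).
Proof.
split=> [a a'|q]; first by rewrite mulrDl.
by exists q => a ha; rewrite -[q]addn0; apply: ordgeM.
Qed.
Lemma ctn_mull b : ctn (fun a => b * a).
Proof. by have [h1 h2] := ctn_mulr b; split=> [a a'|q]; [rewrite mulrDr | have [N hN] := h2 q; exists N => a /hN; rewrite mulrC]. Qed.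
Lemma ctn_add T T' : ctn T -> ctn T' -> ctn (fun a => T a + T' a).
Proof.
move=> [TD Tc] [TD' Tc']; split=> [a b|q]; first by rewrite TD TD' addrACA.
have [N hN] := Tc q; have [N' hN'] := Tc' q; exists (N + N')%N => a ha.
by apply: ordgeD; [apply: hN | apply: hN']; apply: ordgeW ha; rewrite ?leq_addr ?leq_addl.
Qed.

Lemma ctn_dense T T' : ctn T -> ctn T' -> (forall f, T (emb A f) = T' (emb A f)) -> T =1 T'.
Proof.
move=> cT cT' h a; apply/eqP; rewrite -subr_eq0; apply/eqP/ordge_eq0 => q.
have [N hN] := cT.2 q; have [N' hN'] := cT'.2 q; set c := emb A (cutoff (N + N') a).
have -> : T a - T' a = T (a - c) - T' (a - c).
  by rewrite (ctnB a c cT) (ctnB a c cT') -h opprB addrA addrNK.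
have hc : ordge (N + N').+1 (a - c) := @ordge_cutoff _ _.
by apply: ordgeB; [apply: hN | apply: hN']; apply: ordgeW hc; lia.
Qed.

Lemma ctn_dense_chi T T' : ctn T -> ctn T' ->
  (forall c a, T (const c * a) = const c * T a) -> (forall c a, T' (const c * a) = const c * T' a) ->
  (forall u, S u -> T (emb A (chi u)) = T' (emb A (chi u))) -> T =1 T'.
Proof.
move=> cT cT' TZ TZ' h; apply: ctn_dense => //.
apply: (klin_eq (sc := fun c x => const c * x) (F := fun f => T (emb A f)) (G := fun f => T' (emb A f))) => //.
- by split=> [f g|c f]; rewrite ?embD ?cT.1 // embZ TZ.
- by split=> [f g|c f]; rewrite ?embD ?cT'.1 // embZ TZ'.
Qed.

(** Each coefficient of the image depends only on a cutoff of the argument. Linearity and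
    multiplicativity pass to the extension by density. *)
Lemma ctn_ext (T : R -> A) : (forall f g, T (f + g) = T f + T g) ->
  (forall q, exists N, forall f, ordge N (emb A f) -> ordge q (T f)) ->
  exists T' : A -> A, [/\ ctn T', forall f, T' (emb A f) = T f,
    (forall c f, T (c *: f) = const c * T f) -> forall c a, T' (const c * a) = const c * T' a &
    (forall f g, T (f * g) = T f * T g) -> forall a b, T' (a * b) = T' a * T' b].
Proof.
move=> TD Tc; have [M MP] := choice Tc.
have TB f g : T (f - g) = T f - T g by apply/eqP; rewrite eq_sym subr_eq -TD subrK.
have embB f g : emb A (f - g) = emb A f - emb A g by apply/eqP; rewrite eq_sym subr_eq -embD subrK.
have [T' T'P] := choice (fun a => sf_real A (fun u => sf (T (cutoff (M (dg u).+1) a)) u)).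
have T'E a f u : S u -> ordge (M (dg u).+1) (a - emb A f) -> sf (T' a) u = sf (T f) u.
  move=> Su h; rewrite T'P //; apply/eqP; rewrite -subr_eq0 -sfB -TB; apply/eqP.
  apply: MP (ltnSn _) => //; rewrite embB -[emb A _](addrNK a) -addrA; apply: ordgeD => //.
  by rewrite -opprB; apply: ordgeN; apply: ordgeW (@ordge_cutoff _ _).
have T'c : ctn T'.
  split=> [a b|q].
    apply: sf_ext => u Su; set m := M (dg u).+1.
    rewrite sfD (T'E (a + b) (cutoff m a + cutoff m b)) // ?TD ?sfD.
      by rewrite -!T'P.
    rewrite embD opprD addrACA; apply: ordgeD; apply: ordgeW (@ordge_cutoff _ _) => //.
  exists (\sum_(i < q.+1) M i)%N => a ha u Su lt; rewrite (T'E a 0) //.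
    by have := TB 0 0; rewrite !subrr => ->; rewrite sf0.
  rewrite emb0 subr0; apply: ordgeW ha; have lt' : ((dg u).+1 < q.+1)%N by [].
  by rewrite (bigD1 (Ordinal lt')) //= leq_addr.
have T'i f : T' (emb A f) = T f.
  by apply: sf_ext => u Su; rewrite (T'E _ f) // subrr; exact: ordge0.
exists T'; split=> // [TZ c a|TM a b].
  apply: (ctn_dense (T := fun a => T' (const c * a)) (T' := fun a => const c * T' a)) => [||f].
  - exact: (ctn_comp T'c (ctn_mull _)).
  - exact: (ctn_comp (ctn_mull _) T'c).
  by rewrite -embZ !T'i TZ.
apply: (ctn_dense (T := fun a => T' (a * b)) (T' := fun a => T' a * T' b)) => [||f].
- exact: (ctn_comp T'c (ctn_mulr _)).
- exact: (ctn_comp (ctn_mulr _) T'c).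
apply: (ctn_dense (T := fun b => T' (emb A f * b)) (T' := fun b => T' (emb A f) * T' b)) => [||g].
- exact: (ctn_comp T'c (ctn_mull _)).
- exact: (ctn_comp (ctn_mull _) T'c).
by rewrite -embM !T'i TM.
Qed.

Section Unipotent.
Variable E : A -> A.
Hypothesis ED : forall a b, E (a + b) = E a + E b.
Hypothesis Eq : forall q a, ordge q a -> ordge q.+1 (E a).

Lemma unipotent_inj a : a - E a = 0 -> a = 0.
Proof.
move=> /eqP; rewrite subr_eq0 => /eqP e; apply: ordge_eq0; elim=> [|q IH] //.
by rewrite e; exact: Eq.
Qed.

(** The iteration of x |-> b + E x gains one order at each step and converges to the geometric
    series of [E] at [b]. *)
Lemma unipotent_surj b : exists a, a - E a = b.
Proof.
have EB x y : E (x - y) = E x - E y by apply/eqP; rewrite eq_sym subr_eq -ED subrK.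
pose sq i := iter i (fun x => b + E x) b.
have step i : ordge i.+1 (sq i.+1 - sq i).
  elim: i => [|i IH]; first by rewrite /= addrAC subrr add0r; exact: Eq.
  have -> : sq i.+2 - sq i.+1 = E (sq i.+1 - sq i) by rewrite EB /= opprD addrACA subrr add0r.
  exact: Eq.
have far i j : ordge i.+1 (sq (i + j)%N - sq i).
  elim: j => [|j IH]; first by rewrite addn0 subrr; exact: ordge0.
  rewrite -[sq (i + j.+1)%N](addrNK (sq (i + j)%N)) -addrA; apply: ordgeD => //.
  by rewrite addnS; apply: ordgeW (step _); rewrite ltnS leq_addr.
have [a aP] := sf_real A (fun u => sf (sq (dg u)) u).
have lim i : ordge i.+1 (a - sq i).
  move=> u Su lt; rewrite sfB aP //; apply/eqP; rewrite -oppr_eq0 opprB -sfB; apply/eqP.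
  by have /(_ u Su (ltnSn _)) := far (dg u) (i - dg u)%N; rewrite subnKC.
exists a; apply/eqP; rewrite -subr_eq0; apply/eqP/ordge_eq0 => q.
have -> : a - E a - b = (a - sq q.+1) - E (a - sq q).
  by rewrite EB /=; ring.
apply: ordgeB; first by apply: ordgeW (lim q.+1); lia.
by apply: ordgeW (Eq (lim q)); lia.
Qed.
End Unipotent.

(** Powers of the maximal ideal, in the form given to [ideal_pow_set]. *)
Fixpoint mpow q (a : A) : Prop :=
  if q is q'.+1 then exists2 l : seq (A * A),
    (forall p, p \in l -> sf p.1 0 = 0 /\ mpow q' p.2) & a = \sum_(p <- l) p.1 * p.2
  else True.

Lemma mpow_ordge q a : mpow q a -> ordge q a.
Proof.
elim: q a => [|q IH] a //= [l hl ->]; rewrite big_seq.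
apply: (big_ind (ordge q.+1)); [exact: ordge0|exact: ordgeD|].
move=> p /hl[p1 /IH p2]; rewrite -add1n; apply: ordgeM => // u Su.
by rewrite ltnS leqn0 dg_eq0 // => /eqP ->.
Qed.

(** A strict upper bound for the degrees of the Hilbert basis; it compares the filtration by degree
    with the powers of the maximal ideal. *)
Definition hbound := (\sum_(h <- hb s) dg h).+1.

Lemma sf_chiM h b u : S h -> sf (emb A (chi h) * b) u = if S (u - h) then sf b (u - h) else 0.
Proof.
move=> Sh; have out v : v != h -> sf (emb A (chi h)) v = 0.
  by move=> vh; rewrite sf_emb cf_chi eq_sym (negbTE vh) andbF.
have [Su|nS] := boolP (S u); last first.
  rewrite sf_out //; case: ifP => // Suh; case/negP: nS.
  by rewrite -(subrK h u); exact: dual_coneD.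
rewrite sfM; have [hb|hnb] := boolP (h \in ball D (dg u)).
  rewrite (big_rem h) //= sf_emb cf_chi Sh eqxx mul1r big_seq big1 ?addr0 => [|v]; last first.
    by rewrite mem_rem_uniq ?ball_uniq // inE => /andP[vh _]; rewrite out ?mul0r.
  by case: ifP => // /negbT nS; rewrite sf_out.
rewrite big_seq big1 => [|v vb]; last by rewrite out ?mul0r //; apply: contraNneq hnb => <-.
case: ifP => // Suh; case/negP: hnb; rewrite mem_ball Sh /=.
by rewrite -[in leqRHS](subrK h u) dgD // leq_addl.
Qed.

(** Each nonzero exponent is assigned to one element [sel u] of the Hilbert basis that can be split
    off, so the series is a sum of terms chi h times [b h], with [b h] of order at least q times
    [hbound]. *)
Lemma ordge_mpow q a : ordge (q * hbound) a -> mpow q a.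
Proof.
elim: q a => [|q IH] a ha //=.
pose sel u := nth 0 [seq h <- hb s | S (u - h)] 0.
have selP u : S u -> u != 0 -> sel u \in hb s /\ S (u - sel u).
  move=> Su u0; have [h [w [hhb Sw e]]] := hb_split D Su u0.
  have hl : h \in [seq h <- hb s | S (u - h)] by rewrite mem_filter hhb e addrC addKr Sw.
  have /(mem_nth 0) : (0 < size [seq h : 'rV[int]_n <- hb s | S (u - h)%R])%N by case: (filter _ _) hl.
  by rewrite mem_filter => /andP[].
have [b bP] := choice (fun h => sf_real A (fun w => if sel (h + w) == h then sf a (h + w) else 0)).
have bO h : h \in hb s -> ordge (q * hbound) (b h).
  move=> hhb w Sw lt; rewrite bP //; case: ifP => // _; have Sh := hb_inS D hhb.
  apply: ha; first exact: dual_coneD.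
  rewrite dgD // mulSn; have : (dg h <= hbound)%N; last by lia.
  by rewrite /hbound (big_rem h) //= -addnS leq_addr.
exists [seq (emb A (chi h), b h) | h <- hb s].
  move=> _ /mapP[h hhb ->] /=; split; last exact: IH (bO h hhb).
  rewrite sf_emb cf_chi; case: eqP => [e|]; last by rewrite andbF.
  by have := hb_dg D hhb; rewrite e dg0.
apply: sf_ext => u Su; rewrite big_map sf_sum /=.
have [u0|u0] := eqVneq u 0.
  rewrite u0 ha ?dual_cone0 ?dg0 //.
  rewrite big_seq big1 // => h hhb; have Sh := hb_inS D hhb; rewrite sf_chiM // sub0r.
  case: ifP => // Snh; have := hb_dg D hhb.
  by rewrite lt0n dg_eq0 // (dual_cone_sharp Sh Snh (subrr h)) eqxx.
have [sh Ssh] := selP u Su u0.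
rewrite (big_rem (sel u)) //= sf_chiM ?(hb_inS D sh) // Ssh bP // [sel u + _]addrC subrK eqxx.
rewrite big_seq big1 ?add0r ?addr0 // => h; rewrite mem_rem_uniq ?hb_uniq // inE => /andP[hs hhb].
rewrite sf_chiM ?(hb_inS D hhb) //; case: ifP => // Suh; rewrite bP // [h + _]addrC subrK eq_sym.
by rewrite (negbTE hs).
Qed.

Lemma aut_mpow (g : A -> A) : (forall a b, g (a + b) = g a + g b) ->
  (forall a b, g (a * b) = g a * g b) -> (forall a, sf a 0 = 0 -> sf (g a) 0 = 0) ->
  forall q a, mpow q a -> mpow q (g a).
Proof.
move=> gD gM gm; have g0 : g 0 = 0 by apply: (addrI (g 0)); rewrite -gD !addr0.
elim=> [|q IH] a //= [l hl ->]; exists [seq (g p.1, g p.2) | p <- l].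
  by move=> _ /mapP[p /hl[h1 h2] ->] /=; split; [exact: gm | exact: IH].
rewrite big_map (big_morph g gD g0); apply: eq_bigr => p _; exact: gM.
Qed.

(** Continuity of automorphisms is automatic, since they preserve the powers of the maximal
    ideal. *)
Lemma aut_ctn (g : A -> A) : (forall a b, g (a + b) = g a + g b) ->
  (forall a b, g (a * b) = g a * g b) -> (forall a, sf a 0 = 0 -> sf (g a) 0 = 0) -> ctn g.
Proof.
move=> gD gM gm; split=> // q; exists (q * hbound)%N => a /ordge_mpow.
by move=> /(aut_mpow gD gM gm)/mpow_ordge.
Qed.
End SeriesAlgebra.

(** Multiplicative version of the linear extension: the value at u in M is c (u + p) / c p. *)
Lemma cone_character (K : fieldType) n (s : toric_cone n) (D : ray_data s) (c : 'rV[int]_n -> K) :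
  (forall u, dual_cone s u -> c u != 0) ->
  (forall u v, dual_cone s u -> dual_cone s v -> c (u + v) = c u * c v) ->
  exists2 t : 'rV[K]_n, Gm t & forall u, dual_cone s u -> c u = laurent u t.
Proof.
move=> cn cM; have [p pP] := choice (shift_in_cone D).
pose C u := c (u + p u) / c (p u).
have CE u q : dual_cone s q -> dual_cone s (u + q) -> C u = c (u + q) / c q.
  move=> Sq Suq; have [Sp Sup] := pP u; rewrite /C; apply/eqP; rewrite eqr_div ?cn //; apply/eqP.
  by rewrite -!cM //; congr c; rewrite addrAC [RHS]addrAC -!addrA [p u + q]addrC.
have CD u v : C (u + v) = C u * C v.
  have [Sp Sup] := pP u; have [Sq Svq] := pP v.
  have Spq : dual_cone s (p u + p v) by exact: dual_coneD.
  rewrite (CE (u + v) (p u + p v)) //; last by rewrite addrACA; exact: dual_coneD.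
  by rewrite (addrACA u v) (cM _ _ Sup Svq) (cM _ _ Sp Sq) /C invfM mulrACA.
have C0 : C 0 = 1 by rewrite (CE 0 0) ?addr0 ?dual_cone0 // divff // cn // dual_cone0.
have Cn u : C u != 0 by rewrite mulf_neq0 ?invr_eq0 ?cn //; case: (pP u).
pose t : 'rV[K]_n := \row_i C (delta_mx 0 i).
have t0 : Gm t by move=> i /=; rewrite mxE.
exists t => // u Su; have -> : c u = C u by rewrite (CE u 0) ?addr0 ?dual_cone0 // -[in RHS](addr0 u) cM ?dual_cone0 // mulfK ?cn ?dual_cone0.
have CN v : C (- v) = (C v)^-1.
  by apply: (mulfI (Cn v)); rewrite -CD subrr C0 divff.
have CZ (k : int) v : C (k *: v) = C v ^ k.
  have Cnat (m : nat) : C (m%:Z *: v) = C v ^+ m.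
    elim: m => [|m IH]; first by rewrite scale0r C0.
    by rewrite intS scalerDl CD IH scale1r exprS.
  case: k => m; first exact: Cnat.
  by rewrite NegzE scaleNr CN Cnat.
rewrite {1}[u]row_sum_delta (big_morph C CD C0) /laurent; apply: eq_bigr => i _.
by rewrite CZ mxE.
Qed.

Section Linearization.
Variables (K : fieldType) (n : nat) (s : toric_cone n) (D : ray_data s).
Variables (R : toric_alg K s) (A : series_alg D R).
Local Notation S := (dual_cone s).
Local Notation chi := (chi R).
Local Notation dg := (dg D).
Local Notation const := (@const K n s D R A).
Local Notation io := (emb A).
Implicit Types (f : R) (a b : A) (u v w : 'rV[int]_n).

Definition saut : set (A -> A) := Aut_pt const (fun a => sf a 0 == 0).

Lemma constD c c' : const (c + c') = const c + const c'.
Proof. by rewrite -embD -scalerDl. Qed.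
Lemma const1 : const 1 = 1. Proof. by rewrite constE scale1r emb1. Qed.
Lemma sf1 u : sf (1 : A) u = (u == 0)%:R.
Proof. by rewrite -(emb1 A) sf_emb -(chi0 R) cf_chi dual_cone0 eq_sym. Qed.

Lemma sautD g a b : saut g -> g (a + b) = g a + g b.
Proof.
move=> [gB _ _ _ _]; have g0 : g 0 = 0 by have := gB 0 0; rewrite !subrr.
by have := gB a (- b); rewrite opprK => ->; have := gB 0 b; rewrite sub0r g0 sub0r => ->; rewrite opprK.
Qed.
Lemma sautM g a b : saut g -> g (a * b) = g a * g b.
Proof. by case=> _ [_ gM]. Qed.
Lemma saut_const g c a : saut g -> g (const c * a) = const c * g a.
Proof. by move=> ag; rewrite sautM //; case: ag => _ _ _ ->. Qed.
Lemma saut_sf0 g a : saut g -> (sf (g a) 0 == 0) = (sf a 0 == 0).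
Proof. by case=> _ _ _ _ h; have := h a. Qed.
Lemma saut_ctn g : saut g -> ctn g.
Proof.
move=> ag; apply: aut_ctn => [a b|a b|a]; [exact: sautD|exact: sautM|].
by move=> /eqP; rewrite -(saut_sf0 a ag) => /eqP.
Qed.
Lemma saut_comp g h : saut g -> saut h -> saut (g \o h).
Proof.
move=> ag ah; have [gB [g1 gM] gb gc gm] := ag; have [hB [h1 hM] hb hc hm] := ah.
split; first by move=> a b /=; rewrite hB gB.
- by split=> [|a b] /=; rewrite ?h1 ?hM.
- exact: bij_comp.
- by move=> c /=; rewrite hc gc.
- by move=> a; rewrite [LHS]gm hm.
Qed.
Lemma saut_inv g h : saut g -> cancel g h -> cancel h g -> saut h.
Proof.
move=> [gB [g1 gM] gb gc gm] gh hg.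
split; first by move=> a b; apply: (can_inj gh); rewrite gB !hg.
- by split=> [|a b]; apply: (can_inj gh); rewrite ?gM !hg.
- by exists g.
- by move=> c; apply: (can_inj gh); rewrite hg gc.
- by move=> a; rewrite -[LHS]gm hg.
Qed.

Definition diag (c : 'rV[int]_n -> K) a : A := projT1 (cid (sf_real A (fun u => c u * sf a u))).

Lemma sf_diag c a u : sf (diag c a) u = c u * sf a u.
Proof.
have [Su|nS] := boolP (S u); last by rewrite !sf_out ?mulr0.
by rewrite /diag; case: cid => b /= ->.
Qed.
Lemma diagD c a b : diag c (a + b) = diag c a + diag c b.
Proof. by apply: sf_ext => u _; rewrite sfD !sf_diag sfD mulrDr. Qed.
Lemma diag_ord c q a : ordge q a -> ordge q (diag c a).
Proof. by move=> ha u Su lt; rewrite sf_diag ha ?mulr0. Qed.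
Lemma diag_ctn c : ctn (diag c).
Proof. by split=> [a b|q]; [exact: diagD | exists q; exact: diag_ord]. Qed.
Lemma diag_const c k a : diag c (const k * a) = const k * diag c a.
Proof. by apply: sf_ext => u _; rewrite sf_const !sf_diag sf_const mulrCA. Qed.
Lemma diag_chi c u : S u -> diag c (io (chi u)) = const (c u) * io (chi u).
Proof.
move=> Su; apply: sf_ext => v _; rewrite sf_const sf_diag sf_emb cf_chi Su /=.
by have [->|] := eqVneq u v; rewrite ?mulr0.
Qed.
Lemma diagM c a b : (forall u v, S u -> S v -> c (u + v) = c u * c v) ->
  diag c (a * b) = diag c a * diag c b.
Proof.
move=> cM; apply: sf_ext => u _; rewrite sf_diag !sfM mulr_sumr big_seq [RHS]big_seq.
apply: eq_bigr => v; rewrite mem_ball => /andP[Sv _]; rewrite !sf_diag.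
have [Suv|nS] := boolP (S (u - v)); last by rewrite (sf_out b nS) !mulr0.
by have := cM _ _ Sv Suv; rewrite addrC subrK => ->; rewrite mulrACA.
Qed.

Definition torus (t : 'rV[K]_n) := diag (fun u => laurent u t).

Lemma torusE t : torus t = diag (fun u => laurent u t).
Proof. by []. Qed.

Lemma diag_saut t : Gm t -> saut (torus t).
Proof.
move=> t0; have M u v : S u -> S v -> laurent (u + v) t = laurent u t * laurent v t.
  by rewrite laurentD.
split.
- by move=> a b; apply: sf_ext => u _; rewrite sfB !sf_diag sfB mulrBr.
- split; last by move=> a b; exact: diagM.
  apply: sf_ext => u _; rewrite sf_diag sf1; case: eqP => [->|]; last by rewrite mulr0.
  by rewrite laurent0 mulr1.
- exists (diag (fun u => (laurent u t)^-1)) => a; apply: sf_ext => u _; rewrite !sf_diag.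
    by rewrite mulKf // laurent_neq0.
  by rewrite mulVKf // laurent_neq0.
- move=> c; rewrite -[const c]mulr1 /torus diag_const; congr (_ * _).
  apply: sf_ext => u _; rewrite sf_diag sf1; case: eqP => [->|]; last by rewrite mulr0.
  by rewrite laurent0 mulr1.
- by move=> a; rewrite -!topredE /= sf_diag mulf_eq0 (negbTE (laurent_neq0 t0 0)).
Qed.

Lemma saut_diag g : saut g -> (forall u v, S u -> S v -> v != u -> sf (g (io (chi u))) v = 0) ->
  exists2 t, Gm t & g =1 torus t.
Proof.
move=> ag gd; pose c u := sf (g (io (chi u))) u.
have gE u : S u -> g (io (chi u)) = const (c u) * io (chi u).
  move=> Su; apply: sf_ext => v Sv; rewrite sf_const sf_emb cf_chi Su /=.
  by have [<-|vu] := eqVneq u v; rewrite ?mulr1 // mulr0 gd // eq_sym.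
have chi_n u : S u -> io (chi u) != 0.
  move=> Su; apply/eqP => /(congr1 (fun a => sf a u)); rewrite sf_emb cf_chi Su eqxx sf0 => /eqP.
  by rewrite oner_eq0.
have const0 : const 0 = 0 by rewrite constE scale0r emb0.
have gi : injective g by case: ag => _ _ /bij_inj.
have g0 : g 0 = 0 by have := ctn0 (saut_ctn ag).
have cn u : S u -> c u != 0.
  move=> Su; apply: contraNneq (chi_n u Su) => e; apply/eqP/gi.
  by rewrite gE // e const0 mul0r g0.
have cM u v : S u -> S v -> c (u + v) = c u * c v.
  move=> Su Sv; rewrite {1}/c -chiM // embM sautM // !gE // -mulrA sf_const.
  rewrite mulrCA sf_const -embM chiM // sf_emb cf_chi dual_coneD // eqxx.
  by rewrite mulr1.
have [t t0 ct] := cone_character D cn cM; exists t => //.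
apply: ctn_dense_chi => [|||| u Su].
- exact: saut_ctn.
- exact: diag_ctn.
- by move=> k a; exact: saut_const.
- exact: diag_const.
- by rewrite gE // /torus diag_chi // ct.
Qed.

Lemma saut_diag_commute g (c : 'rV[int]_n -> K) : saut g ->
  (forall u v, S u -> S v -> c u = c v -> u = v) ->
  (forall a, g (diag c a) = diag c (g a)) -> exists2 t, Gm t & g =1 torus t.
Proof.
move=> ag ci gc; apply: saut_diag => // u v Su Sv vu.
have := congr1 (fun a => sf a v) (gc (io (chi u))); rewrite diag_chi // saut_const //.
rewrite sf_const sf_diag => /eqP; rewrite -subr_eq0 -mulrBl mulf_eq0 subr_eq0.
by case/orP => /eqP // /(ci _ _ Su Sv) e; rewrite e eqxx in vu.
Qed.

Lemma ordge_sum_chi (T : R -> A) f q : (forall u, S u -> cf f u != 0 -> ordge q (T (chi u))) ->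
  ordge q (\sum_(u <- supp f) const (cf f u) * T (chi u)).
Proof.
move=> hT; rewrite big_seq; apply: (big_ind (ordge q)); [exact: ordge0|exact: ordgeD|].
move=> u us; rewrite -[q]add0n; apply: ordgeM; first exact: ordge_0.
by apply: hT; [exact: supp_inS us | rewrite -mem_supp].
Qed.

Lemma ctn_order T k : ctn T -> (forall c a, T (const c * a) = const c * T a) ->
  (forall u, S u -> ordge (dg u + k) (T (io (chi u)))) ->
  forall q a, ordge q a -> ordge (q + k) (T a).
Proof.
move=> cT TZ hT q a ha; have [N hN] := cT.2 (q + k)%N; pose f := cutoff (q + N) a.
have -> : T a = T (a - io f) + T (io f) by rewrite -cT.1 subrK.
have hc : ordge (q + N).+1 (a - io f) := @ordge_cutoff _ _ _ _ _ _ _ _.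
apply: ordgeD; first by apply: hN; apply: ordgeW hc; lia.
have -> : T (io f) = \sum_(u <- supp f) const (cf f u) * T (io (chi u)).
  rewrite {1}[f]chiE (big_morph io (@embD _ _ _ _ _ A) (emb0 A)).
  by rewrite (big_morph T cT.1 (ctn0 cT)); apply: eq_bigr => u _; rewrite embZ TZ.
apply: (ordge_sum_chi (T := fun f => T (io f))) => u Su cu; apply: ordgeW (hT u Su).
rewrite leq_add2r leqNgt; apply: contra cu => lt; apply/eqP.
have := hc u Su; rewrite sfB sf_emb => /(_ _)/eqP; rewrite subr_eq0 ha // => h.
by apply/esym/eqP/h; lia.
Qed.

Section Flow.
Variables (lam : 'rV[K]_n) (d : A -> A).
Hypothesis lam_gen : forall u, ev lam u = 0 -> u = 0.
Hypothesis d_ctn : ctn d.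
Hypothesis d_const : forall c a, d (const c * a) = const c * d a.
Hypothesis d_der : forall a b, d (a * b) = d a * b + a * d b.
Hypothesis d_lead : forall q a, ordge q a -> ordge q.+1 (d a - diag (ev lam) a).

Let lam_inj u v : ev lam u = ev lam v -> u = v.
Proof. by move=> e; apply/eqP; rewrite -subr_eq0 (lam_gen (u := u - v)) // raddfB /= e subrr. Qed.
Let dD a b : d (a + b) = d a + d b. Proof. exact: d_ctn.1. Qed.

Let F a := d a - diag (ev lam) a.
Let FD a b : F (a + b) = F a + F b.
Proof. by rewrite /F dD diagD opprD addrACA. Qed.
Let inv u v := if v == u then 0 else (ev lam u - ev lam v)^-1.
Let E u a := diag (inv u) (F a).
Let ED u a b : E u (a + b) = E u a + E u b. Proof. by rewrite /E FD diagD. Qed.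
Let Eq u q a : ordge q a -> ordge q.+1 (E u a).
Proof. by move=> /d_lead; apply: diag_ord. Qed.

Let eigen_step u v : v != u -> ev lam u - ev lam v != 0.
Proof. by move=> vu; rewrite subr_eq0; apply: contra vu => /eqP/lam_inj ->. Qed.

(** The eigenvector solves y = chi u + E y. [E] raises the order and divides by ev lam u - ev lam v,
    which is nonzero for v != u as [lam] is generic, so no resonance occurs; the value 0 of
    [inv u u] keeps the leading coefficient equal to 1. *)
Lemma eigenvector_exists u : S u -> exists y,
  ordge (dg u).+1 (y - io (chi u)) /\ d y = const (ev lam u) * y.
Proof.
move=> Su; have [y ye] := unipotent_surj (ED u) (@Eq u) (io (chi u)).
have yE : y = io (chi u) + E u y by rewrite -ye subrK.
have chi_ord : ordge (dg u) (io (chi u)).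
  by move=> v Sv lt; rewrite sf_emb cf_chi; case: eqP => [e|_]; [rewrite e ltnn in lt|rewrite andbF].
have y_ord : ordge (dg u) y.
  have h q : (q <= dg u)%N -> ordge q y.
    elim: q => [|q IH] // le; rewrite yE; apply: ordgeD; first exact: ordgeW chi_ord.
    by apply: Eq; apply: IH; exact: ltnW.
  exact: h.
exists y; split; first by rewrite {1}yE addrAC subrr add0r; exact: Eq.
apply: sf_ext => v Sv; rewrite sf_const.
have -> : d y = F y + diag (ev lam) y by rewrite /F subrK.
rewrite sfD sf_diag; have [->|vu] := eqVneq v u.
  by rewrite (d_lead y_ord) ?add0r.
have e1 : sf y v = inv u v * sf (F y) v.
  by rewrite {1}yE sfD sf_emb cf_chi Su eq_sym (negbTE vu) add0r sf_diag.
rewrite e1 /inv (negbTE vu); move: (eigen_step vu) (sf (F y) v) => nz z.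
by field.
Qed.

Lemma eigenvector_unique u y : sf y u = 0 -> d y = const (ev lam u) * y -> y = 0.
Proof.
move=> y0 dy; apply: (unipotent_inj (@Eq u)); apply/eqP; rewrite subr_eq0; apply/eqP.
apply: sf_ext => v Sv; rewrite sf_diag /inv; have [->|vu] := eqVneq v u; first by rewrite y0 mul0r.
by rewrite sfB dy sf_const sf_diag -mulrBl mulKf // eigen_step.
Qed.

(** An eigenvector is determined by its coefficient at u, so y (u + v) = y u y v and [Th], extending
    chi u |-> y u, is multiplicative. It differs from the identity by a map that raises the order,
    hence it is bijective. *)
Theorem linearization : exists Th, saut Th /\ forall a, d (Th a) = Th (diag (ev lam) a).
Proof.
have yex u : exists y, S u -> ordge (dg u).+1 (y - io (chi u)) /\ d y = const (ev lam u) * y.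
  have [Su|nS] := boolP (S u); last by exists 0.
  by have [y yP] := eigenvector_exists Su; exists y.
have [y yP] := choice yex.
have yo u : S u -> ordge (dg u) (y u).
  move=> Su; rewrite -(subrK (io (chi u)) (y u)); apply: ordgeD.
    by apply: ordgeW (yP u Su).1.
  by move=> v Sv lt; rewrite sf_emb cf_chi; case: eqP => [e|_]; [rewrite e ltnn in lt|rewrite andbF].
have yu u : S u -> sf (y u) u = 1.
  move=> Su; have /(_ u Su (ltnSn _)) := (yP u Su).1; rewrite sfB sf_emb cf_chi Su eqxx.
  by move=> /eqP; rewrite subr_eq0 => /eqP.
have yM u v : S u -> S v -> y (u + v) = y u * y v.
  move=> Su Sv; have Suv := dual_coneD Su Sv; apply/eqP; rewrite eq_sym -subr_eq0; apply/eqP.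
  apply: (@eigenvector_unique (u + v)); last first.
    rewrite ctnB // d_der (yP u Su).2 (yP v Sv).2 (yP _ Suv).2 raddfD /= constD.
    by move: (const _) (const _) (y u) (y v) (y _) => c1 c2 y1 y2 y3; ring.
  rewrite sfB yu // -[y u](subrK (io (chi u))) mulrDl sfD sf_chiM // [u + v]addrC addrK Sv yu //.
  rewrite (ordgeM (p := (dg u).+1) (q := dg v) (yP u Su).1 (yo v Sv)) ?add0r ?subrr //.
    by rewrite addrC.
  by rewrite dgD // addSn addnC.
have y0 : y 0 = 1.
  have := yM 0 0 (dual_cone0 s) (dual_cone0 s); rewrite addr0 => e.
  apply/eqP; rewrite -subr_eq0; apply/eqP; apply: (@eigenvector_unique 0).
    by rewrite sfB yu ?dual_cone0 // sf1 eqxx subrr.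
  have d1 : d 1 = 0 by have := d_der 1 1; rewrite !mulr1 mul1r => /eqP; rewrite -subr_eq0 opprD addNKr oppr_eq0 => /eqP.
  rewrite ctnB // d1 subr0 (yP 0 (dual_cone0 s)).2 raddf0 /=.
  have -> : const 0 = 0 by rewrite constE scale0r emb0.
  by rewrite !mul0r.
pose T f : A := \sum_(u <- supp f) const (cf f u) * y u.
have TEw f (r : seq 'rV[int]_n) : uniq r -> {subset supp f <= r} ->
    T f = \sum_(u <- r) const (cf f u) * y u.
  move=> ur sr; rewrite /T [RHS](bigID (mem (supp f))) /= [X in _ = _ + X]big1 ?addr0.
    rewrite -[RHS]big_filter; apply: perm_big; apply: uniq_perm.
    - exact: supp_uniq.
    - exact: filter_uniq.
    by move=> u; rewrite mem_filter; have [/sr->|//] := boolP (u \in supp f).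
  move=> u; rewrite mem_supp negbK => /eqP ->.
  by rewrite constE scale0r emb0 mul0r.
have sub3 (f g h : R) : {subset supp f <= undup (supp f ++ supp g ++ supp h)} /\
   ({subset supp g <= undup (supp f ++ supp g ++ supp h)} /\
   {subset supp h <= undup (supp f ++ supp g ++ supp h)}).
  by split; [|split] => u; rewrite mem_undup !mem_cat => ->; rewrite ?orbT.
have TD f g : T (f + g) = T f + T g.
  have [h1 [h2 h3]] := sub3 f g (f + g).
  rewrite (TEw _ _ _ h1) ?undup_uniq // (TEw _ _ _ h2) ?undup_uniq // (TEw _ _ _ h3) ?undup_uniq //.
  by rewrite -big_split; apply: eq_bigr => u _; rewrite cfD constD mulrDl.
have TZ c f : T (c *: f) = const c * T f.
  have [h1 [h2 _]] := sub3 f (c *: f) 0.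
  rewrite (TEw _ _ _ h1) ?undup_uniq // (TEw _ _ _ h2) ?undup_uniq // mulr_sumr.
  apply: eq_bigr => u _; rewrite cfZ mulrA; congr (_ * _).
  by rewrite !constE -embM -scalerAl mul1r scalerA.
have Tchi u : S u -> T (chi u) = y u.
  move=> Su; rewrite (TEw _ [:: u]) //; last first.
    by move=> v; rewrite mem_supp cf_chi Su inE; case: (eqVneq u v) => _; rewrite ?eqxx.
  by rewrite big_seq1 cf_chi Su eqxx const1 mul1r.
have Tl : klin (fun c x => const c * x) T by split.
have TM f g : T (f * g) = T f * T g.
  move: f; apply: (klin_eq (sc := fun c x => const c * x) (F := fun f => T (f * g)) (G := fun f => T f * T g)).
  - by split=> [f f'|c f]; rewrite ?mulrDl ?TD // -scalerAl TZ.
  - by split=> [f f'|c f]; rewrite ?TD ?mulrDl // TZ mulrA.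
  move=> u Su; move: g.
  apply: (klin_eq (sc := fun c x => const c * x) (F := fun g => T (chi u * g)) (G := fun g => T (chi u) * T g)).
  - by split=> [f f'|c f]; rewrite ?mulrDr ?TD // -scalerAr TZ.
  - by split=> [f f'|c f]; rewrite ?TD ?mulrDr // TZ mulrCA.
  by move=> v Sv; rewrite chiM // !Tchi ?yM //; exact: dual_coneD.
have sumT f (G : 'rV[int]_n -> A) q : (forall u, S u -> cf f u != 0 -> ordge q (G u)) ->
    ordge q (\sum_(u <- supp f) const (cf f u) * G u).
  move=> hG; rewrite big_seq; apply: (big_ind (ordge q)); [exact: ordge0|exact: ordgeD|].
  move=> u us; rewrite -[q]add0n; apply: ordgeM; first exact: ordge_0.
  by apply: hG; [exact: supp_inS us | rewrite -mem_supp].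
have Tq q : exists N, forall f, ordge N (emb A f) -> ordge q (T f).
  exists q => f hf; apply: sumT => u Su cu; apply: ordgeW (yo u Su).
  by rewrite leqNgt; apply: contra cu => /(hf u Su); rewrite sf_emb => /eqP.
have [Th [Thc ThT ThZ ThM]] := ctn_ext TD Tq.
have {}ThZ := ThZ TZ; have {}ThM := ThM TM.
pose G a := a - Th a.
have GD a b : G (a + b) = G a + G b by rewrite /G Thc.1 opprD addrACA.
have Gc : ctn G.
  by apply: (ctn_add (T := id)); [split=> // q; exists q | split=> [a b|q]; [rewrite Thc.1 opprD|
    have [N hN] := Thc.2 q; exists N => a /hN; exact: ordgeN]].
have Gq q a : ordge q a -> ordge q.+1 (G a).
  rewrite -addn1; apply: ctn_order => // [c {}a|u Su]; first by rewrite /G ThZ mulrBr.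
  by rewrite addn1 /G ThT Tchi // -opprB; apply: ordgeN; exact: (yP u Su).1.
have Thi : injective Th.
  move=> a b e; apply/eqP; rewrite -subr_eq0; apply/eqP/(unipotent_inj Gq).
  by rewrite /G opprB addrCA subrr addr0 ctnB // e subrr.
have Thq q a : ordge q a -> ordge q (Th a).
  move=> ha; have -> : Th a = a - G a by rewrite /G opprB addrCA subrr addr0.
  by apply: ordgeB => //; apply: ordgeW (Gq _ _ ha).
exists Th; split; last first.
  apply: (ctn_dense_chi (T := d \o Th) (T' := fun a => Th (diag (ev lam) a))) => [|||| u Su] /=.
  - exact: ctn_comp.
  - exact: (ctn_comp Thc (diag_ctn _)).
  - by move=> c a /=; rewrite ThZ d_const.
  - by move=> c a; rewrite diag_const ThZ.
  by rewrite diag_chi // ThZ ThT Tchi // (yP u Su).2.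
split.
- by move=> a b; rewrite ctnB.
- by split=> //; rewrite -(emb1 A) ThT -(chi0 R) Tchi ?dual_cone0 // y0 chi0 emb1.
- have [g gP] := choice (fun b => unipotent_surj GD Gq b).
  have gK : cancel g Th by move=> b; rewrite -[RHS]gP /G opprB addrCA subrr addr0.
  by exists g => // a; apply: Thi; rewrite gK.
- by move=> c; rewrite ThT -[const c]mulr1 -[in RHS](emb1 A) -(chi0 R) TZ Tchi ?dual_cone0 // y0 chi0 emb1.
- move=> a; rewrite -!topredE /=; have hG : sf (G a) 0 = 0 by rewrite (Gq 0%N a) ?dual_cone0 ?dg0.
  by move: hG; rewrite /G sfB => /eqP; rewrite subr_eq0 => /eqP ->.
Qed.
End Flow.
End Linearization.

(** * Bases of eigenvectors and extension of automorphisms to series *)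

Section Spanning.
Variables (K : fieldType) (n : nat) (s : toric_cone n) (D : ray_data s).
Variables (R : toric_alg K s).
Hypothesis K0 : [pchar K] =i pred0.
Local Notation S := (dual_cone s).
Local Notation chi := (chi R).
Local Notation dg := (dg D).
Local Notation der := (@der K n s D R).
Local Notation tor := (@tor K n s D).
Variables (lam : 'rV[K]_n) (h' : 'rV[K]_(n + size (rts D))) (f : 'rV[int]_n -> R).
Hypothesis lam_gen : forall u, ev lam u = 0 -> u = 0.
Hypothesis f_neq0 : forall u, S u -> f u != 0.
Hypothesis f_dg : forall u w, S u -> cf (f u) w != 0 -> dg w = dg u.
Hypothesis f_eig : forall u, S u -> der h' (f u) = ev lam u *: f u.
Local Notation W := (linext f).

Let Wl := lin_linext f.
Let derl v : klin (@GRing.scale K R) (der v).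
Proof. exact: is_der_lin (is_der_der R K0 v). Qed.

Let derW r : der h' (W r) = W (der (tor lam) r).
Proof.
move: r; apply: (klin_eq (F := fun r => der h' (W r)) (G := fun r => W (der (tor lam) r))).
- exact: (lin_comp (derl h') Wl).
- exact: (lin_comp Wl (derl (tor lam))).
by move=> u Su; rewrite linext_chi // f_eig // der_tor // Wl.2 linext_chi.
Qed.

Let cf_der_tor r u : cf (der (tor lam) r) u = ev lam u * cf r u.
Proof.
move: r; apply: (klin_eq (sc := fun c x => c * x) (F := fun r => cf (der (tor lam) r) u) (G := fun r => ev lam u * cf r u)).
- exact: (lin_cf u (derl (tor lam))).
- by split=> [g h|c g]; rewrite ?cfD ?cfZ ?mulrDr // mulrCA.
by move=> v Sv; rewrite der_tor // cfZ cf_chi Sv /=; case: eqP => [->|]; rewrite ?mulr0.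
Qed.

(** The weights are distinct, so applying the derivation minus one of them shortens a relation. *)
Lemma eigenbasis_free r : W r = 0 -> r = 0.
Proof.
have [m le] := ubnP (size (supp r)); elim: m r le => // m IH r le Wr.
have [e0|[u0 us]] : supp r = [::] \/ exists u, u \in supp r.
  by case: (supp r) => [|u l]; [left | right; exists u; rewrite mem_head].
  by rewrite [r]chiE e0 big_nil.
pose r1 := der (tor lam) r - ev lam u0 *: r.
have r1E v : cf r1 v = (ev lam v - ev lam u0) * cf r v by rewrite cfB cf_der_tor cfZ mulrBl.
have r10 : r1 = 0.
  apply: IH; last by rewrite linB // -derW Wr Wl.2 Wr (klin0 (derl h')) scaler0 subrr.
  have : {subset supp r1 <= rem u0 (supp r)}.
    move=> v; rewrite mem_supp r1E mulf_eq0 negb_or => /andP[v0 vr].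
    rewrite mem_rem_uniq ?supp_uniq // inE mem_supp vr andbT.
    by apply: contraNneq v0 => ->; rewrite subrr.
  move/(uniq_leq_size (supp_uniq _)); rewrite size_rem //.
  by case: (supp r) us le => //= x l _; lia.
have rE : r = cf r u0 *: chi u0.
  apply: cfP => v Sv; rewrite cfZ cf_chi (supp_inS us) /=.
  have [<-|vu] := eqVneq u0 v; first by rewrite mulr1.
  have := r1E v; rewrite r10 cf0 => /esym/eqP; rewrite mulf_eq0 subr_eq0 mulr0.
  case/orP => /eqP // e; case/eqP: vu; apply/eqP; rewrite -subr_eq0 (lam_gen (u := u0 - v)) //.
  by rewrite raddfB /= e subrr.
have Su := supp_inS us; have := congr1 W rE; rewrite Wr Wl.2 linext_chi // => /esym/eqP.
by rewrite scaler_eq0 (negbTE (f_neq0 Su)) orbF => /eqP c0; rewrite rE c0 scale0r.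
Qed.

(** In the degree of [w] there are as many f_u as monomials and they are independent, so their
    coefficient matrix is invertible. *)
Lemma eigenbasis_chi w : S w -> exists r, W r = chi w /\ forall v, cf r v != 0 -> dg v = dg w.
Proof.
move=> Sw; pose l := [seq v <- ball D (dg w) | dg v == dg w]; pose m := size l.
have lu : uniq l by rewrite filter_uniq // ball_uniq.
have lP v : (v \in l) = S v && (dg v == dg w).
  by rewrite mem_filter mem_ball; case: eqP => [->|]; rewrite ?leqnn ?andbF ?andbT.
have lS (a : 'I_m) : S l`_a /\ dg l`_a = dg w.
  by have := mem_nth 0 (ltn_ord a); rewrite lP => /andP[? /eqP].
pose M := \matrix_(a < m, b < m) cf (f l`_a) l`_b.
pose comb (c : 'rV[K]_m) : R := \sum_a c 0 a *: chi l`_a.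
have combW c : W (comb c) = \sum_a c 0 a *: f l`_a.
  rewrite (klin_sum _ _ _ Wl); apply: eq_bigr => a _.
  by rewrite Wl.2 linext_chi //; case: (lS a).
have cf_comb c (b : 'I_m) : cf (W (comb c)) l`_b = (c *m M) 0 b.
  by rewrite combW cf_sum mxE; apply: eq_bigr => a _; rewrite cfZ mxE.
have cf_comb0 c v : v \notin l -> cf (W (comb c)) v = 0.
  move=> vl; rewrite combW cf_sum big1 // => a _; have [Sa da] := lS a; rewrite cfZ.
  have [->|nz] := eqVneq (cf (f l`_a) v) 0; rewrite ?mulr0 //.
  by case/negP: vl; rewrite lP (cf_neq0 nz) (f_dg Sa nz) da eqxx.
have cf_c c (b : 'I_m) : cf (comb c) l`_b = c 0 b.
  rewrite cf_sum (bigD1 b) //= big1 ?addr0 => [|a ab]; rewrite cfZ cf_chi (lS _).1 /=.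
    by rewrite eqxx mulr1.
  by rewrite nth_uniq // val_eqE (negbTE ab) mulr0.
have inl v : v \in l -> exists b : 'I_m, v = l`_b.
  by move=> vl; have lt : (index v l < m)%N by [rewrite index_mem]; exists (Ordinal lt); rewrite /= nth_index.
have uM : M \in unitmx.
  rewrite -row_free_unit -kermx_eq0; apply/rowV0P => c /sub_kermxP cM.
  have : comb c = 0.
    apply: eigenbasis_free; apply: cfP => v _; rewrite cf0.
    by have [/inl[b ->]|/cf_comb0 //] := boolP (v \in l); rewrite cf_comb cM mxE.
  by move=> e; apply/rowP => b; rewrite -cf_c e cf0 mxE.
have wl : w \in l by rewrite lP Sw eqxx.
have [b wb] := inl w wl; pose c := delta_mx 0 b *m invmx M : 'rV[K]_m.
exists (comb c); split.
  apply: cfP => v Sv; rewrite cf_chi Sw /=; have [/inl[b' ->]|vl] := boolP (v \in l).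
    rewrite cf_comb /c mulmxKV // mxE eqxx /= wb nth_uniq //.
    by rewrite -(inj_eq val_inj) /= eq_sym.
  by rewrite cf_comb0 //; case: eqP => // e; rewrite -e wl in vl.
move=> v nz; apply/eqP; apply: contraNT nz => ne; rewrite cf_sum big1 // => a _.
have [Sa da] := lS a; rewrite cfZ cf_chi; case: eqP => [e|_]; last by rewrite andbF mulr0.
by rewrite -e da eqxx in ne.
Qed.

Lemma eigenbasis_inv : exists V : R -> R, [/\ cancel W V, cancel V W &
  forall w v, S w -> cf (V (chi w)) v != 0 -> dg v = dg w].
Proof.
have ex w : exists r, S w -> W r = chi w /\ forall v, cf r v != 0 -> dg v = dg w.
  have [Sw|nS] := boolP (S w); last by exists 0.
  by have [r rP] := eigenbasis_chi Sw; exists r.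
have [r rP] := choice ex; exists (linext r).
have WV : cancel (linext r) W.
  move=> g; move: g; apply: (klin_eq (F := fun g => W (linext r g)) (G := id)) => //.
    exact: (lin_comp Wl (lin_linext r)).
  by move=> u Su; rewrite linext_chi // (rP u Su).1.
split=> // [g|w v Sw].
  by apply/eqP; rewrite -subr_eq0; apply/eqP/eigenbasis_free; rewrite linB // WV subrr.
by rewrite linext_chi // => /((rP w Sw).2 v).
Qed.

Lemma eigenbasis_eq (F G : R -> R) : klin (@GRing.scale K R) F -> klin (@GRing.scale K R) G ->
  (forall u, S u -> F (f u) = G (f u)) -> F =1 G.
Proof.
move=> lF lG e g; have [V [_ VW _]] := eigenbasis_inv; rewrite -(VW g); move: (V g).
apply: (klin_eq (F := fun r => F (W r)) (G := fun r => G (W r))).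
- exact: (lin_comp lF Wl).
- exact: (lin_comp lG Wl).
by move=> u Su; rewrite linext_chi ?e.
Qed.
End Spanning.

Section Extension.
Variables (K : fieldType) (n : nat) (s : toric_cone n) (D : ray_data s).
Variables (R : toric_alg K s) (A : series_alg D R).
Local Notation S := (dual_cone s).
Local Notation dg := (dg D).
Implicit Types g h : R -> R.

Lemma is_aut_ordge g q u : is_aut g -> S u -> (q * hbound D <= dg u)%N ->
  ordge q (emb A (g (chi R u))).
Proof.
case=> _ gM _ gm; elim: q u => [|q IH] u Su le; first exact: ordge_0.
have u0 : u != 0 by apply: contraTneq le => ->; rewrite dg0.
have [h [w [hhb Sw e]]] := hb_split D Su u0; have Sh := hb_inS D hhb.
rewrite e -chiM // gM embM -add1n; apply: ordgeM.
  move=> v Sv; rewrite ltnS leqn0 dg_eq0 // => /eqP ->; rewrite sf_emb; apply/eqP; rewrite gm.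
  rewrite cf_chi Sh; case: (eqVneq h 0) => [e0|]; last by rewrite eqxx.
  by have := hb_dg D hhb; rewrite e0 dg0.
apply: IH => //; have : (dg h < hbound D)%N by rewrite ltnS (big_rem h) //= leq_addr.
by move: le; rewrite e dgD // mulSn; lia.
Qed.

Lemma is_aut_ext g h : is_aut g -> cancel g h ->
  exists T : A -> A, [/\ ctn T, forall f, T (emb A f) = emb A (g f),
    forall c a, T (const A c * a) = const A c * T a, forall a b, T (a * b) = T a * T b &
    forall a, sf a 0 = 0 -> sf (T a) 0 = 0].
Proof.
move=> ga gK; have [lg gM _ gm] := ga; pose T f := emb A (g f).
have TD f f' : T (f + f') = T f + T f' by rewrite /T lg.1 embD.
have TZ c f : T (c *: f) = const A c * T f by rewrite /T lg.2 embZ.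
have Tc q : exists N, forall f, ordge N (emb A f) -> ordge q (T f).
  exists (q * hbound D)%N => f hf.
  have -> : T f = \sum_(u <- supp f) const A (cf f u) * T (chi R u).
    exact: (klin_chi (sc := fun c x => const A c * x) (F := T)).
  apply: ordge_sum_chi => u Su cu; apply: is_aut_ordge => //.
  by rewrite leqNgt; apply: contra cu => /(hf u Su); rewrite sf_emb => /eqP.
have [T' [cT T'T T'Z T'M]] := ctn_ext TD Tc.
exists T'; split=> //; [exact: T'Z | by apply: T'M => f f'; rewrite /T gM embM |].
move=> a a0; have [N hN] := cT.2 1%N; pose f := cutoff N a.
have h0 (b : A) : ordge 1 b -> sf b 0 = 0 by move=> hb; apply: hb; rewrite ?dual_cone0 ?dg0.
rewrite -(subrK (emb A f) a) cT.1 sfD T'T sf_emb h0 ?add0r; last first.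
  by apply: hN; apply: ordgeW (@ordge_cutoff _ _ _ _ _ _ _ _); lia.
by apply/eqP; rewrite gm cf_cutoff ?dual_cone0 ?dg0 // a0.
Qed.

Lemma saut_ext g h : is_aut g -> cancel g h ->
  exists G H : A -> A, [/\ saut G, cancel G H, cancel H G,
    forall f, G (emb A f) = emb A (g f) & forall f, H (emb A f) = emb A (h f)].
Proof.
move=> ga gK; have ha := is_autV ga gK.
have hK : cancel h g by case: ga => _ _ [k gk kg] _; move=> x; rewrite -{1}[x]kg gK kg.
have [G [cG GE GZ GM Gm]] := is_aut_ext ga gK; have [H [cH HE HZ HM Hm]] := is_aut_ext ha hK.
have GH : cancel G H.
  apply: (ctn_dense (T := H \o G) (T' := id)) => [||f /=]; [exact: ctn_comp | by split=> // q; exists q |].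
  by rewrite GE HE gK.
have HG : cancel H G.
  apply: (ctn_dense (T := G \o H) (T' := id)) => [||f /=]; [exact: ctn_comp | by split=> // q; exists q |].
  by rewrite HE GE hK.
have g1 := is_aut1 ga; exists G, H; split=> //; split.
- by move=> a b; exact: ctnB.
- by split=> //; rewrite -(emb1 A) GE g1.
- by exists H.
- by case: ga => lg _ _ _ c; rewrite GE lg.2 g1.
- move=> a; rewrite -!topredE /=; apply/eqP/eqP => e; last exact: Gm.
  by rewrite -(GH a); exact: Hm.
Qed.
End Extension.

(** * A torus containing the group *)

Section EquivariantTorus.
Variables (K : closedFieldType) (n : nat) (s : toric_cone n) (D : ray_data s).
Variables (R : toric_alg K s) (A : series_alg D R).
Hypothesis K0 : [pchar K] =i pred0.
Local Notation S := (dual_cone s).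
Local Notation chi := (chi R).
Local Notation dg := (dg D).
Local Notation r0 := (n + size (rts D))%N.
Local Notation der := (@der K n s D R).
Local Notation br := (@br K n s D R).
Local Notation crd := (@crd K n s D R).
Local Notation tau := (@tau K n s D R).
Variables (gT : finGroupType) (G : {group gT}) (rho : gT -> R -> R).
Hypothesis rho_aut : forall x, is_aut (rho x).
Hypothesis rhoM : forall x y, rho (x * y)%g = rho x \o rho y.
Hypothesis rho1 : rho 1%g = id.

Lemma rhoK x : cancel (rho x) (rho x^-1%g).
Proof. by move=> f; rewrite -[LHS]/((rho x^-1%g \o rho x) f) -rhoM mulVg rho1. Qed.
Lemma rhoVK x : cancel (rho x^-1%g) (rho x).
Proof. by move=> f; rewrite -[LHS]/((rho x \o rho x^-1%g) f) -rhoM mulgV rho1. Qed.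

Lemma invariant_derivation (v : 'rV[K]_r0) :
  (forall x, x \in G -> v *m tau (rho x) (rho x^-1%g) = v) ->
  exists d, [/\ is_der d, crd d = v & forall x f, x \in G -> rho x (d f) = d (rho x f)].
Proof.
move=> hv; pose dx x := rho x \o der v \o rho x^-1%g.
have ddx x : is_der (dx x) by apply: is_der_conj; [exact: rho_aut | exact: rhoK | exact: is_der_der].
have cG : #|G|%:R != 0 :> K by rewrite (proj1 (pcharf0P K) K0) eqn0Ngt cardG_gt0.
pose d f := #|G|%:R^-1 *: \sum_(x <- enum G) dx x f.
have dd : is_der d by apply: is_der_scale; apply: is_der_sum.
exists d; split=> // [|y f yG].
  rewrite crdZ //; last exact: is_der_sum.
  rewrite crd_sum // big_enum /= (eq_bigr (fun=> v)) => [|x xG].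
    by rewrite sumr_const -scaler_nat scalerA mulVf // scale1r.
  rewrite (tauP D K0 (rho_aut x) (rhoK x) (is_der_der R K0 v)).
  by rewrite crd_der // hv.
have [lr _ _ _] := rho_aut y; rewrite /d lr.2 (klin_sum _ _ _ lr); congr (_ *: _).
rewrite !big_enum /= [RHS](reindex_inj (mulgI y)) /=; apply: eq_big => [x|x xG].
  by rewrite groupMl.
rewrite /dx /= rhoM /= invMg rhoM /= -[rho y^-1%g (rho y f)]/((rho y^-1%g \o rho y) f).
by rewrite -rhoM mulVg rho1.
Qed.

(** [h'] has the eigenbasis of [h] but generic weights; it commutes with [h], so the group fixes it.
    The new coordinates combine two changes: [WA] makes the leading part of the invariant derivation
    diagonal, then [Th] removes the higher terms. *)
Theorem equivariant_torus (h : 'rV[K]_r0) (B : 'M[K]_r0) (w : 'rV[K]_r0) :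
  B \in unitmx -> (forall i, br h (row i B) = w 0 i *: row i B) ->
  (forall v, br h v = 0 -> forall x, x \in G -> v *m tau (rho x) (rho x^-1%g) = v) ->
  exists Th Thi : A -> A, [/\ saut Th, cancel Th Thi, cancel Thi Th &
    forall x g, x \in G -> saut g -> (forall f, g (emb A f) = emb A (rho x f)) ->
      exists2 t, Gm t & forall a, g a = Th (torus t (Thi a))].
Proof.
move=> uB hB hfix; have [f [f1 f2 f3 f4 [[mu f5] f6]]] := graded_diagonalization K0 uB hB.
have [lam lam_gen] := generic_vector n K0; have [h' h'P] := f6 lam.
have derl v : klin (@GRing.scale K R) (der v) by exact: is_der_lin (is_der_der R K0 v).
have br0 : br h h' = 0.
  apply: (@brP _ _ _ _ R K0) => u _; rewrite der0; apply/esym/eqP; rewrite subr_eq0; apply/eqP.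
  apply: (eigenbasis_eq K0 lam_gen f1 f2 h'P (F := fun f => der h (der h' f)) (G := fun f => der h' (der h f))).
  - exact: (lin_comp (derl h) (derl h')).
  - exact: (lin_comp (derl h') (derl h)).
  by move=> v Sv; rewrite f5 // h'P // (derl h).2 (derl h').2 f5 // h'P // !scalerA mulrC.
have [d [dd dc dG]] := invariant_derivation (hfix h' br0).
have draise : raising D (fun f => d f - der h' f) by rewrite -dc; exact: (crdP (D := D) K0 dd).
pose W := linext f; have Wl : klin (@GRing.scale K R) W := lin_linext f.
have [V [WV VW Vd]] := eigenbasis_inv K0 lam_gen f1 f2 h'P.
have WM a b : W (a * b) = W a * W b.
  move: a; apply: (klin_eq (F := fun a => W (a * b)) (G := fun a => W a * W b)).
  - by split=> [a a'|c a]; rewrite ?mulrDl ?Wl.1 // -scalerAl Wl.2.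
  - by split=> [a a'|c a]; rewrite ?Wl.1 ?mulrDl // Wl.2 scalerAl.
  move=> u Su; move: b; apply: (klin_eq (F := fun b => W (chi u * b)) (G := fun b => W (chi u) * W b)).
  - by split=> [a a'|c a]; rewrite ?mulrDr ?Wl.1 // -scalerAr Wl.2.
  - by split=> [a a'|c a]; rewrite ?Wl.1 ?mulrDr // Wl.2 scalerAr.
  by move=> v Sv; rewrite chiM // /W !linext_chi ?f4 //; exact: dual_coneD.
have Wa : is_aut W.
  split=> // [|r]; first by exists V.
  suff -> : cf (W r) 0 = cf r 0 by [].
  move: r; apply: (klin_eq (F := fun r => cf (W r) 0) (G := fun r => cf r 0)).
  - exact: lin_cf.
  - by split=> [a b|c a]; rewrite ?cfD ?cfZ.
  move=> u Su; rewrite /W linext_chi //; have [->|u0] := eqVneq u 0; first by rewrite f3 chi0.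
  rewrite cf_chi (negbTE u0) andbF; apply/eqP; apply: contraNT u0 => /(f2 u 0 Su) /eqP.
  by rewrite dg0 eq_sym dg_eq0.
have [WA [VA [Was WVA VWA WAE VAE]]] := saut_ext A Wa WV.
have Vas := saut_inv Was WVA VWA.
have VAq q a : ordge q a -> ordge q (VA a).
  rewrite -{2}[q]addn0; apply: ctn_order => [|c {}a|u Su]; [exact: saut_ctn|exact: saut_const|].
  rewrite addn0 VAE => v Sv lt; rewrite sf_emb; apply/eqP; apply: contraTT lt => /(Vd u v Su) ->.
  by rewrite ltnn.
have dl := is_der_lin dd; have [_ dM _] := dd.
have emb_d q a : ordge (D := D) q (emb A a) -> ordge q (emb A (d a)).
  move=> ha v Sv lt; rewrite sf_emb; apply/eqP; apply: contraTT lt => /(cf_lin dl)[u [Su fu ku]].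
  rewrite -leqNgt; apply: leq_trans (der_dg D K0 dd Su ku); rewrite leqNgt; apply: contra fu => lt.
  by rewrite -(sf_emb A) ha.
have [dA [dAc dAE dAZ _]] := @ctn_ext _ _ _ _ _ A (fun a => emb A (d a))
  (fun a b => etrans (congr1 _ (dl.1 a b)) (embD _ _ _)) (fun q => ex_intro _ q (emb_d q)).
have {}dAZ : forall c a, dA (const A c * a) = const A c * dA a.
  by apply: dAZ => c a; rewrite dl.2 embZ.
have dAM a b : dA (a * b) = dA a * b + a * dA b.
  apply: (ctn_dense (T := fun a => dA (a * b)) (T' := fun a => dA a * b + a * dA b)) => [||{}a].
  - exact: (ctn_comp dAc (ctn_mulr _)).
  - by apply: ctn_add; [exact: (ctn_comp (ctn_mulr _) dAc) | exact: ctn_mulr].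
  apply: (ctn_dense (T := fun b => dA (emb A a * b)) (T' := fun b => dA (emb A a) * b + emb A a * dA b)) => [||{}b].
  - exact: (ctn_comp dAc (ctn_mull _)).
  - by apply: ctn_add; [exact: ctn_mull | exact: (ctn_comp (ctn_mull _) dAc)].
  by rewrite -embM !dAE dM embD !embM.
pose d1 := VA \o dA \o WA.
have d1c : ctn d1 by apply: (ctn_comp (ctn_comp _ dAc)); exact: saut_ctn.
have d1Z c a : d1 (const A c * a) = const A c * d1 a by rewrite /d1 /= saut_const // dAZ saut_const.
have d1M a b : d1 (a * b) = d1 a * b + a * d1 b.
  by rewrite /d1 /= (sautM _ _ Was) dAM (sautD _ _ Vas) !(sautM _ _ Vas) !WVA.
have d1l q a : ordge q a -> ordge q.+1 (d1 a - diag (ev lam) a).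
  rewrite -addn1; apply: (ctn_order (T := fun a => d1 a - diag (ev lam) a)) => [|c {}a|u Su].
  - split=> [{}a b|{}q]; first by rewrite d1c.1 diagD opprD addrACA.
    have [N hN] := d1c.2 q; exists (N + q)%N => {}a ha; apply: ordgeB.
      by apply: hN; apply: ordgeW ha; lia.
    by apply: diag_ord; apply: ordgeW ha; lia.
  - by rewrite d1Z diag_const mulrBr.
  have -> : d1 (emb A (chi u)) - diag (ev lam) (emb A (chi u)) = VA (emb A (d (f u) - der h' (f u))).
    have embB a1 a2 : emb A (a1 - a2) = emb A a1 - emb A a2.
      by apply/eqP; rewrite eq_sym subr_eq -embD subrK.
    rewrite embB (ctnB _ _ (saut_ctn Vas)) diag_chi // -embZ /d1 /= WAE dAE /W linext_chi // -/W.
    congr (_ - _); rewrite VAE h'P //; congr (emb A _); apply: (can_inj WV).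
    by rewrite /W VW (lin_linext f).2 linext_chi.
  apply: VAq => v Sv lt; rewrite sf_emb; apply/eqP; apply: contraTT lt.
  have ll := lin_sub dl (derl h').
  move=> /(cf_lin ll)[u' [Su' fu' ku']]; rewrite -leqNgt addn1.
  by rewrite -(f2 u u' Su fu'); exact: draise ku'.
have [Th [Ths Thd]] := linearization lam_gen d1c d1Z d1M d1l.
have [Thi ThK ThiK] : bijective Th by case: Ths.
have This := saut_inv Ths ThK ThiK.
exists (WA \o Th), (Thi \o VA); split.
- exact: saut_comp.
- by move=> a /=; rewrite WVA ThK.
- by move=> a /=; rewrite ThiK VWA.
move=> x g xG gs gE; pose g1 := Thi \o (VA \o g \o WA) \o Th.
have gd a : g (dA a) = dA (g a).
  apply: (ctn_dense (T := g \o dA) (T' := dA \o g)) => [||e /=].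
  - by apply: ctn_comp => //; exact: saut_ctn.
  - by apply: ctn_comp => //; exact: saut_ctn.
  by rewrite gE !dAE gE dG.
have gd1 a : VA (g (WA (d1 a))) = d1 (VA (g (WA a))) by rewrite /d1 /= !VWA gd.
have g1s : saut g1 by apply: (saut_comp _ Ths); apply: (saut_comp This); apply: (saut_comp _ Was); exact: saut_comp.
have [|a|t t0 tE] := saut_diag_commute (c := ev lam) g1s.
- by move=> u v Su Sv e; apply/eqP; rewrite -subr_eq0 (lam_gen (u - v)) // raddfB /= e subrr.
- have g1T b : Th (g1 b) = VA (g (WA (Th b))) by exact: ThiK.
  by apply: (can_inj ThK); rewrite g1T -[in RHS]Thd g1T -[in LHS]Thd gd1.
exists t => // a; by rewrite /= -tE /g1 /= !ThiK !VWA.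
Qed.
End EquivariantTorus.

(** * Index and rank bounds from characters *)

Section TorusCharacters.
Variables (K : fieldType) (gT : finGroupType) (G : {group gT}) (r : nat).
Variable ch : gT -> 'I_r -> K.
Hypothesis ch_neq0 : forall x i, x \in G -> ch x i != 0.
Hypothesis chM : forall x y i, x \in G -> y \in G -> ch (x * y)%g i = ch x i * ch y i.
Local Notation "x =ch y" := (forall i, ch x i = ch y i) (at level 70).

Lemma ch1 i : ch 1%g i = 1.
Proof.
apply: (mulfI (ch_neq0 i (group1 G))).
by rewrite mulr1 -chM ?group1 // mulg1.
Qed.
Lemma chX x k i : x \in G -> ch (x ^+ k)%g i = ch x i ^+ k.
Proof.
move=> xG; elim: k => [|k IH]; first by rewrite expg0 ch1.
by rewrite expgS exprS chM ?groupX // IH.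
Qed.
Lemma chV x i : x \in G -> ch x^-1%g i = (ch x i)^-1.
Proof.
move=> xG; apply: (mulfI (ch_neq0 i xG)); rewrite -chM ?groupV // mulgV ch1.
by rewrite divff // ch_neq0.
Qed.

(** Each character takes at most c values on [H], the roots of X^c - 1. *)
Lemma index_torsion (H L : {group gT}) c : (0 < c)%N -> H \subset G -> L \subset H ->
  (forall x, x \in H -> forall i, ch x i ^+ c = 1) -> (forall x, x \in H -> x =ch 1%g -> x \in L) ->
  (#|H : L|%g <= c ^ r)%N.
Proof.
move=> c0 sHG sLH hc hL; pose p : {poly K} := 'X^c - 1.
have p0 : p != 0 by rewrite -size_poly_eq0 size_XnsubC.
pose rs := undup [seq ch x i | x <- enum H, i <- enum 'I_r].
have rs_le : (size rs <= c)%N.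
  have : (size rs < size p)%N.
    apply: max_poly_roots => //; last exact: undup_uniq.
    apply/allP => z; rewrite mem_undup => /allpairsP[[x i] [/= xH _ ->]].
    by rewrite mem_enum in xH; rewrite /root !hornerE hc // subrr.
  by rewrite size_XnsubC.
have [c1 c1E] : exists c1, c = c1.+1 by case: c c0 {hc p p0 rs_le} => // c1; exists c1.
pose F x : {ffun 'I_r -> 'I_c1.+1} := [ffun i => inord (index (ch x i) rs)].
apply: leq_trans (@index_le_card _ _ F H L sLH _) _; last by rewrite card_ffun !card_ord -c1E.
move=> x y xH yH e; have xG := fintype.subsetP sHG _ xH; have yG := fintype.subsetP sHG _ yH.
have inrs z i : z \in H -> (index (ch z i) rs < size rs)%N.
  move=> zH; rewrite index_mem mem_undup; apply/allpairsP; exists (z, i).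
  by rewrite !mem_enum.
apply: hL => [|i]; first by rewrite groupM ?groupV.
rewrite chM ?groupV // chV // ch1.
have := congr1 (fun f : {ffun _ -> _} => val (f i)) e; rewrite !ffunE /= !inordK.
- have mrs z : z \in H -> ch z i \in rs by move=> zH; rewrite -index_mem inrs.
  by move=> h; rewrite -[ch x i](nth_index 0 (mrs x xH)) h nth_index ?mrs // divff ?ch_neq0.
- by apply: leq_trans (inrs _ _ yH) _; rewrite -c1E.
- by apply: leq_trans (inrs _ _ xH) _; rewrite -c1E.
Qed.

(** The rank of a finite abelian group is attained by an elementary abelian p-subgroup, which embeds
    into the p-torsion of a torus of dimension r. *)
Lemma grank_le (A : {group gT}) : A \subset G -> abelian A ->
  (forall x, x \in A -> x =ch 1%g -> x = 1%g) -> ('m(A)%g <= r)%N.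
Proof.
move=> sAG cA inj; rewrite grank_abelian //.
have [p prp ->] := rank_witness A; have [E] := p_rank_witness p A.
move: ('r_p(A))%g => k /pnElemPcard[sEA abE cE].
have [_ Ep] := abelemP prp abE.
rewrite -(leq_exp2l _ _ (prime_gt1 prp)) -cE -indexg1.
apply: (@index_torsion E 1%G p); rewrite ?sub1G ?prime_gt0 //.
- exact: fintype.subset_trans sEA sAG.
- by move=> x xE i; rewrite -chX ?Ep ?ch1 // (fintype.subsetP sAG) // (fintype.subsetP sEA).
by move=> x xE h; rewrite inE (inj x) // (fintype.subsetP sEA).
Qed.

(** Modulo the common kernel [L] the group is abelian, and there the index of the c-th powers is the
    order of the c-torsion, at most c^r. [A] is asked to contain all elements with the characters of
    a c-th power, so it contains [L]. *)
Lemma index_powers (A : {group gT}) c : (0 < c)%N -> A \subset G ->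
  (forall x y, x \in G -> y \in G -> y =ch (x ^+ c)%g -> y \in A) ->
  (#|G : A|%g <= c ^ r)%N.
Proof.
move=> c0 sAG hA.
have grp (P : gT -> Prop) : P 1%g -> (forall x y, x \in G -> y \in G -> P x -> P y -> P (x * y)%g) ->
    exists H : {group gT}, forall x, x \in H <-> x \in G /\ P x.
  move=> P1 PM; pose X := [set x in G | `[< P x >]]%SET.
  have gX : group_set X.
    apply/group_setP; split; first by rewrite inE group1; exact/asboolP.
    move=> x y; rewrite !inE => /andP[xG /asboolP Px] /andP[yG /asboolP Py].
    by rewrite groupM //=; apply/asboolP/PM.
  exists (Group gX) => x; rewrite inE /=; split; first by case/andP => ? /asboolP.
  by case=> -> /asboolP.
have [L LP] : exists H : {group gT}, forall x, x \in H <-> x \in G /\ x =ch 1%g.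
  by apply: grp => // x y xG yG hx hy i; rewrite chM // hx hy !ch1 mulr1.
have [P PP] : exists H : {group gT}, forall x, x \in H <-> x \in G /\ forall i, ch x i ^+ c = 1.
  apply: grp => [i|x y xG yG hx hy i]; first by rewrite ch1 expr1n.
  by rewrite chM // exprMn hx hy mulr1.
have sLA : L \subset A.
  apply/fintype.subsetP => x /LP[xG hx]; apply: (hA 1%g) => // i.
  by rewrite hx expg1n.
have sPG : P \subset G by apply/fintype.subsetP => x /PP[].
have sLP : L \subset P.
  by apply/fintype.subsetP => x /LP[xG hx]; apply/PP; split=> // i; rewrite hx ch1 expr1n.
have h1 : (#|P : L|%g <= c ^ r)%N.
  by apply: index_torsion => // [x /PP[]|x /PP[xG _] hx] //; apply/LP.
have h2 : (#|G : P|%g <= #|A : L|%g)%N.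
  apply: leq_trans (@index_le_imset _ _ (fun x => L :* (x ^+ c))%g G P sPG _) _ => [x y xG yG e|].
    have : (y ^+ c * (x ^+ c)^-1)%g \in L by rewrite -mem_rcoset e; exact: rcoset_refl.
    case/LP => _ h; apply/PP; split=> [|i]; first by rewrite groupM ?groupV.
    have := h i; rewrite !(chM, chV, chX) ?groupV ?groupX // ch1 => h'.
    by rewrite exprMn exprVn.
  apply: subset_leq_card; apply/fintype.subsetP => _ /imsetP[x xG ->]; apply/rcosetsP.
  by exists (x ^+ c)%g => //; apply: (hA x); rewrite ?groupX.
have sLG := fintype.subset_trans sLP sPG.
rewrite -(leq_pmul2r (indexg_gt0 A L)) (Lagrange_index sAG sLA) -(Lagrange_index sPG sLP) mulnC.
exact: leq_mul.
Qed.
End TorusCharacters.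

(** * Conjugates of the split torus and their centralizers *)

Section SplitTorus.
Variables (K : fieldType) (n : nat) (s : toric_cone n) (D : ray_data s).
Variables (R : toric_alg K s) (A : series_alg D R).
Hypothesis K0 : [pchar K] =i pred0.
Local Notation S := (dual_cone s).
Local Notation chi := (chi R).
Local Notation dg := (dg D).
Local Notation const := (@const K n s D R A).
Local Notation torus := (@torus K n s D R A).

Lemma laurent_mul (t u : 'rV[K]_n) w : laurent w (Gm_mul t u) = laurent w t * laurent w u.
Proof. by rewrite /laurent -big_split; apply: eq_bigr => i _; rewrite mxE expfzMl. Qed.

Lemma Gm_mulP (t u : 'rV[K]_n) : Gm t -> Gm u -> Gm (Gm_mul t u).
Proof. by move=> ht hu i; rewrite mxE mulf_neq0. Qed.

Lemma torusM t u a : torus (Gm_mul t u) a = torus t (torus u a).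
Proof. by apply: sf_ext => w _; rewrite !sf_diag laurent_mul mulrA. Qed.

Lemma torus_inj t u : Gm t -> Gm u -> torus t =1 torus u -> t = u.
Proof.
move=> ht hu e; have h w : S w -> laurent w t = laurent w u.
  move=> Sw; have := congr1 (fun a => sf a w) (e (emb A (chi w))).
  by rewrite !sf_diag sf_emb cf_chi Sw eqxx !mulr1.
apply/rowP => i; have [p [Sp Sip]] := shift_in_cone D (delta_mx 0 i).
have := h _ Sip; rewrite !laurentD // !laurent_delta h // => /mulIf; apply.
exact: laurent_neq0.
Qed.

(** In characteristic 0 the element 2 has infinite order, which makes it a test value for exponents
    over any [K]. *)
Lemma expz2_inj (a b : int) : (2 : K) ^ a = 2 ^ b -> a = b.
Proof.
have n2 : (2 : K) != 0 by rewrite ((pcharf0P K).1 K0).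
have nat_inj (m : nat) : (2 : K) ^+ m = 1 -> m = 0%N.
  move=> e; have : (2 ^ m - 1)%:R == 0 :> K by rewrite natrB ?expn_gt0 // natrX e subrr.
  by rewrite ((pcharf0P K).1 K0) subn_eq0; case: m {e} => // m; rewrite expnS; have := expn_gt0 2 m; lia.
move=> e; apply/eqP; rewrite -subr_eq0; apply/eqP.
have : (2 : K) ^ (a - b) = 1 by rewrite expfzDr // -invr_expz e divff // expfz_neq0.
case: (a - b) => m; first by move/nat_inj => ->.
by rewrite NegzE -invr_expz => /(congr1 (@GRing.inv _)); rewrite invrK invr1 => /nat_inj.
Qed.

(** The torus element with 2 in a coordinate where u and v differ separates [chi u] from [chi v], so
    every monomial is an eigenvector of [g]. *)
Lemma saut_torus_commute (g : A -> A) : saut g ->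
  (forall t, Gm t -> forall a, g (torus t a) = torus t (g a)) -> exists2 t, Gm t & g =1 torus t.
Proof.
move=> gs gc; apply: saut_diag => // u v Su Sv vu.
have [i hi] : exists i, u 0 i != v 0 i.
  apply/existsP; rewrite -negb_forall; apply: contra vu => /forallP h.
  by apply/eqP/rowP => i; apply/esym/eqP.
pose t : 'rV[K]_n := \row_j if j == i then 2 else 1.
have t0 : Gm t by move=> j; rewrite mxE; case: ifP; rewrite ?oner_eq0 ?((pcharf0P K).1 K0).
have tE w : laurent w t = 2 ^ w 0 i.
  rewrite /laurent (bigD1 i) //= big1 => [|j ji]; first by rewrite mxE eqxx mulr1.
  by rewrite mxE (negbTE ji) exp1rz.
have := congr1 (fun a => sf a v) (gc t t0 (emb A (chi u))).
rewrite !torusE diag_chi // saut_const // sf_const sf_diag !tE => /eqP.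
rewrite -subr_eq0 -mulrBl mulf_eq0 subr_eq0; case/orP => /eqP // /expz2_inj e.
by rewrite e eqxx in hi.
Qed.

Section Conjugate.
Variables Th Thi : A -> A.
Hypotheses (Ths : saut Th) (ThK : cancel Th Thi) (ThiK : cancel Thi Th).
Definition ctorus t a := Th (torus t (Thi a)).

Lemma ctorus_saut t : Gm t -> saut (ctorus t).
Proof.
move=> t0; have h := saut_inv Ths ThK ThiK.
exact: (saut_comp Ths (saut_comp (diag_saut A t0) h)).
Qed.
Lemma ctorusM t u a : ctorus (Gm_mul t u) a = ctorus t (ctorus u a).
Proof. by rewrite /ctorus torusM ThK. Qed.
Lemma ctorus_inj t u : Gm t -> Gm u -> ctorus t =1 ctorus u -> t = u.
Proof.
move=> ht hu e; apply: torus_inj => // a; apply: (can_inj ThK).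
by have := e (Th a); rewrite /ctorus ThK.
Qed.

(** Modulo order q only a cutoff of [Thi a] matters, and the torus multiplies its finitely many
    monomials by Laurent monomials. *)
Lemma ctorus_algebraic a q : exists l : seq ('rV[int]_n * A), forall t, Gm t ->
  ordge q (ctorus t a - \sum_(p <- l) const (laurent p.1 t) * p.2).
Proof.
have Thc := saut_ctn Ths; have [N hN] := Thc.2 q; pose b := Thi a.
exists [seq (v, Th (const (sf b v) * emb A (chi v))) | v <- ball D N] => t t0; rewrite big_map /=.
have -> : \sum_(v <- ball D N) const (laurent v t) * Th (const (sf b v) * emb A (chi v)) =
    Th (emb A (cutoff N (torus t b))).
  rewrite /cutoff (big_morph (emb A) (@embD _ _ _ _ _ A) (emb0 A)).
  rewrite (big_morph Th Thc.1 (ctn0 Thc)); apply: eq_bigr => v _.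
  rewrite -saut_const //; congr Th; rewrite embZ sf_diag mulrA; congr (_ * _).
  by rewrite !constE -embM -scalerAl mul1r scalerA.
rewrite /ctorus -ctnB //; apply: hN; apply: ordgeW (@ordge_cutoff _ _ _ _ _ _ _ _); exact: leqnSn.
Qed.

Lemma ctorus_maximal g : saut g -> (forall t, Gm t -> forall a, g (ctorus t a) = ctorus t (g a)) ->
  exists2 t, Gm t & g =1 ctorus t.
Proof.
move=> gs gc; have h := saut_inv Ths ThK ThiK.
have [|t t0 a|t t0 tE] := @saut_torus_commute (Thi \o (g \o Th)).
- exact: (saut_comp h (saut_comp gs Ths)).
- have := gc t t0 (Th a); rewrite /ctorus ThK /= => ->; exact: ThK.
by exists t => // a; rewrite /ctorus -tE /= !ThiK.
Qed.
End Conjugate.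
End SplitTorus.

(** * The completed local ring *)

Section CompletedLocalRing.
Variables (K : fieldType) (n : nat) (s : toric_cone n) (D : ray_data s).
Variables (R : toric_alg K s) (x : prime_idealr R).
Hypothesis xE : forall f : R, (f \in x) = (cf f 0 == 0).
Local Notation S := (dual_cone s).
Local Notation chi := (chi R).
Local Notation dg := (dg D).
Local Notation B := (localization x).
Local Notation m := (@local_max R x).
Local Notation C := (completion m).
Implicit Types (f : R) (q : B).

Definition loc f : B := Defs.frac x f 1.

Lemma locE f : loc f = mkfrac f (den1 x).
Proof. by congr mkfrac; apply: val_inj; rewrite /= insubdK //; exact: den1_subproof. Qed.
Lemma loc1 : loc 1 = 1. Proof. by rewrite locE. Qed.
Lemma locD f g : loc (f + g) = loc f + loc g.
Proof. by rewrite !locE -[RHS]/(addl _ _) addlE; apply: mkfrac_eq => /=; rewrite !mulr1. Qed.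
Lemma locM f g : loc (f * g) = loc f * loc g.
Proof. by rewrite !locE -[RHS]/(mull _ _) mullE; apply: mkfrac_eq => /=; rewrite !mulr1. Qed.
Lemma loc0 : loc 0 = 0.
Proof. by apply: (addrI (loc 0)); rewrite -locD !addr0. Qed.
Lemma locB f g : loc (f - g) = loc f - loc g.
Proof. by apply/eqP; rewrite eq_sym subr_eq -locD subrK. Qed.
Lemma loc_sum (I : Type) (r : seq I) (F : I -> R) :
  loc (\sum_(i <- r) F i) = \sum_(i <- r) loc (F i).
Proof. exact: (big_morph loc locD loc0). Qed.
Lemma loc_mkfrac p t : loc (val t) * mkfrac p t = loc p.
Proof. by rewrite !locE -[LHS]/(mull _ _) mullE; apply: mkfrac_eq => /=; ring. Qed.
Lemma loc_max f : cf f 0 = 0 -> loc f \in m.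
Proof.
move=> f0; apply/asboolP; exists f; first by rewrite xE f0.
by exists (den1 x); rewrite locE.
Qed.

Definition ordR k f := forall u, S u -> (dg u < k)%N -> cf f u = 0.

Lemma ordR_add k f g : ordR k f -> ordR k g -> ordR k (f + g).
Proof. by move=> hf hg u Su lt; rewrite cfD hf // hg // addr0. Qed.
Lemma ordR_mul j k f g : ordR j f -> ordR k g -> ordR (j + k) (f * g).
Proof.
move=> hf hg u Su lt; rewrite (cfM D) big_seq big1 // => v; rewrite mem_ball => /andP[Sv _].
have [Suv|nS] := boolP (S (u - v)); last by rewrite [cf g _]cf_out ?mulr0.
have : dg u = (dg v + dg (u - v))%N by rewrite -dgD // addrC subrK.
have [lv|le] := ltnP (dg v) j; first by rewrite hf ?mul0r.
by move=> e; rewrite hg ?mulr0 //; lia.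
Qed.
Lemma ordR_mull k f g : ordR k g -> ordR k (f * g).
Proof. by move=> hg; rewrite -[k]add0n; apply: ordR_mul. Qed.
Lemma ordR1 f : cf f 0 = 0 -> ordR 1 f.
Proof. by move=> f0 u Su; rewrite ltnS leqn0 dg_eq0 // => /eqP ->. Qed.

(** A factor with nonzero constant term does not change the order; this lets the order of a fraction
    be read on its numerator. *)
Lemma ordR_cancel k w f : cf w 0 != 0 -> ordR k (w * f) -> ordR k f.
Proof.
move=> w0 h u Su lt; have [d le] := ubnP (dg u); elim: d u Su lt le => // d IH u Su lt le.
have := h u Su lt; rewrite (cfM D) (big_rem 0) /=; last by rewrite mem_ball dg0 dual_cone0.
rewrite subr0 big_seq big1 ?addr0 => [/eqP|v].
  by rewrite mulf_eq0 (negbTE w0) => /eqP.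
rewrite mem_rem_uniq ?ball_uniq // inE mem_ball => /and3P[v0 Sv _].
have [Suv|nS] := boolP (S (u - v)); last by rewrite [cf f _]cf_out ?mulr0.
have e : dg u = (dg v + dg (u - v))%N by rewrite -dgD // addrC subrK.
have v1 : (0 < dg v)%N by rewrite lt0n dg_eq0.
by rewrite IH ?mulr0 //; lia.
Qed.

Lemma notin_cf f : f \notin x -> cf f 0 != 0. Proof. by rewrite xE. Qed.

Lemma pow_ordR k q : ideal_pow_set m k q -> exists p t, q = mkfrac p t /\ ordR k p.
Proof.
elim: k q => [|k IH] q; first by move=> _; exists (numl q), (denl q); split; [exact: mkfrac_repr|].
move=> [l hl ->]; rewrite big_seq; apply: (big_ind (fun q => exists p t, q = mkfrac p t /\ ordR k.+1 p)).
- by exists 0, (den1 x); split=> // u _ _; rewrite cf0.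
- move=> _ _ [p [t [-> hp]]] [p' [t' [-> hp']]]; exists (p * val t' + p' * val t), (denM t t').
  split; first by rewrite -addlE.
  by apply: ordR_add; rewrite mulrC; exact: ordR_mull.
- move=> [a b] /hl[/= /asboolP[a' ax [t ->]] /IH[p [t' [-> hp]]]].
  exists (a' * p), (denM t t'); split; first by rewrite -mullE.
  by rewrite -add1n; apply: ordR_mul => //; apply: ordR1; apply/eqP; rewrite -xE.
Qed.

Lemma loc_ordR k f : ideal_pow_set m k (loc f) -> ordR k f.
Proof.
move=> /pow_ordR[p [t [e hp]]]; move: e; rewrite locE => /eqP/mkfracP[u /notin_cf u0] /=.
rewrite mulr1 mulrBr => /eqP; rewrite subr_eq0 => /eqP e.
apply: (@ordR_cancel k (u * val t)); first by rewrite (cfM0 D) mulf_neq0 // notin_cf // (valP t).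
by rewrite -mulrA [val t * f]mulrC e; exact: ordR_mull.
Qed.

Lemma powD k a b : ideal_pow_set m k a -> ideal_pow_set m k b -> ideal_pow_set m k (a + b).
Proof.
case: k => // k [l hl ->] [l' hl' ->]; exists (l ++ l'); last by rewrite big_cat.
by move=> p; rewrite mem_cat => /orP[/hl|/hl'].
Qed.
Lemma pow0 k : ideal_pow_set m k 0.
Proof. by case: k => // k; exists [::] => //; rewrite big_nil. Qed.
Lemma pow_sum k (I : eqType) (r : seq I) (F : I -> B) :
  (forall i, i \in r -> ideal_pow_set m k (F i)) -> ideal_pow_set m k (\sum_(i <- r) F i).
Proof. by move=> h; rewrite big_seq; apply: big_ind => //; [exact: pow0 | exact: powD]. Qed.
Lemma pow_mul j k a b : ideal_pow_set m j a -> ideal_pow_set m k b -> ideal_pow_set m (j + k) (a * b).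
Proof.
elim: j a => [|j IH] a; first by move=> _; exact: ideal_pow_setM.
move=> [l hl ->] hb; exists [seq (p.1, p.2 * b) | p <- l].
  by move=> _ /mapP[p /hl[h1 h2] ->]; split=> //; exact: IH.
by rewrite big_map mulr_suml; apply: eq_bigr => p _; rewrite mulrA.
Qed.
Lemma pow1 a : a \in m -> ideal_pow_set m 1 a.
Proof.
move=> am; exists [:: (a, 1)]; last by rewrite big_seq1 mulr1.
by move=> p; rewrite inE => /eqP ->.
Qed.
Lemma powW j k a : (j <= k)%N -> ideal_pow_set m k a -> ideal_pow_set m j a.
Proof.
elim: k j a => [|k IH] [|j] a //= jk [l hl ->]; exists l => // p /hl[h1 h2].
by split=> //; exact: IH h2.
Qed.

Lemma pow_chi k u : S u -> (k * hbound D <= dg u)%N -> ideal_pow_set m k (loc (chi u)).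
Proof.
elim: k u => [|k IH] u Su le //.
have u0 : u != 0 by apply: contraTneq le => ->; rewrite dg0.
have [h [w [hhb Sw e]]] := hb_split D Su u0; have Sh := hb_inS D hhb.
rewrite e -chiM // locM -add1n; apply: pow_mul.
  apply/pow1/loc_max; rewrite cf_chi Sh; case: (eqVneq h 0) => // e0.
  by have := hb_dg D hhb; rewrite e0 dg0.
apply: IH => //; have : (dg h < hbound D)%N by rewrite ltnS (big_rem h) //= leq_addr.
by move: le; rewrite e dgD // mulSn; lia.
Qed.

Lemma pow_loc k f : ordR (k * hbound D) f -> ideal_pow_set m k (loc f).
Proof.
move=> hf; rewrite [f]chiE loc_sum; apply: pow_sum => u us; have Su := supp_inS us.
have -> : cf f u *: chi u = (cf f u *: 1) * chi u by rewrite -scalerAl mul1r.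
rewrite locM.
apply: ideal_pow_setM; apply: pow_chi => //; rewrite leqNgt; apply/negP => /(hf u Su)/eqP.
by rewrite -[_ == _]negbK -mem_supp us.
Qed.

(** With t = c (1 - e) and e in the maximal ideal, a partial geometric series approximates 1/t
    modulo m^k. *)
Lemma localization_approx k q : exists f, ideal_pow_set m k (q - loc f).
Proof.
rewrite (mkfrac_repr q); move: (numl q) (denl q) => p t.
pose c := cf (val t) 0; have c0 : c != 0 by apply: notin_cf; exact: (valP t).
pose e : R := 1 - c^-1 *: val t; pose y := mkfrac p t.
have e0 : cf e 0 = 0 by rewrite cfB (cf1 R) cfZ mulVf // subrr.
exists (p * (c^-1 *: 1 * \sum_(i < k) e ^+ i)).
have locX i : loc (e ^+ i) = loc e ^+ i.
  by elim: i => [|i IH]; rewrite ?loc1 // !exprS locM IH.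
have -> : mkfrac p t - loc (p * (c^-1 *: 1 * \sum_(i < k) e ^+ i)) = y * loc e ^+ k.
  have -> : loc e ^+ k = 1 - (1 - loc e) * \sum_(i < k) loc e ^+ i.
    by rewrite -[LHS](subrK 1) (subrX1 (loc e) k); ring.
  have -> : 1 - loc e = loc (c^-1 *: 1) * loc (val t).
    rewrite -loc1 -locB -locM -scalerAl mul1r; congr loc; rewrite /e; ring.
  rewrite 2!locM -(loc_mkfrac p t) -/y loc_sum.
  under eq_bigr do rewrite locX.
  by move: (loc _) (loc _) (\sum_(i < k) _) y => z1 z2 z3 z4; ring.
apply: ideal_pow_setM; elim: k {y} => [|k IH] //.
by rewrite exprS -add1n; apply: pow_mul => //; apply/pow1/loc_max.
Qed.

Lemma to_truncP k a b : to_trunc m k a = to_trunc m k b <-> ideal_pow_set m k.+1 (a - b).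
Proof.
have e := Quotient.idealrBE (ideal_pow m k.+1 : idealr B) a b.
split=> [h|h].
  have : a - b \in ideal_pow m k.+1 by rewrite e; apply/eqP.
  by move=> /asboolP.
by apply/eqP; rewrite -[_ == _]e; exact/asboolP.
Qed.

Lemma component_le (a : C) j k b : (j <= k)%N -> a k = to_trunc m k b -> a j = to_trunc m j b.
Proof.
elim: k => [|k IH]; first by rewrite leqn0 => /eqP ->.
rewrite leq_eqVlt => /orP[/eqP -> //|]; rewrite ltnS => jk e; apply: IH => //.
have [b' -> e'] := componentP a k; apply/to_truncP; apply: (powW (leqnSn k.+1)).
by apply/to_truncP; rewrite -e' e.
Qed.

Lemma component_approx (a : C) k : exists f, a k = to_trunc m k (loc f).
Proof.
have [b -> _] := componentP a k; have [f hf] := localization_approx k.+1 b.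
by exists f; apply/to_truncP.
Qed.

(** The component of index [dg u] lives modulo the power m^(dg u + 1), all of whose elements have
    order above [dg u]; so any approximation in K[S] has the same coefficient at u. *)
Definition coef (a : C) u : K := cf (projT1 (cid (component_approx a (dg u)))) u.

Lemma coefE (a : C) k f u : (dg u <= k)%N -> a k = to_trunc m k (loc f) -> coef a u = cf f u.
Proof.
have [Su|nS] := boolP (S u); last by move=> _ _; rewrite /coef !cf_out.
move=> le e; rewrite /coef; case: cid => g /= hg.
have : ideal_pow_set m (dg u).+1 (loc g - loc f).
  by apply/to_truncP; rewrite -hg; exact: component_le e.
rewrite -locB => /loc_ordR/(_ u Su (ltnSn _))/eqP.
by rewrite cfB subr_eq0 => /eqP.
Qed.

Definition cemb f : C := to_completion m (loc f).

Lemma coef_cemb f u : coef (cemb f) u = cf f u.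
Proof. exact: (@coefE (cemb f) (dg u)). Qed.
Lemma cemb1 : cemb 1 = 1. Proof. by rewrite /cemb loc1. Qed.
Lemma cembD f g : cemb (f + g) = cemb f + cemb g.
Proof. by apply: completionP => k; rewrite /= locD to_truncD. Qed.
Lemma cembM f g : cemb (f * g) = cemb f * cemb g.
Proof. by apply: completionP => k; rewrite /= locM to_truncM. Qed.
Lemma coefD (a b : C) u : coef (a + b) u = coef a u + coef b u.
Proof.
have [f hf] := component_approx a (dg u); have [g hg] := component_approx b (dg u).
rewrite (coefE (leqnn _) hf) (coefE (leqnn _) hg) -cfD; apply: (coefE (leqnn _)).
by rewrite locD to_truncD -hf -hg.
Qed.
Lemma coefM (a b : C) u : coef (a * b) u = \sum_(v <- ball D (dg u)) coef a v * coef b (u - v).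
Proof.
have [f hf] := component_approx a (dg u); have [g hg] := component_approx b (dg u).
rewrite (@coefE _ (dg u) (f * g)) //; last by rewrite locM to_truncM -hf -hg.
rewrite (cfM D) big_seq [RHS]big_seq; apply: eq_bigr => v; rewrite mem_ball => /andP[Sv le].
rewrite (coefE le hf); have [Suv|nS] := boolP (S (u - v)); last first.
  by rewrite /coef !(cf_out _ nS).
rewrite (coefE _ hg) //; have -> : dg u = (dg v + dg (u - v))%N by rewrite -dgD // addrC subrK.
exact: leq_addl.
Qed.
Lemma coef_out (a : C) u : ~~ S u -> coef a u = 0.
Proof. exact: cf_out. Qed.

Lemma coef_ext (a b : C) : (forall u, S u -> coef a u = coef b u) -> a = b.
Proof.
move=> e; apply: completionP => k; pose N := (k.+1 * hbound D)%N.
have kN : (k <= N)%N by rewrite /N /hbound mulnS; lia.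
have [f hf] := component_approx a N; have [g hg] := component_approx b N.
rewrite (component_le kN hf) (component_le kN hg); apply/to_truncP; rewrite -locB.
by apply: pow_loc => u Su /ltnW le; rewrite cfB -(coefE le hf) -(coefE le hg) e // subrr.
Qed.

Lemma coef_real (c : 'rV[int]_n -> K) : exists a : C, forall u, S u -> coef a u = c u.
Proof.
pose p k := \sum_(v <- ball D (k.+1 * hbound D)) c v *: chi v.
have cfp k u : S u -> (dg u <= k.+1 * hbound D)%N -> cf (p k) u = c u.
  move=> Su le; rewrite cf_sum (big_rem u) /=; last by rewrite mem_ball Su.
  rewrite cfZ cf_chi Su eqxx mulr1 big_seq big1 ?addr0 // => v.
  rewrite mem_rem_uniq ?ball_uniq // inE => /andP[vu _].
  by rewrite cfZ cf_chi (negbTE vu) andbF mulr0.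
have coh : coherent (fun k => to_trunc m k (loc (p k))).
  move=> k; exists (loc (p k.+1)) => //; apply/to_truncP; rewrite -locB; apply: pow_loc.
  move=> u Su /ltnW le; rewrite cfB (cfp k) // (cfp k.+1) ?subrr //.
  by apply: leq_trans le _; rewrite leq_mul2r leqnSn orbT.
exists (Completion coh) => u Su; rewrite (@coefE _ (dg u) (p (dg u))) // cfp //.
by rewrite mulSn /hbound mulnS; lia.
Qed.

Definition complete_series : series_alg D R :=
  SeriesAlg cemb1 cembD cembM coefD coefM coef_out coef_ext coef_cemb coef_real.

Lemma completion_maxE (a : C) : (a \in completion_max (I := m)) = (coef a 0 == 0).
Proof.
have [f hf] := component_approx a 0; rewrite (@coefE a 0 f) ?dg0 // -topredE /= /completion_max hf.
apply/eqP/eqP => [|f0].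
  rewrite -(to_trunc0 m) => /to_truncP; rewrite subr0 => /loc_ordR; apply; rewrite ?dual_cone0 ?dg0 //.
by rewrite -(to_trunc0 m); apply/to_truncP; rewrite subr0; exact/pow1/loc_max.
Qed.

Lemma mpow_component k (a : complete_series) N : mpow k a ->
  exists2 b, ideal_pow_set m k b & (a : C) N = to_trunc m N b.
Proof.
elim: k a => [|k IH] a; first by move=> _; have [b h _] := componentP (a : C) N; exists b.
move=> [l hl ->]; rewrite big_seq.
apply: (big_ind (fun a : C => exists2 b, ideal_pow_set m k.+1 b & a N = to_trunc m N b)).
- by exists 0; first exact: pow0.
- by move=> a1 a2 [b1 h1 e1] [b2 h2 e2]; exists (b1 + b2); [exact: powD | rewrite to_truncD -e1 -e2].
move=> p /hl[p0 /IH[b hb e]]; have [f hf] := component_approx p.1 N.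
exists (loc f * b); last by rewrite to_truncM -hf -e.
rewrite -add1n; apply: pow_mul => //; apply/pow1/loc_max.
by rewrite -(coefE _ hf) // dg0.
Qed.

Lemma pow_mpow k q : ideal_pow_set m k q -> mpow k (to_completion m q : complete_series).
Proof.
elim: k q => [|k IH] q //= [l hl ->]; exists [seq (to_completion m p.1, to_completion m p.2) | p <- l].
  move=> _ /mapP[p /hl[h1 h2] ->] /=; split; last exact: IH.
  have := completion_maxE (to_completion m p.1); rewrite -topredE /= /completion_max /=.
  move=> e; apply/eqP; rewrite -[_ == 0]e -(to_trunc0 m); apply/eqP/to_truncP.
  by rewrite subr0; exact: pow1.
rewrite big_map; apply: completionP => j; rewrite /= (big_morph (fun a : C => a j) (id1 := 0) (op1 := +%R)) //; last by rewrite -(to_trunc0 m).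
rewrite (big_morph (to_trunc m j) (@to_truncD _ m j) (to_trunc0 m j)).
by apply: eq_bigr => p _; rewrite to_truncM.
Qed.

Lemma mpowD k (a b : complete_series) : mpow k a -> mpow k b -> mpow k (a + b).
Proof.
case: k => // k [l hl ->] [l' hl' ->]; exists (l ++ l'); last by rewrite big_cat.
by move=> p; rewrite mem_cat => /orP[/hl|/hl'].
Qed.

(** This translates equality in the k-th truncation, that is modulo m^(k+1), into the filtration of
    the series algebra. An approximation in K[S] up to order (k+1) [hbound] leaves a remainder that
    already lies in the required power. *)
Lemma component0P k (a : complete_series) : (a : C) k = 0 <-> mpow k.+1 a.
Proof.
split=> [e|/(mpow_component k)[b hb ->]]; last first.
  by rewrite -(to_trunc0 m); apply/to_truncP; rewrite subr0.
pose N := (k.+1 * hbound D)%N.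
have kN : (k <= N)%N by rewrite /N /hbound mulnS; lia.
have [f hf] := component_approx a N.
rewrite -[a](subrK (cemb f : complete_series)); apply: mpowD.
  apply: ordge_mpow => u Su lt; rewrite sfB /= coef_cemb (coefE (ltnW lt) hf) subrr //.
apply: pow_mpow; rewrite -[loc f]subr0; apply/to_truncP; rewrite -(component_le kN hf) e.
by rewrite to_trunc0.
Qed.
End CompletedLocalRing.

Lemma diag_mx_inj (K : fieldType) m (B : 'M[K]_m) (d d' : 'rV[K]_m) : B \in unitmx ->
  diag_mx d *m B = diag_mx d' *m B -> d = d'.
Proof.
move=> uB /(congr1 (fun X => X *m invmx B)); rewrite !mulmxK // => e.
by apply/rowP => i; have := congr1 (fun X : 'M_m => X i i) e; rewrite !mxE eqxx.
Qed.

Lemma normal_intersection (gT : finGroupType) (G1 : {group gT}) (P : gT -> Prop) :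
  (G1 <| [set: gT])%g -> P 1%g -> (forall x y, x \in G1 -> y \in G1 -> P x -> P y -> P (x * y)%g) ->
  (forall x g, x \in G1 -> P x -> P (x ^ g)%g) ->
  exists A : {group gT}, (A <| [set: gT])%g /\ forall x, x \in A <-> x \in G1 /\ P x.
Proof.
move=> /andP[_ nG] P1 PM PJ; pose X := [set x in G1 | `[< P x >]]%SET.
have gX : group_set X.
  apply/group_setP; split; first by rewrite inE group1; exact/asboolP.
  move=> x y; rewrite !inE => /andP[xG /asboolP Px] /andP[yG /asboolP Py].
  by rewrite groupM //=; apply/asboolP/PM.
exists (Group gX); split; last first.
  by move=> x; rewrite inE /=; split; [case/andP => ? /asboolP | case=> -> /asboolP].
apply/andP; split; first exact: finset.subsetT.
apply/fintype.subsetP => g gT'; rewrite inE; apply/fintype.subsetP => _ /imsetP[x xX ->].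
move: xX; rewrite !inE => /andP[xG /asboolP Px]; apply/andP; split; last exact/asboolP/PJ.
by rewrite memJ_norm // (fintype.subsetP nG).
Qed.

(** * Selection of the subgroup *)

Section GroupSelection.
Variable n' : nat.
Let n := n'.+1.

(** Only the images of [G1] commute, so the c-th powers of its elements need not form a subgroup;
    [A] collects the elements whose image is the c-th power of an image. *)
Theorem semisimple_subgroup : exists N, forall (K : closedFieldType) (K0 : [pchar K] =i pred0)
  (s : toric_cone n) (D : ray_data s) (R : toric_alg K s)
  (gT : finGroupType) (rho : gT -> R -> R), (forall g, is_aut (rho g)) ->
  (forall g h, rho (g * h)%g = rho g \o rho h) -> rho 1%g = id ->
  exists A : {group gT}, [/\ (A <| [set: gT])%g, (#|[set: gT] : A|%g <= N)%N &
    exists h, (exists2 B, B \in unitmx & exists w : 'rV[K]__, forall i, br R h (row i B) = w 0 i *: row i B) /\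
    forall v, br R h v = 0 -> forall x, x \in A -> v *m tau D (rho x) (rho x^-1%g) = v].
Proof.
pose jp m J := forall (K : closedFieldType)
    (K0 : [pchar K] =i pred0) (gT : finGroupType) (rho : gT -> 'M[K]_(n + m)),
    rho 1%g = 1%:M -> (forall g h, rho (g * h)%g = rho g *m rho h) ->
  exists A : {group gT}, [/\ (A <| [set: gT])%g, (#|[set: gT] : A|%g <= J)%N &
    forall a b, a \in A -> b \in A -> rho a *m rho b = rho b *m rho a].
have jex m : exists J, jp m J by have [J _ h] := jordan_closed (n + m); exists J.
have [J JP] := choice jex.
pose cp m c := (0 < c)%N /\ forall (K : closedFieldType)
    (s : toric_cone n) (D : ray_data s) (R : toric_alg K s) (K0 : [pchar K] =i pred0)
    (gT : finGroupType) (G : {group gT}) (tg : gT -> 'M[K]_(n + size (rts D))),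
    size (rts D) = m -> tg 1%g = 1%:M -> (forall x y, tg (x * y)%g = tg x *m tg y) ->
    (forall x v w, br R (v *m tg x) (w *m tg x) = br R v w *m tg x) ->
    (forall x (q : 'rV[rat]_n), central D (map_mx (ratK K0) q) -> exists q' : 'rV[rat]_n,
      central D (map_mx (ratK K0) q') /\
      tor D (map_mx (ratK K0) q) *m tg x = tor D (map_mx (ratK K0) q')) ->
    (forall x y, x \in G -> y \in G -> tg x *m tg y = tg y *m tg x) ->
  exists h : 'rV[K]_(n + size (rts D)),
   (exists2 B, B \in unitmx & exists w : 'rV[K]__, forall i, br R h (row i B) = w 0 i *: row i B) /\
   forall v, br R h v = 0 -> forall x, x \in G -> v *m tg (x ^+ c)%g = v.
have cex m : exists c, cp m c by have [c c0 h] := invariant_semisimple n' m; exists c.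
have [c cP] := choice cex.
(* The number m of roots depends on the cone but is at most 3^n; summing over all m makes the bound
   uniform. *)
exists (\sum_(m < (3 ^ n).+1) J m * c m ^ (n + m))%N => K K0 s D R gT rho rho_aut rhoM rho1.
have rhoK x : cancel (rho x) (rho x^-1%g).
  by move=> f; rewrite -[LHS]/((rho x^-1%g \o rho x) f) -rhoM mulVg rho1.
have rhoVK x : cancel (rho x^-1%g) (rho x).
  by move=> f; rewrite -[LHS]/((rho x \o rho x^-1%g) f) -rhoM mulgV rho1.
(* Matrices act on row vectors, so [tau] reverses composition; the inverses make [tg] a
   homomorphism. *)
pose m := size (rts D); pose tg x : 'M[K]_(n + m) := tau D (rho x^-1%g) (rho x).
have tgM x y : tg (x * y)%g = tg x *m tg y.
  by rewrite /tg invMg !rhoM; apply: tau_comp => //; exact: rho_aut.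
have tg1 : tg 1%g = 1%:M by rewrite /tg invg1 rho1; exact: tau_id.
have tgX x k : tg (x ^+ k)%g = tg x ^+ k.
  by elim: k => [|k IH]; rewrite ?expg0 ?tg1 // expgS tgM IH exprS.
have tg_br x v w : br R (v *m tg x) (w *m tg x) = br R v w *m tg x.
  exact: br_tau.
have tg_rat x (q : 'rV[rat]_n) : central D (map_mx (ratK K0) q) -> exists q' : 'rV[rat]_n,
      central D (map_mx (ratK K0) q') /\
      tor D (map_mx (ratK K0) q) *m tg x = tor D (map_mx (ratK K0) q').
  move=> cq; have [q' e] := tau_central_rat (rho_aut x^-1%g) (rhoVK x) cq; exists q'; split=> //.
  have [mu cmu e'] := tau_central K0 (rho_aut x^-1%g) (rhoVK x) cq.
  suff -> : map_mx (ratK K0) q' = mu by [].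
  have := congr1 lsubmx (etrans (esym e) e'); rewrite /tor !row_mxKl //.
have [G1 [nG1 iG1 cG1]] := JP m K K0 gT tg tg1 tgM.
have [cm0 /(_ K s D R K0 gT G1 tg erefl tg1 tgM tg_br tg_rat cG1)[h [hB hfix]]] := cP m.
have [A [nA AP]] : exists A : {group gT}, (A <| [set: gT])%g /\ forall x, x \in A <->
    x \in G1 /\ exists2 y, y \in G1 & tg x = tg (y ^+ c m)%g.
  apply: normal_intersection => //.
  - by exists 1%g; rewrite ?group1 // expg1n.
  - move=> x y xG yG [x' x'G ex] [y' y'G ey]; exists (x' * y')%g; first exact: groupM.
    have cxy : tg x' *m tg y' = tg y' *m tg x' by exact: cG1.
    rewrite tgM ex ey !tgX tgM -[RHS]/((tg x' * tg y') ^+ _) exprMn_comm //.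
  - move=> x g xG [y yG e]; exists (y ^ g)%g.
      by rewrite memJ_norm // (fintype.subsetP (normal_norm nG1)) // inE.
    by rewrite -conjXg !conjgE !tgM e.
exists A; split=> //; last first.
  exists h; split=> // v hv x xA.
  have : v *m tg x^-1%g = v.
    have /AP[_ [y yG ->]] : (x^-1 \in A)%g by rewrite groupV.
    exact: hfix.
  by rewrite /tg invgK.
have index_le : (#|[set: gT] : A|%g <= J m * c m ^ (n + m))%N.
  have sAG1 : A \subset G1 by apply/fintype.subsetP => x /AP[].
  rewrite -(Lagrange_index (normal_sub nG1) sAG1); apply: leq_mul => //.
  have [||B uB BP] := @finite_order_codiag K (n' + m) [seq tg x | x <- enum G1] K0.
  - by move=> _ _ /mapP[x + ->] /mapP[y + ->]; rewrite !mem_enum; exact: cG1.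
  - move=> _ /mapP[x _ ->]; exists #[x]%g; first exact: order_gt0.
    by have := tgX x #[x]%g; rewrite expg_order tg1 => /esym.
  have dex x : exists d : 'rV[K]_(n + m), x \in G1 -> B *m tg x = diag_mx d *m B.
    have [xG|nG] := boolP (x \in G1); last by exists 0.
    have [|d dE] := BP (tg x); last by exists d.
    by apply: map_f; rewrite mem_enum.
  have [d dP] := choice dex; pose ch x i := d x 0 i.
  have d1 : d 1%g = const_mx 1.
    apply: (diag_mx_inj uB); rewrite -dP ?group1 // tg1 mulmx1.
    by have -> : diag_mx (const_mx 1) = 1%:M :> 'M[K]_(n + m); [rewrite diag_const_mx | rewrite mul1mx].
  have dM x y : x \in G1 -> y \in G1 -> d (x * y)%g = \row_i (d x 0 i * d y 0 i).
    move=> xG yG; apply: (diag_mx_inj uB); rewrite -dP ?groupM // tgM mulmxA dP // -mulmxA dP //.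
    by rewrite mulmxA mulmx_diag.
  have chM x y i : x \in G1 -> y \in G1 -> ch (x * y)%g i = ch x i * ch y i.
    by move=> xG yG; rewrite /ch dM // mxE.
  have ch_neq0 x i : x \in G1 -> ch x i != 0.
    move=> xG; have := chM x x^-1%g i xG; rewrite groupV => /(_ xG).
    rewrite mulgV /ch d1 mxE => e; apply/eqP => e0; move: e; rewrite e0 mul0r => /eqP.
    by rewrite oner_eq0.
  apply: (index_powers (ch := ch)) => // x y xG yG e; apply/AP; split=> //; exists x => //.
  have : d y = d (x ^+ c m)%g by apply/rowP => i; exact: e.
  move=> ed; have : B *m tg y = B *m tg (x ^+ c m)%g by rewrite !dP ?groupX // ed.
  by move=> /(congr1 (mulmx (invmx B))); rewrite !mulKmx.
have lt : (m < (3 ^ n).+1)%N by rewrite ltnS; exact: size_rts.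
apply: leq_trans index_le _; rewrite (bigD1 (Ordinal lt)) //=; exact: leq_addr.
Qed.
End GroupSelection.

(** Each element of the group becomes a point [t x] of a torus, and the group embeds there since
    [rho] and [emb] are injective. Commutativity and rank come from this embedding, the adjoint
    action possibly having a kernel. *)
Theorem linearized_subgroup (K : closedFieldType) (n : nat) (s : toric_cone n) (D : ray_data s)
  (R : toric_alg K s) (A : series_alg D R) (K0 : [pchar K] =i pred0)
  (gT : finGroupType) (G : {group gT}) (rho : gT -> R -> R) (h : 'rV[K]_(n + size (rts D))) :
  (forall x, is_aut (rho x)) -> (forall x y, rho (x * y)%g = rho x \o rho y) -> rho 1%g = id ->
  injective rho ->
  (exists2 B, B \in unitmx & exists w : 'rV[K]__, forall i, br R h (row i B) = w 0 i *: row i B) ->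
  (forall v, br R h v = 0 -> forall x, x \in G -> v *m tau D (rho x) (rho x^-1%g) = v) ->
  [/\ abelian G, ('m(G)%g <= n)%N & exists Th Thi : A -> A,
    [/\ saut Th, cancel Th Thi, cancel Thi Th & forall x, x \in G -> exists t g,
      [/\ Gm t, saut g, forall f, g (emb A f) = emb A (rho x f) & g =1 ctorus Th Thi t]]].
Proof.
move=> rho_aut rhoM rho1 rho_inj [B uB [w hB]] hfix.
have [Th [Thi [Ths ThK ThiK tP]]] := equivariant_torus A K0 rho_aut rhoM rho1 uB hB hfix.
have tex x : exists t : 'rV[K]_n, x \in G -> Gm t /\ exists g,
    [/\ saut g, forall f, g (emb A f) = emb A (rho x f) & g =1 ctorus Th Thi t].
  have [xG|nG] := boolP (x \in G); last by exists 0.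
  have rK : cancel (rho x) (rho x^-1%g).
    by move=> f; rewrite -[LHS]/((rho x^-1%g \o rho x) f) -rhoM mulVg rho1.
  have [g [_ [gs _ _ gE _]]] := saut_ext A (rho_aut x) rK.
  by have [t t0 gt] := tP x g xG gs gE; exists t => _; split=> //; exists g.
have [t tG] := choice tex.
have tE x f : x \in G -> ctorus Th Thi (t x) (emb A f) = emb A (rho x f).
  by move=> /tG[_ [g [_ gE gt]]]; rewrite -gt gE.
have rhoE x y : x \in G -> y \in G -> ctorus Th Thi (t x) =1 ctorus Th Thi (t y) -> x = y.
  move=> xG yG e; apply: rho_inj; apply/funext => f; apply: (@emb_inj _ _ _ _ _ A).
  by rewrite -!tE.
have tM x y : x \in G -> y \in G -> t (x * y)%g = Gm_mul (t x) (t y).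
  move=> xG yG; have [x0 _] := tG x xG; have [y0 _] := tG y yG.
  have [xy0 _] := tG _ (groupM xG yG); have xy0' := Gm_mulP x0 y0.
  apply: (ctorus_inj (A := A) ThK) => //.
  apply: ctn_dense => [||f].
  - exact: saut_ctn (ctorus_saut Ths ThK ThiK xy0).
  - exact: saut_ctn (ctorus_saut Ths ThK ThiK xy0').
  by rewrite ctorusM // !tE ?groupM // rhoM.
have GmC u v : Gm_mul u v = Gm_mul v u :> 'rV[K]_n by apply/rowP => i; rewrite !mxE mulrC.
have cG : abelian G.
  apply/centsP => x xG y yG; apply: rhoE; rewrite ?groupM //.
  by move=> a; rewrite !tM // GmC.
split=> //.
  apply: (grank_le (G := G) (ch := fun x i => t x 0 i)) => //.
  - by move=> x i /tG[t0 _]; exact: t0.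
  - by move=> x y i xG yG; rewrite tM // mxE.
  move=> x xG e; apply: rhoE => //; have -> : t x = t 1%g by apply/rowP => i; exact: e.
  by [].
exists Th, Thi; split=> // x xG; have [t0 [g [gs gE gt]]] := tG x xG.
by exists (t x), g.
Qed.

(** * The ideal of the fixed point *)

Section FixedPoint.
Variables (K : fieldType) (n : nat) (s : toric_cone n).
Hypothesis K0 : [pchar K] =i pred0.
Local Notation S := (dual_cone s).

Definition vanishing : pred (toric_ring K s) := fun f => mcf f 0 == 0.

Lemma vanishing_idealr_closed : idealr_closed vanishing.
Proof.
have [D] := ray_data_exists s; split.
- by rewrite /vanishing -topredE /= mcf0.
- by rewrite /vanishing -topredE /= -(mchi0 K s) mcf_mchi dual_cone0 eqxx oner_eq0.
- move=> a u v; rewrite /vanishing -!topredE /= => /eqP u0 /eqP v0.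
  rewrite mcfD v0 addr0; apply/eqP; have := @cfM0 K n s D (malg_toric_alg K s) a u.
  by rewrite /= => ->; rewrite u0 mulr0.
Qed.
HB.instance Definition _ := isIdealr.Build (toric_ring K s) vanishing vanishing_idealr_closed.

Lemma mcf_torus_act t (f : toric_ring K s) u :
  mcf (torus_act t f) u = laurent u t * mcf f u.
Proof.
have [Su|nS] := boolP (S u); last by rewrite !mcf_out ?mulr0.
pose mu : dual_monoid s := exist _ u Su.
rewrite -[u]/(val mu) !mcf_val /torus_act raddf_sum /=.
under eq_bigr do rewrite mcoeffU.
have [im|nm] := boolP (mu \in msupp f).
  rewrite (bigD1_seq mu) ?fset_uniq //= eqxx mulr1n big1 ?addr0 // => m' /negbTE ne.
  by rewrite ne.
rewrite big_seq big1 ?(mcoeff_outdom nm) ?mulr0 // => m' im'.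
by case: eqP => // e; rewrite e (negbTE nm) in im'.
Qed.

(** For f in [x] and u != 0 in its support, the translate of f by t minus [laurent u t] times f lies
    in [x], has lost u, and has the constant term of f up to a nonzero factor. Repeating this, a
    nonzero constant term would put a unit in [x]. So [x] lies in the ideal of zero constant terms,
    and equals it because the point is closed. *)
Lemma fixed_point_vanishing (x : prime_idealr (toric_ring K s)) :
  closed_point x -> torus_fixed x -> forall f, (f \in x) = (mcf f 0 == 0).
Proof.
move=> xc xf; have n2 : (2 : K) != 0 by rewrite ((pcharf0P K).1 K0).
have const_act (c : K) (f : toric_ring K s) : f \in x -> c *: f \in x.
  by move=> fx; rewrite -mul_malgC; exact: idealMr.
have x_sub f : f \in x -> mcf f 0 = 0.
  have [k le] := ubnP (size (supps f)); elim: k f le => // k IH f le fx.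
  have [[u us u0]|triv] := pselect (exists2 u, u \in supps f & u != 0); last first.
    apply/eqP; apply: contraT => f0; have fE : f = mcf f 0 *: 1.
      apply: mcfP => u Su; rewrite mcfZ -(mchi0 K s) mcf_mchi dual_cone0 /= eq_sym.
      have [->|u0] := eqVneq u 0; first by rewrite mulr1.
      rewrite mulr0; apply/eqP; apply: contraT => nz; case: triv; exists u => //.
      by rewrite mem_supps.
    have := const_act (mcf f 0)^-1 f fx; rewrite {2}fE scalerA mulVf // scale1r.
    by rewrite idealr1.
  have [i ui] : exists i, u 0 i != 0.
    apply/existsP; rewrite -negb_forall; apply: contra u0 => /forallP h.
    by apply/eqP/rowP => i; rewrite mxE; exact/eqP.
  pose t : 'rV[K]_n := \row_j if j == i then 2 else 1.
  have t0 : Gm t by move=> j; rewrite mxE; case: ifP; rewrite ?oner_eq0.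
  have tE : laurent u t = 2 ^ u 0 i.
    rewrite /laurent (bigD1 i) //= big1 => [|j ji]; first by rewrite mxE eqxx mulr1.
    by rewrite mxE (negbTE ji) exp1rz.
  have tn1 : 1 - laurent u t != 0.
    rewrite subr_eq0 tE; apply: contra ui => /eqP e; apply/eqP; apply: (@expz2_inj K K0).
    by rewrite -e expr0z.
  pose f' := torus_act t f - laurent u t *: f.
  have f'E v : mcf f' v = (laurent v t - laurent u t) * mcf f v.
    by rewrite mulrBl -mcf_torus_act -(mcfZ (laurent u t) f v); exact: mcfB.
  have f'x : f' \in x by rewrite rpredB //; [exact: xf | exact: const_act].
  have /IH/(_ f'x) : (size (supps f') < k)%N.
    have sub : {subset supps f' <= rem u (supps f)}.
      move=> v; rewrite mem_supps f'E mulf_eq0 negb_or => /andP[v0 vr].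
      rewrite mem_rem_uniq ?supps_uniq // inE mem_supps vr andbT.
      by apply: contraNneq v0 => ->; rewrite subrr.
    have := uniq_leq_size (supps_uniq _) sub; rewrite size_rem //.
    by case: (supps f) us le => //= y l _; lia.
  by rewrite f'E laurent0 => /eqP; rewrite mulf_eq0 (negbTE tn1) => /eqP.
have sub : {subset x <= (vanishing : idealr (toric_ring K s))}.
  by move=> f /x_sub f0; rewrite -topredE /= /vanishing f0.
move=> f; apply/idP/eqP => [/x_sub //|f0]; apply: (xc _ sub).
by rewrite -topredE /= /vanishing f0.
Qed.

Lemma toric_is_aut (x : prime_idealr (toric_ring K s)) (g : toric_ring K s -> toric_ring K s) :
  (forall f, (f \in x) = (mcf f 0 == 0)) -> Aut_toric x g -> @is_aut K n s (malg_toric_alg K s) g.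
Proof.
move=> xE [gB [g1 gM] gb gc gx].
have g0 : g 0 = 0 by have := gB 0 0; rewrite !subrr.
have gD a b : g (a + b) = g a + g b.
  have := gB a (- b); rewrite opprK => ->; have := gB 0 b; rewrite !sub0r g0 sub0r => ->.
  by rewrite opprK.
split.
- split=> // c f; have := gM (toric_const s c) f; rewrite gc /toric_const => e.
  by rewrite -mul_malgC; apply: etrans e _; exact: mul_malgC.
- exact: gM.
- exact: gb.
- by move=> f; rewrite /= -!xE gx.
Qed.
End FixedPoint.

(** * Maximal tori of the completion and the natural homomorphism *)

Section CompleteTorus.
Variables (K : fieldType) (n : nat) (s : toric_cone n) (D : ray_data s).
Hypothesis K0 : [pchar K] =i pred0.
Variable x : prime_idealr (toric_ring K s).
Hypothesis xE : forall f, (f \in x) = (mcf f 0 == 0).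
Local Notation R := (malg_toric_alg K s).
Local Notation A := (complete_series D (R := R) (x := x) xE).
Local Notation m := (@local_max _ x).

Lemma complete_constE c : complete_const x c = const A c.
Proof.
apply: (congr1 (fun f : toric_ring K s => to_completion m (Defs.frac x f 1))).
by rewrite -[RHS]mul_malgC mulr1.
Qed.

Lemma Aut_completeP (g : A -> A) : Aut_complete (x := x) g <-> saut g.
Proof.
have pE (a : A) : (a \in completion_max (I := m)) = (sf a 0 == 0) := completion_maxE D (R := R) xE a.
split=> -[h1 h2 h3 h4 h5]; split; try exact h1; try exact h2; try exact h3.
- by move=> c; have := h4 c; rewrite complete_constE.
- by move=> b; have := h5 b; rewrite !pE.
- by move=> c; rewrite complete_constE; exact: h4.
- by move=> b; rewrite !pE; exact: h5.
Qed.

Section Torus.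
Variables Th Thi : A -> A.
Hypotheses (Ths : saut Th) (ThK : cancel Th Thi) (ThiK : cancel Thi Th).
Definition torus_set : set (complete_ring x -> complete_ring x) :=
  [set ctorus Th Thi t | t in @Gm K n]%classic.

Lemma torus_set_is_torus : is_torus (x := x) n torus_set.
Proof.
exists (ctorus Th Thi); split; last exact: erefl.
- by move=> t t0; apply/Aut_completeP; exact: ctorus_saut.
- by move=> t u t0 u0; apply/funext => a; exact: (ctorusM (A := A) ThK).
- by move=> t u t0 u0 e; apply: (ctorus_inj (A := A) ThK) => // a; rewrite e.
- move=> f k; have [l hl] := ctorus_algebraic (A := A) Thi Ths f (k.+1 * hbound D).
  exists l => t t0; apply/eqP; rewrite -subr_eq0; apply/eqP.
  have /ordge_mpow/component0P := hl t t0.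
  by under eq_bigr do rewrite -complete_constE.
Qed.

(** A torus that contains this one is commutative, and an automorphism commuting with all [ctorus]
    elements is one of them. *)
Lemma torus_set_maximal : is_maximal_torus (x := x) n torus_set.
Proof.
split; first exact: torus_set_is_torus.
move=> r' T' [lam [l1 l2 l3 l4 T'E]] sub.
have lamC t u : Gm t -> Gm u -> lam t \o lam u = lam u \o lam t.
  move=> t0 u0; rewrite -!l2 //; congr lam; apply/rowP => i; by rewrite !mxE mulrC.
apply/seteqP; split=> // g; rewrite T'E => -[u u0 <-].
have [|t t0 a|t t0 e] := ctorus_maximal K0 Ths ThK ThiK (g := lam u).
- by apply/Aut_completeP; exact: l1.
- have : T' (ctorus Th Thi t) by apply: sub; exists t.
  rewrite T'E => -[v v0 <-]; have := lamC u v u0 v0.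
  by move=> /(congr1 (fun h => h a)).
by exists t => //; apply/funext => a; rewrite e.
Qed.
End Torus.

(** Agreement on K[S] extends to fractions because denominators become units, and to truncations
    because [g] preserves the powers of the maximal ideal. *)
Lemma completion_of_ext (f : toric_ring K s -> toric_ring K s) (g : A -> A) :
  (forall p, (f p \in x) = (p \in x)) -> saut g -> (forall p, g (emb A p) = emb A (f p)) ->
  is_completion_of (x := x) f g.
Proof.
move=> fx gs gE c k q hc; pose tc := to_completion m.
have tcM a b : tc (a * b) = tc a * tc b by apply: completionP => j; rewrite /= to_truncM.
have q_eq : g (tc q) = tc (local_map f q).
  pose t := denl q; have ft : f (val t) \notin x by rewrite fx; exact: (valP t).
  pose rt : denom x := exist _ (f (val t)) ft.
  have lE : local_map f q = mkfrac (f (numl q)) rt.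
    congr mkfrac; apply: val_inj; rewrite /= insubdK //; exact: ft.
  have e1 : emb A (val t) * tc q = emb A (numl q).
    by rewrite [q in tc q]mkfrac_repr -[RHS](congr1 tc (loc_mkfrac (R := R) (numl q) t)) tcM.
  have e2 : emb A (f (val t)) * g (tc q) = emb A (f (numl q)).
    by rewrite -!gE -sautM // e1.
  have e3 : emb A (f (val t)) * tc (mkfrac (f (numl q)) rt) = emb A (f (numl q)).
    by rewrite -[RHS](congr1 tc (loc_mkfrac (R := R) (f (numl q)) rt)) tcM.
  have e4 : tc (mkfrac 1 rt) * emb A (f (val t)) = 1.
    rewrite mulrC -(emb1 A) -[RHS](congr1 tc (loc_mkfrac (R := R) 1 rt)) tcM //.
  rewrite lE -[LHS]mul1r -[RHS]mul1r -e4 -!mulrA e2 -e3 //.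
have gm : forall a : A, sf a 0 = 0 -> sf (g a) 0 = 0.
  by move=> a /eqP; rewrite -(saut_sf0 a gs) => /eqP.
have : mpow k.+1 (g (c - tc q : A)).
  apply: aut_mpow => //; [by move=> a b; exact: sautD | by move=> a b; exact: sautM|].
  by apply/component0P; rewrite -[LHS]/(c k - to_trunc m k q) hc subrr.
rewrite (ctnB _ _ (saut_ctn gs)) q_eq => /component0P h.
by apply/eqP; rewrite -subr_eq0; apply/eqP.
Qed.
End CompleteTorus.

Theorem theorem2 (n : nat) (n_gt0 : (0 < n)%N) :
  exists N : nat,
  forall (K : closedFieldType) (charK0 : [pchar K] =i pred0)
    (s : toric_cone n)
    (x : prime_idealr (toric_ring K s))
    (x_closed : closed_point x) (x_fixed : torus_fixed x)
    (gT : finGroupType) (rho : gT -> toric_ring K s -> toric_ring K s)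
    (rho_aut : forall g, Aut_toric x (rho g))
    (rhoM : forall g h, rho (g * h)%g = rho g \o rho h)
    (rho_inj : injective rho),
  exists A : {group gT},
    [/\ (A <| [set: gT])%g, abelian A, (#|[set: gT] : A|%g <= N)%N,
        ('m(A)%g <= n)%N
      & exists T, is_maximal_torus (x := x) n T /\
          forall a, a \in A -> exists2 g, T g & is_completion_of (rho a) g].
Proof.
case: n n_gt0 => // n' _; have [N NP] := semisimple_subgroup n'; exists N.
move=> K K0 s x xc xf gT rho rho_aut rhoM rho_inj.
have xE := fixed_point_vanishing K0 xc xf; have [D] := ray_data_exists s.
have r_aut g := toric_is_aut xE (rho_aut g).
(* [rho 1] is idempotent and bijective. *)
have rho1 : rho 1%g = id.
  apply/funext => f; have [_ _ [k rk _] _] := r_aut 1%g; apply: (can_inj rk).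
  by rewrite -[LHS]/((rho 1%g \o rho 1%g) f) -rhoM mulg1.
have [G [nG iG [h [hB hfix]]]] := NP K K0 s D (malg_toric_alg K s) gT rho r_aut rhoM rho1.
have [cG mG [Th [Thi [Ths ThK ThiK tG]]]] :=
  linearized_subgroup (complete_series D (R := malg_toric_alg K s) xE) K0 r_aut rhoM rho1 rho_inj hB hfix.
exists G; split=> //; exists (torus_set Th Thi); split; first exact: torus_set_maximal.
move=> a /tG[t [g [t0 gs gE gt]]]; exists g; first by exists t => //; apply/funext => b; rewrite gt.
by apply: (@completion_of_ext _ _ _ D x xE) => // p; case: (rho_aut a).
Qed.
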